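(* Let $G$ be the simply connected simple complex algebraic group of type $E_7$ and let $H\subset G$ be the maximal reductive subgroup of type $A_7$. Then $G/P_7$ is a spherical $H$-variety, whereas $G/P_i$ is not $H$-spherical for $i\neq 7$.
   Context: The ground field is $\mathbb{C}$. Fix a maximal torus $T$ and a Borel subgroup $B\supset T$ of $G$, with simple roots $\alpha_1,\ldots,\alpha_7$ and fundamental weights $\omega_1,\ldots,\omega_7$ in Bourbaki numbering. $P_i\supset B$ ($1\le i\le 7$) is the maximal parabolic subgroup associated to $\omega_i$ (the stabilizer of the highest weight line in the irreducible $G$-module of highest weight $\omega_i$). The subgroup $H$ is the connected subsystem subgroup containing $T$ with simple roots $\alpha_1,\alpha_3,\alpha_4,\alpha_5,\alpha_6,\alpha_7$ and $\alpha_1+2\alpha_2+2\alpha_3+3\alpha_4+2\alpha_5+\alpha_6$. $H$ acts on $G/P_i$ by left multiplication. $G/P_i$ is $H$-spherical (a spherical $H$-variety) if a Borel subgroup of $H$ has an open orbit in it. *)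

(* Defs.v *)
(* The ground field of the statement is R[i], for R : realType. *)
From HB Require Import structures.
From mathcomp Require Import all_boot all_order all_algebra.
From mathcomp Require Import mpoly.
From mathcomp Require Import classical_sets reals complex.

Set Implicit Arguments.
Unset Strict Implicit.
Unset Printing Implicit Defensive.

Import GRing.Theory.
Local Open Scope classical_set_scope.
Local Open Scope ring_scope.

(* A linear algebraic group over K is a Zariski-closed subgroup of GL_n(K),
   seen as a set of invertible matrices; a polynomial in n * n variables is
   evaluated at the entries of a matrix, enumerated by mxvec. *)
Section AlgebraicGroups.
Variable K : fieldType.

Definition mxeval n (A : 'M[K]_n) (p : {mpoly K[n * n]}) : K :=
  p.@[fun k => mxvec A 0 k].

(* Closed subsets of GL_n; denominators det^k may be cleared, so that
   polynomials in the entries suffice. *)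
Definition zariski_closed n (Z : set 'M[K]_n) : Prop :=
  exists I : set {mpoly K[n * n]},
    Z = [set A | A \in unitmx /\ forall p, I p -> mxeval A p = 0].

Definition open_in n (S U : set 'M[K]_n) : Prop :=
  exists2 Z, zariski_closed Z & U = S `\` Z.

Definition zariski_connected n (S : set 'M[K]_n) : Prop :=
  forall Z1 Z2, zariski_closed Z1 -> zariski_closed Z2 ->
    S `<=` Z1 `|` Z2 -> S `&` (Z1 `&` Z2) = set0 -> S `<=` Z1 \/ S `<=` Z2.

Definition mx_group n (G : set 'M[K]_n) : Prop :=
  [/\ G `<=` [set A | A \in unitmx], G 1%:M,
      forall A B, G A -> G B -> G (A *m B)
    & forall A, G A -> G (invmx A)].

Definition generated n (S : set 'M[K]_n) : set 'M[K]_n :=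
  smallest (@mx_group n) S.

Definition algebraic_group n (G : set 'M[K]_n) : Prop :=
  mx_group G /\ zariski_closed G.

Definition normal_in n (G N : set 'M[K]_n) : Prop :=
  N `<=` G /\ forall A B, G A -> N B -> N (A *m B *m invmx A).

Definition abelian_mx n (G : set 'M[K]_n) : Prop :=
  forall A B, G A -> G B -> A *m B = B *m A.

Definition simple_algebraic_group n (G : set 'M[K]_n) : Prop :=
  [/\ algebraic_group G, zariski_connected G, ~ abelian_mx G
    & forall N, algebraic_group N -> zariski_connected N -> normal_in G N ->
        N = [set 1%:M] \/ N = G].

Definition derived n (G : set 'M[K]_n) : set 'M[K]_n :=
  generated [set C | exists A B, [/\ G A, G B
                       & C = A *m B *m invmx A *m invmx B]].

Definition solvable_mx n (G : set 'M[K]_n) : Prop :=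
  exists k, iter k (@derived n) G = [set 1%:M].

Definition connected_solvable n (S : set 'M[K]_n) : Prop :=
  [/\ algebraic_group S, zariski_connected S & solvable_mx S].

Definition borel_subgroup n (G B : set 'M[K]_n) : Prop :=
  [/\ B `<=` G, connected_solvable B
    & forall S, S `<=` G -> connected_solvable S -> B `<=` S -> S = B].

Definition regular_on n (S : set 'M[K]_n) (f : 'M[K]_n -> K) : Prop :=
  exists (p : {mpoly K[n * n]}) (k : nat),
    forall A, S A -> f A = mxeval A p / \det A ^+ k.

(* Morphisms are total functions on matrices, of which only the values on the
   source group are meaningful. *)
Definition algebraic_hom n m (G : set 'M[K]_n) (G' : set 'M[K]_m)
    (f : 'M[K]_n -> 'M[K]_m) : Prop :=
  [/\ forall A, G A -> G' (f A),
      forall A B, G A -> G B -> f (A *m B) = f A *m f B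
    & forall i j, regular_on G (fun A => f A i j)].

Definition diagonal_group r : set 'M[K]_r :=
  [set D | D \in unitmx /\ is_diag_mx D].

Definition torus n (T : set 'M[K]_n) : Prop :=
  algebraic_group T /\
  exists (r : nat) (f : 'M[K]_n -> 'M[K]_r) (g : 'M[K]_r -> 'M[K]_n),
    [/\ algebraic_hom T (@diagonal_group r) f,
        algebraic_hom (@diagonal_group r) T g,
        forall t, T t -> g (f t) = t
      & forall d, diagonal_group d -> f (g d) = d].

Definition maximal_torus n (G T : set 'M[K]_n) : Prop :=
  [/\ T `<=` G, torus T
    & forall T', T' `<=` G -> torus T' -> T `<=` T' -> T' = T].

Definition is_character n (T : set 'M[K]_n) (chi : 'M[K]_n -> K) : Prop :=
  [/\ forall s t, T s -> T t -> chi (s *m t) = chi s * chi t,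
      forall t, T t -> chi t != 0
    & regular_on T chi].

(* The character sum_j c_j chi_j of the (additively written) group X(T). *)
Definition char_comb n l (chi : 'I_l -> 'M[K]_n -> K) (c : 'rV[int]_l)
    (t : 'M[K]_n) : K :=
  \prod_j chi j t ^ c 0 j.

(* The Lie algebra: tangent space at the identity, defined by the vanishing
   of the differentials at 1 of all polynomials vanishing on G. *)
Definition lie_algebra n (G : set 'M[K]_n) : set 'M[K]_n :=
  [set X | forall p : {mpoly K[n * n]}, (forall A, G A -> mxeval A p = 0) ->
     \sum_k mxeval 1%:M (mderiv k p) * mxvec X 0 k = 0].

Definition lie_bracket n (X Y : 'M[K]_n) : 'M[K]_n := X *m Y - Y *m X.

Definition lie_subalgebra n (L : set 'M[K]_n) : Prop :=
  [/\ L 0, forall a X Y, L X -> L Y -> L (a *: X + Y)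
    & forall X Y, L X -> L Y -> L (lie_bracket X Y)].

Definition root_space n (G T : set 'M[K]_n) (chi : 'M[K]_n -> K) :
    set 'M[K]_n :=
  [set X | lie_algebra G X /\
     forall t, T t -> t *m X *m invmx t = chi t *: X].

(* The alpha_j are the simple roots of G with respect to T and B, with Cartan
   matrix C i j = <alpha_j, alpha_i^vee>: the simple root vectors e_j in
   Lie(B), the opposite root vectors f_j and the coroots h_j = [e_j, f_j]
   generate Lie(G) and satisfy the Chevalley-Serre relations of C. *)
Definition simple_roots n l (C : 'M[int]_l) (G T B : set 'M[K]_n)
    (alpha : 'I_l -> 'M[K]_n -> K) : Prop :=
  (forall j, is_character T (alpha j)) /\
  exists e f : 'I_l -> 'M[K]_n,
    let h i := lie_bracket (e i) (f i) in
    [/\ forall j, [/\ root_space G T (alpha j) (e j), lie_algebra B (e j),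
                      e j != 0 & root_space G T (fun t => (alpha j t)^-1) (f j)],
        forall i j, [/\ lie_bracket (h i) (h j) = 0,
                        lie_bracket (h i) (e j) = (C i j)%:~R *: e j
                      & lie_bracket (h i) (f j) = - (C i j)%:~R *: f j],
        forall i j, i != j ->
          [/\ lie_bracket (e i) (f j) = 0,
              iter (absz (1 - C i j)) (lie_bracket (e i)) (e j) = 0
            & iter (absz (1 - C i j)) (lie_bracket (f i)) (f j) = 0]
      & lie_algebra G =
          smallest (@lie_subalgebra n) (range e `|` range f)].

(* alpha_j = sum_i <alpha_j, alpha_i^vee> omega_i. *)
Definition fundamental_weights n l (C : 'M[int]_l) (T : set 'M[K]_n)
    (alpha omega : 'I_l -> 'M[K]_n -> K) : Prop :=
  (forall i, is_character T (omega i)) /\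
  forall j t, T t -> alpha j t = char_comb omega (\row_i C i j) t.

(* X(T) is the full weight lattice, which is the definition of simple
   connectedness for semisimple groups. *)
Definition simply_connected n l (T : set 'M[K]_n)
    (omega : 'I_l -> 'M[K]_n -> K) : Prop :=
  forall chi, is_character T chi ->
    exists! c : 'rV[int]_l, forall t, T t -> chi t = char_comb omega c t.

(* Exponential series of a nilpotent matrix. *)
Definition mx_exp n (X : 'M[K]_n) : 'M[K]_n :=
  \sum_(k < n.+1) (k`!%:R)^-1 *: X ^+ k.

Definition root_subgroup n (G T : set 'M[K]_n) (chi : 'M[K]_n -> K) :
    set 'M[K]_n :=
  [set mx_exp X | X in root_space G T chi].

(* The subgroup generated by T and the root subgroups of the roots +- beta_k,
   for the roots beta_k = sum_j beta k 0 j alpha_j; it is closed and connected,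
   reductive with base beta_1, ..., beta_s when no difference of two distinct
   beta_k is a root. *)
Definition subsystem_subgroup n l s (G T : set 'M[K]_n)
    (alpha : 'I_l -> 'M[K]_n -> K) (beta : 'I_s -> 'rV[int]_l) :
    set 'M[K]_n :=
  generated (T `|` \bigcup_k (root_subgroup G T (char_comb alpha (beta k)) `|`
                              root_subgroup G T (char_comb alpha (- beta k)))).

Definition irreducible_module n m (G : set 'M[K]_n)
    (rho : 'M[K]_n -> 'M[K]_m) : Prop :=
  [/\ (0 < m)%N, algebraic_hom G [set A | A \in unitmx] rho
    & forall W : {vspace 'cV[K]_m},
        (forall g w, G g -> w \in W -> rho g *m w \in W) ->
        W = 0%VS \/ W = fullv].

Definition highest_weight_vector n m (T B : set 'M[K]_n)
    (rho : 'M[K]_n -> 'M[K]_m) (omega : 'M[K]_n -> K) (v : 'cV[K]_m) : Prop :=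
  [/\ v != 0, forall b, B b -> exists c, rho b *m v = c *: v
    & forall t, T t -> rho t *m v = omega t *: v].

(* P is the stabilizer of the highest weight line in an irreducible G-module
   of highest weight omega. *)
Definition highest_weight_parabolic n (G T B : set 'M[K]_n)
    (omega : 'M[K]_n -> K) (P : set 'M[K]_n) : Prop :=
  exists (m : nat) (rho : 'M[K]_n -> 'M[K]_m) (v : 'cV[K]_m),
    [/\ irreducible_module G rho, highest_weight_vector T B rho omega v
      & P = [set g | G g /\ exists c, rho g *m v = c *: v]].

(* A point of G/P is a coset gP; the Zariski topology of G/P is the quotient
   topology of G. *)
Definition left_translate n (g : 'M[K]_n) (X : set 'M[K]_n) : set 'M[K]_n :=
  [set g *m x | x in X].

Definition coset_space n (G P : set 'M[K]_n) : set (set 'M[K]_n) :=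
  [set left_translate g P | g in G].

Definition open_in_coset_space n (G P : set 'M[K]_n)
    (O : set (set 'M[K]_n)) : Prop :=
  O `<=` coset_space G P /\
  open_in G [set g | G g /\ O (left_translate g P)].

Definition orbit_of n (S : set 'M[K]_n) (x : set 'M[K]_n) :
    set (set 'M[K]_n) :=
  [set left_translate s x | s in S].

(* G/P is a spherical H-variety. *)
Definition spherical n (H G P : set 'M[K]_n) : Prop :=
  exists2 BH, borel_subgroup H BH &
  exists2 x, coset_space G P x & open_in_coset_space G P (orbit_of BH x).

End AlgebraicGroups.

(* Bourbaki numbering; the label of a node i : 'I_7 is i.+1. *)
Definition E7_edges : seq (nat * nat) :=
  [:: (1, 3); (3, 4); (4, 5); (5, 6); (6, 7); (2, 4)]%N.

Definition E7_cartan : 'M[int]_7 :=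
  \matrix_(i, j)
    if i == j then 2%:Z
    else if ((i.+1, j.+1) \in E7_edges) || ((j.+1, i.+1) \in E7_edges)
    then -1 else 0.

(* alpha_1, alpha_3, ..., alpha_7, and, in the place of alpha_2, the root
   alpha_1 + 2 alpha_2 + 2 alpha_3 + 3 alpha_4 + 2 alpha_5 + alpha_6. *)
Definition A7_base (k : 'I_7) : 'rV[int]_7 :=
  if k.+1 == 2%N then \row_j nth 0 [:: 1; 2; 2; 3; 2; 1; 0] j
  else delta_mx 0 k.

(* Main.v *)
(* Write g = Lie(G) = h + q for the eigenspaces of the involution Theta whose fixed
   points are h = Lie(H).

   For i <> 7, let W be the centre of the nilradical of Lie(P_i) and y a vector of q
   spanning a line stable under a Borel subgroup of H.  In a basis of Ad(g) W, the
   h-part of the invariant form, the form (u, v) |-> ([y, u_h], v_q) and the linear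
   form (y, -) restrict to a symmetric matrix Q, a matrix C and a row vector b.  The
   functions tr(adj(Q) C)^2 and det(Q) b adj(Q) b^t of g have the same weight under
   the Borel subgroup on the left and under P_i on the right.  If the Borel subgroup
   has an open orbit in G/P_i, they are therefore proportional on G; moving y to a
   root vector by the torus and H, this is contradicted by explicit values at two
   elements g, products of exp(e_k) and exp(f_k), with integral Ad(g).

   For i = 7, let S be the product of T and the group generated by the exponentials
   of the positive simple root vectors of H; it is connected and solvable, hence
   contained in a Borel subgroup of H.  There is an explicit g0 such that
   Ad(g0^-1) Lie(S) + Lie(P_7) = g.  Then all iterated invariant derivatives at g0 of
   a polynomial vanishing on S g0 P_7 vanish, so S g0 P_7 is dense in G; being
   constructible, it contains a nonempty open set, whose translates cover the orbit.

   Computations in g are carried out in an integral model of the Lie algebra of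
   type E_7, identified with g through the Chevalley-Serre relations. *)
From Stdlib Require Import BinInt.
Require Import Defs.
From mathcomp Require Import all_boot all_order all_algebra.
From mathcomp Require Import closed_field.
From mathcomp Require Import mpoly.
From mathcomp Require Import boolp classical_sets reals complex.
From mathcomp Require Import ssrZ ring zify.

Set Implicit Arguments.
Unset Strict Implicit.
Unset Printing Implicit Defensive.

Import Order.TTheory GRing.Theory Num.Theory.
Local Open Scope classical_set_scope.
Local Open Scope ring_scope.

(** * Derivations of polynomial functions *)

Section PolynomialFunctions.
Variable K : numClosedFieldType.

(** A Borel subgroup of H has dimension 35. A dimension count would thus exclude i = 2, ..., 6,
    where dim G/P_i is 42, 47, 53, 50, 42, but it says nothing about i = 1, where the dimension is
    33. The quotient of the two functions is a rational invariant that treats all six nodes alike.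
    Since the Borel subgroup is arbitrary, y is not explicit: the Lie-Kolchin theorem, applied to q,
    provides it. Proportionality of the two functions is a closed condition on y, homogeneous and
    invariant under H; it therefore survives a limit of torus translates, and because q is
    irreducible under H this limit can be made the root vector of alpha_2. There only integers
    occur. For i = 7 sphericity asks for one Borel subgroup, and Zorn's lemma finds one that
    contains S. Constructibility comes from quantifier elimination over the algebraically closed
    field. For this S, P_7 and G are written as sets of values of polynomial maps on parameters
    subject to polynomial equations, which is why a group generated by exponentials is first shown
    to be the image of a single word map. *)

Lemma poly_fun_inj (p q : {poly K}) : (forall s, s != 0 -> p.[s] = q.[s]) -> p = q.
Proof.
move=> h; apply/eqP; rewrite -subr_eq0; apply/eqP.
apply: contraTeq isT => nz.
have sz := @max_poly_roots _ (p - q) [seq i.+1%:R | i <- iota 0 (size (p - q))] nz.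
rewrite size_map size_iota ltnn in sz.
have/sz: all (root (p - q)) [seq (i.+1%:R : K) | i <- iota 0 (size (p - q))].
  apply/allP=> _ /mapP [i _ ->]; rewrite rootE hornerD hornerN h ?subrr //.
  by rewrite pnatr_eq0.
rewrite map_inj_uniq ?iota_uniq; first by move=> /(_ isT).
by move=> i j /eqP; rewrite eqr_nat eqSS => /eqP.
Qed.

Lemma poly_fun_eq0 (p : {poly K}) : (forall s, s != 0 -> p.[s] = 0) -> p = 0.
Proof. by move=> h; apply: poly_fun_inj => s /h ->; rewrite horner0. Qed.

Definition pfun n (f : 'M[K]_n -> K) :=
  exists p : {mpoly K[n * n]}, forall A, f A = mxeval A p.

Section PFun.
Variable n : nat.
Implicit Types f g : 'M[K]_n -> K.

Lemma pfun_ext f g : f =1 g -> pfun f -> pfun g.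
Proof. by move=> e [p hp]; exists p => A; rewrite -e. Qed.

Lemma pfun_mxeval p : pfun (fun A : 'M[K]_n => mxeval A p).
Proof. by exists p. Qed.

Lemma pfunC c : pfun (fun _ : 'M[K]_n => c).
Proof. by exists c%:MP => A; rewrite /mxeval mevalC. Qed.

Lemma pfun_coord i j : pfun (fun A : 'M[K]_n => A i j).
Proof. by exists 'X_(mxvec_index i j) => A; rewrite /mxeval mevalXU mxvecE. Qed.

Lemma pfunD f g : pfun f -> pfun g -> pfun (fun A => f A + g A).
Proof. by move=> [p hp] [q hq]; exists (p + q) => A; rewrite /mxeval mevalD hp hq. Qed.

Lemma pfunM f g : pfun f -> pfun g -> pfun (fun A => f A * g A).
Proof. by move=> [p hp] [q hq]; exists (p * q) => A; rewrite /mxeval mevalM hp hq. Qed.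

Lemma pfunZ c f : pfun f -> pfun (fun A => c * f A).
Proof. by move=> h; apply: pfunM => //; exact: pfunC. Qed.

Lemma pfunN f : pfun f -> pfun (fun A => - f A).
Proof. by move=> h; apply: (pfun_ext _ (pfunZ (-1) h)) => A; rewrite mulN1r. Qed.

Lemma pfunB f g : pfun f -> pfun g -> pfun (fun A => f A - g A).
Proof. by move=> h1 h2; apply: pfunD => //; apply: pfunN. Qed.

Lemma pfun_sum I (r : seq I) (P : pred I) (F : I -> 'M[K]_n -> K) :
  (forall i, pfun (F i)) -> pfun (fun A => \sum_(i <- r | P i) F i A).
Proof.
move=> h; elim: r => [|i r IH].
  by apply: (pfun_ext _ (pfunC 0)) => A; rewrite big_nil.
case Pi: (P i); last by apply: (pfun_ext _ IH) => A; rewrite big_cons Pi.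
by apply: (pfun_ext _ (pfunD (h i) IH)) => A; rewrite big_cons Pi.
Qed.

Lemma pfun_prod I (r : seq I) (P : pred I) (F : I -> 'M[K]_n -> K) :
  (forall i, pfun (F i)) -> pfun (fun A => \prod_(i <- r | P i) F i A).
Proof.
move=> h; elim: r => [|i r IH].
  by apply: (pfun_ext _ (pfunC 1)) => A; rewrite big_nil.
case Pi: (P i); last by apply: (pfun_ext _ IH) => A; rewrite big_cons Pi.
by apply: (pfun_ext _ (pfunM (h i) IH)) => A; rewrite big_cons Pi.
Qed.

Lemma pfunX f k : pfun f -> pfun (fun A => f A ^+ k).
Proof.
move=> h; apply: (@pfun_ext (fun A => \prod_(i < k) f A)).
  by move=> A; rewrite prodr_const card_ord.
exact: pfun_prod.
Qed.

End PFun.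

(** Substitution principle: a class of functions that contains the constants and the coordinates
    [x i] and is closed under sums and products contains all polynomials in the coordinates. It
    serves polynomial, regular, Laurent and first-order definable functions alike. *)
Lemma mpoly_closed N (T : Type) (C : (T -> K) -> Prop) (x : 'I_N -> T -> K)
    (p : {mpoly K[N]}) :
  (forall f g, f =1 g -> C f -> C g) -> (forall c, C (fun _ => c)) ->
  (forall f g, C f -> C g -> C (fun t => f t + g t)) ->
  (forall f g, C f -> C g -> C (fun t => f t * g t)) ->
  (forall i, C (x i)) -> C (fun t => p.@[fun i => x i t]).
Proof.
move=> Ce Cc Cd Cm Cx; elim/mpolyind: p => [|c m p _ _ IH].
  by apply: Ce (Cc 0) => t; rewrite meval0.
apply: (Ce (fun t => c * 'X_[m].@[fun i => x i t] + p.@[fun i => x i t])).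
  by move=> t; rewrite mevalD mevalZ.
apply/Cd => //; apply/Cm; first exact/Cc.
apply: (Ce (fun t => \prod_(i < N) x i t ^+ m i)); first by move=> t; rewrite mevalX.
clear IH.
elim: (index_enum 'I_N) => [|i r IH]; first by apply: Ce (Cc 1) => t; rewrite big_nil.
apply: (Ce (fun t => x i t ^+ m i * \prod_(i <- r) x i t ^+ m i)).
  by move=> t; rewrite big_cons.
apply: (Cm (fun t => x i t ^+ m i)) => //; elim: (m i) => [|k IHk]; first by apply: Ce (Cc 1) => t; rewrite expr0.
by apply: (Ce (fun t => x i t * x i t ^+ k)); [move=> t; rewrite exprS | apply/Cm].
Qed.

Definition pmx n m1 m2 (F : 'M[K]_n -> 'M[K]_(m1, m2)) :=
  forall i j, pfun (fun A => F A i j).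

Lemma pfun_comp n m (F : 'M[K]_n -> 'M[K]_m) f :
  pfun f -> pmx F -> pfun (fun A => f (F A)).
Proof.
move=> [p hp] hF; apply: (@pfun_ext _ (fun A => p.@[fun k => mxvec (F A) 0 k])).
  by move=> A; rewrite hp.
apply: (@mpoly_closed _ _ (@pfun n) (fun k A => mxvec (F A) 0 k)) => //.
- exact: pfun_ext.
- exact: pfunC.
- exact: pfunD.
- exact: pfunM.
by move=> k; case/mxvec_indexP: k => i j; apply: (pfun_ext _ (hF i j)) => A; rewrite mxvecE.
Qed.

Section PMx.
Variable n : nat.

Lemma pmxC m1 m2 (B : 'M[K]_(m1, m2)) : pmx (fun _ : 'M[K]_n => B).
Proof. by move=> i j; apply: pfunC. Qed.

Lemma pmx_id : pmx (fun A : 'M[K]_n => A).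
Proof. by move=> i j; apply: pfun_coord. Qed.

Lemma pmxM m1 m2 m3 (F : 'M[K]_n -> 'M[K]_(m1, m2)) (G : 'M[K]_n -> 'M[K]_(m2, m3)) :
  pmx F -> pmx G -> pmx (fun A => F A *m G A).
Proof.
move=> hF hG i j; apply: (@pfun_ext _ (fun A => \sum_k F A i k * G A k j)).
  by move=> A; rewrite mxE.
by apply: pfun_sum => k; apply: pfunM.
Qed.

Lemma pmx_tr m1 m2 (F : 'M[K]_n -> 'M[K]_(m1, m2)) :
  pmx F -> pmx (fun A => (F A)^T).
Proof. by move=> hF i j; apply: (pfun_ext _ (hF j i)) => A; rewrite mxE. Qed.

Lemma pfun_det m (F : 'M[K]_n -> 'M[K]_m) : pmx F -> pfun (fun A => \det (F A)).
Proof.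
move=> hF; apply: pfun_sum => s; apply: pfunZ.
by apply: pfun_prod => i.
Qed.

Lemma pmx_adj m (F : 'M[K]_n -> 'M[K]_m) : pmx F -> pmx (fun A => \adj (F A)).
Proof.
move=> hF i j; apply: (@pfun_ext _ (fun A => cofactor (F A) j i)).
  by move=> A; rewrite mxE.
apply: pfunZ; apply: pfun_det => a b.
by apply: (pfun_ext _ (hF (lift j a) (lift i b))) => A; rewrite !mxE.
Qed.

Lemma pfun_tr m (F : 'M[K]_n -> 'M[K]_m) : pmx F -> pfun (fun A => \tr (F A)).
Proof. by move=> hF; apply: pfun_sum => i. Qed.

End PMx.

(* Laurent polynomial functions of s, with their derivative at s = 1. *)
Definition lder (F : K -> K) (d : K) :=
  exists (P : {poly K}) (k : nat),
    (forall s, s != 0 -> F s = P.[s] / s ^+ k) /\ d = P^`().[1] - k%:R * P.[1].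

Lemma lder_ext F G d : (forall s, s != 0 -> F s = G s) -> lder F d -> lder G d.
Proof. by move=> e [P [k [h ->]]]; exists P, k; split=> // s nz; rewrite -e // h. Qed.

Lemma lder_poly (P : {poly K}) : lder (fun s => P.[s]) P^`().[1].
Proof. by exists P, 0%N; split=> [s|]; rewrite ?mul0r ?subr0 // expr0 divr1. Qed.

Lemma lderC c : lder (fun _ => c) 0.
Proof.
by apply: lder_ext (_ : lder (fun s => c%:P.[s]) _); [move=> s _; rewrite hornerC|
   have := lder_poly c%:P; rewrite derivC horner0].
Qed.

Lemma lder_Xn_inv k : lder (fun s => s ^- k) (- k%:R).
Proof.
exists 1, k; split=> [s _|]; first by rewrite hornerC mul1r.
by rewrite -polyC1 derivC horner0 hornerC mulr1 sub0r.
Qed.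

Lemma lderD F G a b : lder F a -> lder G b -> lder (fun s => F s + G s) (a + b).
Proof.
move=> [P [k [hP ->]]] [Q [l [hQ ->]]]; exists (P * 'X^l + Q * 'X^k), (k + l)%N; split.
  move=> s nz; rewrite hP // hQ // !(hornerD, hornerM, hornerXn) exprD.
  by field; rewrite !expf_neq0.
by rewrite derivD !derivM !derivXn !(hornerD, hornerM, hornerMn, hornerXn) !expr1n natrD; ring.
Qed.

Lemma lderM F G a b : lder F a -> lder G b ->
  lder (fun s => F s * G s) (a * G 1 + F 1 * b).
Proof.
move=> [P [k [hP ->]]] [Q [l [hQ ->]]]; exists (P * Q), (k + l)%N; split.
  move=> s nz; rewrite hP // hQ // hornerM exprD.
  by field; rewrite !expf_neq0.
by rewrite hP ?oner_neq0 // hQ ?oner_neq0 // derivM !(hornerD, hornerM) !expr1n natrD !divr1; ring.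
Qed.

Lemma lderZ c F a : lder F a -> lder (fun s => c * F s) (c * a).
Proof. by move=> h; have := lderM (lderC c) h; rewrite mul0r add0r. Qed.

Lemma lderN F a : lder F a -> lder (fun s => - F s) (- a).
Proof.
by move=> /(lderZ (-1)); rewrite mulN1r; apply: lder_ext => s _; rewrite mulN1r.
Qed.

Lemma lder_sum I (r : seq I) (P : pred I) F a :
  (forall i, lder (F i) (a i)) ->
  lder (fun s => \sum_(i <- r | P i) F i s) (\sum_(i <- r | P i) a i).
Proof.
move=> h; elim: r => [|i r IH].
  by rewrite big_nil; apply: lder_ext (lderC 0) => s _; rewrite big_nil.
rewrite big_cons; case Pi: (P i); last by apply: lder_ext IH => s _; rewrite big_cons Pi.
by apply: lder_ext (lderD (h i) IH) => s _; rewrite big_cons Pi.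
Qed.

(** The pair [P], [k] is not determined by [F]. Clearing denominators gives [P * 'X^l = Q * 'X^k],
    and differentiating at 1 compares the two values. *)
Lemma lder_uniq F a b : lder F a -> lder F b -> a = b.
Proof.
move=> [P [k [hP ->]]] [Q [l [hQ ->]]].
have e : P * 'X^l = Q * 'X^k.
  apply: poly_fun_inj => s nz; have := hP s nz; rewrite hQ // !hornerM !hornerXn.
  move=> /(congr1 (fun x => x * (s ^+ k * s ^+ l))).
  have ks: s ^+ k != 0 by rewrite expf_neq0.
  have ls: s ^+ l != 0 by rewrite expf_neq0.
  have -> : Q.[s] / s ^+ l * (s ^+ k * s ^+ l) = Q.[s] * s ^+ k by field.
  by have -> : P.[s] / s ^+ k * (s ^+ k * s ^+ l) = P.[s] * s ^+ l by field.
have e1 : P.[1] = Q.[1].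
  by have := congr1 (fun p => p.[1]) e; rewrite /= !hornerM !hornerXn !expr1n !mulr1.
have := congr1 (fun p => p^`().[1]) e.
rewrite !derivM !derivXn !(hornerD, hornerM, hornerMn, hornerXn) !expr1n !mulr1 e1 => h.
have -> : P^`().[1] = Q^`().[1] + Q.[1] * k%:R - Q.[1] * l%:R by rewrite -h addrK.
by ring.
Qed.

Definition lmx m1 m2 (c : K -> 'M[K]_(m1, m2)) (X : 'M[K]_(m1, m2)) :=
  forall i j, lder (fun s => c s i j) (X i j).

Lemma lmxC m1 m2 (B : 'M[K]_(m1, m2)) : lmx (fun _ => B) 0.
Proof. by move=> i j; rewrite mxE; apply: lderC. Qed.

Lemma lmxM m1 m2 m3 (c : K -> 'M[K]_(m1, m2)) (d : K -> 'M[K]_(m2, m3)) X Y :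
  lmx c X -> lmx d Y -> lmx (fun s => c s *m d s) (X *m d 1 + c 1 *m Y).
Proof.
move=> hc hd i j; rewrite mxE mxE mxE -big_split /=.
apply: (@lder_ext (fun s => \sum_k c s i k * d s k j)); first by move=> s _; rewrite mxE.
by apply: lder_sum => k; apply: lderM.
Qed.

Lemma lmx_uniq m1 m2 (c : K -> 'M[K]_(m1, m2)) X Y : lmx c X -> lmx c Y -> X = Y.
Proof. by move=> h1 h2; apply/matrixP=> i j; apply: lder_uniq (h1 i j) (h2 i j). Qed.

(** The differential of [p] at [A] in the direction [X]; at [A = 1%:M] it is the linear form in the
    definition of [lie_algebra]. *)
Definition dpf n (p : {mpoly K[n * n]}) (A X : 'M[K]_n) :=
  \sum_k mxeval A (mderiv k p) * mxvec X 0 k.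

Section Differential.
Variable n : nat.
Implicit Types (p q : {mpoly K[n * n]}) (A X Y Z : 'M[K]_n).

Lemma dpf_lin p A a X Y : dpf p A (a *: X + Y) = a * dpf p A X + dpf p A Y.
Proof.
rewrite /dpf mulr_sumr -big_split /=; apply: eq_bigr => k _.
by rewrite linearP /= !mxE; ring.
Qed.

Lemma dpf0 p A : dpf p A 0 = 0.
Proof. by rewrite /dpf big1 // => k _; rewrite linear0 mxE mulr0. Qed.

Lemma dpfD p A X Y : dpf p A (X + Y) = dpf p A X + dpf p A Y.
Proof. by have := dpf_lin p A 1 X Y; rewrite scale1r mul1r. Qed.

Lemma dpfZ p A a X : dpf p A (a *: X) = a * dpf p A X.
Proof. by have := dpf_lin p A a X 0; rewrite !addr0 dpf0 addr0. Qed.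

Lemma lder_mxeval (c : K -> 'M[K]_n) X p :
  lmx c X -> lder (fun s => mxeval (c s) p) (dpf p (c 1) X).
Proof.
move=> hc.
have hk k : lder (fun s => mxvec (c s) 0 k) (mxvec X 0 k).
  by case/mxvec_indexP: k => i j; rewrite mxvecE; apply: lder_ext (hc i j) => s _; rewrite mxvecE.
rewrite /dpf /mxeval; elim/mpolyind: p => [|a m p _ _ IH].
  rewrite big1 => [|k _]; last by rewrite linear0 meval0 mul0r.
  by apply: lder_ext (lderC 0) => s _; rewrite meval0.
set x := fun s k => mxvec (c s) 0 k.
suff hX : lder (fun s => 'X_[m].@[x s]) (\sum_k ('X_[m]^`M(k)).@[x 1] * mxvec X 0 k).
  have := lderD (lderZ a hX) IH; rewrite mulr_sumr -big_split /=.
  rewrite (_ : \sum_k _ = \sum_k ((a *: 'X_[m] + p)^`M(k)).@[x 1] * mxvec X 0 k).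
    by apply: lder_ext => s _; rewrite mevalD mevalZ.
  by apply: eq_bigr => k _; rewrite mderivD mderivZ mevalD mevalZ; ring.
pose Q p := lder (fun s => p.@[x s]) (\sum_k (p^`M(k)).@[x 1] * mxvec X 0 k).
have Q1 : Q 1.
  rewrite /Q big1 => [|k _]; last by rewrite -mpolyC1 mderivC meval0 mul0r.
  by apply: lder_ext (lderC 1) => s _; rewrite meval1.
have QM p1 q : Q p1 -> Q q -> Q (p1 * q).
  move=> hp hq; have := lderM hp hq.
  rewrite mulr_suml mulr_sumr -big_split /= /Q.
  rewrite (_ : \sum_k _ = \sum_k ((p1 * q)^`M(k)).@[x 1] * mxvec X 0 k).
    by apply: lder_ext => s _; rewrite mevalM.
  by apply: eq_bigr => k _; rewrite mderivM mevalD !mevalM; ring.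
have QX k : Q 'X_k.
  rewrite /Q (bigD1 k) //= big1 => [|l lk].
    rewrite mderivX mnm1E eqxx scale1r (_ : (U_(k) - U_(k))%MM = 0%MM) ?mpolyX0 ?meval1 ?mul1r ?addr0; last first.
      by apply/mnmP=> l; rewrite mnmBE subnn mnm0E.
    by apply: lder_ext (hk k) => s _; rewrite mevalXU.
  by rewrite mderivX mnm1E eq_sym (negbTE lk) scale0r meval0 mul0r.
rewrite -/(Q 'X_[m]) mpolyXE_id; elim/big_rec: _ => // k p1 _ hp; apply/QM => //.
by elim: (m k) => [|j IHj]; rewrite ?expr0 // exprS; apply/QM.
Qed.

(** A polynomial chosen to represent [f], and 0 if there is none. It turns derivations given
    pointwise into operators on polynomials, which can be iterated. *)
Definition polf (f : 'M[K]_n -> K) : {mpoly K[n * n]} :=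
  xget 0 [set p | forall A, f A = mxeval A p].

Lemma polfE f A : pfun f -> mxeval A (polf f) = f A.
Proof. by move=> [p hp]; rewrite /polf; case: xgetP => [q -> /= h|/(_ p)]; rewrite ?h. Qed.

(* The derivations of functions along X given by right and left translations. *)
Definition dR X p := polf (fun A => dpf p A (A *m X)).
Definition dL X p := polf (fun A => dpf p A (X *m A)).

Lemma pfun_dpf p (L : 'M[K]_n -> 'M[K]_n) : pmx L -> pfun (fun A => dpf p A (L A)).
Proof.
move=> hL; apply: pfun_sum => k; apply: pfunM; first exact: pfun_mxeval.
by case/mxvec_indexP: k => i j; apply: (pfun_ext _ (hL i j)) => A; rewrite mxvecE.
Qed.

Lemma dRE X p A : mxeval A (dR X p) = dpf p A (A *m X).
Proof. by rewrite polfE //; apply: pfun_dpf; apply: pmxM; [apply: pmx_id|apply: pmxC]. Qed.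

Lemma dLE X p A : mxeval A (dL X p) = dpf p A (X *m A).
Proof. by rewrite polfE //; apply: pfun_dpf; apply: pmxM; [apply: pmxC|apply: pmx_id]. Qed.

Lemma lder_dR (c : K -> 'M[K]_n) X p A :
  lmx c X -> c 1 = 1%:M -> lder (fun s => mxeval (A *m c s) p) (mxeval A (dR X p)).
Proof.
move=> hc c1; have := lder_mxeval p (lmxM (lmxC A) hc).
by rewrite mul0mx add0r c1 mulmx1 dRE.
Qed.

Lemma lder_dL (c : K -> 'M[K]_n) X p A :
  lmx c X -> c 1 = 1%:M -> lder (fun s => mxeval (c s *m A) p) (mxeval A (dL X p)).
Proof.
move=> hc c1; have := lder_mxeval p (lmxM hc (lmxC A)).
by rewrite mulmx0 addr0 c1 mul1mx dLE.
Qed.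

Definition hess p A X Y :=
  \sum_k \sum_l mxeval A (mderiv l (mderiv k p)) * mxvec X 0 k * mxvec Y 0 l.

Lemma hessC p A X Y : hess p A X Y = hess p A Y X.
Proof.
rewrite /hess exchange_big /=; apply: eq_bigr => k _; apply: eq_bigr => l _.
by rewrite mderiv_comm; ring.
Qed.

Lemma lmx_line A Z : lmx (fun s => A + (s - 1) *: Z) Z.
Proof.
move=> i j; have := lder_poly ((A i j)%:P + ('X - 1%:P) * (Z i j)%:P).
rewrite derivD derivM derivC derivXsubC derivC mulr0 addr0 mul1r add0r hornerC.
by apply: lder_ext => s _; rewrite !hornerE !mxE.
Qed.

(** Differentiating twice along linear vector fields gives the Hessian plus a first-order term. The
    Hessian is symmetric, so only first-order terms survive in the commutators of [dR] and [dL]. *)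
Lemma dpf_dpf p q (L : {linear 'M[K]_n -> 'M[K]_n}) A Z :
  (forall B, mxeval B q = dpf p B (L B)) ->
  dpf q A Z = hess p A (L A) Z + dpf p A (L Z).
Proof.
move=> hq; have h1 := lder_mxeval q (lmx_line A Z).
rewrite subrr scale0r addr0 in h1; apply: (lder_uniq h1).
have hL : lmx (fun s => L (A + (s - 1) *: Z)) (L Z).
  move=> i j; apply: lder_ext (lmx_line (L A) (L Z) i j) => s _.
  by rewrite linearD linearZ.
rewrite /hess /dpf -big_split /=.
apply: (@lder_ext (fun s => \sum_k mxeval (A + (s - 1) *: Z) p^`M(k) *
   mxvec (L (A + (s - 1) *: Z)) 0 k)); first by move=> s _; rewrite hq.
apply: lder_sum => k.
have hk : lder (fun s => mxvec (L (A + (s - 1) *: Z)) 0 k) (mxvec (L Z) 0 k).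
  by case/mxvec_indexP: k => i j; rewrite mxvecE; apply: lder_ext (hL i j) => s _; rewrite mxvecE.
have := lderM (lder_mxeval p^`M(k) (lmx_line A Z)) hk.
rewrite subrr scale0r addr0 /dpf mulr_suml.
rewrite [X in X + _](_ : _ = \sum_l mxeval A p^`M(k)^`M(l) * mxvec (L A) 0 k * mxvec Z 0 l) //.
by apply: eq_bigr => l _; ring.
Qed.

Lemma dRR X Y p A : mxeval A (dR X (dR Y p)) - mxeval A (dR Y (dR X p)) =
  mxeval A (dR (X *m Y - Y *m X) p).
Proof.
rewrite !dRE (@dpf_dpf p (dR Y p) (mulmxr Y)) => [|B]; last by rewrite dRE.
rewrite (@dpf_dpf p (dR X p) (mulmxr X)) => [|B]; last by rewrite dRE.
by rewrite hessC /= mulmxBr -!mulmxA dpfD -scaleN1r dpfZ; ring.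
Qed.

Lemma dLL X Y p A : mxeval A (dL X (dL Y p)) - mxeval A (dL Y (dL X p)) =
  mxeval A (dL (Y *m X - X *m Y) p).
Proof.
rewrite !dLE (@dpf_dpf p (dL Y p) (mulmx Y)) => [|B]; last by rewrite dLE.
rewrite (@dpf_dpf p (dL X p) (mulmx X)) => [|B]; last by rewrite dLE.
by rewrite hessC /= mulmxBl -!mulmxA dpfD -scaleN1r dpfZ; ring.
Qed.

Lemma dRL X Y p A : mxeval A (dR X (dL Y p)) = mxeval A (dL Y (dR X p)).
Proof.
rewrite dRE dLE (@dpf_dpf p _ (mulmx Y)) => [|B]; last by rewrite dLE.
rewrite (@dpf_dpf p (dR X p) (mulmxr X)) => [|B]; last by rewrite dRE.
by rewrite hessC /= mulmxA.
Qed.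

End Differential.
End PolynomialFunctions.

(** * Exponentials of nilpotent matrices and Taylor expansion along them *)

Section Exponential.
Variable K : numClosedFieldType.

(** Polynomial functions with their derivative at every point, for the uniqueness of solutions of
    differential equations; [lder] only sees the point 1. *)
Definition pder (F F' : K -> K) :=
  exists P : {poly K}, forall s, F s = P.[s] /\ F' s = P^`().[s].

Lemma pder_ext F G F' G' : F =1 G -> F' =1 G' -> pder F F' -> pder G G'.
Proof. by move=> e e' [P h]; exists P => s; rewrite -e -e'; apply: h. Qed.

Lemma pderC c : pder (fun _ => c) (fun _ => 0).
Proof. by exists c%:P => s; rewrite derivC hornerC horner0. Qed.

Lemma pderD F G F' G' : pder F F' -> pder G G' ->
  pder (fun s => F s + G s) (fun s => F' s + G' s).
Proof.
move=> [P hP] [Q hQ]; exists (P + Q) => s.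
by rewrite derivD !hornerD; case: (hP s) => -> ->; case: (hQ s) => -> ->.
Qed.

Lemma pderM F G F' G' : pder F F' -> pder G G' ->
  pder (fun s => F s * G s) (fun s => F' s * G s + F s * G' s).
Proof.
move=> [P hP] [Q hQ]; exists (P * Q) => s.
by rewrite derivM hornerD !hornerM; case: (hP s) => -> ->; case: (hQ s) => -> ->.
Qed.

Lemma pder_sum I (r : seq I) (P : pred I) F F' :
  (forall i, pder (F i) (F' i)) ->
  pder (fun s => \sum_(i <- r | P i) F i s) (fun s => \sum_(i <- r | P i) F' i s).
Proof.
move=> h; elim: r => [|i r IH].
  by apply: pder_ext (pderC 0) => s; rewrite big_nil.
case Pi: (P i); last by apply: pder_ext IH => s; rewrite big_cons Pi.
by apply: pder_ext (pderD (h i) IH) => s; rewrite big_cons Pi.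
Qed.

Lemma pder_Xn k : pder (fun s => s ^+ k.+1) (fun s => k.+1%:R * s ^+ k).
Proof.
by exists ('X^(k.+1)) => s; rewrite derivXn hornerMn !hornerXn mulr_natl.
Qed.

Lemma pder_uniq F F1 F2 : pder F F1 -> pder F F2 -> F1 =1 F2.
Proof.
move=> [P hP] [Q hQ] s; case: (hP s) => _ ->; case: (hQ s) => _ ->.
by congr (_^`().[_]); apply: poly_fun_inj => t _; case: (hP t) => <- _; case: (hQ t).
Qed.

Lemma pder0_const F : pder F (fun _ => 0) -> forall s, F s = F 0.
Proof.
move=> [P hP] s; case: (hP s) => -> _; case: (hP 0) => -> _.
have d0 : P^`() = 0 by apply: poly_fun_eq0 => t _; case: (hP t).
suff -> : P = (P`_0)%:P by rewrite !hornerC.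
apply/polyP=> -[|i]; rewrite coefC //=.
have /eqP := congr1 (fun p : {poly K} => p`_i) d0.
by rewrite coef_deriv coef0 mulrn_eq0 /= => /eqP.
Qed.

Definition mpder m1 m2 (c c' : K -> 'M[K]_(m1, m2)) :=
  forall i j, pder (fun s => c s i j) (fun s => c' s i j).

Section MPder.
Variables m1 m2 m3 : nat.
Implicit Types (c d : K -> 'M[K]_(m1, m2)).

Lemma mpder_ext c d c' d' : c =1 d -> c' =1 d' -> mpder c c' -> mpder d d'.
Proof. by move=> e e' h i j; apply: pder_ext (h i j) => s; rewrite ?e ?e'. Qed.

Lemma mpderC (B : 'M[K]_(m1, m2)) : mpder (fun _ => B) (fun _ => 0).
Proof. by move=> i j; apply: pder_ext (pderC (B i j)) => s //; rewrite mxE. Qed.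

Lemma mpderD c d c' d' : mpder c c' -> mpder d d' ->
  mpder (fun s => c s + d s) (fun s => c' s + d' s).
Proof. by move=> h1 h2 i j; apply: pder_ext (pderD (h1 i j) (h2 i j)) => s; rewrite mxE. Qed.

Lemma mpderZ f f' c c' : pder f f' -> mpder c c' ->
  mpder (fun s => f s *: c s) (fun s => f' s *: c s + f s *: c' s).
Proof.
by move=> h1 h2 i j; apply: pder_ext (pderM h1 (h2 i j)) => s; rewrite !mxE.
Qed.

Lemma mpder_sum I (r : seq I) (P : pred I) (F F' : I -> K -> 'M[K]_(m1, m2)) :
  (forall i, mpder (F i) (F' i)) ->
  mpder (fun s => \sum_(i <- r | P i) F i s) (fun s => \sum_(i <- r | P i) F' i s).
Proof.
move=> h i j; apply: pder_ext (pder_sum r P (fun k => h k i j)) => s;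
 by rewrite summxE.
Qed.

Lemma mpderM c c' (d d' : K -> 'M[K]_(m2, m3)) : mpder c c' -> mpder d d' ->
  mpder (fun s => c s *m d s) (fun s => c' s *m d s + c s *m d' s).
Proof.
move=> hc hd i j.
apply: (@pder_ext (fun s => \sum_k c s i k * d s k j) _
  (fun s => \sum_k (c' s i k * d s k j + c s i k * d' s k j))) => [s|s|].
- by rewrite mxE.
- by rewrite !mxE -big_split.
by apply: pder_sum => k; apply: pderM.
Qed.

Lemma mpder_uniq c d d' : mpder c d -> mpder c d' -> d =1 d'.
Proof. by move=> h1 h2 s; apply/matrixP=> i j; apply: pder_uniq (h1 i j) (h2 i j) s. Qed.

Lemma mpder0_const c : mpder c (fun _ => 0) -> forall s, c s = c 0.
Proof.
move=> h s; apply/matrixP=> i j; apply: (@pder0_const (fun s => c s i j)).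
by apply: pder_ext (h i j) => t //; rewrite mxE.
Qed.

End MPder.

Definition nilp n (X : 'M[K]_n) := exists k, X ^+ k = 0.

Lemma expmxZ n (X : 'M[K]_n) s k : (s *: X) ^+ k = s ^+ k *: X ^+ k.
Proof.
elim: k => [|k IH]; first by rewrite !expr0 scale1r.
by rewrite !exprS IH -!mulmxE -scalemxAl -scalemxAr scalerA.
Qed.

Lemma nilpZ n (X : 'M[K]_n) s : nilp X -> nilp (s *: X).
Proof. by move=> [k hk]; exists k; rewrite expmxZ hk scaler0. Qed.

Lemma nilpN n (X : 'M[K]_n) : nilp X -> nilp (- X).
Proof. by move=> h; rewrite -scaleN1r; apply: nilpZ. Qed.

(** The minimal polynomial of a nilpotent [X] is a power of ['X] dividing the characteristic
    polynomial, which has degree [n]. Hence the sum in [mx_exp] is the full exponential series. *)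
Lemma nilp_expn n (X : 'M[K]_n) : nilp X -> forall k, (n <= k)%N -> X ^+ k = 0.
Proof.
case: n X => [|n] X [k Xk] l nl; first by apply/matrixP=> -[].
have /dvdp_exp_XsubCP : mxminpoly X %| ('X - 0%:P) ^+ k.
  by rewrite mxminpoly_min // subr0 rmorphXn /= horner_mx_X.
case=> j [_ e]; rewrite subr0 in e.
have e2 : mxminpoly X = 'X^j.
  by apply/eqP; rewrite -eqp_monic ?mxminpoly_monic ?monicXn.
have jl : (j <= l)%N.
  have := dvdp_leq (monic_neq0 (char_poly_monic X)) (mxminpoly_dvd_char X).
  by rewrite e2 size_polyXn size_char_poly ltnS => /leq_trans; apply.
have Xj : X ^+ j = 0.
  by have := mx_root_minpoly X; rewrite e2 rmorphXn /= horner_mx_X.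
by rewrite -(subnK jl) exprD Xj mulr0.
Qed.

Lemma mx_exp_trunc n (X : 'M[K]_n) N : nilp X -> (n < N)%N ->
  mx_exp X = \sum_(k < N) (k`!%:R)^-1 *: X ^+ k.
Proof.
move=> hX nN; rewrite /mx_exp (big_ord_widen N (fun k => (k`!%:R)^-1 *: X ^+ k)) //.
rewrite [RHS](bigID (fun k : 'I_N => (k < n.+1)%N)) /= [X in _ + X]big1 ?addr0 // => k.
by rewrite -leqNgt => /ltnW/(nilp_expn hX) ->; rewrite scaler0.
Qed.

Lemma mx_exp0 n : mx_exp (0 : 'M[K]_n) = 1%:M.
Proof.
rewrite /mx_exp big_ord_recl big1 ?addr0 => [|i _].
  by rewrite expr0 fact0 invr1 scale1r.
by rewrite exprS mul0r scaler0.
Qed.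

(** Both series are truncated at the same bound and compared term by term. With [B] a column vector
    and [Y = 0] this says that [exp X] fixes the vectors killed by [X]. *)
Lemma mx_exp_intertwine m n (X : 'M[K]_m) (Y : 'M[K]_n) (B : 'M[K]_(m, n)) :
  nilp X -> nilp Y -> X *m B = B *m Y -> mx_exp X *m B = B *m mx_exp Y.
Proof.
move=> hX hY e; rewrite (@mx_exp_trunc _ X (maxn m n).+1) // ?ltnS ?leq_maxl //.
rewrite (@mx_exp_trunc _ Y (maxn m n).+1) // ?ltnS ?leq_maxr //.
rewrite mulmx_suml mulmx_sumr; apply: eq_bigr => k _.
rewrite -scalemxAl -scalemxAr; congr (_ *: _).
elim: {k}(val k) => [|k IH]; first by rewrite !expr0 mul1mx mulmx1.
by rewrite !exprS -!mulmxE -mulmxA IH !mulmxA e.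
Qed.

Lemma mpder_mx_exp n (X : 'M[K]_n) : nilp X ->
  mpder (fun s => mx_exp (s *: X)) (fun s => mx_exp (s *: X) *m X).
Proof.
move=> hX.
apply: (@mpder_ext _ _ (fun s => 1%:M + \sum_(k < n) (s ^+ k.+1) *: ((k.+1`!%:R)^-1 *: X ^+ k.+1)) _
  (fun s => 0 + \sum_(k < n) ((k.+1%:R * s ^+ k) *: ((k.+1`!%:R)^-1 *: X ^+ k.+1) + s ^+ k.+1 *: 0))).
- move=> s; rewrite /mx_exp big_ord_recl expr0 fact0 invr1 scale1r; congr (_ + _).
  apply: eq_bigr => k _; rewrite lift0 expmxZ !scalerA; congr (_ *: _); ring.
- move=> s; rewrite (mx_exp_trunc (nilpZ s hX) (ltnSn n)) big_ord_recr /= add0r mulmxDl.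
  have hS k : X ^+ k *m X = X ^+ k.+1 by rewrite exprSr.
  rewrite -scalemxAl expmxZ -scalemxAl hS.
  rewrite (nilp_expn hX (leqnSn n)) !scaler0 addr0 mulmx_suml.
  apply: eq_bigr => k _; rewrite scaler0 addr0 expmxZ scalerA -!scalemxAl hS !scalerA.
  congr (_ *: _); rewrite factS natrM invfM.
  by rewrite mulrACA divff ?pnatr_eq0 // mul1r mulrC.
apply: mpderD; first exact: mpderC.
by apply: mpder_sum => k; apply: mpderZ (pder_Xn k) (mpderC _).
Qed.

(** The curve [exp (s X) exp (- s X)] has derivative zero and value 1 at [s = 0]. *)
Lemma mx_expNK n (X : 'M[K]_n) : nilp X -> mx_exp X *m mx_exp (- X) = 1%:M.
Proof.
move=> hX.
have h := mpderM (mpder_mx_exp hX) (mpder_mx_exp (nilpN hX)).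
have h0 := @mpder0_const _ _ _ (mpder_ext (fun=> erefl) _ h).
have := h0 _ 1; rewrite !scale1r !scale0r mx_exp0 mulmx1; apply=> s.
rewrite (mx_exp_intertwine (nilpZ s (nilpN hX)) (nilpZ s (nilpN hX)) (B := - X)).
  by rewrite mulNmx mulmxN !mulmxA subrr.
by rewrite -scalemxAl -scalemxAr.
Qed.

Lemma mx_expKN n (X : 'M[K]_n) : nilp X -> mx_exp (- X) *m mx_exp X = 1%:M.
Proof. by move=> /nilpN/mx_expNK; rewrite opprK. Qed.

Lemma mx_exp_unit n (X : 'M[K]_n) : nilp X -> mx_exp X \in unitmx.
Proof. by move=> /mx_expNK/mulmx1_unit []. Qed.

Lemma invmx_unique n (A B : 'M[K]_n) : A *m B = 1%:M -> invmx A = B.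
Proof.
move=> e; have [uA _] := mulmx1_unit e.
by rewrite -[RHS](mulKmx uA) e mulmx1.
Qed.

Lemma mx_exp_inv n (X : 'M[K]_n) : nilp X -> invmx (mx_exp X) = mx_exp (- X).
Proof. by move=> h; apply: invmx_unique; apply: mx_expNK. Qed.

Lemma ode_exp m n (c : K -> 'M[K]_(m, n)) (X : 'M[K]_n) : nilp X ->
  mpder c (fun s => c s *m X) -> forall s, c s = c 0 *m mx_exp (s *: X).
Proof.
move=> hX hc s.
have h := mpderM hc (mpder_mx_exp (nilpN hX)).
have h0 := @mpder0_const _ _ _ (mpder_ext (fun=> erefl) _ h).
have e : c s *m mx_exp (s *: - X) = c 0.
  rewrite h0 ?scale0r ?mx_exp0 ?mulmx1 // => t.
  rewrite (mx_exp_intertwine (nilpZ t (nilpN hX)) (nilpZ t (nilpN hX)) (B := - X)).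
    by rewrite mulNmx mulmxN !mulmxA subrr.
  by rewrite -scalemxAl -scalemxAr.
by rewrite -e -mulmxA scalerN mx_expKN ?mulmx1 //; apply: nilpZ.
Qed.

(** [D] acts on labels and realises [d/ds]. In characteristic 0 a polynomial whose derivatives all
    vanish at 0 is zero; the induction is on its size. *)
Lemma pder_taylor (T : Type) (D : T -> T) (F : T -> K -> K) :
  (forall t, pder (F t) (F (D t))) -> forall t, (forall k, F (iter k D t) 0 = 0) ->
  forall s, F t s = 0.
Proof.
move=> hF t0 h0 s.
have [P0 hP0] : exists P : {poly K}, forall s, F t0 s = P.[s].
  by have [P hP] := hF t0; exists P => r; case: (hP r).
suff: P0 = 0 by rewrite hP0 => ->; rewrite horner0.
elim: {P0}(size P0) {-2}P0 (leqnn (size P0)) t0 h0 hP0 => [|k IH] P szP t h0 hP.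
  by apply/eqP; rewrite -size_poly_leq0.
have hP' r : F (D t) r = P^`().[r].
  have [Q hQ] := hF t; case: (hQ r) => _ ->; congr (_^`().[_]).
  by apply: poly_fun_inj => u _; case: (hQ u) => <- _; rewrite hP.
have d0 : P^`() = 0.
  apply: (IH _ _ (D t)) => // [|j].
    case: (eqVneq P 0) => [->|nz]; first by rewrite deriv0 size_poly0.
    by rewrite -ltnS (leq_trans (lt_size_deriv nz)).
  by rewrite -iterSr; apply: h0.
have P0 : P`_0 = 0 by rewrite -horner_coef0 -hP; apply: (h0 0%N).
apply/polyP=> -[|i]; rewrite coef0 //.
have /eqP := congr1 (fun p : {poly K} => p`_i) d0.
by rewrite coef_deriv coef0 mulrn_eq0 /= => /eqP.
Qed.

Section Taylor.
Variable n : nat.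
Implicit Types (p : {mpoly K[n * n]}) (A B X : 'M[K]_n).

(** The chain rule at a point [s] is the one at 1, applied to the curve [u |-> c (s + (u - 1))]. *)
Lemma pder_mxeval (c c' : K -> 'M[K]_n) p : mpder c c' ->
  pder (fun s => mxeval (c s) p) (fun s => dpf p (c s) (c' s)).
Proof.
move=> hc.
have [P hP] : exists P : {poly K}, forall s, mxeval (c s) p = P.[s].
  rewrite /mxeval.
  have := @mpoly_closed K (n * n) K (fun F => exists P : {poly K}, forall s, F s = P.[s])
    (fun k s => mxvec (c s) 0 k) p; apply.
  - by move=> f g e [P hP]; exists P => s; rewrite -e.
  - by move=> a; exists a%:P => s; rewrite hornerC.
  - by move=> f g [P hP] [Q hQ]; exists (P + Q) => s; rewrite hornerD hP hQ.
  - by move=> f g [P hP] [Q hQ]; exists (P * Q) => s; rewrite hornerM hP hQ.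
  by case/mxvec_indexP=> i j; have [P hP] := hc i j; exists P => s; rewrite mxvecE; case: (hP s).
exists P => s; split=> //.
have h1 : lmx (fun u => c (s + (u - 1))) (c' s).
  move=> i j; have [Q hQ] := hc i j.
  have := lder_poly (Q \Po ((s - 1)%:P + 'X)).
  rewrite deriv_comp derivD derivC derivX add0r mulr1 horner_comp hornerD hornerC hornerX subrK.
  case: (hQ s) => _ ->; apply: lder_ext => u _.
  by case: (hQ (s + (u - 1))) => -> _; rewrite horner_comp hornerD hornerC hornerX addrCA addrC.
have h2 := lder_mxeval p h1; rewrite subrr addr0 in h2.
apply: (lder_uniq h2).
have := lder_poly (P \Po ((s - 1)%:P + 'X)).
rewrite deriv_comp derivD derivC derivX add0r mulr1 horner_comp hornerD hornerC hornerX subrK.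
by apply: lder_ext => u _; rewrite hP horner_comp hornerD hornerC hornerX addrCA addrC.
Qed.

Lemma pder_expR A X p : nilp X ->
  pder (fun s => mxeval (A *m mx_exp (s *: X)) p)
       (fun s => mxeval (A *m mx_exp (s *: X)) (dR X p)).
Proof.
move=> hX; apply: (pder_ext (fun=> erefl) _
  (pder_mxeval p (mpderM (mpderC A) (mpder_mx_exp hX)))) => s.
by rewrite mul0mx add0r dRE mulmxA.
Qed.

(** The passage from infinitesimal to global statements: all derivatives of [p] along [A exp (s X)]
    at [s = 0] are values at [A] of members of [F]. *)
Lemma taylorR (F : set {mpoly K[n * n]}) A X : nilp X ->
  (forall p, F p -> F (dR X p)) -> (forall p, F p -> mxeval A p = 0) ->
  forall p s, F p -> mxeval (A *m mx_exp (s *: X)) p = 0.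
Proof.
move=> hX stab F0 p s Fp.
apply: (@pder_taylor _ (dR X) (fun p s => mxeval (A *m mx_exp (s *: X)) p)) => [q|k].
  exact: pder_expR.
rewrite scale0r mx_exp0 mulmx1; apply: F0.
by elim: k => [|k IH] //=; apply: stab.
Qed.

End Taylor.
End Exponential.

(** * Closed sets, irreducible sets and Lie algebras *)

Section ZariskiTopology.
Variable K : numClosedFieldType.

Definition vanish n (S : set 'M[K]_n) : set {mpoly K[n * n]} :=
  [set p | forall A, S A -> mxeval A p = 0].

Section Regular.
Variables (n : nat) (S : set 'M[K]_n).
Hypothesis Su : forall A, S A -> A \in unitmx.
Implicit Types f g : 'M[K]_n -> K.

Let detS A k : S A -> \det A ^+ k != 0.
Proof. by move=> /Su uA; rewrite expf_neq0 // -unitfE -unitmxE. Qed.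

Lemma reg_ext f g : (forall A, S A -> f A = g A) -> regular_on S f -> regular_on S g.
Proof. by move=> e [p [k h]]; exists p, k => A SA; rewrite -e // h. Qed.

Lemma reg_pfun f : pfun f -> regular_on S f.
Proof. by move=> [p h]; exists p, 0%N => A _; rewrite expr0 divr1. Qed.

Lemma regC c : regular_on S (fun _ => c).
Proof. exact/reg_pfun/pfunC. Qed.

Lemma regD f g : regular_on S f -> regular_on S g -> regular_on S (fun A => f A + g A).
Proof.
move=> [p [k hp]] [q [l hq]].
have [r hr] : pfun (fun A : 'M[K]_n => mxeval A p * \det A ^+ l + mxeval A q * \det A ^+ k).
  by apply: pfunD; apply: pfunM; (try exact: pfun_mxeval); apply: pfunX; apply: pfun_det; apply: pmx_id.
exists r, (k + l)%N => A SA; rewrite -hr hp // hq // exprD.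
by field; rewrite !detS.
Qed.

Lemma regM f g : regular_on S f -> regular_on S g -> regular_on S (fun A => f A * g A).
Proof.
move=> [p [k hp]] [q [l hq]]; exists (p * q), (k + l)%N => A SA.
rewrite hp // hq // exprD /mxeval mevalM.
by field; rewrite !detS.
Qed.

Lemma reg_sum I (r : seq I) (P : pred I) (F : I -> 'M[K]_n -> K) :
  (forall i, regular_on S (F i)) -> regular_on S (fun A => \sum_(i <- r | P i) F i A).
Proof.
move=> h; elim: r => [|i r IH]; first by apply: (reg_ext _ (regC 0)) => A; rewrite big_nil.
case Pi: (P i); last by apply: (reg_ext _ IH) => A; rewrite big_cons Pi.
by apply: (reg_ext _ (regD (h i) IH)) => A; rewrite big_cons Pi.
Qed.

Lemma reg_prod I (r : seq I) (P : pred I) (F : I -> 'M[K]_n -> K) :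
  (forall i, regular_on S (F i)) -> regular_on S (fun A => \prod_(i <- r | P i) F i A).
Proof.
move=> h; elim: r => [|i r IH]; first by apply: (reg_ext _ (regC 1)) => A; rewrite big_nil.
case Pi: (P i); last by apply: (reg_ext _ IH) => A; rewrite big_cons Pi.
by apply: (reg_ext _ (regM (h i) IH)) => A; rewrite big_cons Pi.
Qed.

Lemma reg_detV k : regular_on S (fun A => \det A ^- k).
Proof. by exists 1, k => A _; rewrite /mxeval meval1 mul1r. Qed.

Lemma reg_inv i j : regular_on S (fun A => invmx A i j).
Proof.
apply: (@reg_ext (fun A => \det A ^- 1 * (\adj A) i j)).
  by move=> A /Su uA; rewrite /invmx uA !mxE expr1.
by apply: regM (reg_detV 1) _; apply: reg_pfun; apply: pmx_adj; apply: pmx_id.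
Qed.

Definition rmx m1 m2 (F : 'M[K]_n -> 'M[K]_(m1, m2)) :=
  forall i j, regular_on S (fun A => F A i j).

Lemma rmx_pmx m1 m2 (F : 'M[K]_n -> 'M[K]_(m1, m2)) : pmx F -> rmx F.
Proof. by move=> h i j; apply: reg_pfun. Qed.

Lemma rmx_inv : rmx (@invmx K n).
Proof. by move=> i j; apply: reg_inv. Qed.

Lemma rmxM m1 m2 m3 (F : 'M[K]_n -> 'M[K]_(m1, m2)) (G : 'M[K]_n -> 'M[K]_(m2, m3)) :
  rmx F -> rmx G -> rmx (fun A => F A *m G A).
Proof.
move=> hF hG i j; apply: (@reg_ext (fun A => \sum_k F A i k * G A k j)).
  by move=> A; rewrite mxE.
by apply: reg_sum => k; apply: regM.
Qed.

Lemma rmxC m1 m2 (B : 'M[K]_(m1, m2)) : rmx (fun _ => B).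
Proof. exact/rmx_pmx/pmxC. Qed.

Lemma rmx_id : rmx id.
Proof. exact/rmx_pmx/pmx_id. Qed.

Lemma reg_mxeval m (F : 'M[K]_n -> 'M[K]_m) p : rmx F ->
  regular_on S (fun A => mxeval (F A) p).
Proof.
move=> hF; have := @mpoly_closed K _ _ (regular_on S) (fun k A => mxvec (F A) 0 k) p.
apply.
- by move=> f g e; apply: reg_ext => A _.
- exact: regC.
- exact: regD.
- exact: regM.
by case/mxvec_indexP=> i j; apply: (reg_ext _ (hF i j)) => A _; rewrite mxvecE.
Qed.

(** A regular function on the target has a power of the determinant as denominator, hence the
    hypothesis on the inverse determinant of [F]. *)
Lemma reg_comp m (F : 'M[K]_n -> 'M[K]_m) (S' : set 'M[K]_m) (f : 'M[K]_m -> K) :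
  regular_on S' f ->
  rmx F -> (forall A, S A -> S' (F A)) ->
  regular_on S (fun A => (\det (F A))^-1) -> regular_on S (fun A => f (F A)).
Proof.
move=> [p [k h]] hF FS hd.
apply: (@reg_ext (fun A => mxeval (F A) p * \prod_(i < k) (\det (F A))^-1)).
  by move=> A SA; rewrite h; [rewrite prodr_const card_ord exprVn | apply: FS].
by apply: regM; [apply: reg_mxeval | apply: reg_prod].
Qed.

End Regular.

Lemma reg_sub n (S S' : set 'M[K]_n) f : S `<=` S' -> regular_on S' f -> regular_on S f.
Proof. by move=> ss [p [k h]]; exists p, k => A /ss; apply: h. Qed.

Definition units n : set 'M[K]_n := [set A | A \in unitmx].

Lemma zclosed_reg n (F : set ('M[K]_n -> K)) :
  (forall f, F f -> regular_on (@units n) f) ->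
  zariski_closed [set A | A \in unitmx /\ forall f, F f -> f A = 0].
Proof.
move=> hF; exists [set p | exists f k, F f /\ forall A, A \in unitmx -> f A = mxeval A p / \det A ^+ k].
apply/seteqP; split=> A [uA h]; split=> //.
  move=> p [f [k [Ff e]]]; have := h f Ff; rewrite e // => /eqP.
  have dz : \det A != 0 by rewrite -unitfE -unitmxE.
  by rewrite mulf_eq0 invr_eq0 (negbTE (expf_neq0 _ dz)) orbF => /eqP.
move=> f Ff; have [p [k e]] := hF f Ff; rewrite e //.
by rewrite h ?mul0r //; exists f, k.
Qed.

Lemma zclosed_units n (Z : set 'M[K]_n) : zariski_closed Z -> Z `<=` @units n.
Proof. by move=> [I ->] A []. Qed.

Lemma zclosed_preim n m (Z : set 'M[K]_m) (F : 'M[K]_n -> 'M[K]_m) :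
  zariski_closed Z -> rmx (@units n) F ->
  (forall A, A \in unitmx -> F A \in unitmx) ->
  zariski_closed [set A | A \in unitmx /\ Z (F A)].
Proof.
move=> [I ->] hF uF.
rewrite (_ : [set A | _] = [set A | A \in unitmx /\
  forall f, (exists2 p, I p & f = fun A => mxeval (F A) p) -> f A = 0]).
  by apply: zclosed_reg => f [p _ ->]; apply: reg_mxeval.
apply/seteqP; split=> A [uA h]; split=> //.
  by move=> _ [p Ip ->]; case: h => _; apply.
by split=> [|p Ip]; [apply: uF | apply: (h (fun A => mxeval (F A) p)); exists p].
Qed.

Definition zclosure n (S : set 'M[K]_n) : set 'M[K]_n :=
  [set A | A \in unitmx /\ forall p, vanish S p -> mxeval A p = 0].

Lemma zclosure_closed n (S : set 'M[K]_n) : zariski_closed (zclosure S).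
Proof. by exists (vanish S). Qed.

Lemma sub_zclosure n (S : set 'M[K]_n) : S `<=` @units n -> S `<=` zclosure S.
Proof. by move=> Su A SA; split; [apply: Su | move=> p; apply]. Qed.

Lemma zclosure_min n (S Z : set 'M[K]_n) : zariski_closed Z -> S `<=` Z -> zclosure S `<=` Z.
Proof.
move=> [I ->] SZ A [uA h]; split=> // p Ip; apply: h => B /SZ [_]; exact.
Qed.

Lemma zclosure_id n (Z : set 'M[K]_n) : zariski_closed Z -> zclosure Z = Z.
Proof.
move=> cZ; apply/seteqP; split; first exact: zclosure_min.
by apply: sub_zclosure; apply: zclosed_units.
Qed.

Section Groups.
Variables (n : nat) (S : set 'M[K]_n).
Hypothesis gS : mx_group S.

Lemma mxg_unit A : S A -> A \in unitmx. Proof. by case: gS => h _ _ _; apply: h. Qed.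
Lemma mxg1 : S 1%:M. Proof. by case: gS. Qed.
Lemma mxgM A B : S A -> S B -> S (A *m B). Proof. by case: gS => _ _ h _; apply: h. Qed.
Lemma mxgV A : S A -> S (invmx A). Proof. by case: gS => _ _ _ h; apply: h. Qed.
Lemma mxgMV A B : S A -> S B -> S (A *m invmx B).
Proof. by move=> hA hB; apply: mxgM => //; apply: mxgV. Qed.

End Groups.

Lemma mulmx_unit n (A B : 'M[K]_n) : A \in unitmx -> B \in unitmx -> A *m B \in unitmx.
Proof. by move=> uA uB; rewrite unitmx_mul uA. Qed.

Lemma invmxM n (A B : 'M[K]_n) : A \in unitmx -> B \in unitmx ->
  invmx (A *m B) = invmx B *m invmx A.
Proof.
by move=> uA uB; apply: invmx_unique; rewrite mulmxA mulmxK // mulmxV.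
Qed.

Lemma invmx1 n : invmx (1%:M : 'M[K]_n) = 1%:M.
Proof. by apply: invmx_unique; rewrite mulmx1. Qed.

Lemma units_group n : mx_group (@units n).
Proof.
split=> //; [exact: unitmx1 | by move=> A B; apply: mulmx_unit |].
by move=> A; rewrite /units /= unitmx_inv.
Qed.

(** For a fixed [B], the matrices [A] with [A *m B] in the closure form a closed set. For [B] in [S]
    it contains [S], hence the closure; the same argument on the other side then frees [B]. *)
Lemma zclosure_group n (S : set 'M[K]_n) : mx_group S -> mx_group (zclosure S).
Proof.
move=> gS; have Su := mxg_unit gS.
have scl := sub_zclosure Su.
have trans B (uB : B \in unitmx) : zariski_closed [set A | A \in unitmx /\ zclosure S (A *m B)].
  apply: zclosed_preim (zclosure_closed S) _ _; last by move=> A uA; apply: mulmx_unit.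
  by apply: rmxM; [|apply: rmx_id|apply: rmxC].
have transl B (uB : B \in unitmx) : zariski_closed [set A | A \in unitmx /\ zclosure S (B *m A)].
  apply: zclosed_preim (zclosure_closed S) _ _; last by move=> A uA; apply: mulmx_unit.
  by apply: rmxM; [|apply: rmxC|apply: rmx_id].
have hinv : zariski_closed [set A | A \in unitmx /\ zclosure S (invmx A)].
  apply: zclosed_preim (zclosure_closed S) _ _; last by move=> A; rewrite unitmx_inv.
  exact: rmx_inv.
have sub B : S B -> forall A, zclosure S A -> zclosure S (A *m B).
  move=> SB A clA; have := zclosure_min (trans B (Su B SB)) _ clA.
  by case=> // C SC; split; [apply: Su | apply: scl; apply: mxgM].
split.
- by move=> A [].
- by apply: scl; apply: mxg1.
- move=> A B clA clB; have := zclosure_min (transl A (proj1 clA)) _ clB.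
  by case=> // C SC; split; [apply: Su | apply: sub].
- move=> A clA; have := zclosure_min hinv _ clA.
  by case=> // C SC; split; [apply: Su | apply: scl; apply: mxgV].
Qed.

(** The vanishing ideal of [S] is prime, or the whole ring for empty [S]: the closure of [S] is
    irreducible. In this form images of morphisms qualify before they are known to be closed. *)
Definition irr n (S : set 'M[K]_n) := forall p q : {mpoly K[n * n]},
  (forall A, S A -> mxeval A p * mxeval A q = 0) -> vanish S p \/ vanish S q.

Lemma notvanish n (S : set 'M[K]_n) p : ~ vanish S p -> exists2 A, S A & mxeval A p != 0.
Proof.
move=> /existsNP [A /not_implyP [SA /eqP h]]; by exists A.
Qed.

Lemma irr_connected n (S : set 'M[K]_n) : S `<=` @units n -> irr S -> zariski_connected S.
Proof.
move=> Su iS Z1 Z2 [I1 ->] [I2 ->] cov _.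
case: (pselect (S `<=` [set A | A \in unitmx /\ forall p, I1 p -> mxeval A p = 0])); first by left.
move=> h; right=> A SA; split; first exact: Su.
move/existsNP: h => [B /not_implyP [SB hB]] q Iq.
have [p Ip pB] : exists2 p, I1 p & mxeval B p != 0.
  apply: contrapT => hp; apply: hB; split; first exact: Su.
  by move=> p Ip; apply/eqP; apply: contrapT => /negP np; apply: hp; exists p.
case: (iS p q) => [C SC|/(_ B SB) /eqP|/(_ A SA) //]; last by rewrite (negbTE pB).
case: (cov C SC) => -[_ hC]; first by rewrite (hC p) ?mul0r.
by rewrite (hC q) ?mulr0.
Qed.

Lemma mxeval_mul n (A : 'M[K]_n) p q : mxeval A (p * q) = mxeval A p * mxeval A q.
Proof. by rewrite /mxeval mevalM. Qed.

Lemma pfun_trans n (B C : 'M[K]_n) p : pfun (fun A => mxeval (B *m A *m C) p).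
Proof.
apply: (pfun_comp (pfun_mxeval p)).
by apply: pmxM; [apply: pmxM; [apply: pmxC | apply: pmx_id] | apply: pmxC].
Qed.

(** If [p] is nonzero at [A1 B1] and [q] at [A2 B2], irreducibility of [S2] yields one [B] with [p]
    nonzero at [A1 B] and [q] nonzero at [A2 B]; irreducibility of [S1] then contradicts the
    vanishing of [p q] on [S1 B]. *)
Lemma irr_mul n (S1 S2 : set 'M[K]_n) : irr S1 -> irr S2 ->
  irr [set C | exists A B, [/\ S1 A, S2 B & C = A *m B]].
Proof.
move=> i1 i2 p q pq.
case: (pselect (vanish [set C | exists A B, [/\ S1 A, S2 B & C = A *m B]] p)) => [|np]; first by left.
right=> _ [A2 [B2 [SA2 SB2 ->]]].
have [C [A1 [B1 [SA1 SB1 ->]]] {}np] := notvanish np.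
have [f1 h1] := pfun_trans A1 1%:M p; have [f2 h2] := pfun_trans A2 1%:M q.
apply/eqP; apply: contrapT => /negP nq.
have [B SB fB] : exists2 B, S2 B & mxeval B (f1 * f2) != 0.
  apply: notvanish => h; case: (i2 f1 f2) => [B /h|/(_ B1 SB1)|/(_ B2 SB2)].
  - by rewrite mxeval_mul.
  - by rewrite -h1 mulmx1 => /eqP; rewrite (negbTE np).
  - by rewrite -h2 mulmx1 => /eqP; rewrite (negbTE nq).
move: fB; rewrite mxeval_mul -h1 -h2 !mulmx1 mulf_eq0 => /norP [n1 n2].
have [g1 k1] := pfun_trans 1%:M B p; have [g2 k2] := pfun_trans 1%:M B q.
case: (i1 g1 g2) => [A SA|/(_ A1 SA1)|/(_ A2 SA2)].
- by rewrite -k1 -k2 mul1mx; apply: pq; exists A, B.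
- by rewrite -k1 mul1mx => /eqP; rewrite (negbTE n1).
- by rewrite -k2 mul1mx => /eqP; rewrite (negbTE n2).
Qed.

Lemma irr_laurent n (c : K -> 'M[K]_n) X : lmx c X -> irr [set c s | s in [set s | s != 0]].
Proof.
move=> hc p q pq.
have [P [k [hP _]]] := lder_mxeval p hc; have [Q [l [hQ _]]] := lder_mxeval q hc.
have : P * Q = 0.
  apply: poly_fun_eq0 => s nz; have := pq (c s); rewrite hP // hQ // hornerM.
  move=> /(_ (ex_intro2 _ _ s nz erefl)) h.
  have ks: s ^+ k != 0 by rewrite expf_neq0.
  have ls: s ^+ l != 0 by rewrite expf_neq0.
  have := congr1 (fun x => x * (s ^+ k * s ^+ l)) h; rewrite mul0r => <-.
  by field; rewrite ls ks.
move=> /eqP; rewrite mulf_eq0 => /orP [/eqP e|/eqP e]; [left|right] => _ [s /= nz <-].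
  by rewrite hP // e horner0 mul0r.
by rewrite hQ // e horner0 mul0r.
Qed.

Lemma gen_sub n (S : set 'M[K]_n) : S `<=` generated S.
Proof. by move=> A SA G [_]; apply. Qed.

Lemma gen_group n (S : set 'M[K]_n) : S `<=` @units n -> mx_group (generated S).
Proof.
move=> Su; split.
- by move=> A /(_ (@units n)); apply; split=> //; apply: units_group.
- by move=> G [gG _]; apply: mxg1.
- by move=> A B hA hB G [gG SG]; apply: mxgM => //; [apply: hA | apply: hB].
- by move=> A hA G [gG SG]; apply: mxgV => //; apply: hA.
Qed.

Lemma gen_min n (S G : set 'M[K]_n) : mx_group G -> S `<=` G -> generated S `<=` G.
Proof. by move=> gG SG A /(_ G); apply. Qed.

Lemma gen_ind n (S : set 'M[K]_n) (Q : 'M[K]_n -> Prop) : S `<=` @units n ->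
  Q 1%:M ->
  (forall A B, generated S A -> S B -> Q A -> Q (A *m B) /\ Q (A *m invmx B)) ->
  forall A, generated S A -> Q A.
Proof.
move=> Su Q1 QM; have gg := gen_group Su.
(* The elements that preserve [Q] by right multiplication, along with their inverses, form a group
   containing [S]. *)
pose G := [set B | generated S B /\
  forall A, generated S A -> Q A -> Q (A *m B) /\ Q (A *m invmx B)].
suff sub : generated S `<=` G.
  by move=> A gA; have [_ /(_ 1%:M (mxg1 gg) Q1)] := sub A gA; rewrite mul1mx => -[].
apply: gen_min; last by move=> B SB; split; [apply: gen_sub | move=> A gA; apply: QM].
split.
- by move=> B [/(mxg_unit gg)].
- by split=> [|A _ QA]; [apply: mxg1 | rewrite invmx1 mulmx1].
- move=> B C [gB hB] [gC hC]; split=> [|A gA QA]; first exact: (mxgM gg).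
  rewrite invmxM ?(mxg_unit gg) // !mulmxA.
  have [h1 _] := hB A gA QA; have [h2 _] := hC _ (mxgM gg gA gB) h1.
  have [_ h3] := hC A gA QA; have [_ h4] := hB _ (mxgMV gg gA gC) h3.
  by split.
- move=> B [gB hB]; split=> [|A gA QA]; first exact: (mxgV gg).
  by have [h1 h2] := hB A gA QA; rewrite invmxK.
Qed.

Lemma zclosure_connected n (S : set 'M[K]_n) : S `<=` @units n ->
  zariski_connected S -> zariski_connected (zclosure S).
Proof.
move=> Su cS Z1 Z2 c1 c2 cov dis; have scl := sub_zclosure Su.
have [] := cS Z1 Z2 c1 c2.
- by move=> A /scl /cov.
- by rewrite -subset0 => A [/scl h1 h2]; rewrite -dis.
- by left; apply: zclosure_min.
- by right; apply: zclosure_min.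
Qed.

(* Unlike Zariski connectedness, this passes to derived groups without any
   closedness. *)
Definition finval_const n (S : set 'M[K]_n) := forall f, regular_on S f ->
  forall l : seq K, (forall A, S A -> f A \in l) -> forall A B, S A -> S B -> f A = f B.

(** The fibre of [f] over [f A] and the union of the fibres over the other values in [l] are
    relatively closed and disjoint, and cover [S]. *)
Lemma connected_fc n (S : set 'M[K]_n) : S `<=` @units n ->
  zariski_connected S -> finval_const S.
Proof.
move=> Su cS f [p [k hf]] l fl A B SA SB.
have fun_b b : pfun (fun C : 'M[K]_n => mxeval C p - b * \det C ^+ k).
  by apply: pfunB; [apply: pfun_mxeval | apply: pfunZ; apply: pfunX; apply: pfun_det; apply: pmx_id].
have eq_b C b : S C -> (mxeval C p - b * \det C ^+ k == 0) = (f C == b).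
  move=> SC; have dz : \det C ^+ k != 0 by rewrite expf_neq0 // -unitfE -unitmxE; apply: Su.
  by rewrite hf // subr_eq0 -(inj_eq (mulIf (invr_neq0 dz))) mulfK.
have cl (g : 'M[K]_n -> K) : pfun g -> zariski_closed [set C | C \in unitmx /\ g C = 0].
  move=> [q hq]; exists [set q]; apply/seteqP; split=> C [uC h]; split=> //.
    by move=> _ ->; rewrite -hq.
  by rewrite hq; apply: h.
have cl1 := cl _ (fun_b (f A)).
have cl2 := cl _ (pfun_prod l (fun b => b != f A) fun_b).
have [] := cS _ _ cl1 cl2.
- move=> C SC; have uC := Su C SC.
  case: (eqVneq (f C) (f A)) => [e|ne]; [left|right]; split=> //.
    by apply/eqP; rewrite eq_b // e.
  rewrite (big_rem (f C)) /=; last exact: fl.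
  by rewrite ne; have /eqP -> := etrans (eq_b C (f C) SC) (eqxx _); rewrite mul0r.
- rewrite -subset0 => C [SC [[_ /eqP]]]; rewrite eq_b // => /eqP e [_ /eqP].
  rewrite prodf_seq_eq0 => /hasP [b _ /andP [ne]]; rewrite eq_b // e eq_sym.
  by rewrite (negbTE ne).
- by move=> /(_ B SB) [_ /eqP]; rewrite eq_b // eq_sym => /eqP.
move=> /(_ A SA) [_ /eqP]; rewrite prodf_seq_eq0 => /hasP [b _ /andP [ne]].
by rewrite eq_b // eq_sym (negbTE ne).
Qed.

Section LieAlgebra.
Variable n : nat.
Implicit Types (S : set 'M[K]_n) (p : {mpoly K[n * n]}) (A X Y : 'M[K]_n).

Lemma lieE S X : lie_algebra S X <-> forall p, vanish S p -> dpf p 1%:M X = 0.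
Proof. by []. Qed.

Lemma dpf_trans p q A B C X : (forall D, mxeval D q = mxeval (B *m D *m C) p) ->
  dpf q A X = dpf p (B *m A *m C) (B *m X *m C).
Proof.
move=> h; have h1 := lder_mxeval q (lmx_line A X).
rewrite subrr scale0r addr0 in h1; apply: (lder_uniq h1).
have h2 := lder_mxeval p (lmx_line (B *m A *m C) (B *m X *m C)).
rewrite subrr scale0r addr0 in h2; apply: lder_ext h2 => s _.
by rewrite h mulmxDr mulmxDl -scalemxAr -scalemxAl.
Qed.

(** A tangent vector at 1 extends to a translation-invariant derivation; translations by [S]
    preserve the vanishing ideal, hence so does the derivation. *)
Lemma lie_dR S X p : mx_group S -> lie_algebra S X -> vanish S p -> vanish S (dR X p).
Proof.
move=> gS lX vp A SA; have [q hq] := pfun_trans A 1%:M p.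
rewrite dRE; have := dpf_trans 1%:M X (fun D => esym (hq D)); rewrite !mulmx1 => <-.
by apply: lX => B SB; rewrite -hq mulmx1; apply: vp; apply: mxgM.
Qed.

Lemma lie_subspace S a X Y : lie_algebra S X -> lie_algebra S Y -> lie_algebra S (a *: X + Y).
Proof. by rewrite !lieE => hX hY p vp; rewrite dpf_lin hX // hY // mulr0 addr0. Qed.

Lemma lie0 S : lie_algebra S 0.
Proof. by rewrite lieE => p _; rewrite dpf0. Qed.

Lemma lieZ S a X : lie_algebra S X -> lie_algebra S (a *: X).
Proof. by move=> h; rewrite -[_ *: _]addr0; apply: lie_subspace => //; apply: lie0. Qed.

Lemma lie_br S X Y : mx_group S -> lie_algebra S X -> lie_algebra S Y ->
  lie_algebra S (X *m Y - Y *m X).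
Proof.
move=> gS lX lY; rewrite lieE => p vp; have := dRR X Y p 1%:M.
rewrite [in RHS]dRE mul1mx => <-.
by rewrite !(lie_dR gS) ?subrr //; do ?[apply: lie_dR => //]; apply: mxg1.
Qed.

Lemma lie_subalg S : mx_group S -> lie_subalgebra (lie_algebra S).
Proof.
by move=> gS; split; [apply: lie0 | move=> *; apply: lie_subspace | move=> *; apply: lie_br].
Qed.

Lemma lie_Ad S A X : mx_group S -> S A -> lie_algebra S X ->
  lie_algebra S (A *m X *m invmx A).
Proof.
move=> gS SA lX; rewrite lieE => p vp; have uA := mxg_unit gS SA.
have [q hq] := pfun_trans A (invmx A) p.
have := dpf_trans 1%:M X (fun D => esym (hq D)); rewrite mulmx1 mulmxV // => <-.
by apply: lX => B SB; rewrite -hq; apply: vp; apply: mxgMV => //; apply: mxgM.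
Qed.

(** The derivation along [X] preserves the vanishing ideal of [S], so by Taylor expansion at 1 this
    ideal vanishes at [exp (s X)]; and [S] is closed. *)
Lemma exp_in_group S X s : algebraic_group S -> lie_algebra S X -> nilp X ->
  S (mx_exp (s *: X)).
Proof.
move=> [gS cS] lX hX; rewrite -(zclosure_id cS); split.
  exact/mx_exp_unit/nilpZ.
move=> p vp; rewrite -[mx_exp _]mul1mx.
apply: (@taylorR K n (vanish S)) => // [q|q vq]; first exact: lie_dR.
by apply: vq; apply: mxg1.
Qed.

Lemma lie_curve S (c : K -> 'M[K]_n) X : lmx c X -> (forall s, s != 0 -> S (c s)) ->
  c 1 = 1%:M -> lie_algebra S X.
Proof.
move=> hc cS c1; rewrite lieE => p vp; have := lder_mxeval p hc; rewrite c1.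
by move=> /lder_uniq; apply; apply: lder_ext (lderC 0) => s nz; rewrite vp //; apply: cS.
Qed.

Lemma lmx_exp X : nilp X -> lmx (fun s => mx_exp ((s - 1) *: X)) X.
Proof.
move=> hX i j.
have [P hP] := mpder_mx_exp hX i j.
have := lder_poly (P \Po ('X - 1%:P)).
rewrite deriv_comp derivXsubC mulr1 horner_comp !hornerE subrr.
have -> : P^`().[0] = X i j by case: (hP 0) => _ <-; rewrite scale0r mx_exp0 mul1mx.
by apply: lder_ext => s _; case: (hP (s - 1)) => -> _; rewrite horner_comp !hornerE.
Qed.

Lemma lie_exp S X : nilp X -> (forall s, S (mx_exp (s *: X))) -> lie_algebra S X.
Proof.
move=> hX h; apply: (lie_curve (lmx_exp hX)) => [s _|]; first exact: h.
by rewrite subrr scale0r mx_exp0.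
Qed.

End LieAlgebra.
End ZariskiTopology.

(** * Groups generated by one-parameter unipotent subgroups *)

Section RingClass.
Variables (K : numClosedFieldType) (T : Type) (C : (T -> K) -> Prop).

(** The closure properties under which matrix products, determinants and exponentials stay in a
    class. Instances: functions polynomial on lines, first-order terms, Laurent functions and
    polynomial functions of one variable. *)
Definition ring_class := [/\ forall f g, f =1 g -> C f -> C g, forall c, C (fun _ => c),
  forall f g, C f -> C g -> C (fun t => f t + g t) &
  forall f g, C f -> C g -> C (fun t => f t * g t)].

Hypothesis hC : ring_class.

Lemma rc_ext f g : f =1 g -> C f -> C g. Proof. by case: hC => h _ _ _; apply: h. Qed.
Lemma rcC c : C (fun _ => c). Proof. by case: hC. Qed.
Lemma rcD f g : C f -> C g -> C (fun t => f t + g t).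
Proof. by case: hC => _ _ h _; apply: h. Qed.
Lemma rcM f g : C f -> C g -> C (fun t => f t * g t).
Proof. by case: hC => _ _ _; apply. Qed.

Lemma rc_sum I (r : seq I) (P : pred I) (F : I -> T -> K) :
  (forall i, C (F i)) -> C (fun t => \sum_(i <- r | P i) F i t).
Proof.
move=> h; elim: r => [|i r IH]; first by apply: rc_ext (rcC 0) => t; rewrite big_nil.
case Pi: (P i); last by apply: rc_ext IH => t; rewrite big_cons Pi.
by apply: rc_ext (rcD (h i) IH) => t; rewrite big_cons Pi.
Qed.

Lemma rc_prod I (r : seq I) (P : pred I) (F : I -> T -> K) :
  (forall i, C (F i)) -> C (fun t => \prod_(i <- r | P i) F i t).
Proof.
move=> h; elim: r => [|i r IH]; first by apply: rc_ext (rcC 1) => t; rewrite big_nil.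
case Pi: (P i); last by apply: rc_ext IH => t; rewrite big_cons Pi.
by apply: rc_ext (rcM (h i) IH) => t; rewrite big_cons Pi.
Qed.

Lemma rcX f k : C f -> C (fun t => f t ^+ k).
Proof.
move=> hf; apply: (@rc_ext (fun t => \prod_(i < k) f t)); last exact: rc_prod.
by move=> t; rewrite prodr_const card_ord.
Qed.

Definition rcmx m1 m2 (F : T -> 'M[K]_(m1, m2)) := forall i j, C (fun t => F t i j).

Lemma rcmxC m1 m2 (B : 'M[K]_(m1, m2)) : rcmx (fun _ => B).
Proof. by move=> i j; apply: rcC. Qed.

Lemma rcmxM m1 m2 m3 (F : T -> 'M[K]_(m1, m2)) (G : T -> 'M[K]_(m2, m3)) :
  rcmx F -> rcmx G -> rcmx (fun t => F t *m G t).
Proof.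
move=> hF hG i j; apply: (@rc_ext (fun t => \sum_k F t i k * G t k j)).
  by move=> t; rewrite mxE.
by apply: rc_sum => k; apply: rcM.
Qed.

Lemma rcmxZ m1 m2 f (F : T -> 'M[K]_(m1, m2)) :
  C f -> rcmx F -> rcmx (fun t => f t *: F t).
Proof. by move=> hf hF i j; apply: rc_ext (rcM hf (hF i j)) => t; rewrite mxE. Qed.

Lemma rcmxB m1 m2 (F G : T -> 'M[K]_(m1, m2)) :
  rcmx F -> rcmx G -> rcmx (fun t => F t - G t).
Proof.
move=> hF hG i j; apply: rc_ext (rcD (hF i j) (rcM (rcC (-1)) (hG i j))) => t.
by rewrite !mxE mulN1r.
Qed.

Lemma rcmx_sum m1 m2 I (r : seq I) (P : pred I) (F : I -> T -> 'M[K]_(m1, m2)) :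
  (forall i, rcmx (F i)) -> rcmx (fun t => \sum_(i <- r | P i) F i t).
Proof.
move=> h i j; apply: (@rc_ext (fun t => \sum_(k <- r | P k) F k t i j)).
  by move=> t; rewrite summxE.
by apply: rc_sum => k; apply: h.
Qed.

Lemma rcmx_exp n f (X : 'M[K]_n) : C f -> rcmx (fun t => mx_exp (f t *: X)).
Proof.
move=> hf i j.
apply: (@rc_ext (fun t => (\sum_(k < n.+1) f t ^+ k *: ((k`!%:R)^-1 *: X ^+ k)) i j)).
  move=> t; rewrite /mx_exp !summxE; apply: eq_bigr => k _.
  by rewrite expmxZ !mxE mulrCA.
move: i j; apply: rcmx_sum => k; apply: rcmxZ; [exact: rcX | exact: rcmxC].
Qed.

Lemma rc_det m (F : T -> 'M[K]_m) : rcmx F -> C (fun t => \det (F t)).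
Proof.
move=> hF; apply: rc_sum => s; apply: rcM; first exact: rcC.
by apply: rc_prod => i.
Qed.

Lemma rc_mxeval m (F : T -> 'M[K]_m) p : rcmx F -> C (fun t => mxeval (F t) p).
Proof.
move=> hF; apply: (@mpoly_closed K _ T C (fun k t => mxvec (F t) 0 k)).
- exact: rc_ext.
- exact: rcC.
- exact: rcD.
- exact: rcM.
by case/mxvec_indexP=> i j; apply: (rc_ext _ (hF i j)) => t; rewrite mxvecE.
Qed.

End RingClass.

Section WordMaps.
Variable K : numClosedFieldType.

(** Words have no bound on their length, so their parameters are sequences. Being polynomial along
    every line is a weak condition, but it already excludes zero divisors. *)
Definition line_poly (F : (nat -> K) -> K) := forall s0 s1,
  exists P : {poly K}, forall u, F (fun i => s0 i + u * (s1 i - s0 i)) = P.[u].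

Lemma line_poly_class : ring_class line_poly.
Proof.
split.
- by move=> f g e hf s0 s1; have [P hP] := hf s0 s1; exists P => u; rewrite -e.
- by move=> c s0 s1; exists c%:P => u; rewrite hornerC.
- move=> f g hf hg s0 s1; have [P hP] := hf s0 s1; have [Q hQ] := hg s0 s1.
  by exists (P + Q) => u; rewrite hornerD hP hQ.
- move=> f g hf hg s0 s1; have [P hP] := hf s0 s1; have [Q hQ] := hg s0 s1.
  by exists (P * Q) => u; rewrite hornerM hP hQ.
Qed.

Lemma line_poly_coord i : line_poly (fun s => s i).
Proof.
move=> s0 s1; exists ((s0 i)%:P + 'X * (s1 i - s0 i)%:P) => u.
by rewrite hornerD hornerM !hornerC hornerX.
Qed.

(** Restrict to the line that joins a point where [F] is nonzero to the given point, and use that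
    [{poly K}] is a domain. *)
Lemma line_poly_domain F G : line_poly F -> line_poly G -> (forall s, F s * G s = 0) ->
  (exists s, F s != 0) -> forall s, G s = 0.
Proof.
move=> hF hG FG [s0 F0] s1; have [P hP] := hF s0 s1; have [Q hQ] := hG s0 s1.
have ext (f : (nat -> K) -> K) u s :
    (forall i, s0 i + u * (s1 i - s0 i) = s i) -> f (fun i => s0 i + u * (s1 i - s0 i)) = f s.
  by move=> e; congr f; apply: funext.
have PQ : P * Q = 0.
  by apply: poly_fun_eq0 => u _; rewrite hornerM -hP -hQ.
have P0 : P != 0.
  apply: contraNneq F0 => P0; rewrite -(ext F 0 s0) ?hP ?P0 ?horner0 // => i.
  by rewrite mul0r addr0.
move/eqP: PQ; rewrite mulf_eq0 (negbTE P0) => /eqP Q0.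
by rewrite -(ext G 1 s1) ?hQ ?Q0 ?horner0 // => i; rewrite mul1r addrC subrK.
Qed.

Variables (n : nat) (I : Type) (x : I -> 'M[K]_n).
Hypothesis nx : forall c, nilp (x c).

Definition exp_curves : set 'M[K]_n := \bigcup_(c in setT) range (fun s => mx_exp (s *: x c)).
Definition exp_group := generated exp_curves.

Lemma exp_curves_unit : exp_curves `<=` @units K n.
Proof. by move=> _ [c _ [s _ <-]]; apply: mx_exp_unit; apply: nilpZ. Qed.

Lemma exp_groupP : mx_group exp_group.
Proof. exact: gen_group exp_curves_unit. Qed.

Lemma exp_group_exp c s : exp_group (mx_exp (s *: x c)).
Proof. by apply: gen_sub; exists c => //; exists s. Qed.

Fixpoint wmap (w : seq I) (s : nat -> K) : 'M[K]_n :=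
  if w is c :: w' then mx_exp (s 0%N *: x c) *m wmap w' (fun i => s i.+1) else 1%:M.

Fixpoint winv (w : seq I) (s : nat -> K) : 'M[K]_n :=
  if w is c :: w' then winv w' (fun i => s i.+1) *m mx_exp (- (s 0%N *: x c)) else 1%:M.

(** The logarithmic derivatives [W^-1 dW/ds_j] of the word map [W], one for each letter. *)
Fixpoint wtan (w : seq I) (s : nat -> K) : seq 'M[K]_n :=
  if w is c :: w' then
    (winv w' (fun i => s i.+1) *m x c *m wmap w' (fun i => s i.+1)) ::
    wtan w' (fun i => s i.+1)
  else [::].

Definition scat (w : seq I) (s t : nat -> K) i := if (i < size w)%N then s i else t (i - size w)%N.

Lemma wmapV w s : wmap w s *m winv w s = 1%:M.
Proof.
elim: w s => [|c w IH] s /=; first by rewrite mulmx1.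
by rewrite mulmxA -(mulmxA (mx_exp _)) IH mulmx1 mx_expNK //; apply: nilpZ.
Qed.

Lemma winvV w s : winv w s *m wmap w s = 1%:M.
Proof. exact/mulmx1C/wmapV. Qed.

Lemma winvE w s : winv w s = invmx (wmap w s).
Proof. by apply/esym/invmx_unique/wmapV. Qed.

Lemma wmap_group w s : exp_group (wmap w s).
Proof.
elim: w s => [|c w IH] s /=; first exact: mxg1 exp_groupP.
by apply: (mxgM exp_groupP); [apply: exp_group_exp | apply: IH].
Qed.

Lemma wmap_ext w s t : (forall i, (i < size w)%N -> s i = t i) -> wmap w s = wmap w t.
Proof.
elim: w s t => [|c w IH] s t //= e; rewrite e // (IH _ (fun i => t i.+1)) // => i iw.
exact: e.
Qed.

Lemma winv_ext w s t : (forall i, (i < size w)%N -> s i = t i) -> winv w s = winv w t.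
Proof. by move=> e; rewrite !winvE (wmap_ext e). Qed.

Lemma wtan_ext w s t : (forall i, (i < size w)%N -> s i = t i) -> wtan w s = wtan w t.
Proof.
elim: w s t => [|c w IH] s t //= e.
have e' i : (i < size w)%N -> s i.+1 = t i.+1 by move=> iw; apply: e.
by rewrite (winv_ext e') (wmap_ext e') (IH _ _ e').
Qed.

Lemma scat_cons c w s t : (fun i => scat (c :: w) s t i.+1) = scat w (fun i => s i.+1) t.
Proof. by apply: funext => i; rewrite /scat /= ltnS subSS. Qed.

Lemma wmap_cat w1 w2 s t : wmap (w1 ++ w2) (scat w1 s t) = wmap w1 s *m wmap w2 t.
Proof.
elim: w1 s => [|c w IH] s /=.
  by rewrite mul1mx; apply: wmap_ext => i _; rewrite /scat subn0.
by rewrite scat_cons IH mulmxA.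
Qed.

Lemma winv_cat w1 w2 s t : winv (w1 ++ w2) (scat w1 s t) = winv w2 t *m winv w1 s.
Proof.
rewrite !winvE wmap_cat invmxM //; apply: (mxg_unit exp_groupP); exact: wmap_group.
Qed.

Lemma wtan_cat w1 w2 s t : wtan (w1 ++ w2) (scat w1 s t) =
  [seq winv w2 t *m Y *m wmap w2 t | Y <- wtan w1 s] ++ wtan w2 t.
Proof.
elim: w1 s => [|c w IH] s /=.
  by apply: wtan_ext => i _; rewrite /scat subn0.
by rewrite scat_cons IH wmap_cat winv_cat !mulmxA.
Qed.

Lemma exp_group_word A : exp_group A -> exists w s, A = wmap w s.
Proof.
move: A; apply: (gen_ind (Q := fun A => exists w s, A = wmap w s) exp_curves_unit) => [|A B _ [c _ [r _ <-]] [w [s ->]]].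
  by exists [::], (fun _ => 0).
have step u : exists w' s', wmap w s *m mx_exp (u *: x c) = wmap w' s'.
  exists (w ++ [:: c]), (scat w s (fun _ => u)).
  by rewrite wmap_cat /= mulmx1.
split; first exact: step.
by rewrite mx_exp_inv; [rewrite -scaleNr; apply: step | apply: nilpZ].
Qed.

Lemma line_poly_shift F : line_poly F -> line_poly (fun s => F (fun i => s i.+1)).
Proof. by move=> h s0 s1; apply: (h (fun i => s0 i.+1) (fun i => s1 i.+1)). Qed.

Let LP := line_poly_class.

Lemma wmap_line_poly w : rcmx line_poly (wmap w).
Proof.
elim: w => [|c w IH] /=; first exact: rcmxC LP _ _ _.
apply: rcmxM => //; first by apply: rcmx_exp => //; apply: line_poly_coord.
by move=> i j; apply: (@line_poly_shift (fun s => wmap w s i j)).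
Qed.

Lemma winv_line_poly w : rcmx line_poly (winv w).
Proof.
elim: w => [|c w IH] /=; first exact: rcmxC LP _ _ _.
apply: rcmxM => //.
  by move=> i j; apply: (@line_poly_shift (fun s => winv w s i j)).
move=> i j; apply: (rc_ext LP) (rcmx_exp LP (- x c) (line_poly_coord 0%N) i j) => s.
by rewrite scalerN.
Qed.

Lemma wtan_line_poly w k : rcmx line_poly (fun s => nth 0 (wtan w s) k).
Proof.
elim: w k => [|c w IH] [|k] /=.
- exact: rcmxC LP _ _ _.
- exact: rcmxC LP _ _ _.
- move=> i j; apply: (@line_poly_shift (fun s => (winv w s *m x c *m wmap w s) i j)).
  move: i j; apply: rcmxM => //; last exact: wmap_line_poly.
  by apply: rcmxM => //; [apply: winv_line_poly | apply: rcmxC].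
- by move=> i j; apply: (@line_poly_shift (fun s => (nth 0 (wtan w s) k) i j)); apply: IH.
Qed.

Lemma mem_wtan w s Y : Y \in wtan w s ->
  exists2 g, exp_group g & exists c, Y = g *m x c *m invmx g.
Proof.
elim: w s => [|c w IH] s //=; rewrite inE => /orP [/eqP ->|]; last exact: IH.
exists (winv w (fun i => s i.+1)); last by exists c; rewrite !winvE invmxK.
by rewrite winvE; apply: (mxgV exp_groupP); apply: wmap_group.
Qed.

Lemma wtan_deriv w B p s Y : (forall s', mxeval (B *m wmap w s') p = 0) ->
  Y \in wtan w s -> mxeval (B *m wmap w s) (dR Y p) = 0.
Proof.
elim: w B s => [|c w IH] B s //= h; rewrite inE => /orP [/eqP ->|]; last first.
  rewrite mulmxA; apply: IH => s'.
  by have := h (fun i => if i is j.+1 then s' j else s 0%N); rewrite mulmxA.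
set s1 := fun i => s i.+1.
have := pder_mxeval p (mpderM (mpderM (mpderC B) (mpder_mx_exp (nx c))) (mpderC (wmap w s1))).
move=> h1; have h2 : pder (fun r => mxeval (B *m mx_exp (r *: x c) *m wmap w s1) p) (fun _ => 0).
  apply: pder_ext (pderC 0) => // r.
  by have := h (fun i => if i is j.+1 then s1 j else r); rewrite mulmxA => ->.
have := pder_uniq h1 h2 (s 0%N); rewrite mulmx0 addr0 mul0mx add0r dRE => <-.
congr dpf; first by rewrite mulmxA.
by rewrite !mulmxA -(mulmxA _ _ (winv _ _)) wmapV mulmx1.
Qed.

(** The basis is given by positions in the sequence, so that the same positions can be read at other
    parameters of the word map. *)
Lemma free_subseq (V : vectType K) (X : seq V) : exists2 idx : seq nat,
  free [seq nth (0%R : V) X i | i <- idx] & (<<[seq nth (0%R : V) X i | i <- idx]>> = <<X>>)%VS.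
Proof.
elim: X => [|v X [idx fr sp]]; first by exists [::]; rewrite ?nil_free.
have e : [seq nth 0 (v :: X) i | i <- map S idx] = [seq nth 0 X i | i <- idx].
  by rewrite -map_comp.
case vX : (v \in <<X>>%VS).
  exists (map S idx); rewrite e // sp span_cons; apply/esym/addv_idPr.
  by rewrite -memvE.
by exists (0%N :: map S idx); rewrite /= e ?free_cons ?sp ?vX ?fr // !span_cons sp.
Qed.

(* The span V of the tangent vectors of a word map of maximal rank contains all
   conjugates of the generators.  Polynomials vanishing on the image are then
   stable under the derivations along V, hence vanish on the group. *)
Lemma dense_word : exists w, forall p, (forall s, mxeval (wmap w s) p = 0) ->
  vanish exp_group p.
Proof.
have bound d : asbool (exists w s, \dim <<wtan w s>> = d) -> (d <= \dim {:'M[K]_n})%N.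
  by move=> /asboolP [w [s <-]]; apply: dimvS; apply: subvf.
have ex : exists d, asbool (exists w s, \dim <<wtan w s>> = d).
  by exists (\dim <<wtan [::] (fun _ => 0)>>); apply/asboolP; exists [::], (fun _ => 0).
case: (ex_maxnP ex bound) => d /asboolP [w [s0 dw]] dmax.
exists w => p0 h0; set V := <<wtan w s0>>%VS.
have VG g c : exp_group g -> g *m x c *m invmx g \in V.
  move=> Gg; have GV := mxgV exp_groupP Gg.
  have Gw : exp_group (winv w s0).
    by rewrite winvE; apply: (mxgV exp_groupP); apply: wmap_group.
  (* [w1] represents [g^-1 (W s0)^-1] for the word map [W] of [w]. In the word [(c :: w1) ++ w],
     with parameter 0 for [c], the first tangent vector is then [g x_c g^-1]. The span for this word
     contains [V], so it equals [V] by maximality. *)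
  have [w1 [s1 e1]] := exp_group_word (mxgM exp_groupP GV Gw).
  pose s' := scat (c :: w1) (fun i => if i is j.+1 then s1 j else 0) s0.
  have sub : (V <= <<wtan ((c :: w1) ++ w) s'>>)%VS.
    by rewrite wtan_cat span_cat; apply: addvSr.
  have Veq : V = <<wtan ((c :: w1) ++ w) s'>>%VS.
    apply/eqP; rewrite eqEdim sub dw; apply: dmax.
    by apply/asboolP; eexists _, _.
  rewrite Veq; apply: memv_span; rewrite wtan_cat mem_cat; apply/orP; left.
  apply/mapP; exists (winv w1 s1 *m x c *m wmap w1 s1).
    by rewrite /= inE eqxx.
  have e2 : wmap w1 s1 *m wmap w s0 = invmx g by rewrite -e1 -mulmxA winvV mulmx1.
  have e3 : winv w s0 *m winv w1 s1 = g.
    by rewrite !winvE -invmxM ?e2 ?invmxK //; apply: (mxg_unit exp_groupP (wmap_group _ _)).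
  by rewrite !mulmxA e3 -(mulmxA (g *m x c)) e2.
have [idx fr sp] := free_subseq (wtan w s0).
pose b := in_tuple [seq nth 0 (wtan w s0) i | i <- idx].
(* Coordinates of the chosen tangent vectors at [s] in their basis at [s0]. Where [det (a s)] is
   nonzero, the derivatives along [V] vanish; [line_poly_domain] removes this restriction. *)
pose a s := \matrix_(i < size [seq nth 0 (wtan w s0) i | i <- idx], j < _)
  coord b j (nth 0 (wtan w s) (nth 0%N idx i)).
have tanV s k : nth 0 (wtan w s) k \in V.
  case: (ltnP k (size (wtan w s))) => kw; last by rewrite nth_default ?mem0v.
  by have [g Gg [c ->]] := mem_wtan (mem_nth 0 kw); apply: VG.
have a0 : a s0 = 1%:M.
  apply/matrixP=> i j; rewrite !mxE.
  rewrite (_ : nth 0 (wtan w s0) _ = b`_i); last first.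
    rewrite /b /= (nth_map 0%N) //.
    by apply: (leq_trans (ltn_ord i)); rewrite size_map.
  by rewrite coord_free // eq_sym.
have aLP : rcmx line_poly a.
  move=> i j.
  pose co : 'M[K]_n -> K := coord b j.
  apply: (@rc_ext _ _ _ LP (fun s => \sum_k \sum_l
     (nth 0 (wtan w s) (nth 0%N idx i)) k l * co (delta_mx k l))).
    move=> s; rewrite mxE [in RHS](matrix_sum_delta (nth 0 (wtan w s) (nth 0%N idx i))) linear_sum.
    by apply: eq_bigr => k _; rewrite linear_sum; apply: eq_bigr => l _; rewrite linearZ.
  apply: (rc_sum LP) => k; apply: (rc_sum LP) => l; apply: (rcM LP); last exact: (rcC LP).
  exact: wtan_line_poly.
pose F := [set p | forall s, mxeval (wmap w s) p = 0].
have FV p Y : F p -> Y \in V -> F (dR Y p).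
  move=> Fp YV; pose g s := \col_(j < size [seq nth 0 (wtan w s0) i | i <- idx])
    mxeval (wmap w s) (dR b`_j p).
  have ag s : a s *m g s = 0.
    apply/matrixP=> i k; rewrite !mxE.
    have Yi : nth 0 (wtan w s) (nth 0%N idx i) \in <<b>>%VS by rewrite sp; apply: tanV.
    have : mxeval (wmap w s) (dR (nth 0 (wtan w s) (nth 0%N idx i)) p) = 0.
      case: (ltnP (nth 0%N idx i) (size (wtan w s))) => kw; last first.
        by rewrite nth_default // dRE mulmx0 dpf0.
      rewrite -[wmap w s]mul1mx; apply: wtan_deriv (mem_nth 0 kw) => s'.
      by rewrite mul1mx.
    rewrite (coord_span Yi) dRE mulmx_sumr => {2}<-.
    rewrite (_ : dpf p _ _ = \sum_j dpf p (wmap w s) (wmap w s *m (coord b j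
        (nth 0 (wtan w s) (nth 0%N idx i)) *: b`_j))).
      by apply: eq_bigr => j _; rewrite !mxE dRE -scalemxAr dpfZ.
    by elim/big_rec2: _ => [|j y1 y2 _ <-]; rewrite ?dpf0 ?dpfD.
  have dg s : \det (a s) *: g s = 0.
    by rewrite -mul_scalar_mx -mul_adj_mx -mulmxA ag mulmx0.
  have g0 j : F (dR b`_j p).
    move=> s; have [jb|jb] := ltnP j (size b); last by rewrite nth_default // dRE mulmx0 dpf0.
    pose jj := Ordinal jb.
    apply: (@line_poly_domain (fun s => \det (a s)) (fun s => mxeval (wmap w s) (dR b`_j p))).
    - exact: (rc_det LP).
    - by apply: (rc_mxeval LP); apply: wmap_line_poly.
    - by move=> s1; have /matrixP /(_ jj 0) := dg s1; rewrite !mxE.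
    - by exists s0; rewrite a0 det1 oner_eq0.
  have YV' : Y \in <<b>>%VS by rewrite sp.
  move=> s; rewrite (coord_span YV') dRE mulmx_sumr.
  apply: (@big_rec _ (fun Z => dpf p (wmap w s) Z = 0)) => [|j Z _ hZ]; first exact: dpf0.
  by rewrite dpfD hZ addr0 -scalemxAr dpfZ -dRE g0 mulr0.
have Fx c p : F p -> F (dR (x c) p).
  move=> Fp; apply: FV => //; have := VG 1%:M c (mxg1 exp_groupP).
  by rewrite invmx1 mulmx1 mul1mx.
have main w' s' A : (forall p, F p -> mxeval A p = 0) ->
    forall p, F p -> mxeval (A *m wmap w' s') p = 0.
  elim: w' s' A => [|c w' IH] s' A hA p Fp /=; first by rewrite mulmx1; apply: hA.
  rewrite mulmxA; apply: IH => // q Fq.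
  by apply: (@taylorR K n F) => // r Fr; apply: Fx.
move=> A GA; have Gw := mxgV exp_groupP (wmap_group w s0).
have [w' [s' e']] := exp_group_word (mxgM exp_groupP Gw GA).
have -> : A = wmap w s0 *m wmap w' s'.
  by rewrite -e' mulmxA mulmxV ?mul1mx //; apply: (mxg_unit exp_groupP (wmap_group w s0)).
by apply: main => // q; apply.
Qed.

(** The parameter space is irreducible, by [line_poly_domain], and the image of a suitable word map
    is dense. *)
Lemma exp_group_irr : irr exp_group.
Proof.
have [w hw] := dense_word => p q pq.
case: (pselect (vanish exp_group p)) => [|np]; [by left | right].
apply/hw; apply: (@line_poly_domain (fun s => mxeval (wmap w s) p)).
- by apply: (rc_mxeval LP); apply: wmap_line_poly.
- by apply: (rc_mxeval LP); apply: wmap_line_poly.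
- by move=> s; apply: pq; apply: wmap_group.
apply: contrapT => h; apply: np; apply/hw => s; apply/eqP; apply: contrapT => /negP hs.
by apply: h; exists s.
Qed.

End WordMaps.

(** * Constructible sets *)

Section Chevalley.
Variable K : numClosedFieldType.
Implicit Types (e : seq K).

(** Functions of an environment computed by a division-free term of the language of rings, hence
    available to quantifier elimination. *)
Definition term_fun (F : seq K -> K) :=
  exists2 t : GRing.term K, GRing.rterm t & forall e, GRing.eval e t = F e.

Lemma term_fun_class : ring_class term_fun.
Proof.
split.
- by move=> f g h [t rt ht]; exists t => // e; rewrite ht.
- by move=> c; exists (c%:T)%T.
- by move=> f g [t rt ht] [u ru hu]; exists (t + u)%T => /= [|e]; rewrite ?rt // ht hu.
- by move=> f g [t rt ht] [u ru hu]; exists (t * u)%T => /= [|e]; rewrite ?rt // ht hu.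
Qed.

Lemma term_fun_var i : term_fun (fun e => e`_i).
Proof. by exists ('X_i)%T. Qed.

Definition env n (A : 'M[K]_n) : seq K := [seq mxvec A 0 k | k <- enum 'I_(n * n)].

Lemma size_env n (A : 'M[K]_n) : size (env A) = (n * n)%N.
Proof. by rewrite size_map size_enum_ord. Qed.

Lemma env_nth n (A : 'M[K]_n) (k : 'I_(n * n)) : (env A)`_k = mxvec A 0 k.
Proof. by rewrite (nth_map k) ?size_enum_ord // nth_ord_enum. Qed.

Definition env_mx n e : 'M[K]_n := \matrix_(i, j) e`_(mxvec_index i j).

Lemma env_mxK n (A : 'M[K]_n) e : env_mx n (env A ++ e) = A.
Proof.
apply/matrixP=> i j; rewrite mxE nth_cat size_env ltn_ord.
by rewrite env_nth mxvecE.
Qed.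

Lemma rterm_mxeval n t : GRing.rterm t ->
  pfun (fun A : 'M[K]_n => GRing.eval (env A) t).
Proof.
elim: t => //=.
- move=> i _; case: (ltnP i (n * n)) => h.
    apply: (@pfun_ext _ _ (fun A => mxvec A 0 (Ordinal h))) => [A|].
      by rewrite -env_nth.
    case/mxvec_indexP: (Ordinal h) => a b.
    by apply: (pfun_ext _ (pfun_coord K a b)) => A; rewrite mxvecE.
  by apply: (pfun_ext _ (pfunC n 0)) => A; rewrite nth_default // size_env.
- by move=> c _; apply: pfunC.
- by move=> k _; apply: pfunC.
- by move=> t IHt u IHu /andP [/IHt ht /IHu hu]; apply: pfunD.
- by move=> t IHt /IHt; apply: pfunN.
- move=> t IHt k /IHt ht; apply: (pfun_ext _ (pfunZ k%:R ht)) => A.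
  by rewrite mulr_natl.
- by move=> t IHt u IHu /andP [/IHt ht /IHu hu]; apply: pfunM.
- by move=> t IHt k /IHt ht; apply: pfunX.
Qed.

(** On an irreducible set an equation either holds identically or fails wherever the difference of
    its sides is nonzero. For a connective the two polynomials are multiplied; by irreducibility the
    product does not vanish on [Z]. *)
Lemma qf_generic n (Z : set 'M[K]_n) (f : GRing.formula K) : irr Z -> (exists A, Z A) ->
  GRing.qf_form f -> GRing.rformula f ->
  exists p b, ~ vanish Z p /\
    forall A, Z A -> mxeval A p != 0 -> GRing.qf_eval (env A) f = b.
Proof.
move=> iZ [A0 ZA0].
have one : ~ vanish Z (1 : {mpoly K[n * n]}).
  by move=> /(_ A0 ZA0) /eqP; rewrite /mxeval meval1 oner_eq0.
have comb (op : bool -> bool -> bool) f1 f2 :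
    (exists p b, ~ vanish Z p /\
      forall A, Z A -> mxeval A p != 0 -> GRing.qf_eval (env A) f1 = b) ->
    (exists p b, ~ vanish Z p /\
      forall A, Z A -> mxeval A p != 0 -> GRing.qf_eval (env A) f2 = b) ->
    exists p b, ~ vanish Z p /\ forall A, Z A -> mxeval A p != 0 ->
      op (GRing.qf_eval (env A) f1) (GRing.qf_eval (env A) f2) = b.
  move=> [p [b [np hp]]] [q [c [nq hq]]]; exists (p * q), (op b c); split.
    by move=> pq; case: (iZ p q) => // A ZA; rewrite -mxeval_mul; apply: pq.
  by move=> A ZA; rewrite mxeval_mul mulf_eq0 => /norP [h1 h2]; rewrite hp ?hq.
elim: f => //=.
- by move=> b _ _; exists 1, b.
- move=> t u _ /andP [rt ru].
  have [p hp] := pfunB (rterm_mxeval n rt) (rterm_mxeval n ru).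
  case: (pselect (vanish Z p)) => h.
    exists 1, true; split=> // A ZA _; apply/eqP/subr0_eq.
    by rewrite hp; apply: h.
  exists p, false; split=> // A ZA; rewrite -hp subr_eq0.
  exact: negbTE.
- by move=> f1 IH1 f2 IH2 /andP [q1 q2] /andP [r1 r2]; apply: (comb andb); [apply: IH1|apply: IH2].
- by move=> f1 IH1 f2 IH2 /andP [q1 q2] /andP [r1 r2]; apply: (comb orb); [apply: IH1|apply: IH2].
- by move=> f1 IH1 f2 IH2 /andP [q1 q2] /andP [r1 r2]; apply: (comb implb); [apply: IH1|apply: IH2].
- move=> f IH qf rf; have [p [b [np hp]]] := IH qf rf.
  by exists p, (~~ b); split=> // A ZA h; rewrite hp.
Qed.

Fixpoint ex_vars i k (f : GRing.formula K) : GRing.formula K :=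
  if k is k'.+1 then ('exists 'X_i, ex_vars i.+1 k' f)%T else f.

Lemma ex_varsP k f e :
  GRing.holds e (ex_vars (size e) k f) <-> exists2 y, size y = k & GRing.holds (e ++ y) f.
Proof.
elim: k e => [|k IH] e /=.
  split; first by exists [::]; rewrite ?cats0.
  by case=> y /size0nil ->; rewrite cats0.
have e1 a : set_nth 0 e (size e) a = rcons e a by elim: (e) => //= b e' ->.
split=> [[a]|[[|a y] // [sy] h]].
  rewrite e1 -[(size e).+1](size_rcons e a) => /IH [y sy]; rewrite cat_rcons => h.
  by exists (a :: y) => //=; rewrite sy.
exists a; rewrite e1 -[(size e).+1](size_rcons e a); apply/IH.
by exists y => //; rewrite cat_rcons.
Qed.

Lemma rformula_ex_vars i k f : GRing.rformula (ex_vars i k f) = GRing.rformula f.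
Proof. by elim: k i => //= k IH i. Qed.

Definition conj_eq0 (I : eqType) (t : I -> GRing.term K) (r : seq I) : GRing.formula K :=
  foldr (fun i f => (t i == GRing.NatConst _ 0 /\ f)%T) (GRing.Bool true) r.

Lemma conj_eq0P (I : eqType) (t : I -> GRing.term K) r e :
  GRing.holds e (conj_eq0 t r) <-> forall i, i \in r -> GRing.eval e (t i) = 0.
Proof.
elim: r => [|i r IH] //=; rewrite IH; split=> [[h1 h2] j|h].
  by rewrite inE => /orP [/eqP ->|/h2].
by split=> [|j jr]; apply: h; rewrite inE ?eqxx // jr orbT.
Qed.

(** Projections of closed sets, the shape in which images of polynomial maps come; the variables
    from [n * n] on are the ones projected away. *)
Definition definable n (E : set 'M[K]_n) := exists (k : nat) (I : finType) (F : I -> seq K -> K),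
  (forall i, term_fun (F i)) /\
  forall A, E A <-> exists2 y, size y = k & forall i, F i (env A ++ y) = 0.

(** Quantifier elimination makes membership in [E] quantifier-free, so its truth value is constant
    on a nonempty open part of [Z]; by the density hypothesis this value is true. *)
Lemma chevalley n (Z E : set 'M[K]_n) : irr Z -> definable E ->
  (forall p, vanish (Z `&` E) p -> vanish Z p) -> (exists A, Z A) ->
  exists2 p, ~ vanish Z p & forall A, Z A -> mxeval A p != 0 -> E A.
Proof.
move=> iZ [k [I [F [tF hE]]]] dense neZ.
pose t i := projT1 (cid2 (tF i)).
have ht i e : GRing.eval e (t i) = F i e by rewrite /t; case: (cid2 (tF i)).
have rt i : GRing.rterm (t i) by rewrite /t; case: (cid2 (tF i)).
pose f := ex_vars (n * n) k (conj_eq0 t (enum I)).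
have rf : GRing.rformula f.
  by rewrite rformula_ex_vars; elim: (enum I) => //= i r ->; rewrite rt.
have hf A : E A <-> GRing.holds (env A) f.
  rewrite hE /f -(size_env A) ex_varsP; split=> -[y sy h]; exists y => //.
    by apply/conj_eq0P => i _; rewrite ht.
  by move=> i; rewrite -ht; move/conj_eq0P: h; apply; rewrite mem_enum.
have qeP := GRing.quantifier_elim_rformP (@ClosedFieldQE.wf_ex_elim K)
  (ClosedFieldQE.holds_ex_elim (@GRing.solve_monicpoly K)).
have /andP [qf rqf] := GRing.quantifier_elim_wf (@ClosedFieldQE.wf_ex_elim K) rf.
have [p [b [np hp]]] := qf_generic iZ neZ qf rqf.
case: b hp => hp; first by exists p => // A ZA pA; apply/hf/(qeP _ _ rf); rewrite hp.
case: np; apply: dense => A [ZA EA]; apply/eqP; apply: contrapT => /negP pA.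
by have /hf/(qeP _ _ rf) := EA; rewrite hp.
Qed.

(** Two nonempty open subsets of an irreducible set meet: the [B] with [p] nonzero at [B], and the
    [B] with [p] nonzero at [A B^-1]. *)
Lemma irr_group_factor n (S : set 'M[K]_n) p : mx_group S -> irr S -> ~ vanish S p ->
  forall A, S A -> exists B C,
    [/\ S B, S C, mxeval B p != 0, mxeval C p != 0 & A = B *m C].
Proof.
move=> gS iS np A SA; have Su := mxg_unit gS.
have : regular_on (@units K n) (fun B => mxeval (A *m invmx B) p).
  by apply: reg_mxeval => //; apply: rmxM => //; [apply: rmxC | apply: rmx_inv].
case=> r [k hr].
have nr : ~ vanish S r.
  move=> vr; have [B SB pB] := notvanish np; have uB := Su B SB; have uA := Su A SA.
  have SBA : S (invmx B *m A) by apply: (mxgM gS) => //; apply: (mxgV gS).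
  have := hr (invmx B *m A) (Su _ SBA); rewrite (vr _ SBA) mul0r.
  rewrite invmxM ?unitmx_inv // invmxK mulKVmx //.
  by move/eqP; rewrite (negbTE pB).
have [B SB] : exists2 B, S B & mxeval B (p * r) != 0.
  by apply: notvanish => pr; case: (iS p r) => // B SB; rewrite -mxeval_mul; apply: pr.
rewrite mxeval_mul mulf_eq0 => /norP [pB rB]; have uB := Su B SB.
exists (A *m invmx B), B; split=> //; first exact: (mxgMV gS).
  by rewrite hr // mulf_neq0 // invr_eq0 expf_neq0 // -unitfE -unitmxE.
by rewrite mulmxKV.
Qed.

(* An irreducible definable group contains a nonempty open subset of its closure. *)
Lemma definable_group_closed n (S : set 'M[K]_n) : mx_group S -> irr S -> definable S ->
  zariski_closed S.
Proof.
move=> gS iS dS; have Su := mxg_unit gS.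
have scl := sub_zclosure Su; have gcl := zclosure_group gS.
have icl : irr (zclosure S).
  move=> p q pq; case: (iS p q) => [A /scl|h|h]; first exact: pq.
    by left=> A [_]; apply.
  by right=> A [_]; apply.
have [] := @chevalley n (zclosure S) S icl dS.
- by move=> p h A [_]; apply=> B SB; apply: h; split=> //; apply: scl.
- by exists 1%:M; apply/scl/(mxg1 gS).
move=> p np hp; suff -> : S = zclosure S by apply: zclosure_closed.
apply/seteqP; split=> // A /(irr_group_factor gcl icl np) [B [C [clB clC pB pC ->]]].
by apply: (mxgM gS); apply: hp.
Qed.

End Chevalley.

Section ExpGroupClosed.
Variables (K : numClosedFieldType) (n : nat) (I : Type) (x : I -> 'M[K]_n).
Hypothesis nx : forall c, nilp (x c).

Let TF := term_fun_class K.

Lemma wmap_term_fun w N : rcmx (@term_fun K) (fun e => wmap x w (fun i => e`_(N + i))).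
Proof.
elim: w N => [|c w IH] N /=; first exact: (rcmxC TF).
apply: (rcmxM TF).
  by apply: (rcmx_exp TF); apply: term_fun_var.
move=> i j; apply: (rc_ext TF) (IH N.+1 i j) => e.
by congr (wmap _ _ _ _ _); apply: funext => k; rewrite addnS.
Qed.

Lemma env_mx_term_fun : rcmx (@term_fun K) (env_mx n).
Proof.
move=> i j; apply: (rc_ext TF) (term_fun_var K (mxvec_index i j)) => e.
by rewrite mxE.
Qed.

Lemma wmap_definable w : definable [set wmap x w s | s in setT].
Proof.
exists (size w), ('I_n * 'I_n)%type, (fun ij e =>
  (wmap x w (fun i => e`_(n * n + i)) - env_mx n e) ij.1 ij.2); split.
  by move=> [i j]; apply: (rcmxB TF); [apply: wmap_term_fun | apply: env_mx_term_fun].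
move=> A.
have e1 (y : seq K) : wmap x w (fun i => (env A ++ y)`_(n * n + i)) = wmap x w (fun i => y`_i).
  by apply: wmap_ext => i _; rewrite nth_cat size_env ltnNge leq_addr /= addKn.
split=> [[s _ <-]|[y sy h]].
  exists (mkseq s (size w)); rewrite ?size_mkseq // => -[i j] /=.
  rewrite env_mxK; set A' := wmap x w _.
  have -> : A' = wmap x w s; last by rewrite subrr mxE.
  by apply: wmap_ext => k kw; rewrite nth_cat size_env ltnNge leq_addr /= addKn nth_mkseq.
exists (fun i => y`_i) => //; apply/matrixP=> i j; have := h (i, j).
by rewrite /= env_mxK e1 mxE [X in _ + X]mxE => /eqP; rewrite subr_eq0 => /eqP.
Qed.

(** If the word map of [w] is dominant, its image contains a nonempty open subset, and every element
    of the group is a product of two elements of that subset; hence [w ++ w] is onto. *)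
Lemma exp_group_image : exists w, forall A, exp_group x A <-> exists s, A = wmap x w s.
Proof.
have [w hw] := dense_word nx; have gG := exp_groupP nx.
have [] := @chevalley K n (exp_group x) _ (exp_group_irr nx) (wmap_definable w).
- move=> p h; apply: hw => s; apply: h; split; last by exists s.
  exact: wmap_group.
- by exists 1%:M; apply: (mxg1 gG).
move=> p np hp; exists (w ++ w) => A; split=> [GA|[s ->]]; last exact: wmap_group.
have [B [C [GB GC pB pC ->]]] := irr_group_factor gG (exp_group_irr nx) np GA.
have [s _ <-] := hp B GB pB; have [t _ <-] := hp C GC pC.
by exists (scat w s t); rewrite wmap_cat.
Qed.

Lemma exp_group_closed : zariski_closed (exp_group x).
Proof.
apply: definable_group_closed; [exact: exp_groupP | exact: exp_group_irr |].
have [w hw] := exp_group_image.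
rewrite (_ : exp_group x = [set wmap x w s | s in setT]); first exact: wmap_definable.
apply/seteqP; split=> A; first by move=> /hw [s ->]; exists s.
by move=> [s _ <-]; apply/hw; exists s.
Qed.

Lemma exp_group_algebraic : algebraic_group (exp_group x).
Proof. by split; [apply: exp_groupP | apply: exp_group_closed]. Qed.

Lemma exp_group_connected : zariski_connected (exp_group x).
Proof.
apply: irr_connected (exp_group_irr nx) => A; exact: (mxg_unit (exp_groupP nx)).
Qed.

End ExpGroupClosed.

(** * Solvable groups *)

Section DerivedGroups.
Variable K : numClosedFieldType.

Section Derived.
Variable n : nat.
Implicit Types S : set 'M[K]_n.

Lemma comm_unit S : S `<=` @units K n ->
  [set C | exists A B, [/\ S A, S B & C = A *m B *m invmx A *m invmx B]] `<=` @units K n.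
Proof.
move=> Su _ [A [B [/Su uA /Su uB ->]]].
by do 3?[apply: mulmx_unit]; rewrite ?unitmx_inv.
Qed.

Lemma derived_group S : S `<=` @units K n -> mx_group (derived S).
Proof. by move=> Su; apply: gen_group; apply: comm_unit. Qed.

Lemma derived_comm S A B : S A -> S B -> derived S (A *m B *m invmx A *m invmx B).
Proof. by move=> SA SB; apply: gen_sub; exists A, B. Qed.

Lemma derived_sub S : mx_group S -> derived S `<=` S.
Proof.
move=> gS; apply: gen_min => // _ [A [B [SA SB ->]]].
by apply: (mxgMV gS) => //; apply: (mxgMV gS) => //; apply: (mxgM gS).
Qed.

Lemma derived_mono S S' : S `<=` S' -> S' `<=` @units K n -> derived S `<=` derived S'.
Proof.
move=> ss u; apply: gen_min; first exact: derived_group.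
by move=> _ [A [B [/ss SA /ss SB ->]]]; apply: derived_comm.
Qed.

Lemma iter_derived_group S k : mx_group S -> mx_group (iter k (@derived K n) S).
Proof.
by move=> gS; elim: k => //= k IH; apply: derived_group; case: IH.
Qed.

Lemma iter_derived1 S k : mx_group S -> iter k (@derived K n) S 1%:M.
Proof. by move=> gS; apply: mxg1; apply: iter_derived_group. Qed.

Lemma iter_derived_mono S S' k : mx_group S -> mx_group S' -> S `<=` S' ->
  iter k (@derived K n) S `<=` iter k (@derived K n) S'.
Proof.
move=> gS gS' ss; elim: k => //= k IH; apply: derived_mono => //.
by case: (iter_derived_group k gS').
Qed.

Lemma iter_derived_add S j k : mx_group S ->
  iter (j + k) (@derived K n) S `<=` iter k (@derived K n) S.
Proof.
move=> gS; elim: j => //= j IH A.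
by move=> /(derived_sub (iter_derived_group _ gS)) /IH.
Qed.

Lemma derived_normal S A D : mx_group S -> S A -> derived S D ->
  derived S (A *m D *m invmx A).
Proof.
move=> gS SA dD; have gD := derived_group (mxg_unit gS).
have SD := derived_sub gS dD.
rewrite -[_ *m _ *m _](@mulmxKV _ _ _ D) ?(mxg_unit gS) //.
by apply: (mxgM gD) => //; apply: derived_comm.
Qed.

(** For fixed [x] and [s], the function [t |-> f (x [s, t])] is regular on [S] with values in [l],
    so it equals its value [f x] at [t = 1]. Thus [f] does not change under right multiplication by
    commutators. *)
Lemma fc_derived S : mx_group S -> finval_const S -> finval_const (derived S).
Proof.
move=> gS fS f rf l fl; have Su := mxg_unit gS; have gD := derived_group Su.
have step x s t : derived S x -> S s -> S t ->
    f (x *m (s *m t *m invmx s *m invmx t)) = f x.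
  move=> Dx Ss St.
  pose F t := x *m (s *m t *m invmx s *m invmx t).
  have FD u : S u -> derived S (F u) by move=> Su'; apply: (mxgM gD) => //; apply: derived_comm.
  have rF : rmx S F.
    by apply: rmxM => //; [apply: rmxC | apply: rmxM => //; [|apply: rmx_inv => //];
      apply: rmxM => //; [|apply: rmxC]; apply: rmxM => //; [apply: rmxC|apply: rmx_id]].
  have rfF : regular_on S (fun u => f (F u)).
    apply: (reg_comp Su rf rF FD).
    apply: (@reg_ext _ _ _ (fun _ => (\det x)^-1)); last exact: regC.
    move=> u Su'; have us := Su _ Ss; have uu := Su _ Su'.
    rewrite /F !det_mulmx !det_inv; congr (_^-1).
    have : \det s != 0 by rewrite -unitfE -unitmxE.
    have : \det u != 0 by rewrite -unitfE -unitmxE.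
    by move=> h1 h2; field; rewrite h1.
  have := fS _ rfF l (fun u Su' => fl _ (FD u Su')) t 1%:M St (mxg1 gS).
  by rewrite /F mulmx1 mulmxV ?(Su s) // invmx1 !mulmx1.
suff h A : derived S A -> f A = f 1%:M by move=> A B /h -> /h ->.
apply: (gen_ind (Q := fun A => f A = f 1%:M)) => [|//|x C Dx [s [t [Ss St ->]]] fx].
  exact: comm_unit.
split; first by rewrite step.
rewrite -(step _ s t) //; last first.
  by apply: (mxgMV gD) => //; apply: derived_comm.
by rewrite mulmxKV //; apply: (mxg_unit gD); apply: derived_comm.
Qed.

(** [D] is a decreasing multiplicative filtration that reaches zero; [S] lies in degree 0 and is
    commutative modulo degree 1. For [k > 0] the [k]-th derived group lies in [1 + D k], since
    [[A, B] - 1] is the additive commutator of [A - 1] and [B - 1] times [A^-1 B^-1]. *)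
Lemma filtered_solvable S (D : nat -> 'M[K]_n -> Prop) N : mx_group S ->
  (forall i j A B, D i A -> D j B -> D (i + j)%N (A *m B)) ->
  (forall i A B, D i A -> D i B -> D i (A + B)) ->
  (forall i A, D i A -> D i (- A)) ->
  (forall i A, D i.+1 A -> D i A) -> (forall A, D N A -> A = 0) ->
  (forall A, S A -> D 0%N A) ->
  (forall A B, S A -> S B -> D 1%N (A *m B - B *m A)) ->
  iter N.+1 (@derived K n) S = [set 1%:M].
Proof.
move=> gS DM DD DN Ddec DN0 SD SD1; have Su := mxg_unit gS.
have mono i j A : (i <= j)%N -> D j A -> D i A.
  by move=> /subnK <-; elim: (j - i)%N => // k IH /Ddec.
have key k A : iter k.+1 (@derived K n) S A -> D k.+1 (A - 1%:M).
  elim: k A => [|k IH] A.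
    have comm A1 B1 : S A1 -> S B1 -> D 1%N (A1 *m B1 *m invmx A1 *m invmx B1 - 1%:M).
      move=> SA1 SB1; have uA := Su _ SA1; have uB := Su _ SB1.
      have -> : A1 *m B1 *m invmx A1 *m invmx B1 - 1%:M =
                (A1 *m B1 - B1 *m A1) *m (invmx A1 *m invmx B1).
        by rewrite mulmxBl !mulmxA mulmxK // mulmxV.
      rewrite -[1%N]addn0; apply/DM; first exact: SD1.
      by apply/SD; apply: (mxgM gS); apply: (mxgV gS).
    apply: (gen_ind (Q := fun A => D 1%N (A - 1%:M))); first exact: comm_unit.
      have := SD1 _ _ (mxg1 gS) (mxg1 gS); by rewrite subrr subrr.
    move=> x _ Dx [s [t [Ss St ->]]] hx.
    have Sx : S x by apply: (derived_sub gS).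
    set c := s *m t *m invmx s *m invmx t.
    have hc : D 1%N (c - 1%:M) by apply: comm.
    have Sc : S c by apply: (derived_sub gS); apply: derived_comm.
    have uc := Su _ Sc.
    split.
      have -> : x *m c - 1%:M = x *m (c - 1%:M) + (x - 1%:M).
        by rewrite mulmxBr mulmx1 addrA subrK.
      by apply/DD => //; rewrite -[1%N]add0n; apply/DM => //; apply/SD.
    have -> : x *m invmx c - 1%:M = (x - 1%:M) - x *m (invmx c *m (c - 1%:M)).
      by rewrite mulmxBr mulmx1 mulVmx // mulmxBr mulmx1 opprB [RHS]addrC addrA subrK.
    apply/DD => //; apply/DN; rewrite -[1%N]add0n; apply/DM; first exact: SD.
    by rewrite -[1%N]add0n; apply/DM => //; apply/SD/(mxgV gS).
  set L := iter k.+1 (@derived K n) S in IH *.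
  have gL : mx_group L by apply: iter_derived_group.
  have LS : L `<=` S by move=> B; have := @iter_derived_add S k.+1 0 gS; rewrite addn0; apply.
  rewrite iterS -/L; clearbody L.
  have comm A1 B1 : L A1 -> L B1 -> D k.+2 (A1 *m B1 *m invmx A1 *m invmx B1 - 1%:M).
    move=> LA LB; have uA := mxg_unit gL LA; have uB := mxg_unit gL LB.
    have -> : A1 *m B1 *m invmx A1 *m invmx B1 - 1%:M =
        ((A1 - 1%:M) *m (B1 - 1%:M) - (B1 - 1%:M) *m (A1 - 1%:M)) *m (invmx A1 *m invmx B1).
      have -> : (A1 - 1%:M) *m (B1 - 1%:M) - (B1 - 1%:M) *m (A1 - 1%:M) = A1 *m B1 - B1 *m A1.
        rewrite !mulmxBl !mulmxBr !mul1mx !mulmx1; move: (A1 *m B1) (B1 *m A1) => P Q.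
        by apply/matrixP=> a b; rewrite !mxE; ring.
      by rewrite mulmxBl !mulmxA mulmxK // mulmxV.
    rewrite -[k.+2]addn0; apply/DM; last by apply/SD/LS; apply: (mxgM gL); apply: (mxgV gL).
    have h (X Y : 'M[K]_n) : L X -> L Y -> D k.+2 ((X - 1%:M) *m (Y - 1%:M)).
      move=> LX LY; apply: (@mono _ (k.+1 + k.+1)%N); first by lia.
      by apply/DM; apply: IH.
    by apply/DD; [apply: h | apply/DN; apply: h].
  have gdL := derived_group (mxg_unit gL).
  apply: (gen_ind (Q := fun A => D k.+2 (A - 1%:M))).
  - exact: comm_unit (mxg_unit gL).
  - have := comm _ _ (mxg1 gL) (mxg1 gL); by rewrite invmx1 !mulmx1.
  move=> x _ Dx [s [t [Ss St ->]]] hx.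
  have Sx : S x by apply: LS; apply: (derived_sub gL).
  set c := s *m t *m invmx s *m invmx t.
  have hc : D k.+2 (c - 1%:M) by apply: comm.
  have Sc : S c by apply: LS; apply: (derived_sub gL); apply: derived_comm.
  have uc := Su _ Sc.
  split.
    have -> : x *m c - 1%:M = x *m (c - 1%:M) + (x - 1%:M).
      by rewrite mulmxBr mulmx1 addrA subrK.
    by apply/DD => //; rewrite -[k.+2]add0n; apply/DM => //; apply/SD.
  have -> : x *m invmx c - 1%:M = (x - 1%:M) - x *m (invmx c *m (c - 1%:M)).
    by rewrite mulmxBr mulmx1 mulVmx // mulmxBr mulmx1 opprB [RHS]addrC addrA subrK.
  apply/DD => //; apply/DN; rewrite -[k.+2]add0n; apply/DM; first exact: SD.
  by rewrite -[k.+2]add0n; apply/DM => //; apply/SD/(mxgV gS).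
apply/seteqP; split=> A.
  move=> /key h; apply/eqP; rewrite -subr_eq0; apply/eqP/DN0.
  exact: (mono _ N.+1).
by move=> ->; apply: iter_derived1.
Qed.

End Derived.
End DerivedGroups.

(** * Common eigenvectors of connected solvable groups *)

Section LieKolchin.
Variable K : numClosedFieldType.

(** Turns a linear condition in [Prop] into a [{vspace V}]: a subspace of maximal dimension among
    those satisfying it absorbs every solution. *)
Lemma pred_vspace (V : vectType K) (P : V -> Prop) : P 0 ->
  (forall a u v, P u -> P v -> P (a *: u + v)) ->
  exists W : {vspace V}, forall v, v \in W <-> P v.
Proof.
move=> P0 Plin.
pose Q d := asbool (exists W : {vspace V}, (forall v, v \in W -> P v) /\ \dim W = d).
have exQ : exists d, Q d.
  by exists 0%N; apply/asboolP; exists 0%VS; split=> [v|]; rewrite ?memv0 ?dimv0 // => /eqP ->.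
have bound d : Q d -> (d <= \dim {:V})%N.
  by move=> /asboolP [W [_ <-]]; apply: dimvS; apply: subvf.
case: (ex_maxnP exQ bound) => d /asboolP [W [WP dW]] dmax.
exists W => v; split; first exact: WP.
move=> Pv; apply: contrapT => /negP vW.
have : Q (\dim (<[v]> + W)%VS).
  apply/asboolP; exists (<[v]> + W)%VS; split=> // u /memv_addP [x /vlineP [a ->] [w wW ->]].
  by apply: Plin => //; apply: WP.
move=> /dmax; rewrite -dW => le.
have /eqP e : W == (<[v]> + W)%VS by rewrite eqEdim addvSr.
by move/negP: vW; apply; rewrite e; apply: (subvP (addvSl _ _)); apply: memv_line.
Qed.

Section Restriction.
Variables (m : nat) (W : {vspace 'cV[K]_m}).

(** The matrix of [A] on [W] in the basis [vbasis W]; meaningful when [W] is stable under [A]. *)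
Definition rmat (A : 'M[K]_m) : 'M[K]_(\dim W) :=
  \matrix_(i, j) coord (vbasis W) i (A *m (vbasis W)`_j).

Definition wvec (x : 'cV[K]_(\dim W)) : 'cV[K]_m := \sum_i x i 0 *: (vbasis W)`_i.

Lemma wvec_mem x : wvec x \in W.
Proof.
apply: memv_suml => i _; apply: memvZ; apply: vbasis_mem.
by apply: mem_nth; rewrite size_tuple.
Qed.

Lemma wvec_inj x : wvec x = 0 -> x = 0.
Proof.
move=> h; have /freeP fr := basis_free (vbasisP W).
by apply/matrixP=> i j; rewrite ord1 (fr _ h) mxE.
Qed.

Lemma wvec_lin a x y : wvec (a *: x + y) = a *: wvec x + wvec y.
Proof.
rewrite /wvec scaler_sumr -big_split; apply: eq_bigr => i _.
by rewrite /= !mxE scalerDl scalerA.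
Qed.

Lemma wvecZ a x : wvec (a *: x) = a *: wvec x.
Proof.
by rewrite /wvec scaler_sumr; apply: eq_bigr => i _; rewrite mxE scalerA.
Qed.

Lemma rmatE A x : (forall v, v \in W -> A *m v \in W) -> A *m wvec x = wvec (rmat A *m x).
Proof.
move=> st; rewrite /wvec mulmx_sumr.
transitivity (\sum_j \sum_i (rmat A i j * x j 0) *: (vbasis W)`_i).
  apply: eq_bigr => j _; rewrite -scalemxAr.
  have bj : A *m (vbasis W)`_j \in W.
    by apply: st; apply: vbasis_mem; apply: mem_nth; rewrite size_tuple.
  rewrite {1}(coord_vbasis bj) scaler_sumr; apply: eq_bigr => i _.
  by rewrite scalerA !mxE mulrC.
rewrite exchange_big; apply: eq_bigr => i _; rewrite -scaler_suml; congr (_ *: _).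
by rewrite mxE.
Qed.

Lemma rmat_uniq A B : (forall x, wvec (A *m x) = wvec (B *m x)) -> A = B :> 'M_(\dim W).
Proof.
move=> h; apply/eqP; rewrite -subr_eq0; apply/eqP/matrixP=> i j.
have := wvec_lin (-1) (B *m delta_mx j 0) (A *m delta_mx j 0).
rewrite h [_ *: wvec _]scaleN1r addNr => /wvec_inj.
rewrite scaleN1r addrC -mulmxBl => /matrixP /(_ i 0); rewrite -colE !mxE.
by move=> ->.
Qed.

End Restriction.

Lemma eigen_exists m (W : {vspace 'cV[K]_m}) A : W != 0%VS ->
  (forall v, v \in W -> A *m v \in W) -> exists a v, [/\ v \in W, v != 0 & A *m v = a *: v].
Proof.
move=> W0 st; have d0 : (0 < \dim W)%N by rewrite lt0n dimv_eq0.
have [a ra] : exists a, root (char_poly (rmat W A)^T) a.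
  apply/closed_rootP; rewrite size_char_poly; by move: d0; case: (\dim W).
move: ra; rewrite -eigenvalue_root_char => /eigenvalueP [u uA u0].
exists a, (wvec u^T); split; first exact: wvec_mem.
  by apply: contraNneq u0 => /wvec_inj /eqP; rewrite trmx_eq0.
rewrite rmatE // -[rmat W A]trmxK -trmx_mul uA linearZ /=.
by rewrite wvecZ.
Qed.

Lemma commuting_eigen m (Phi : set 'M[K]_m) (W : {vspace 'cV[K]_m}) : W != 0%VS ->
  (forall A v, Phi A -> v \in W -> A *m v \in W) ->
  (forall A B v, Phi A -> Phi B -> v \in W -> A *m (B *m v) = B *m (A *m v)) ->
  exists v, [/\ v \in W, v != 0 & forall A, Phi A -> exists a, A *m v = a *: v].
Proof.
elim: {W}(\dim W) {-2}W (leqnn (\dim W)) => [|d IH] W dW W0 st com.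
  by move: W0; rewrite -dimv_eq0 -leqn0 dW.
case: (pselect (forall A, Phi A -> exists a, forall v, v \in W -> A *m v = a *: v)) => [h|].
  exists (vpick W); split; rewrite ?memv_pick ?vpick0 // => A /h [a ha].
  by exists a; rewrite ha ?memv_pick.
move/existsNP => [A /not_implyP [PA nA]].
have [a [v [vW v0 Av]]] := eigen_exists W0 (fun v => st A v PA).
have [] := @pred_vspace _ (fun u => u \in W /\ A *m u = a *: u).
- by rewrite mem0v mulmx0 scaler0.
- move=> b u w [uW uA] [wW wA]; split; first by rewrite memvD // memvZ.
  by rewrite mulmxDr -scalemxAr uA wA scalerDr !scalerA mulrC.
move=> W' hW'.
have sub : (W' <= W)%VS by apply/subvP=> u /hW' [].
have [] := IH W'.
- rewrite -ltnS (leq_trans _ dW) // ltn_neqAle dimvS // andbT.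
  apply/negP=> /eqP e; apply: nA; exists a => u uW.
  have /eqP WW : W' == W by rewrite eqEdim sub e leqnn.
  by rewrite -WW in uW; case/hW': uW.
- by apply/negP=> /eqP e; have /hW' : v \in W /\ A *m v = a *: v by []; rewrite e memv0 (negbTE v0).
- move=> B u PB /hW' [uW uA]; apply/hW'; split; first exact: st.
  by rewrite com // uA -scalemxAr.
- by move=> B C u PB PC /hW' [uW _]; apply: com.
move=> u [/hW' [uW _] u0 h]; by exists u.
Qed.

Lemma eigenvalues_finite m (A : 'M[K]_m) : exists l : seq K,
  forall a v, v != 0 -> A *m v = a *: v :> 'cV[K]_m -> a \in l.
Proof.
have [l hl] := closed_field_poly_normal (char_poly A^T).
exists l => a v v0 Av.
have : eigenvalue A^T a.
  apply/eigenvalueP; exists v^T; last by rewrite trmx_eq0.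
  by rewrite -trmx_mul Av linearZ.
rewrite eigenvalue_root_char hl (monicP (char_poly_monic _)) scale1r.
by rewrite root_prod_XsubC.
Qed.

Section Kolchin.
Variables (n m : nat).

Definition is_rep (S : set 'M[K]_n) (phi : 'M[K]_n -> 'M[K]_m) :=
  [/\ rmx S phi, phi 1%:M = 1%:M & forall A B, S A -> S B -> phi (A *m B) = phi A *m phi B].

Lemma rep_sub S S' phi : S `<=` S' -> is_rep S' phi -> is_rep S phi.
Proof.
move=> ss [h1 h2 h3]; split=> // [i j|A B /ss SA /ss SB]; last exact: h3.
exact: reg_sub (h1 i j).
Qed.

Lemma rep_unit S phi A : mx_group S -> is_rep S phi -> S A -> phi A \in unitmx.
Proof.
move=> gS [_ h1 hM] SA; suff /mulmx1_unit [] : phi A *m phi (invmx A) = 1%:M by [].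
by rewrite -hM ?mulmxV ?h1 //; [apply: (mxg_unit gS) | apply: (mxgV gS)].
Qed.

(** Induction on the derived length, with [finval_const] in the role of connectedness because it
    passes to derived groups. On the eigenspace [W] of a character [chi] of [derived S],
    determinants show that the values of [chi] are roots of unity of bounded order, hence all 1. So
    [S] acts on [W] by commuting matrices. *)
Lemma lie_kolchin (S : set 'M[K]_n) (phi : 'M[K]_n -> 'M[K]_m) (U : {vspace 'cV[K]_m}) :
  mx_group S -> finval_const S -> solvable_mx S -> is_rep S phi -> U != 0%VS ->
  (forall A v, S A -> v \in U -> phi A *m v \in U) ->
  exists v, [/\ v \in U, v != 0 & forall A, S A -> exists a, phi A *m v = a *: v].
Proof.
move=> gS fS [k sk]; elim: k S gS fS sk U => [|k IH] S gS fS sk U rep U0 st.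
  have sS : S = [set 1%:M] by [].
  exists (vpick U); split; rewrite ?memv_pick ?vpick0 // => A.
  by rewrite sS => ->; exists 1; case: rep => _ -> _; rewrite mul1mx scale1r.
have Su := mxg_unit gS; have gD := derived_group Su; have DS := derived_sub gS.
have repD := rep_sub DS rep; have [rphi phi1 phiM] := rep.
have [||v0 [v0U v00 ev0]] := IH (derived S) gD (fc_derived gS fS) _ U repD U0.
- by rewrite -iterSr.
- by move=> A v /DS; apply: st.
have [i0 v0i] : exists i0, v0 i0 0 != 0.
  by have /cV0Pn [i0 ?] := v00; exists i0.
(* Reading the eigenvalue in a nonzero coordinate of [v0] makes it a regular function. *)
pose chi d := (phi d *m v0) i0 0 / v0 i0 0.
have chiE d : derived S d -> phi d *m v0 = chi d *: v0.
  by move=> /ev0 [a e]; rewrite /chi e mxE mulfK.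
have rchi S' : S' `<=` S -> regular_on S' chi.
  move=> ss; apply: regM; [by move=> A /ss/Su | | exact: regC].
  by apply: rmxM => [A /ss/Su //|i j|]; [exact: reg_sub ss (rphi i j) | apply: rmxC].
have chi_conj s d : S s -> derived S d -> chi (invmx s *m d *m s) = chi d.
  move=> Ss Dd.
  have DF t : S t -> derived S (invmx t *m d *m t).
    move=> St; have := derived_normal gS (mxgV gS St) Dd; by rewrite invmxK.
  have rF : rmx S (fun t => invmx t *m d *m t).
    by apply: rmxM => //; [apply: rmxM => //; [apply: rmx_inv|apply: rmxC] | apply: rmx_id].
  have rc : regular_on S (fun t => chi (invmx t *m d *m t)).
    apply: (reg_comp Su (rchi _ DS) rF DF).
    apply: (@reg_ext _ _ _ (fun _ => (\det d)^-1)); last exact: regC.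
    move=> t St; rewrite !det_mulmx det_inv mulrAC mulVf ?mul1r //.
    by rewrite -unitfE -unitmxE; apply: Su.
  (* The value of [chi] at a conjugate of [d] is an eigenvalue of [phi d], with eigenvector
     [phi t *m v0]; finitely many values are possible, so [chi] is constant on conjugates. *)
  have [l hl] := eigenvalues_finite (phi d).
  have := fS _ rc l _ s 1%:M Ss (mxg1 gS); rewrite invmx1 mulmx1 mul1mx; apply=> t St.
  have ut := rep_unit gS rep St.
  apply: (hl _ (phi t *m v0)).
    by apply: contraNneq v00 => e; rewrite -[v0](mulKmx ut) e mulmx0.
  have e : phi d *m phi t = phi t *m phi (invmx t *m d *m t).
    rewrite -!phiM //; try exact: DS; try exact: (DS _ (DF t St)).
    by rewrite mulmxA mulKVmx //; apply: Su.
  by rewrite mulmxA e -mulmxA chiE ?scalemxAr //; apply: DF.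
have [] := @pred_vspace _ (fun u => u \in U /\ forall d, derived S d -> phi d *m u = chi d *: u).
- by split=> [|d _]; rewrite ?mem0v // mulmx0 scaler0.
- move=> b u w [uU ue] [wU we]; split; first by rewrite memvD // memvZ.
  by move=> d Dd; rewrite mulmxDr -scalemxAr ue // we // scalerDr !scalerA mulrC.
move=> W hW.
have W0 : W != 0%VS.
  apply/negP=> /eqP e; have /hW : v0 \in U /\ forall d, derived S d -> phi d *m v0 = chi d *: v0 by [].
  by rewrite e memv0 (negbTE v00).
have stW A v : S A -> v \in W -> phi A *m v \in W.
  move=> SA /hW [vU ve]; apply/hW; split=> [|d Dd]; first exact: st.
  have Dd' : derived S (invmx A *m d *m A).
    by have := derived_normal gS (mxgV gS SA) Dd; rewrite invmxK.
  rewrite mulmxA -phiM //; last exact: DS.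
  have -> : d *m A = A *m (invmx A *m d *m A) by rewrite !mulmxA mulmxV ?mul1mx // Su.
  rewrite phiM //; last exact: DS.
  by rewrite -mulmxA ve // chi_conj // scalemxAr.
have r0 : (0 < \dim W)%N by rewrite lt0n dimv_eq0.
have rM A B : S A -> S B -> rmat W (phi (A *m B)) = rmat W (phi A) *m rmat W (phi B).
  move=> SA SB; apply: rmat_uniq => x.
  rewrite -rmatE; last by move=> v; apply: stW; apply: (mxgM gS).
  by rewrite phiM // -!mulmxA -!rmatE // => v; apply: stW.
have rD d : derived S d -> rmat W (phi d) = (chi d)%:M.
  move=> Dd; apply: rmat_uniq => x; rewrite -rmatE; last by move=> v; apply/stW/DS.
  have /hW [_ ->] // := wvec_mem x.
  by rewrite mul_scalar_mx wvecZ.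
have detd d : derived S d -> chi d ^+ (\dim W) = \det (rmat W (phi d)).
  by move=> /rD ->; rewrite det_scalar.
have det1S : \det (rmat W (phi 1%:M)) = 1.
  by rewrite rD; [rewrite det_scalar /chi phi1 mul1mx divff // expr1n | apply: (mxg1 gD)].
(* [chi d ^+ \dim W] is the determinant of [phi d] on [W], which is 1 on commutators. *)
have chi1 d : derived S d -> chi d ^+ (\dim W) = 1.
  move=> Dd; rewrite detd //; move: d Dd.
  have hdet A B : S A -> S B -> \det (rmat W (phi (A *m B))) =
      \det (rmat W (phi A)) * \det (rmat W (phi B)).
    by move=> SA SB; rewrite rM // det_mulmx.
  have hV A : S A -> \det (rmat W (phi A)) * \det (rmat W (phi (invmx A))) = 1.
    by move=> SA; rewrite -hdet ?mulmxV ?det1S //; [apply: Su | apply: (mxgV gS)].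
  have hc A B : S A -> S B -> \det (rmat W (phi (A *m B *m invmx A *m invmx B))) = 1.
    move=> SA SB; have SA' := mxgV gS SA; have SB' := mxgV gS SB.
    rewrite !hdet //; do ?[apply: (mxgM gS) => //].
    by rewrite -mulrA mulrACA hV // hV // mulr1.
  apply: (gen_ind (Q := fun d => \det (rmat W (phi d)) = 1)) => //; first exact: comm_unit.
  move=> x _ Dx [A [B [SA SB ->]]] hx; have Sx := DS _ Dx.
  set c := _ *m _ *m _ *m _.
  have Sc : S c by apply: DS; apply: derived_comm.
  have hcc : \det (rmat W (phi c)) = 1 by apply: hc.
  have hcv : \det (rmat W (phi (invmx c))) = 1 by rewrite -[RHS](hV c Sc) hcc mul1r.
  by split; rewrite hdet ?hx ?hcc ?hcv ?mulr1 //; apply: (mxgV gS).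
have chi1' d : derived S d -> chi d = 1.
  move=> Dd; have [l hl] := closed_field_poly_normal ('X^(\dim W) - 1%:P : {poly K}).
  have := fc_derived gS fS (rchi _ DS) (l := l) _ Dd (mxg1 gD).
  rewrite {3}/chi phi1 mul1mx divff //; apply=> A DA.
  have : root ('X^(\dim W) - 1%:P : {poly K}) (chi A).
    by rewrite rootE hornerD hornerN hornerC hornerXn chi1 // subrr.
  have monic : lead_coef ('X^(\dim W) - 1%:P : {poly K}) = 1.
    by apply/monicP; apply: monicXnsubC.
  by rewrite hl monic scale1r root_prod_XsubC.
have [] := @commuting_eigen m [set phi A | A in S] W W0.
- by move=> _ v [A SA <-]; apply: stW.
- move=> _ _ v [A SA <-] [B SB <-] vW.
  have vBA : phi B *m (phi A *m v) \in W by apply/stW => //; apply/stW.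
  have /hW [_ e] := vBA.
  have := e _ (derived_comm SA SB); rewrite chi1'; last exact: derived_comm.
  rewrite scale1r => <-; rewrite !mulmxA -!phiM //; do ?[apply: (mxgM gS) => //];
    do ?[apply: (mxgV gS) => //].
  by rewrite mulmxKV ?mulmxKV //; apply: Su.
move=> v [vW v00' h]; exists v; split=> //; first by case/hW: vW.
by move=> A SA; apply: h; exists A.
Qed.

End Kolchin.
End LieKolchin.

(** * Bound on the derived length and existence of Borel subgroups *)

Section BorelExistence.
Variable K : numClosedFieldType.

(* Every connected solvable group of matrices of size m has derived length at
   most m + 1, by induction on m along a fixed line. *)
Lemma rep_derived_trivial n m (S : set 'M[K]_n) (phi : 'M[K]_n -> 'M[K]_m) :
  mx_group S -> finval_const S -> solvable_mx S -> is_rep S phi ->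
  forall A, iter m.+1 (@derived K n) S A -> phi A = 1%:M.
Proof.
move=> gS fS sS; elim: m phi => [|m IH] phi rep A.
  by move=> _; apply/matrixP=> -[].
have [rphi phi1 phiM] := rep; have Su := mxg_unit gS.
have U0 : (fullv : {vspace 'cV[K]_m.+1}) != 0%VS.
  apply/negP=> /eqP e; have := memvf (const_mx 1 : 'cV[K]_m.+1); rewrite e memv0.
  by move=> /eqP/matrixP/(_ 0 0)/eqP; rewrite !mxE oner_eq0.
have [v [_ v0 ev]] := lie_kolchin gS fS sS rep U0 (fun A v _ _ => memvf _).
(* An invertible matrix whose first column is proportional to [v]; conjugation by it makes [phi]
   block triangular. *)
pose Q := (row_ebase v^T)^T.
have uQ : Q \in unitmx by rewrite unitmx_tr row_ebase_unit.
have [a vQ] : exists a, v = a *: col 0 Q.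
  have e := mulmx_ebase v^T.
  exists (col_ebase v^T 0 0); apply: trmx_inj; rewrite -{1}e linearZ /= tr_col trmxK.
  have -> : pid_mx (\rank v^T) = delta_mx 0 0 :> 'M[K]_(1, m.+1).
    rewrite rank_rV trmx_eq0 v0; apply/matrixP=> i j; rewrite !mxE ord1 /=.
    by rewrite andbT eq_sym; case: j => -[|j] //= h; rewrite ltnS leq0n.
  rewrite -mulmxA -rowE [col_ebase _]mx11_scalar mul_scalar_mx.
  by rewrite !mxE.
have a0 : a != 0 by apply: contraNneq v0 => a0; rewrite vQ a0 scale0r.
pose psi B : 'M[K]_(1 + m) := invmx Q *m phi B *m Q.
have psiM B C : S B -> S C -> psi (B *m C) = psi B *m psi C.
  by move=> SB SC; rewrite /psi phiM // !mulmxA mulmxK.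
have psi1 : psi 1%:M = 1%:M by rewrite /psi phi1 mulmx1 mulVmx.
have rpsi : rmx S psi.
  by apply: rmxM => //; [apply: rmxM => //; apply: rmxC | apply: rmxC].
have ll B : S B -> dlsubmx (psi B) = 0.
  move=> /ev [c hc]; have hq : phi B *m col 0 Q = c *: col 0 Q.
    by apply: (scalerI a0); rewrite scalemxAr -vQ hc vQ !scalerA mulrC.
  have : col 0 (psi B) = c *: col 0 1%:M.
    by move: hq; rewrite !colE /psi -!mulmxA => ->; rewrite -scalemxAr mulKmx // mul1mx.
  move=> e; apply/matrixP=> i j; rewrite !mxE ord1.
  have /matrixP /(_ (rshift 1 i) 0) := e; rewrite !mxE.
  rewrite (_ : lshift m 0 = 0); last exact/val_inj.
  by move=> ->; rewrite mulr0.
pose phi' B := drsubmx (psi B).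
have rep' : is_rep S phi'.
  split=> [i j||B C SB SC].
  - by apply: (reg_ext _ (rpsi (rshift 1 i) (rshift 1 j))) => B _; rewrite !mxE.
  - by rewrite /phi' psi1 (scalar_mx_block 1 m) block_mxKdr.
  - rewrite /phi' psiM // -{1}[psi B]submxK -{1}[psi C]submxK mulmx_block block_mxKdr.
    by rewrite ll // mul0mx add0r.
pose ul B := ulsubmx (psi B).
have ulM B C : S B -> S C -> ul (B *m C) = ul B *m ul C.
  move=> SB SC; rewrite /ul psiM // -{1}[psi B]submxK -{1}[psi C]submxK mulmx_block block_mxKul.
  by rewrite (ll C) // mulmx0 addr0.
have ul1 : ul 1%:M = 1%:M by rewrite /ul psi1 (scalar_mx_block 1 m) block_mxKul.
have comm11 (X Y : 'M[K]_1) : X *m Y = Y *m X.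
  by rewrite [X]mx11_scalar [Y]mx11_scalar -!scalar_mxM mulrC.
have gD := iter_derived_group m.+1 gS.
have DS : iter m.+1 (@derived K n) S `<=` S.
  by have := @iter_derived_add K n S m.+1 0 gS; rewrite addn0.
have ulD B : derived S B -> ul B = 1%:M.
  apply: (gen_ind (Q := fun B => ul B = 1%:M)) => [|//|x C Dx [s [t [Ss St ->]]] hx].
    exact: comm_unit.
  have Sx := derived_sub gS Dx.
  have us : ul s *m ul (invmx s) = 1%:M by rewrite -ulM ?mulmxV ?Su //; apply: (mxgV gS).
  have ut : ul t *m ul (invmx t) = 1%:M by rewrite -ulM ?mulmxV ?Su //; apply: (mxgV gS).
  have Ss' := mxgV gS Ss; have St' := mxgV gS St.
  set c := s *m t *m invmx s *m invmx t.
  have Sc : S c by apply: (derived_sub gS); apply: derived_comm.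
  have hc : ul c = 1%:M.
    rewrite /c !ulM //; do ?[apply: (mxgM gS) => //].
    by rewrite (comm11 (ul s)) -(mulmxA (ul t)) us mulmx1 ut.
  split; first by rewrite ulM // hx hc mulmx1.
  have : ul c *m ul (invmx c) = 1%:M by rewrite -ulM ?mulmxV ?Su //; apply: (mxgV gS).
  by rewrite hc mul1mx ulM // ?hx ?mul1mx //; apply: (mxgV gS).
have block B : iter m.+1 (@derived K n) S B ->
    psi B = block_mx 1%:M (ursubmx (psi B)) 0 1%:M.
  move=> DB; rewrite -{1}[psi B]submxK ll; last exact: DS.
  rewrite -[drsubmx _]/(phi' B) (IH phi' rep' B DB) -[ulsubmx _]/(ul B) ulD //.
  have := @iter_derived_add K n S m 1 gS; rewrite addn1; exact.
(* After [m + 1] steps both diagonal blocks are trivial. The remaining unipotent block matrices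
   commute with each other, so one more step makes them trivial. *)
have psiD B : iter m.+2 (@derived K n) S B -> psi B = 1%:M.
  have Du := mxg_unit gD.
  apply: (gen_ind (Q := fun B => psi B = 1%:M)) => [|//|x C Dx [s [t [Ds Dt ->]]] hx].
    exact: comm_unit.
  have Sx : S x by apply: DS; apply: (derived_sub gD).
  have Ss := DS _ Ds; have St := DS _ Dt.
  have Ss' := mxgV gS Ss; have St' := mxgV gS St.
  have com : psi s *m psi t = psi t *m psi s.
    rewrite (block _ Ds) (block _ Dt) !mulmx_block !mul1mx !mul0mx !mulmx0 !mulmx1 !addr0.
    by rewrite addrC.
  set c := s *m t *m invmx s *m invmx t.
  have Sc : S c by apply: (derived_sub gS); apply: derived_comm.
  have hc : psi c = 1%:M.
    rewrite /c !psiM //; do ?[apply: (mxgM gS) => //].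
    rewrite com -(mulmxA (psi t)) -psiM // mulmxV ?Su // psi1 mulmx1 -psiM // mulmxV ?Su //.
  split; first by rewrite psiM // hx hc mulmx1.
  have : psi c *m psi (invmx c) = 1%:M by rewrite -psiM ?mulmxV ?Su //; apply: (mxgV gS).
  by rewrite hc mul1mx psiM // ?hx ?mul1mx //; apply: (mxgV gS).
move=> /psiD; rewrite /psi => /(congr1 (fun X => Q *m X *m invmx Q)).
by rewrite !mulmxA mulmxV // mul1mx mulmxK // mulmx1 mulmxV.
Qed.

Lemma is_rep_id n (S : set 'M[K]_n) : is_rep S id.
Proof. by split=> //; apply: rmx_id. Qed.

Lemma solvable_bound n (S : set 'M[K]_n) : mx_group S -> finval_const S -> solvable_mx S ->
  iter n.+1 (@derived K n) S = [set 1%:M].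
Proof.
move=> gS fS sS; apply/seteqP; split=> A; first exact: (rep_derived_trivial gS fS sS (is_rep_id S)).
by move=> ->; apply: iter_derived1.
Qed.

Lemma derived_zclosure n (S : set 'M[K]_n) : mx_group S ->
  derived (zclosure S) `<=` zclosure (derived S).
Proof.
move=> gS; have Su := mxg_unit gS; have gcl := zclosure_group gS.
have clu := mxg_unit gcl.
have gD := derived_group Su; have gE := zclosure_group gD.
apply: gen_min => // _ [A [B [clA clB ->]]].
have cl F : rmx (@units K n) F -> (forall C, C \in unitmx -> F C \in unitmx) ->
    (forall C, S C -> zclosure (derived S) (F C)) ->
    forall C, zclosure S C -> zclosure (derived S) (F C).
  move=> rF uF h C clC.
  have := zclosure_min (zclosed_preim (zclosure_closed (derived S)) rF uF) _ clC.
  by case=> // D SD; split; [apply: Su | apply: h].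
have one C D : S C -> zclosure S D -> zclosure (derived S) (C *m D *m invmx C *m invmx D).
  move=> SC; have uC := Su _ SC; move: D.
  apply: (cl (fun D => C *m D *m invmx C *m invmx D)).
  - by do 3?[apply: rmxM => //]; do ?[exact: rmxC | exact: rmx_id | exact: rmx_inv].
  - by move=> D uD; do 3?[apply: mulmx_unit]; rewrite ?unitmx_inv.
  - move=> D SD; apply: sub_zclosure; last exact: derived_comm.
    exact: (mxg_unit gD).
move: A clA; apply: (cl (fun C => C *m B *m invmx C *m invmx B)).
- by do 3?[apply: rmxM => //]; do ?[exact: rmxC | exact: rmx_id | exact: rmx_inv].
- by move=> C uC; do 3?[apply: mulmx_unit]; rewrite ?unitmx_inv //; apply: clu.
- by move=> C SC; apply: one.
Qed.

Lemma iter_derived_zclosure n (S : set 'M[K]_n) k : mx_group S ->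
  iter k (@derived K n) (zclosure S) `<=` zclosure (iter k (@derived K n) S).
Proof.
move=> gS; have gcl := zclosure_group gS; elim: k => //= k IH A.
have gk := iter_derived_group k gS.
move=> /(derived_mono IH (mxg_unit (zclosure_group gk))); exact: derived_zclosure.
Qed.

Lemma zclosed1 n : zariski_closed [set (1%:M : 'M[K]_n)].
Proof.
have -> : [set (1%:M : 'M[K]_n)] = [set A | A \in unitmx /\
    forall f, (exists i j, f = fun A : 'M[K]_n => A i j - 1%:M i j) -> f A = 0].
  apply/seteqP; split=> A.
    by move=> ->; split=> [|_ [i [j ->]]]; rewrite ?unitmx1 ?subrr.
  move=> [_ h]; apply/matrixP=> i j; apply/eqP; rewrite -subr_eq0; apply/eqP.
  by apply: (h (fun A : 'M[K]_n => A i j - 1%:M i j)); exists i, j.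
apply: zclosed_reg => _ [i [j ->]]; apply: reg_pfun.
by apply: pfunB; [apply: pfun_coord | apply: pfunC].
Qed.

Lemma zclosure_solvable n (S : set 'M[K]_n) k : mx_group S ->
  iter k (@derived K n) S = [set 1%:M] -> iter k (@derived K n) (zclosure S) = [set 1%:M].
Proof.
move=> gS e; apply/seteqP; split=> A.
  by move=> /(iter_derived_zclosure gS); rewrite e zclosure_id //; apply: zclosed1.
by move=> ->; apply: iter_derived1; apply: zclosure_group.
Qed.

(** Zorn's lemma. The bound [n.+1] on derived lengths is uniform, which keeps the union of a chain
    solvable. The closure of a maximal element satisfies the same conditions, so a maximal element
    is closed. *)
Lemma borel_exists n (H S0 : set 'M[K]_n) : algebraic_group H -> mx_group S0 -> S0 `<=` H ->
  zariski_connected S0 -> solvable_mx S0 ->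
  exists2 B, borel_subgroup H B & S0 `<=` B.
Proof.
move=> [gH cH] g0 s0H c0 sol0.
have Hu := mxg_unit gH.
have bound S : mx_group S -> zariski_connected S -> solvable_mx S ->
    iter n.+1 (@derived K n) S = [set 1%:M].
  by move=> gS cS; apply: solvable_bound => //; apply: connected_fc => // A; apply: (mxg_unit gS).
pose good S := [/\ S0 `<=` S, S `<=` H, mx_group S, zariski_connected S &
                   iter n.+1 (@derived K n) S = [set 1%:M]].
have good0 : good S0 by split=> //; apply: bound.
pose P S := S = set0 \/ good S.
have [F FP tF|B [PB maxB]] := @Zorn_bigcup _ P.
  case: (pselect (exists2 S, F S & good S)) => [[S1 FS1 good1]|no]; last first.
    left; rewrite -subset0 => A [S FS SA].
    by case: (FP S FS) SA => [->|gd] //; case: no; exists S.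
  right; set Un := \bigcup_(X in F) X.
  have memU S : F S -> S `<=` Un by move=> FS A SA; exists S.
  have U1 : Un 1%:M by exists S1 => //; case: good1 => _ _ /mxg1.
  have goodm A S : F S -> S A -> good S by move=> FS SA; case: (FP S FS) SA => [->|].
  have dir A B : Un A -> Un B -> exists S, [/\ F S, good S, S A & S B].
    move=> [S FS SA] [S' FS' SB]; case: (tF S S' FS FS') => ss.
      by exists S'; split=> //; [apply: (goodm B) | apply: ss].
    by exists S; split=> //; [apply: (goodm A) | apply: ss].
  have gU : mx_group Un.
    split=> //.
    - by move=> A [S FS SA]; have [_ _ /mxg_unit h _ _] := goodm _ _ FS SA; apply: h.
    - move=> A B UA UB; have [S [FS [_ _ gS _ _] SA SB]] := dir A B UA UB.
      by exists S => //; apply: (mxgM gS).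
    - move=> A [S FS SA]; have [_ _ gS _ _] := goodm _ _ FS SA.
      by exists S => //; apply: (mxgV gS).
  split=> //.
  - by move=> A S0A; exists S1 => //; case: good1 => h _ _ _ _; apply: h.
  - by move=> A [S FS SA]; have [_ h _ _ _] := goodm _ _ FS SA; apply: h.
  (* Every good member of the chain contains 1, so by connectedness it lies in whichever of the two
     closed sets contains 1. *)
  - move=> Z1 Z2; wlog Z11 : Z1 Z2 / Z1 1%:M.
      move=> W c1 c2 cov dis; case: (cov _ U1) => h1; first exact: W.
      by rewrite setUC in cov; rewrite (setIC Z1) in dis; case: (W _ _ h1 c2 c1 cov dis); [right|left].
    move=> c1 c2 cov dis; left=> A [S FS SA]; have [_ _ gS cS _] := goodm _ _ FS SA.
    have [] := cS Z1 Z2 c1 c2; last first.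
    + move=> /(_ _ (mxg1 gS)) Z21.
      have : (Un `&` (Z1 `&` Z2)) 1%:M by [].
      by rewrite dis.
    + exact.
    + rewrite -subset0 => C [SC Z12]; have : (Un `&` (Z1 `&` Z2)) C by split=> //; exists S.
      by rewrite dis.
    + by move=> C SC; apply: cov; exists S.
  - apply/seteqP; split; last by move=> A ->; apply: iter_derived1.
    (* An element of a derived group of the union involves finitely many elements, all of them in
       one member of the chain. *)
    suff h k A : iter k (@derived K n) Un A -> exists2 S, F S /\ good S & iter k (@derived K n) S A.
      by move=> A /h [S [FS [_ _ _ _ e]]]; rewrite e.
    elim: k A => [|k IH] A; first by move=> [S FS SA]; exists S => //; split=> //; apply: goodm SA.
    have gk := iter_derived_group k gU.
    have dir2 S S' C D : F S -> good S -> F S' -> good S' ->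
        iter k.+1 (@derived K n) S C -> iter k (@derived K n) S' D ->
        exists S'', [/\ F S'', good S'', iter k.+1 (@derived K n) S'' C & iter k (@derived K n) S'' D].
      move=> FS gdS FS' gdS' SC SD.
      have [_ _ gS _ _] := gdS; have [_ _ gS' _ _] := gdS'.
      case: (tF S S' FS FS') => ss.
        by exists S'; apply: And4 FS' gdS' (iter_derived_mono gS gS' ss SC) SD.
      by exists S; apply: And4 FS gdS SC (iter_derived_mono gS' gS ss SD).
    apply: (gen_ind (Q := fun A => exists2 S, F S /\ good S & iter k.+1 (@derived K n) S A)).
    + exact/comm_unit/(mxg_unit gk).
    + by have [_ _ gS1 _ _] := good1; exists S1 => //; apply: (iter_derived1 k.+1 gS1).
    move=> x _ _ [s [t [/IH [Ss [FSs gSs] Sss] /IH [St [FSt gSt] Stt] ->]]] [Sx [FSx gSx] Sxx].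
    have [S [FS gdS Sx1 Ss1]] := dir2 _ _ _ _ FSx gSx FSs gSs Sxx Sss.
    have [S' [FS' gdS' Sx2 St2]] := dir2 _ _ _ _ FS gdS FSt gSt Sx1 Stt.
    have [_ _ gS _ _] := gdS; have [_ _ gS' _ _] := gdS'.
    have [T [FT gdT Tx Ts Tt]] : exists T, [/\ F T, good T, iter k.+1 (@derived K n) T x,
        iter k (@derived K n) T s & iter k (@derived K n) T t].
      case: (tF S S' FS FS') => ss.
        by exists S'; apply: And5 FS' gdS' Sx2 (iter_derived_mono gS gS' ss Ss1) St2.
      by exists S; apply: And5 FS gdS Sx1 Ss1 (iter_derived_mono gS' gS ss St2).
    have [_ _ gT _ _] := gdT; have gDT := iter_derived_group k.+1 gT.
    have Tc : iter k.+1 (@derived K n) T (s *m t *m invmx s *m invmx t).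
      exact: derived_comm.
    split; exists T => //; first exact: (mxgM gDT).
    exact: (mxgMV gDT).
have goodB : good B.
  case: PB => // B0; case: (maxB S0); last by right.
  rewrite B0; split=> [A|] //.
  by move=> /(_ 1%:M (mxg1 g0)).
have [S0B BH gB cB solB] := goodB.
have cl : zclosure B = B.
  apply: contrapT => ne; apply: (maxB (zclosure B)).
    split; first by apply: sub_zclosure => A; apply: (mxg_unit gB).
    move=> ss; apply: ne; apply/seteqP; split=> //.
    by apply: sub_zclosure => A; apply: (mxg_unit gB).
  right; split.
  - by apply: subset_trans S0B _; apply: sub_zclosure => A; apply: (mxg_unit gB).
  - exact: zclosure_min.
  - exact: zclosure_group.
  - by apply: zclosure_connected => // A; apply: (mxg_unit gB).
  - exact: zclosure_solvable.
exists B => //; split=> //.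
  split=> //; last by exists n.+1.
  by split=> //; rewrite -cl; apply: zclosure_closed.
move=> S SH [[gS cS] conS sS] BS; apply: contrapT => ne; apply: (maxB S).
  by split=> // ss; apply: ne; apply/seteqP.
right; split=> //; first exact: subset_trans BS.
exact: bound.
Qed.

End BorelExistence.

(** * Tori *)

Section Tori.
Variable K : numClosedFieldType.

Lemma exprz_neq0 (s : K) (m : int) : s != 0 -> s ^ m != 0.
Proof. exact: expfz_neq0. Qed.

Definition laurent (F : K -> K) := exists d, lder F d.

Lemma laurent_ext F G : (forall s, s != 0 -> F s = G s) -> laurent F -> laurent G.
Proof. by move=> e [d h]; exists d; apply: lder_ext h. Qed.

Lemma laurent_class : ring_class laurent.
Proof.
split.
- by move=> f g e [d h]; exists d; apply: lder_ext h => s _.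
- by move=> c; exists 0; apply: lderC.
- by move=> f g [a ha] [b hb]; eexists; apply: lderD ha hb.
- by move=> f g [a ha] [b hb]; eexists; apply: lderM ha hb.
Qed.

Lemma lder_exprz (m : int) : lder (fun s : K => s ^ m) (m%:~R : K).
Proof.
case: m => k.
  have := lder_poly ('X^k : {poly K}); rewrite derivXn hornerMn hornerXn expr1n.
  by apply: lder_ext => s _; rewrite hornerXn.
by rewrite NegzE mulrNz; apply: lder_ext (lder_Xn_inv K k.+1) => s _; rewrite -invr_expz.
Qed.

Lemma laurent_inv F : laurent F -> laurent (fun s => F s^-1).
Proof.
move=> [_ [P [k [h _]]]].
apply: (@laurent_ext (fun s => s ^+ k * \sum_(i < size P) P`_i * s ^ (- i%:Z))).
  by move=> s nz; rewrite h ?invr_eq0 // -exprVn invrK mulrC horner_coef; congr (_ * _);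
    apply: eq_bigr => i _; rewrite -invr_expz exprVn.
apply: (rcM laurent_class).
  by have h1 := lder_exprz (Posz k); exists (Posz k)%:~R.
apply: (rc_sum laurent_class) => i; apply: (rcM laurent_class).
  exact: (rcC laurent_class).
by eexists; apply: lder_exprz.
Qed.

(** The numerator has no root but 0, so [phi] is a multiple of a power of [s]; [phi 1 = 1] fixes the
    factor. *)
Lemma mult_monomial (phi : K -> K) : laurent phi ->
  (forall s t, s != 0 -> t != 0 -> phi (s * t) = phi s * phi t) ->
  (forall s, s != 0 -> phi s != 0) -> exists m : int, forall s, s != 0 -> phi s = s ^ m.
Proof.
move=> [_ [P [k [h _]]]] phiM phi0.
have [l hl] := closed_field_poly_normal P.
have P0 s : s != 0 -> P.[s] != 0.
  by move=> nz; have := phi0 s nz; rewrite h // mulf_eq0 => /norP [].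
have l0 r : r \in l -> r = 0.
  move=> rl; apply/eqP; apply: contrapT => /negP r0; have := P0 r r0; rewrite hl hornerZ mulf_eq0.
  case/norP => _; rewrite -rootE root_prod_XsubC; by rewrite rl.
have eP : P = lead_coef P *: 'X^(size l).
  rewrite {1}hl; congr (_ *: _); rewrite big_seq (eq_bigr (fun _ => 'X)); last first.
    by move=> r /l0 ->; rewrite subr0.
  by rewrite -big_seq big_const_seq count_predT iter_mulr_1.
have p1 : phi 1 = 1.
  have n1 := phi0 1 (oner_neq0 _); apply: (mulfI n1).
  by rewrite -phiM ?oner_neq0 // !mulr1.
have lc : lead_coef P = 1.
  by have := h 1 (oner_neq0 _); rewrite p1 {1}eP hornerZ hornerXn !expr1n mulr1 divr1 => <-.
exists ((size l)%:Z - k%:Z) => s nz; rewrite h // eP lc scale1r hornerXn.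
by rewrite expfzDr // -invr_expz.
Qed.

Section OneParam.
Variables (n l : nat) (T : set 'M[K]_n) (omega : 'I_l -> 'M[K]_n -> K).
Hypothesis tT : torus T.
Hypothesis chw : forall i, is_character T (omega i).
Hypothesis scT : simply_connected T omega.

Lemma torus_abelian s t : T s -> T t -> s *m t = t *m s.
Proof.
move=> Ts Tt; case: tT => [[gT _] [r [f [g [[f1 f2 f3] [g1 g2 g3] gf fg]]]]].
rewrite -(gf (s *m t)); last exact: (mxgM gT).
rewrite -(gf (t *m s)); last exact: (mxgM gT).
  rewrite !f2 //; congr g.
have [_ /is_diag_mxP ds] := f1 _ Ts; have [_ /is_diag_mxP dt] := f1 _ Tt.
have sdiag (A : 'M[K]_r) : (forall i j : 'I_r, (i : nat) != j -> A i j = 0) -> A = diag_mx (\row_i A i i).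
  move=> hA; apply/matrixP=> i j; rewrite !mxE; case: (eqVneq i j) => [->|ij]; rewrite ?mulr1n //.
  by rewrite mulr0n hA // (inj_eq val_inj).
by rewrite (sdiag _ ds) (sdiag _ dt) diag_mxC.
Qed.

Lemma one_param_subgroups : exists tau : 'I_l -> K -> 'M[K]_n,
  [/\ forall j s, s != 0 -> T (tau j s),
      forall j, exists X, lmx (tau j) X,
      forall j s t, s != 0 -> t != 0 -> tau j (s * t) = tau j s *m tau j t,
      forall i j s, s != 0 -> omega i (tau j s) = s ^+ (i == j) &
      forall t, T t -> t = \big[mulmx/1%:M]_(j < l) tau j (omega j t)].
Proof.
case: tT => [[gT _] [r [f [g [[f1 f2 f3] [g1 g2 g3] gf fg]]]]].
have Tu := mxg_unit gT.
pose D (c : 'I_r -> int) (s : K) : 'M[K]_r := diag_mx (\row_a s ^ c a).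
have DM c c' s s' : D c s *m D c' s' = diag_mx (\row_a (s ^ c a * s' ^ c' a)).
  by rewrite /D mulmx_diag; congr diag_mx; apply/rowP=> a; rewrite !mxE.
have Du c s : s != 0 -> diagonal_group (D c s).
  move=> nz; split; last exact: diag_mx_is_diag.
  rewrite unitmxE det_diag unitfE; apply/prodf_neq0 => a _; rewrite mxE.
  exact: exprz_neq0.
have g0 : g 1%:M = 1%:M.
  have d1 : diagonal_group (1%:M : 'M[K]_r).
    by split; [apply: unitmx1 | apply: scalar_mx_is_diag].
  have ug : g 1%:M \in unitmx by apply: Tu; apply: g1.
  by rewrite -[LHS](mulKmx ug) -g2 // mulmx1 mulVmx.
pose gam c s := g (D c s).
have gamT c s : s != 0 -> T (gam c s) by move=> nz; apply: g1; apply: Du.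
have gamL c : rcmx laurent (gam c).
  move=> i j; have [p [k hp]] := g3 i j.
  have LC := laurent_class.
  have DL : rcmx laurent (D c).
    move=> a b; apply: (@rc_ext _ _ _ LC (fun s => (a == b)%:R * s ^ c a)).
      by move=> s; rewrite !mxE; case: (a == b); rewrite ?mulr1n ?mul1r ?mulr0n ?mul0r.
    by apply: (rcM LC); [apply: (rcC LC) | eexists; apply: lder_exprz].
  apply: (@laurent_ext (fun s => mxeval (D c s) p * (\prod_a s ^ (- c a)) ^+ k)).
    move=> s nz; rewrite /gam hp; last exact: Du.
    congr (_ * _); rewrite det_diag -exprVn -prodfV; congr (_ ^+ _).
    by apply: eq_bigr => a _; rewrite mxE -invr_expz.
  apply: (rcM LC); first exact: (rc_mxeval LC).
  by apply: (rcX LC); apply: (rc_prod LC) => a; eexists; apply: lder_exprz.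
have gamM c s t : s != 0 -> t != 0 -> gam c (s * t) = gam c s *m gam c t.
  move=> nz nt; rewrite -g2; [|exact: Du|exact: Du]; congr g; rewrite DM.
  by congr diag_mx; apply/rowP=> a; rewrite !mxE expfzMl.
have chi1 chi : is_character T chi -> chi 1%:M = 1.
  move=> [cM c0 _]; apply: (mulfI (c0 _ (mxg1 gT))).
  by rewrite -cM ?mulmx1 ?mulr1 //; apply: (mxg1 gT).
have chi_gam chi c : is_character T chi -> exists m : int, forall s, s != 0 -> chi (gam c s) = s ^ m.
  move=> hchi; have [cM c0 [p [k hp]]] := hchi.
  apply: mult_monomial.
  - apply: (@laurent_ext (fun s => mxeval (gam c s) p * (\det (gam c s^-1)) ^+ k)).
      move=> s nz; rewrite hp; last exact: gamT.
      congr (_ * _); rewrite -exprVn; congr (_ ^+ _).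
      have ns : s^-1 != 0 by rewrite invr_eq0.
      apply: (mulfI (_ : \det (gam c s) != 0)); first by rewrite -unitfE -unitmxE Tu //; apply: gamT.
      rewrite divff; last by rewrite -unitfE -unitmxE; apply: Tu; apply: gamT.
      rewrite -det_mulmx -gamM // divff // /gam (_ : D c 1 = 1%:M) ?g0 ?det1 //.
      by apply/matrixP=> a b; rewrite !mxE exp1rz.
    apply: (rcM laurent_class); first exact: (rc_mxeval laurent_class).
    apply: (rcX laurent_class).
    apply: (@laurent_inv (fun s => \det (gam c s))); exact: (rc_det laurent_class).
  - by move=> s t nz nt; rewrite gamM // cM //; apply: gamT.
  - by move=> s nz; apply: c0; apply: gamT.
pose e (a : 'I_r) (b : 'I_r) : int := (a == b)%:Z.
have [b hb] : exists b : 'I_l -> 'I_r -> int, forall i a s, s != 0 ->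
    omega i (gam (e a) s) = s ^ b i a.
  have h i a := cid (chi_gam _ (e a) (chw i)).
  by exists (fun i a => projT1 (h i a)) => i a s nz; rewrite (projT2 (h i a)).
have chf a : is_character T (fun t => f t a a).
  split=> [s t Ts Tt|t Tt|]; last exact: f3.
    have [_ /is_diag_mxP dt] := f1 _ Tt.
    rewrite f2 // mxE (bigD1 a) //= big1 ?addr0 // => j ja.
    by rewrite dt ?mulr0 // (inj_eq val_inj).
  have [ut dt] := f1 _ Tt; move: ut; rewrite unitmxE unitfE.
  rewrite (_ : f t = diag_mx (\row_i f t i i)).
    by rewrite det_diag => /prodf_neq0 /(_ a isT); rewrite !mxE eqxx mulr1n.
  apply/matrixP=> i j; rewrite !mxE; case: (eqVneq i j) => [->|ij]; rewrite ?mulr1n //.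
  by rewrite mulr0n; move/is_diag_mxP: dt => ->.
have [c hc] : exists c : 'I_r -> 'rV[int]_l, forall a t, T t ->
    f t a a = char_comb omega (c a) t.
  have h a := cid (scT (chf a)).
  by exists (fun a => projT1 (h a)) => a; case: (projT2 (h a)).
pose tau j := gam (fun a => c a 0 j).
have om0 i t : T t -> omega i t != 0 by case: (chw i) => _ + _; apply.
have om_prod i (F : 'I_r -> 'M[K]_n) (r0 : seq 'I_r) : (forall a, T (F a)) ->
    T (\big[mulmx/1%:M]_(a <- r0) F a) /\
    omega i (\big[mulmx/1%:M]_(a <- r0) F a) = \prod_(a <- r0) omega i (F a).
  move=> hF; elim: r0 => [|a r0 [IH1 IH2]].
    by rewrite !big_nil; split; [apply: (mxg1 gT) | apply: chi1].
  rewrite !big_cons; split; first exact: (mxgM gT).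
  by case: (chw i) => cM _ _; rewrite cM ?IH2.
have decomp (d : 'I_r -> K) : (forall a, d a != 0) ->
    g (diag_mx (\row_a d a)) = \big[mulmx/1%:M]_a gam (e a) (d a).
  move=> d0.
  suff h (r0 : seq 'I_r) : uniq r0 -> g (diag_mx (\row_a (if a \in r0 then d a else 1))) =
      \big[mulmx/1%:M]_(a <- r0) gam (e a) (d a).
    rewrite -h ?index_enum_uniq //; congr (g (diag_mx _)); apply/rowP=> a.
    by rewrite !mxE mem_index_enum.
  elim: r0 => [_|a r0 IH /= /andP [ar u]].
    rewrite big_nil -[RHS]g0; congr g; apply/matrixP=> i j; rewrite !mxE.
    by rewrite in_nil.
  rewrite big_cons -IH // /gam -g2; first congr g.
  - apply/matrixP=> i j; rewrite mulmx_diag !mxE; congr (_ *+ _); rewrite inE /e eq_sym.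
    case: (eqVneq a i) => [<-|ai] /=; first by rewrite (negbTE ar) mulr1 expr1z.
    by rewrite expr0z mul1r.
  - exact: Du.
  split; last exact: diag_mx_is_diag.
  rewrite unitmxE det_diag unitfE; apply/prodf_neq0 => i _; rewrite mxE.
  by case: ifP => _; rewrite ?d0 ?oner_neq0.
have fdiag t : T t -> f t = diag_mx (\row_a f t a a).
  move=> /f1 [_ /is_diag_mxP dt]; apply/matrixP=> i j; rewrite !mxE.
  by case: (eqVneq i j) => [->|ij]; rewrite ?mulr1n // mulr0n dt.
pose bc i j : int := \sum_a b i a * c a 0 j.
have hbc i t : T t -> omega i t = char_comb omega (\row_j bc i j) t.
  move=> Tt; rewrite -{1}(gf t Tt) (fdiag _ Tt) decomp; last by move=> a; case: (chf a) => _ + _; apply.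
  have := (om_prod i (fun a => gam (e a) (f t a a)) (index_enum _)).
  case=> [a|_ ->]; first by apply: gamT; case: (chf a) => _ + _; apply.
  rewrite /char_comb.
  transitivity (\prod_a \prod_j omega j t ^ (b i a * c a 0 j)).
    apply: eq_bigr => a _; rewrite hb; last by case: (chf a) => _ + _; apply.
    rewrite hc // /char_comb; elim/big_rec2: _ => [|j y1 y2 _ <-]; first by rewrite exp1rz.
    by rewrite expfzMl exprz_exp (mulrC (c a 0 j)).
  rewrite exchange_big; apply: eq_bigr => j _; rewrite mxE /bc.
  have nz := om0 j t Tt; elim/big_rec2: _ => [|a y1 y2 _ ->]; first by rewrite expr0z.
  by rewrite expfzDr.
have bcE i j : bc i j = (i == j)%:Z.
  have [x [_ ux]] := scT (chw i).
  have e1 := ux _ (fun t Tt => hbc i t Tt).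
  have e2 : x = delta_mx 0 i.
    apply: ux => t Tt; rewrite /char_comb (bigD1 i) //= !mxE !eqxx expr1z big1 ?mulr1 //.
    by move=> k ki; rewrite mxE eqxx (negbTE ki) expr0z.
  have e3 : \row_j bc i j = delta_mx 0 i by rewrite -e1.
  by have := congr1 (fun v : 'rV[int]_l => v 0 j) e3; rewrite !mxE eqxx /= (eq_sym j) natz.
have omtau i j s : s != 0 -> omega i (tau j s) = s ^+ (i == j).
  move=> nz; rewrite /tau /gam /D decomp; last by move=> a; apply: exprz_neq0.
  have := (om_prod i (fun a => gam (e a) (s ^ c a 0 j)) (index_enum _)).
  case=> [a|_ ->]; first by apply: gamT; apply: exprz_neq0.
  rewrite (eq_bigr (fun a => s ^ (b i a * c a 0 j))); last first.
    by move=> a _; rewrite hb ?exprz_neq0 // exprz_exp mulrC.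
  rewrite -[RHS]/(s ^ ((i == j)%:Z)) -bcE /bc.
  by elim/big_rec2: _ => [|a y1 y2 _ ->]; rewrite ?expr0z // expfzDr.
exists tau; split.
- by move=> j s nz; apply: gamT.
- move=> j; have h a b0 := cid (gamL (fun a => c a 0 j) a b0).
  by exists (\matrix_(a, b0) projT1 (h a b0)) => a b0; rewrite mxE; apply: (projT2 (h a b0)).
- by move=> j s t; apply: gamM.
- exact: omtau.
move=> t Tt; rewrite -{1}(gf t Tt).
have fprod (r0 : seq 'I_l) : T (\big[mulmx/1%:M]_(j <- r0) tau j (omega j t)) /\
    f (\big[mulmx/1%:M]_(j <- r0) tau j (omega j t)) =
    diag_mx (\row_a \prod_(j <- r0) omega j t ^ c a 0 j).
  elim: r0 => [|j r0 [IH1 IH2]].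
    rewrite big_nil; split; first exact: (mxg1 gT).
    rewrite -g0 fg; last by split; [apply: unitmx1 | apply: scalar_mx_is_diag].
    by apply/matrixP=> i j; rewrite !mxE big_nil.
  have nz := om0 j t Tt.
  rewrite big_cons; split; first by apply: (mxgM gT) => //; apply: gamT.
  rewrite f2 //; last exact: gamT.
  rewrite IH2 fg; last exact: Du.
  by rewrite mulmx_diag; congr diag_mx; apply/rowP=> a; rewrite !mxE big_cons.
have [Tp fp] := fprod (index_enum _).
rewrite -(gf _ Tp) fp (fdiag _ Tt); congr (g (diag_mx _)); apply/rowP=> a.
by rewrite !mxE hc.
Qed.

End OneParam.
End Tori.

(** * A model of the Lie algebra of type E_7 *)

(* The simply laced model of E_7: a basis vector of index i < 7 is a coroot h_i,
   of index 7 + a the root vector of the a-th positive root, of index 70 + a that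
   of its opposite.  The adjoint action of e_k and f_k maps basis vectors to
   multiples of basis vectors, with the signs (-1)^(k,b)' of a bilinear form
   (-,-)' such that (b,b)' = (b,b)/2 mod 2. *)
Section Model.
Local Open Scope nat_scope.

Definition cz (i j : nat) : Z :=
  if i == j then Z.two else
  if ((i.+1, j.+1) \in E7_edges) || ((j.+1, i.+1) \in E7_edges) then (Z.opp Z.one) else Z0.

Definition rt_pair (b : seq nat) (k : nat) : Z :=
  foldr (fun j s => Z.add (Z.mul (Z.of_nat (nth 0%N b j)) (cz j k)) s) Z0 (iota 0 7).

Definition rt_add (k : nat) (b : seq nat) := set_nth 0%N b k (nth 0%N b k).+1.
Definition rt_sub (k : nat) (b : seq nat) := set_nth 0%N b k (nth 0%N b k).-1.
Definition rt_simple (k : nat) : seq nat := rt_add k (nseq 7 0%N).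

Definition rt_next (L : seq (seq nat)) : seq (seq nat) :=
  undup (flatten [seq [seq rt_add k b | k <- iota 0 7 & Z.eqb (rt_pair b k) (Z.opp Z.one)] | b <- L]).

(** In simply laced type, [b + alpha_k] is a root whenever the root [b] takes the value -1 on the
    coroot of [alpha_k]. The list is ordered by height, up to the height 17 of the highest root;
    positions 0 to 6 hold the simple roots in order. *)
Definition pos_roots : seq (seq nat) :=
  Eval vm_compute in
    flatten [seq iter m rt_next [seq rt_simple k | k <- iota 0 7] | m <- iota 0 17].

Definition rt (a : nat) : seq nat := nth [::] pos_roots a.
Definition rt_ht (a : nat) : nat := sumn (rt a).

Definition rt_sg (k a : nat) : Z :=
  if odd (foldr (fun j s => nth 0%N (rt a) j *
      ((k == j) || ((k < j) && ~~ Z.eqb (cz k j) Z0))%N + s)%N 0%N (iota 0 7))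
  then (Z.opp Z.one) else Z.one.

Definition opEp (k a : nat) : nat * Z :=
  if Z.eqb (rt_pair (rt a) k) (Z.opp Z.one)
  then (7 + index (rt_add k (rt a)) pos_roots, rt_sg k a)%N else (0%N, Z0).

Definition opFp (k a : nat) : nat * Z :=
  if a == k then (k, (Z.opp Z.one)) else
  if Z.eqb (rt_pair (rt a) k) Z.one
  then (7 + index (rt_sub k (rt a)) pos_roots, Z.opp (rt_sg k a))%N else (0%N, Z0).

(** The Chevalley involution: it negates coroots and sends positive root vectors to the opposite
    ones, so the action on negative root vectors is read off from that on positive ones. *)
Definition op_swap (p : nat * Z) : nat * Z :=
  if (p.1 < 7)%N then (p.1, Z.opp p.2) else (p.1 + 63, p.2)%N.

Definition tabEp := Eval vm_compute in [seq [seq opEp k a | a <- iota 0 63] | k <- iota 0 7].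
Definition tabFp := Eval vm_compute in [seq [seq opFp k a | a <- iota 0 63] | k <- iota 0 7].
Definition tabP := Eval vm_compute in
  [seq [seq (if (a < 63)%N then rt_pair (rt a) k else Z0) | a <- iota 0 63] | k <- iota 0 7].

Definition tEp k a := nth (0%N, Z0) (nth [::] tabEp k) a.
Definition tFp k a := nth (0%N, Z0) (nth [::] tabFp k) a.
Definition tP k a : Z := nth Z0 (nth [::] tabP k) a.

Definition opE (k i : nat) : nat * Z :=
  if (i < 7)%N then (7 + k, Z.opp (cz i k))%N else
  if (i < 70)%N then tEp k (i - 7) else op_swap (tFp k (i - 70)).

Definition opF (k i : nat) : nat * Z :=
  if (i < 7)%N then (70 + k, cz i k)%N else
  if (i < 70)%N then tFp k (i - 7) else op_swap (tEp k (i - 70)).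

Definition opH (k i : nat) : Z :=
  if (i < 7)%N then Z0 else
  if (i < 70)%N then tP k (i - 7) else Z.opp (tP k (i - 70)).

(* Formal integral combinations of basis vectors. *)
Definition lc := seq (nat * Z).

Definition lc_scale (c : Z) (L : lc) : lc := [seq (p.1, Z.mul c p.2) | p <- L].
Definition lc_map (op : nat -> nat * Z) (L : lc) : lc :=
  [seq ((op p.1).1, Z.mul p.2 (op p.1).2) | p <- L].

Fixpoint lc_ins (p : nat * Z) (L : lc) : lc :=
  if L is q :: L' then
    if q.1 == p.1 then (q.1, Z.add q.2 p.2) :: L' else q :: lc_ins p L'
  else [:: p].

Definition lc_null (L : lc) : bool := all (fun p => Z.eqb p.2 Z0) (foldr lc_ins [::] L).

Definition delta (k l : nat) : Z := if k == l then Z.one else Z0.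

(* [E_k, F_l] = delta_kl H_k *)
Definition lc_comm k l i : lc :=
  lc_map (opE k) (lc_map (opF l) [:: (i, Z.one)]) ++
  lc_scale (Z.opp Z.one) (lc_map (opF l) (lc_map (opE k) [:: (i, Z.one)])) ++
  [:: (i, Z.opp (Z.mul (delta k l) (opH k i)))].

(** A pair [(k, b)] such that root [a] is root [b] plus [alpha_k]. The resulting tree normalises all
    positive root vectors from the simple ones; a simple root gets the default [(0, 0)]. *)
Definition parent (a : nat) : nat * nat :=
  head (0, 0)%N [seq (k, (tFp k a).1 - 7)%N | k <- iota 0 7 & (7 <= (tFp k a).1)%N].

Definition tab_parent := Eval vm_compute in [seq parent a | a <- iota 0 63].
Definition par a := nth (0, 0)%N tab_parent a.

Lemma model_parent :
  all (fun a => [&& (par a).2 < a, (par a).1 < 7, rt_ht a == (rt_ht (par a).2).+1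
    & (tEp (par a).1 (par a).2 == (7 + a, rt_sg (par a).1 (par a).2))%N]) (iota 7 56).
Proof. by vm_compute. Qed.

Lemma model_comm :
  all (fun k => all (fun l => all (fun i => lc_null (lc_comm k l i)) (iota 0 133)) (iota 0 7))
    (iota 0 7).
Proof. by vm_compute. Qed.

Lemma model_up :
  all (fun k => all (fun a => (Z.eqb (tEp k a).2 Z0) ||
      [&& (7 <= (tEp k a).1 < 70)%N, rt_ht ((tEp k a).1 - 7) == (rt_ht a).+1 &
       all (fun l => Z.eqb (tP l ((tEp k a).1 - 7)) (Z.add (tP l a) (cz l k))) (iota 0 7)])
    (iota 0 63)) (iota 0 7).
Proof. by vm_compute. Qed.

(** Some coroot is positive on [a + alpha_k], whether or not this is a root; this is the positive
    weight that [lowest_weight_zero] asks for. *)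
Lemma model_pos :
  all (fun k => all (fun a => has (fun l => Z.ltb Z0 (Z.add (tP l a) (cz l k))) (iota 0 7))
    (iota 0 63)) (iota 0 7).
Proof. by vm_compute. Qed.

Lemma model_down :
  all (fun k => all (fun a => ((tFp k a).1 < 7)%N ||
      [&& ((tFp k a).1 < 70)%N & (rt_ht ((tFp k a).1 - 7)).+1 == rt_ht a])
    (iota 0 63)) (iota 0 7).
Proof. by vm_compute. Qed.

Lemma allP2 (P : nat -> bool) m N : all P (iota m N) -> forall i, (m <= i < m + N)%N -> P i.
Proof. by move=> /allP h i im; apply: h; rewrite mem_iota. Qed.

End Model.

Arguments Z.add : simpl never.
Arguments Z.mul : simpl never.
Arguments Z.opp : simpl never.

(** * Eigenvectors, and vectors of lowest weight for sl_2 *)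

Section Sl2.
Variable K : numClosedFieldType.

(** Applying [A - lam i] removes the [i]-th summand and rescales the others by nonzero factors. The
    subspace [Z] is a predicate, since it will be given by quantified conditions. *)
Lemma eigen_mem (V : lmodType K) (I : eqType) (A : V -> V) (Z : V -> Prop)
    (r : seq I) (lam : I -> K) (v : I -> V) :
  (forall a u w, A (a *: u + w) = a *: A u + A w) ->
  (forall a u w, Z u -> Z w -> Z (a *: u + w)) -> (forall u, Z u -> Z (A u)) ->
  Z 0 -> uniq r -> {in r &, injective lam} -> (forall i, i \in r -> A (v i) = lam i *: v i) ->
  Z (\sum_(i <- r) v i) -> forall i, i \in r -> Z (v i).
Proof.
move=> Al Zl ZA Z0.
have ZZ a u : Z u -> Z (a *: u) by move=> Zu; rewrite -[_ *: _]addr0; apply: Zl.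
have A0 : A 0 = 0.
  by have := Al 1 0 0; rewrite !scale1r !addr0 => /eqP; rewrite eq_sym -subr_eq0 addrK => /eqP.
elim: r v => [|i r IH] v //= /andP [ir ur] inj Av ZS.
have hr j : j \in r -> Z (v j).
  move=> jr.
  have Zj : Z ((lam j - lam i) *: v j).
    have := IH (fun j => (lam j - lam i) *: v j) ur _ _ _ j jr; apply.
    - by move=> a b ar br; apply: inj; rewrite inE ?ar ?br orbT.
    - move=> a ar; have := Al (lam a - lam i) (v a) 0; rewrite !addr0 A0 addr0 => ->.
      by rewrite Av ?inE ?ar ?orbT // !scalerA mulrC.
    have -> : \sum_(j <- r) (lam j - lam i) *: v j =
        (- lam i) *: (\sum_(j <- i :: r) v j) + A (\sum_(j <- i :: r) v j).
      have -> : A (\sum_(j <- i :: r) v j) = \sum_(j <- i :: r) lam j *: v j.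
        have : {subset i :: r <= i :: r} by [].
        elim: {1 3 4}(i :: r) => [|k s IHs] sub; first by rewrite !big_nil.
        rewrite !big_cons -IHs; last by move=> a as_; apply: sub; rewrite inE as_ orbT.
        by have := Al 1 (v k) (\sum_(j <- s) v j); rewrite !scale1r => ->; rewrite Av // sub ?inE ?eqxx.
      rewrite !big_cons scalerDr scaleNr addrACA addNr add0r scaler_sumr -big_split /=.
      by apply: eq_bigr => k _; rewrite scalerBl scaleNr addrC.
    exact: (Zl _ _ _ ZS (ZA _ ZS)).
  have nz : lam j - lam i != 0.
    rewrite subr_eq0; apply/negP => /eqP e; move: ir; rewrite -(inj j i) ?jr // inE ?eqxx ?jr ?orbT //.
  by have := ZZ (lam j - lam i)^-1 _ Zj; rewrite scalerA mulVf // scale1r.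
move=> j; rewrite inE => /orP [/eqP ->|]; last exact: hr.
have -> : v i = - (\sum_(j <- r) v j) + \sum_(j <- i :: r) v j.
  by rewrite big_cons addrC addrK.
rewrite -scaleN1r; apply: (Zl (-1) _ _ _ ZS).
have : {subset r <= r} by [].
elim: {1 3}r => [|k s IHs] sub; first by rewrite big_nil.
rewrite big_cons -[v k]scale1r; apply: (Zl 1 (v k)); first by apply/hr/sub; rewrite inE eqxx.
by apply: IHs => a as_; apply: sub; rewrite inE as_ orbT.
Qed.

Lemma infinite_eigen (V : vectType K) (A : V -> V) (lam : nat -> K) (v : nat -> V) :
  (forall a u w, A (a *: u + w) = a *: A u + A w) ->
  (forall k, v k != 0) -> (forall k, A (v k) = lam k *: v k) -> injective lam -> False.
Proof.
move=> Al v0 Av inj.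
have A0 : A 0 = 0.
  by have := Al 1 0 0; rewrite !scale1r !addr0 => /eqP; rewrite eq_sym -subr_eq0 addrK => /eqP.
have AZ a u : A (a *: u) = a *: A u by have := Al a u 0; rewrite !addr0 A0 addr0.
pose N := (\dim {:V}).+1; pose X := [tuple v i | i < N].
have fr : free X.
  apply/freeP => c hc i; pose w j := c (inord j) *: v j.
  have hs : \sum_(j <- iota 0 N) w j = 0.
    rewrite -{1}[N]subn0 -/(index_iota 0 N) big_mkord -[RHS]hc; apply: eq_bigr => j _.
    by rewrite /w inord_val -tnth_nth tnth_mktuple.
  have := @eigen_mem V nat A (fun u => u = 0) (iota 0 N) lam w Al _ _ (erefl _)
    (iota_uniq _ _) (fun a b _ _ => inj a b) _ hs i.
  rewrite /w inord_val => /(_ _ _ _ _)/eqP; rewrite scaler_eq0 (negbTE (v0 _)) orbF => h.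
  apply/eqP/h.
  - by move=> a u u' -> ->; rewrite scaler0 addr0.
  - by move=> u ->.
  - by move=> j _; rewrite AZ Av !scalerA mulrC.
  - by rewrite mem_iota /=.
move: fr; rewrite /free size_tuple => /eqP e.
by have := dimvS (subvf <<X>>%VS); rewrite e ltnn.
Qed.

(** Otherwise all vectors [E^k y] are nonzero, by the formula for [F E^(k+1) y], and they have
    infinitely many distinct weights. *)
Lemma lowest_weight_zero (V : vectType K) (E F H : V -> V) (y : V) (m : nat) :
  (forall a u w, E (a *: u + w) = a *: E u + E w) ->
  (forall a u w, F (a *: u + w) = a *: F u + F w) ->
  (forall a u w, H (a *: u + w) = a *: H u + H w) ->
  (forall x, E (F x) - F (E x) = H x) -> (forall x, H (E x) = E (H x) + 2%:R *: E x) ->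
  F y = 0 -> H y = m.+1%:R *: y -> y = 0.
Proof.
move=> El Fl Hl EF HE Fy Hy; apply: contrapT => /eqP y0.
have lin0 (A : V -> V) : (forall a u w, A (a *: u + w) = a *: A u + A w) ->
    A 0 = 0 /\ forall a u, A (a *: u) = a *: A u.
  move=> Al; have A0 : A 0 = 0.
    by have := Al 1 0 0; rewrite !scale1r !addr0 => /eqP; rewrite eq_sym -subr_eq0 addrK => /eqP.
  by split=> // a u; have := Al a u 0; rewrite !addr0 A0 addr0.
have [E0 EZ] := lin0 E El; have [F0 FZ] := lin0 F Fl; have [H0 HZ] := lin0 H Hl.
pose v k := iter k E y.
have Hv k : H (v k) = (m.+1 + 2 * k)%:R *: v k.
  elim: k => [|k IH]; first by rewrite muln0 addn0.
  rewrite /v iterS HE -/(v k) IH EZ -scalerDl -natrD; congr (_%:R *: _); lia.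
pose c k := (\sum_(j < k.+1) (m.+1 + 2 * j))%N.
have Fv k : F (v k.+1) = - ((c k)%:R *: v k).
  elim: k => [|k IH].
    have := EF y; rewrite Fy E0 sub0r Hy => /eqP; rewrite eqr_oppLR => /eqP ->.
    by rewrite /c big_ord1 muln0 addn0.
  have := EF (v k.+1); rewrite IH -scaleNr EZ Hv -/(v k.+1) -[E (v k)]/(v k.+1).
  move=> /eqP; rewrite subr_eq => /eqP e.
  rewrite -[v k.+2]/(E (v k.+1)).
  have -> : F (E (v k.+1)) = - (c k)%:R *: v k.+1 - (m.+1 + 2 * k.+1)%:R *: v k.+1.
    by rewrite e addrAC subrr add0r.
  have -> : c k.+1 = (c k + (m.+1 + 2 * k.+1))%N by rewrite /c big_ord_recr.
  by rewrite [in RHS]natrD scalerDl scaleNr opprD.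
have v0 k : v k != 0.
  elim: k => // k IH; apply/negP=> /eqP e; have := Fv k; rewrite e F0 => /eqP.
  rewrite eq_sym oppr_eq0 scaler_eq0 (negbTE IH) orbF pnatr_eq0.
  by rewrite /c big_ord_recl addn_eq0.
apply: (@infinite_eigen V H (fun k => (m.+1 + 2 * k)%:R) v) => // a b /eqP.
by rewrite eqr_nat => /eqP; lia.
Qed.

End Sl2.

Section LieBracket.
Variables (K : numClosedFieldType) (n : nat).
Implicit Types A B C : 'M[K]_n.

Lemma brDr a A B C : lie_bracket A (a *: B + C) = a *: lie_bracket A B + lie_bracket A C.
Proof.
rewrite /lie_bracket mulmxDr mulmxDl -scalemxAr -scalemxAl opprD scalerBr.
by rewrite addrACA.
Qed.

Lemma br_anti A B : lie_bracket A B = - lie_bracket B A.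
Proof. by rewrite /lie_bracket opprB. Qed.

Lemma br0r A : lie_bracket A 0 = 0.
Proof. by rewrite /lie_bracket mulmx0 mul0mx subrr. Qed.

Lemma br0l A : lie_bracket 0 A = 0.
Proof. by rewrite br_anti br0r oppr0. Qed.

Lemma brZr a A B : lie_bracket A (a *: B) = a *: lie_bracket A B.
Proof. by have := brDr a A B 0; rewrite br0r !addr0. Qed.

Lemma brZl a A B : lie_bracket (a *: A) B = a *: lie_bracket A B.
Proof. by rewrite br_anti brZr br_anti scalerN opprK. Qed.

Lemma brD A B C : lie_bracket A (B + C) = lie_bracket A B + lie_bracket A C.
Proof. by have := brDr 1 A B C; rewrite !scale1r. Qed.

Lemma brN A B : lie_bracket A (- B) = - lie_bracket A B.
Proof. by rewrite -scaleN1r brZr scaleN1r. Qed.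

Lemma brDl A B C : lie_bracket (A + B) C = lie_bracket A C + lie_bracket B C.
Proof. by rewrite br_anti brD opprD -!(br_anti _ C). Qed.

Lemma brNl A B : lie_bracket (- A) B = - lie_bracket A B.
Proof. by rewrite br_anti brN -br_anti. Qed.

Lemma br_sum I (r : seq I) (P : pred I) A (F : I -> 'M[K]_n) :
  lie_bracket A (\sum_(i <- r | P i) F i) = \sum_(i <- r | P i) lie_bracket A (F i).
Proof.
elim: r => [|i r IH]; first by rewrite !big_nil br0r.
by rewrite !big_cons; case: (P i); rewrite ?brD IH.
Qed.

Lemma jacobi A B C : lie_bracket A (lie_bracket B C) =
  lie_bracket (lie_bracket A B) C + lie_bracket B (lie_bracket A C).
Proof.
rewrite /lie_bracket !mulmxBr !mulmxBl !mulmxA.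
move: (A *m B *m C) (A *m C *m B) (B *m C *m A) (C *m B *m A) (B *m A *m C) (C *m A *m B).
by move=> X1 X2 X3 X4 X5 X6; apply/matrixP=> i j; rewrite !mxE; ring.
Qed.

End LieBracket.

(** * Root vectors built from the Chevalley-Serre relations *)

Section ChevalleyBasis.
Variables (K : numClosedFieldType) (n : nat).

Definition zK (z : Z) : K := (int_of_Z z)%:~R.

Lemma zKD a b : zK (Z.add a b) = zK a + zK b.
Proof. by rewrite /zK -intrD; congr (_%:~R); apply: (rmorphD int_of_Z). Qed.

Lemma zKM a b : zK (Z.mul a b) = zK a * zK b.
Proof. by rewrite /zK -intrM; congr (_%:~R); apply: (rmorphM int_of_Z). Qed.

Lemma zKN a : zK (Z.opp a) = - zK a.
Proof. by rewrite /zK -mulrNz; congr (_%:~R); apply: (rmorphN int_of_Z). Qed.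

Lemma zK0 : zK Z0 = 0. Proof. by []. Qed.
Lemma zK1 : zK Z.one = 1. Proof. by []. Qed.

Lemma zK_inj a b : zK a = zK b -> a = b.
Proof. by move=> /intr_inj /(can_inj int_of_ZK). Qed.

Lemma zK_eq0 a : zK a = 0 -> a = Z0.
Proof. by rewrite -zK0 => /zK_inj. Qed.

Section Linear.
Variables (V : lmodType K) (X : nat -> V).

Definition mono (p : nat * Z) : V := zK p.2 *: X p.1.
Definition lin (L : lc) : V := \sum_(p <- L) mono p.

Lemma lin_cat L1 L2 : lin (L1 ++ L2) = lin L1 + lin L2.
Proof. by rewrite /lin big_cat. Qed.

Lemma lin_scale c L : lin (lc_scale c L) = zK c *: lin L.
Proof.
rewrite /lin big_map scaler_sumr; apply: eq_bigr => p _.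
by rewrite /mono /= zKM scalerA.
Qed.

Lemma lin_ins p L : lin (lc_ins p L) = mono p + lin L.
Proof.
elim: L => [|q L IH] /=; first by rewrite /lin !big_cons big_nil.
case: eqP => e; last by rewrite /lin !big_cons -/(lin _) IH addrCA.
by rewrite /lin !big_cons /mono /= e zKD scalerDl addrCA addrA.
Qed.

Lemma lin_null L : lc_null L -> lin L = 0.
Proof.
rewrite /lc_null => h.
have -> : lin L = lin (foldr lc_ins [::] L).
  by elim: L {h} => //= p L IH; rewrite lin_ins -IH /lin big_cons.
elim: (foldr _ _ _) h => [|p L' IH] /=; first by rewrite /lin big_nil.
by case/andP=> /Z.eqb_eq e /IH h; rewrite /lin big_cons -/(lin _) h addr0 /mono e zK0 scale0r.
Qed.

End Linear.

(** Nonzero powers [A^k] are eigenvectors of [ad H] for the distinct eigenvalues [2 k], so not all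
    powers can be nonzero. *)
Lemma lie_nilp (A H : 'M[K]_n) : lie_bracket H A = 2%:R *: A -> nilp A.
Proof.
move=> hA; apply: contrapT => nn.
have Ak k : A ^+ k != 0 by apply/negP=> /eqP e; apply: nn; exists k.
have ev k : lie_bracket H (A ^+ k) = (2 * k)%:R *: A ^+ k.
  elim: k => [|k IH].
    by rewrite expr0 muln0 scale0r /lie_bracket mulmx1 mul1mx subrr.
  have -> : lie_bracket H (A ^+ k.+1) = lie_bracket H A *m A ^+ k + A *m lie_bracket H (A ^+ k).
    by rewrite exprS -mulmxE /lie_bracket mulmxBl mulmxBr !mulmxA addrA subrK.
  rewrite IH hA -scalemxAl -scalemxAr mulmxE -exprS -scalerDl -natrD; congr (_%:R *: _).
  by rewrite mulnS.
apply: (@infinite_eigen K 'M[K]_n (lie_bracket H) (fun k => (2 * k)%:R) (fun k => A ^+ k)) => //.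
  by move=> a u u'; apply: brDr.
by move=> a b /eqP; rewrite eqr_nat => /eqP; lia.
Qed.

Definition chevalley_rel (e f : nat -> 'M[K]_n) :=
  let h i := lie_bracket (e i) (f i) in
  [/\ forall i j, (i < 7)%N -> (j < 7)%N -> lie_bracket (h i) (h j) = 0,
      forall i j, (i < 7)%N -> (j < 7)%N -> lie_bracket (h i) (e j) = zK (cz i j) *: e j,
      forall i j, (i < 7)%N -> (j < 7)%N -> lie_bracket (h i) (f j) = - (zK (cz i j) *: f j) &
      forall i j, (i < 7)%N -> (j < 7)%N -> i != j -> lie_bracket (e i) (f j) = 0].

(** [m] is fuel for the recursion along [par], which decreases [a]; [a.+1] units suffice. *)
Fixpoint xpf (e : nat -> 'M[K]_n) (m a : nat) : 'M[K]_n :=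
  if (a < 7)%N then e a else
  if m is m'.+1 then
    zK (rt_sg (par a).1 (par a).2) *: lie_bracket (e (par a).1) (xpf e m' (par a).2)
  else 0.
Definition xp e a := xpf e a.+1 a.

Lemma model_par a : (7 <= a < 63)%N -> [/\ ((par a).2 < a)%N, ((par a).1 < 7)%N,
  rt_ht a = (rt_ht (par a).2).+1 &
  tEp (par a).1 (par a).2 = (7 + a, rt_sg (par a).1 (par a).2)%N].
Proof.
move=> ha; have /allP2 h := model_parent.
by have /and4P [h1 h2 /eqP h3 /eqP h4] := h a ha.
Qed.

Lemma xpE e a : (7 <= a < 63)%N ->
  xp e a = zK (rt_sg (par a).1 (par a).2) *: lie_bracket (e (par a).1) (xp e (par a).2).
Proof.
move=> ha; have stab m m' b : (b < m)%N -> (b < m')%N -> (b < 63)%N -> xpf e m b = xpf e m' b.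
  elim: m m' b => [|m IH] [|m'] b // bm bm' b63 /=; case: ifP => // /negbT; rewrite -leqNgt => b7.
  have [h1 _ _ _] := @model_par b (introT andP (conj b7 b63)).
  by rewrite (IH m') //; lia.
have [h1 _ _ _] := model_par ha; case/andP: ha => a7 a63.
rewrite {1}/xp /= ltnNge a7 /=; congr (_ *: lie_bracket _ _).
by apply: stab; lia.
Qed.

Lemma xp_simple e k : (k < 7)%N -> xp e k = e k.
Proof. by rewrite /xp /= => ->. Qed.

Lemma rel_comm k l i : (k < 7)%N -> (l < 7)%N -> (i < 133)%N -> lc_null (lc_comm k l i).
Proof.
move=> k7 l7 i7; have /allP2 h3 := model_comm.
by have /allP2/(_ l l7)/allP2/(_ i i7) := h3 k k7.
Qed.

Lemma comm_rel (V : lmodType K) (X : nat -> V) k l i : (k < 7)%N -> (l < 7)%N -> (i < 133)%N ->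
  zK (opF l i).2 *: mono X (opE k (opF l i).1) - zK (opE k i).2 *: mono X (opF l (opE k i).1) =
  zK (delta k l) *: (zK (opH k i) *: X i).
Proof.
move=> k7 l7 i133; have := lin_null X (rel_comm k7 l7 i133).
rewrite /lc_comm !lin_cat lin_scale /lin /= !big_cons !big_nil !addr0 /mono /=.
rewrite zKN zK1 scaleN1r zKN !zKM zK1 !mul1r !scalerA scaleNr.
by rewrite addrA => /eqP; rewrite subr_eq0 => /eqP.
Qed.

Section Half.
Variables e f : nat -> 'M[K]_n.
Hypothesis rel : chevalley_rel e f.
Let h i := lie_bracket (e i) (f i).
Let X i := if (i < 7)%N then h i else xp e (i - 7).

Lemma br_f_e i j : (i < 7)%N -> (j < 7)%N -> lie_bracket (f i) (e j) = - (zK (delta i j) *: h j).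
Proof.
move=> i7 j7; rewrite br_anti /delta; case: eqP => [->|/eqP ne]; first by rewrite zK1 scale1r.
by case: rel => _ _ _ ef; rewrite ef // 1?eq_sym // zK0 scale0r.
Qed.

Lemma tP_simple : all (fun l => all (fun k => Z.eqb (tP l k) (cz l k)) (iota 0 7)) (iota 0 7).
Proof. by vm_compute. Qed.

Lemma tP_par : all (fun l => all (fun a => Z.eqb (tP l a) (Z.add (tP l (par a).2) (cz l (par a).1)))
  (iota 7 56)) (iota 0 7).
Proof. by vm_compute. Qed.

Lemma rel_h l a : (l < 7)%N -> (a < 63)%N -> lie_bracket (h l) (xp e a) = zK (tP l a) *: xp e a.
Proof.
move=> l7; have [N] := ubnP a; elim: N a => // N IH a; rewrite ltnS => aN a63.
case: (ltnP a 7) => a7.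
  rewrite xp_simple //; case: rel => _ he _ _; rewrite he //.
  by have /allP2/(_ l l7)/allP2/(_ a a7)/Z.eqb_eq -> := tP_simple.
have ha : (7 <= a < 63)%N by rewrite a7.
have [h1 h2 _ _] := model_par ha.
rewrite xpE // brZr jacobi; case: (rel) => _ he _ _.
rewrite he // IH; try lia.
have /allP2/(_ l l7)/allP2/(_ a ha)/Z.eqb_eq -> := tP_par.
by rewrite brZl brZr -scalerDl zKD [X in X *: lie_bracket _ _]addrC !scalerA mulrC.
Qed.

Lemma rel_Eh k j : (k < 7)%N -> (j < 7)%N -> lie_bracket (e k) (X j) = mono X (opE k j).
Proof.
move=> k7 j7; rewrite /X j7 /mono /opE j7 /= addKn br_anti.
by case: (rel) => _ he _ _; rewrite he // zKN scaleNr xp_simple.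
Qed.

Lemma opE_up k a : (k < 7)%N -> (a < 63)%N -> zK (tEp k a).2 = 0 \/
  [/\ (7 <= (tEp k a).1 < 70)%N, rt_ht ((tEp k a).1 - 7) = (rt_ht a).+1 &
   forall l, (l < 7)%N -> tP l ((tEp k a).1 - 7) = Z.add (tP l a) (cz l k)].
Proof.
move=> k7 a63; have /allP2 h4 := model_up.
have /allP2/(_ a a63)/orP [/Z.eqb_eq ->|/and3P [h1 /eqP h2 /allP2 h3]] := h4 k k7; first by left.
by right; split=> // l l7; apply/Z.eqb_eq/h3.
Qed.

Lemma opF_dn k a : (k < 7)%N -> (a < 63)%N -> ((tFp k a).1 < 7)%N \/
  ((tFp k a).1 < 70)%N /\ (rt_ht ((tFp k a).1 - 7)).+1 = rt_ht a.
Proof.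
move=> k7 a63; have /allP2 h6 := model_down.
have /allP2/(_ a a63)/orP [lt7|/andP [h1 /eqP h2]] := h6 k k7; first by left.
by right.
Qed.

Lemma rt_ht_simple : all (fun k => rt_ht k == 1%N) (iota 0 7).
Proof. by vm_compute. Qed.

Lemma rt_ht_gt1 : all (fun k => (1 < rt_ht k)%N) (iota 7 56).
Proof. by vm_compute. Qed.

(* Induction on the height m.  The relation for e_k x_b holds because the
   difference of both sides is a vector of positive weight killed by all f_l. *)
Lemma half_rel : forall m,
  (forall a k, (a < 63)%N -> (k < 7)%N -> (rt_ht a <= m)%N ->
     lie_bracket (f k) (xp e a) = mono X (tFp k a)) /\
  (forall b k, (b < 63)%N -> (k < 7)%N -> (rt_ht b < m)%N ->
     lie_bracket (e k) (xp e b) = mono X (tEp k b)).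
Proof.
have Xp a : X (7 + a) = xp e a by rewrite /X ltnNge leq_addr /= addKn.
have FS : all (fun k => all (fun a => (tFp k a == if k == a then (k, Z.opp Z.one) else tFp k a)
     && ((k == a) || Z.eqb (tFp k a).2 Z0)) (iota 0 7)) (iota 0 7) by vm_compute.
have P1 a k : (a < 63)%N -> (k < 7)%N -> (rt_ht a <= 1)%N ->
     lie_bracket (f k) (xp e a) = mono X (tFp k a).
  move=> a63 k7 h1.
  have a7 : (a < 7)%N.
    rewrite ltnNge; apply/negP=> a7; have /allP2/(_ a) := rt_ht_gt1.
    by rewrite a7 a63 => /(_ isT); lia.
  rewrite xp_simple // br_f_e // /delta.
  have /allP2/(_ k k7)/allP2/(_ a a7)/andP [/eqP e1 e2] := FS.
  case: eqP e1 e2 => [<-|ne] e1 e2.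
    by rewrite e1 /mono /= /X k7 zKN zK1 scaleN1r scale1r.
  rewrite zK0 scale0r oppr0 /mono; move: e2 => /Z.eqb_eq ->.
  by rewrite zK0 scale0r.
have ht0 a : (a < 63)%N -> (0 < rt_ht a)%N.
  move=> a63; case: (ltnP a 7) => a7; first by have /allP2/(_ a a7)/eqP -> := rt_ht_simple.
  by have /allP2/(_ a) := rt_ht_gt1; rewrite a7 a63 => /(_ isT); lia.
have hE1 b k l : (b < 63)%N -> (k < 7)%N -> (l < 7)%N ->
    (forall c, (c < 63)%N -> (rt_ht c).+1 = rt_ht b -> lie_bracket (e k) (xp e c) = mono X (tEp k c)) ->
    lie_bracket (e k) (mono X (tFp l b)) = zK (tFp l b).2 *: mono X (opE k (tFp l b).1).
  move=> b63 k7 l7 hc; rewrite {1}/mono brZr; congr (_ *: _).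
  have [i7|[i70 hti]] := opF_dn l7 b63; first exact: rel_Eh.
  case: (ltnP (tFp l b).1 7) => i7; first exact: rel_Eh.
  rewrite {1}/X ltnNge i7 /= hc //; last by lia.
  by rewrite /opE ltnNge i7 /= i70.
elim=> [|m [IHP IHQ]].
  by split=> a k a63 k7; [move=> h1; apply: P1 => //; lia | lia].
have hP a l : (a < 63)%N -> (l < 7)%N -> (rt_ht a <= m.+1)%N ->
     lie_bracket (f l) (xp e a) = mono X (tFp l a).
  move=> a63 l7 hta; case: (leqP (rt_ht a) m) => htm; first exact: IHP.
  case: (leqP (rt_ht a) 1) => ht1; first exact: P1.
  have a7 : (7 <= a)%N.
    rewrite leqNgt; apply/negP=> a7; have /allP2/(_ a a7)/eqP h1 := rt_ht_simple.
    by rewrite h1 in ht1.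
  have ha : (7 <= a < 63)%N by rewrite a7.
  have [h1 h2 h3 h4] := model_par ha.
  set k := (par a).1 in h2 h4 *; set b := (par a).2 in h1 h3 h4 *.
  have b63 : (b < 63)%N by lia.
  (* [[f_l, [e_k, x_b]]] is expanded by Jacobi and the induction hypotheses. The model satisfies the
     same identity, by [comm_rel], and comparison gives the value of [f_l] on [x_a]. *)
  rewrite xpE // -/k -/b brZr jacobi br_f_e // IHP //; last by lia.
  rewrite brNl brZl rel_h //.
  have b133 : (7 + b < 133)%N by lia.
  have oF : opF l (7 + b) = tFp l b by rewrite /opF ltnNge leq_addr /= addKn; case: ltnP => //; lia.
  have oE : opE k (7 + b) = tEp k b by rewrite /opE ltnNge leq_addr /= addKn; case: ltnP => //; lia.
  have oFa : opF l (7 + a) = tFp l a by rewrite /opF ltnNge leq_addr /= addKn; case: ltnP => //; lia.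
  have oH : opH k (7 + b) = tP k b by rewrite /opH ltnNge leq_addr /= addKn; case: ltnP => //; lia.
  rewrite hE1 //; last by move=> c c63 hc; apply: IHQ => //; lia.
  have := comm_rel X h2 l7 b133; rewrite oF oE oH h4 /= oFa Xp => /eqP.
  rewrite subr_eq => /eqP ->; rewrite (_ : delta l k = delta k l) ?addKr; last by rewrite /delta eq_sym.
  by rewrite scalerA -zKM (_ : Z.mul _ _ = Z.one) ?zK1 ?scale1r // /rt_sg; case: ifP.
split=> // b k b63 k7; rewrite ltnS => htb.
case: (ltnP (rt_ht b) m) => htm; first exact: IHQ.
pose Y := lie_bracket (e k) (xp e b) - mono X (tEp k b).
suff : Y = 0 by move=> /eqP; rewrite subr_eq0 => /eqP.
have up := opE_up k7 b63.
have b133 : (7 + b < 133)%N by lia.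
have oE : opE k (7 + b) = tEp k b by rewrite /opE ltnNge leq_addr /= addKn; case: ltnP => //; lia.
have FY l : (l < 7)%N -> lie_bracket (f l) Y = 0.
  move=> l7.
  have oF : opF l (7 + b) = tFp l b by rewrite /opF ltnNge leq_addr /= addKn; case: ltnP => //; lia.
  have oH : opH k (7 + b) = tP k b by rewrite /opH ltnNge leq_addr /= addKn; case: ltnP => //; lia.
  rewrite /Y brD brN jacobi br_f_e // IHP // brNl brZl rel_h //.
  rewrite hE1 //; last by move=> c c63 hc; apply: IHQ => //; lia.
  have -> : lie_bracket (f l) (mono X (tEp k b)) = zK (tEp k b).2 *: mono X (opF l (tEp k b).1).
    rewrite {1}/mono brZr; case: up => [->|[h1 h2 _]]; first by rewrite !scale0r.
    congr (_ *: _); rewrite /X ltnNge; case/andP: (h1) => -> i70 /=.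
    rewrite hP //; [|lia|lia].
    by rewrite /opF ltnNge; case/andP: (h1) => -> _ /=; rewrite i70.
  have := comm_rel X k7 l7 b133; rewrite oF oE oH Xp => /eqP; rewrite subr_eq => /eqP ->.
  by rewrite (_ : delta l k = delta k l) ?addKr ?subrr // /delta eq_sym.
have HY l : (l < 7)%N -> lie_bracket (h l) Y = zK (Z.add (tP l b) (cz l k)) *: Y.
  move=> l7; rewrite /Y brD brN jacobi; case: (rel) => _ he _ _.
  rewrite he // rel_h // brZl brZr -scalerDl -zKD [X in zK X]Z.add_comm [RHS]scalerBr.
  congr (_ - _).
  rewrite /mono brZr; case: up => [->|[h1 h2 h3]]; first by rewrite !scale0r scaler0.
  rewrite /X ltnNge; case/andP: (h1) => -> i70 /=; rewrite rel_h ?h3 //; last by lia.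
  by rewrite !scalerA mulrC.
have /allP2 h5 := model_pos.
have /allP2/(_ b b63)/hasP [l] := h5 k k7; rewrite mem_iota add0n /= => l7 /Z.ltb_lt pos.
have [m' e'] : exists m', zK (Z.add (tP l b) (cz l k)) = m'.+1%:R.
  case: (Z.add _ _) pos => // p _; exists (Pos.to_nat p).-1.
  by rewrite prednK; [rewrite /zK /= | lia].
apply: (@lowest_weight_zero K 'M[K]_n (lie_bracket (e l)) (lie_bracket (f l)) (lie_bracket (h l)) Y m').
- by move=> a u w; apply: brDr.
- by move=> a u w; apply: brDr.
- by move=> a u w; apply: brDr.
- by move=> y; rewrite [lie_bracket (e l) (lie_bracket _ _)]jacobi addrK.
- move=> y; rewrite jacobi; case: (rel) => _ he _ _; rewrite he // brZl addrC; congr (_ + _ *: _).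
  by rewrite /cz eqxx.
- exact: FY.
- by rewrite HY // e'.
Qed.
End Half.
End ChevalleyBasis.

(** * The model as a representation of the generators *)

Section AdjointModel.
Variables (K : numClosedFieldType).
Local Notation zK := (zK K).

Lemma op_range : all (fun k => all (fun i => ((opE k i).1 < 133)%N && ((opF k i).1 < 133)%N)
  (iota 0 133)) (iota 0 7).
Proof. by vm_compute. Qed.

(** Powers of 5: the values of the simple coroots on roots lie between -2 and 2, so they are the
    digits of the combined weight. *)
Definition wts : seq Z := Eval vm_compute in
  [seq Z.pow (Z.of_nat 5) (Z.of_nat k) | k <- iota 0 7].

(* A weight of the h_k separating the roots. *)
Definition opW (i : nat) : Z :=
  foldr (fun k s => Z.add (Z.mul (nth Z0 wts k) (opH k i)) s) Z0 (iota 0 7).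

Definition tabW := Eval vm_compute in [seq opW i | i <- iota 0 133].

Lemma tabWE i : (i < 133)%N -> opW i = nth Z0 tabW i.
Proof.
have h : all (fun i => Z.eqb (opW i) (nth Z0 tabW i)) (iota 0 133) by vm_compute.
by move=> i133; apply/Z.eqb_eq; apply: (allP2 h).
Qed.

Lemma opW_sep : all (fun i => ~~ Z.eqb (nth Z0 tabW i) Z0 &&
  all (fun j => (i == j) || ~~ Z.eqb (nth Z0 tabW i) (nth Z0 tabW j)) (iota 7 126)) (iota 7 126).
Proof. by vm_compute. Qed.

Lemma opW_h : all (fun i => Z.eqb (opW i) Z0) (iota 0 7).
Proof. by vm_compute. Qed.

Definition opmx (op : nat -> nat * Z) : 'M[K]_133 :=
  \matrix_(i, j) if (op j).1 == i then zK (op j).2 else 0.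

Definition dl (i : nat) : 'cV[K]_133 := \col_j (i == j)%:R.

Lemma colE_dl (c : 'cV[K]_133) : c = \sum_(i < 133) c i 0 *: dl i.
Proof.
apply/colP=> i; rewrite summxE (bigD1 i) //= big1 ?addr0 => [|j ji]; rewrite !mxE.
  by rewrite eqxx mulr1.
by rewrite (inj_eq val_inj) (negbTE ji) mulr0.
Qed.

Lemma opmx_dl op j : (j < 133)%N -> opmx op *m dl j = mono dl (op j).
Proof.
move=> j133; apply/colP=> i; rewrite !mxE (bigD1 (Ordinal j133)) //= big1 => [|l lj].
  rewrite !mxE /= eqxx mulr1 addr0; case: eqP => e; last by rewrite mulr0.
  by rewrite mulr1.
rewrite !mxE; case: (eqVneq j l) => [e|]; last by rewrite mulr0.
by move: lj; rewrite -(inj_eq val_inj) /= e eqxx.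
Qed.

Definition Emx k := opmx (opE k).
Definition Fmx k := opmx (opF k).
Definition Hmx k := opmx (fun i => (i, opH k i)).

Lemma Hmx_dl k j : (j < 133)%N -> Hmx k *m dl j = zK (opH k j) *: dl j.
Proof. exact: opmx_dl. Qed.

Lemma mx_ext (A B : 'M[K]_133) : (forall j, (j < 133)%N -> A *m dl j = B *m dl j) -> A = B.
Proof.
move=> h; apply/matrixP=> i j; have /colP /(_ i) := h j (ltn_ord j).
have e (C : 'M[K]_133) : (C *m dl j) i 0 = C i j.
  rewrite mxE (bigD1 j) //= big1 => [|l lj]; rewrite mxE ?eqxx ?mulr1 ?addr0 //.
  by rewrite eq_sym (inj_eq val_inj) (negbTE lj) mulr0.
by rewrite !e.
Qed.

Lemma mulmx_mono (A : 'M[K]_133) p : A *m mono dl p = zK p.2 *: (A *m dl p.1).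
Proof. by rewrite /mono scalemxAr. Qed.

Lemma EF_comm k l : (k < 7)%N -> (l < 7)%N ->
  Emx k *m Fmx l - Fmx l *m Emx k = zK (delta k l) *: Hmx k.
Proof.
move=> k7 l7; apply: mx_ext => j j133.
have /allP2/(_ k k7)/allP2/(_ j j133)/andP [rE _] := op_range.
have /allP2/(_ l l7)/allP2/(_ j j133)/andP [_ rF] := op_range.
rewrite mulmxBl -!mulmxA !opmx_dl // !mulmx_mono !opmx_dl // -scalemxAl Hmx_dl //.
exact: comm_rel.
Qed.

Lemma inj_cons (lam : nat -> K) x s : lam x = 0 ->
  (forall a, a \in s -> (lam a != 0) * (forall b, b \in s -> lam a = lam b -> a = b)) ->
  {in x :: s &, injective lam}.
Proof.
move=> l0 sep a b; rewrite !in_cons => /orP [/eqP ->|ha] /orP [/eqP ->|hb] //.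
- by rewrite l0 => e; have [/eqP] := sep b hb; rewrite -e.
- by rewrite l0 => e; have [/eqP] := sep a ha; rewrite e.
- by have [_] := sep a ha; apply.
Qed.

(** The matrix [W] combines the [h_k] into one operator with distinct nonzero eigenvalues on the
    root vectors and eigenvalue 0 on the Cartan part; [eigen_mem] applies to it. *)
Lemma wt_split (Z : 'cV[K]_133 -> Prop) (c : 'cV[K]_133) :
  Z 0 -> (forall a u w, Z u -> Z w -> Z (a *: u + w)) ->
  (forall k u, (k < 7)%N -> Z u -> Z (Hmx k *m u)) -> Z c ->
  (forall i : 'I_133, (7 <= i)%N -> Z (c i 0 *: dl i)) /\
  Z (\sum_(i < 133 | (i < 7)%N) c i 0 *: dl i).
Proof.
move=> zZ Zl ZH Zc.
pose W := opmx (fun i => (i, opW i)).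
have WH : W = \sum_(k < 7) zK (nth Z0 wts k) *: Hmx k.
  apply: mx_ext => j j133; rewrite mulmx_suml opmx_dl // /mono /=.
  rewrite (eq_bigr (fun k : 'I_7 => zK (Z.mul (nth Z0 wts k) (opH k j)) *: dl j)).
    rewrite -scaler_suml; congr (_ *: _); rewrite -(big_mkord xpredT (fun k => zK (Z.mul (nth Z0 wts k) (opH k j)))).
    by rewrite /opW /index_iota /= !big_cons big_nil !zKD zK0.
  by move=> k _; rewrite -scalemxAl Hmx_dl // scalerA zKM.
have ZZ a u : Z u -> Z (a *: u) by move=> Zu; rewrite -[_ *: _]addr0; apply: Zl.
have ZD u w : Z u -> Z w -> Z (u + w) by move=> Zu Zw; rewrite -[u]scale1r; apply: Zl.
have ZW u : Z u -> Z (W *m u).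
  move=> Zu; rewrite WH mulmx_suml; apply: (@big_ind _ Z) => // k _.
  by rewrite -scalemxAl; apply: ZZ; apply: ZH.
(* The label 0 stands for the whole Cartan part, the labels 7 to 132 for the root vectors. *)
pose c' i := if i == 0%N then \sum_(i < 133 | (i < 7)%N) c i 0 *: dl i else c (inord i) 0 *: dl i.
pose lam i : K := if i == 0%N then 0 else zK (opW i).
pose r := 0%N :: iota 7 126.
have Wh : W *m c' 0%N = 0.
  rewrite /c' eqxx mulmx_sumr big1 // => i i7; rewrite -scalemxAr opmx_dl // /mono /=.
  by have /allP2/(_ i i7)/Z.eqb_eq -> := opW_h; rewrite zK0 scale0r scaler0.
have sum : \sum_(i <- r) c' i = c.
  have ec := colE_dl c; rewrite (bigID (fun i : 'I_133 => (i < 7)%N)) /= in ec.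
  rewrite [RHS]ec /r big_cons {1}/c' eqxx; congr (_ + _).
  rewrite (eq_big_seq (fun i => c (inord i) 0 *: dl i)); last first.
    by move=> i; rewrite mem_iota => /andP [i7 _]; rewrite /c'; case: i i7.
  rewrite -[126%N]/(133 - 7)%N -/(index_iota 7 133) (big_nat_widenl _ 0) // big_mkord; apply: eq_big => [i|i _].
    by rewrite -leqNgt.
  by rewrite inord_val.
have ur : uniq r by [].
have mr i : i \in iota 7 126 = (7 <= i < 133)%N by rewrite mem_iota.
have inj : {in r &, injective lam}.
  have sep a : a \in iota 7 126 -> (lam a != 0) * (forall b, b \in iota 7 126 -> lam a = lam b -> a = b).
    move=> ha; have a7 : (a == 0%N) = false by move: ha; rewrite mem_iota; case: a.
    have /allP/(_ a ha)/andP [/negbTE/Z.eqb_neq nz /allP h] := opW_sep.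
    have a133 : (a < 133)%N by move: ha; rewrite mem_iota; lia.
    rewrite /lam a7 tabWE; last exact: a133.
    split; first by apply/eqP => /zK_eq0.
    move=> b hb; have b7 : (b == 0%N) = false by move: hb; rewrite mem_iota; case: b.
    rewrite b7 tabWE => [/zK_inj e|]; last by move: hb; rewrite mem_iota; lia.
    have /orP [/eqP //|] := h b hb.
    by rewrite e Z.eqb_refl.
  exact: inj_cons.
have Wc i : i \in r -> W *m c' i = lam i *: c' i.
  rewrite in_cons => /orP [/eqP ->|]; first by rewrite Wh /lam eqxx scale0r.
  rewrite mem_iota => hi; have i7 : (i == 0%N) = false by case: i hi.
  rewrite /c' /lam i7 -scalemxAr opmx_dl; last by lia.
  by rewrite /mono /= !scalerA mulrC.
have Zs : Z (\sum_(i <- r) c' i) by rewrite sum.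
have h := @eigen_mem K 'cV[K]_133 nat (mulmx W) Z r lam c' _ Zl ZW zZ ur inj Wc Zs.
have {}h i : i \in r -> Z (c' i).
  by apply: h => a u w; rewrite mulmxDr scalemxAr.
split; last by have := h 0%N; rewrite /c' eqxx; apply; rewrite in_cons.
move=> i i7; have := h i; rewrite /c' in_cons mem_iota inord_val.
have -> : (nat_of_ord i == 0%N) = false by case: i i7 => -[].
by apply; rewrite i7 /=; have := ltn_ord i; lia.
Qed.

(* Twice the inverse of the Cartan matrix. *)
Definition cartan_inv : seq (seq Z) := Eval vm_compute in
  map (map Z.of_nat) [:: [:: 4; 4; 6; 8; 6; 4; 2]; [:: 4; 7; 8; 12; 9; 6; 3];
    [:: 6; 8; 12; 16; 12; 8; 4]; [:: 8; 12; 16; 24; 18; 12; 6]; [:: 6; 9; 12; 18; 15; 10; 5];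
    [:: 4; 6; 8; 12; 10; 8; 4]; [:: 2; 3; 4; 6; 5; 4; 3]]%N.

Definition ci i j : Z := nth Z0 (nth [::] cartan_inv i) j.

Definition zsum (r : seq nat) (F : nat -> Z) : Z := foldr (fun k s => Z.add (F k) s) Z0 r.

Lemma zK_sum n (F : nat -> Z) : zK (zsum (iota 0 n) F) = \sum_(k < n) zK (F k).
Proof.
rewrite -(big_mkord xpredT (fun k => zK (F k))) /index_iota subn0.
elim: (iota 0 n) => [|k r IH]; first by rewrite big_nil; apply: zK0.
by rewrite big_cons -IH -zKD.
Qed.

Lemma cartan_invP : all (fun i => all (fun j =>
  Z.eqb (zsum (iota 0 7) (fun k => Z.mul (cz i k) (ci k j))) (Z.mul Z.two (delta i j))) (iota 0 7)) (iota 0 7).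
Proof. by vm_compute. Qed.

Lemma cartan_inj (V : lmodType K) (v : nat -> V) :
  (forall k, (k < 7)%N -> \sum_(j < 7) zK (cz j k) *: v j = 0) -> forall j, (j < 7)%N -> v j = 0.
Proof.
move=> h j j7.
have : \sum_(k < 7) zK (ci k j) *: (\sum_(i < 7) zK (cz i k) *: v i) = 0.
  by apply: big1 => k _; rewrite h ?scaler0.
under eq_bigr => k _ do rewrite scaler_sumr.
rewrite exchange_big /= (eq_bigr (fun i : 'I_7 => (zK (Z.mul Z.two (delta i j))) *: v i)) => [|i _].
  rewrite (bigD1 (Ordinal j7)) //= big1 => [|i ij].
    rewrite addr0 /delta eqxx zKM zK1 mulr1 => /eqP; rewrite scaler_eq0 => /orP [/eqP|/eqP //].
    by move=> /zK_eq0.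
  rewrite /delta (_ : (nat_of_ord i == j) = false) ?zKM ?zK0 ?mulr0 ?scale0r //.
  by apply/negbTE; move: ij; rewrite -(inj_eq val_inj).
have /allP2/(_ i (ltn_ord i))/allP2/(_ j j7)/Z.eqb_eq <- := cartan_invP.
by rewrite zK_sum scaler_suml; apply: eq_bigr => k _; rewrite scalerA mulrC zKM.
Qed.

Lemma root_moves : all (fun i => has (fun k => ~~ Z.eqb (opE k i).2 Z0 || ~~ Z.eqb (opF k i).2 Z0)
  (iota 0 7)) (iota 7 126).
Proof. by vm_compute. Qed.

Lemma dl_neq0 i : (i < 133)%N -> dl i != 0.
Proof.
move=> i133; apply/negP=> /eqP/colP /(_ (Ordinal i133)); rewrite !mxE eqxx => /eqP.
by rewrite oner_eq0.
Qed.

Lemma hsum_E (c : 'cV[K]_133) k : (k < 7)%N -> Emx k *m (\sum_(i < 133 | (i < 7)%N) c i 0 *: dl i) =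
  - (\sum_(i < 7) zK (cz i k) * c (inord i) 0) *: dl (7 + k).
Proof.
move=> k7; rewrite mulmx_sumr scaleNr scaler_suml -sumrN.
rewrite (eq_bigr (fun i : 'I_133 => - ((zK (cz i k) * c (inord i) 0) *: dl (7 + k)))).
  rewrite -(big_mkord (fun i => (i < 7)%N) (fun i => - ((zK (cz i k) * c (inord i) 0) *: dl (7 + k)))).
  rewrite -(big_mkord xpredT (fun i => - ((zK (cz i k) * c (inord i) 0) *: dl (7 + k)))).
  by rewrite [RHS](big_nat_widen _ _ 133).
move=> i i7; rewrite -scalemxAr opmx_dl // /mono /opE i7 scalerA inord_val zKN mulrN scaleNr mulrC.
by [].
Qed.

Lemma hsum0 (c : 'cV[K]_133) : (forall k, (k < 7)%N -> \sum_(i < 7) zK (cz i k) * c (inord i) 0 = 0) ->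
  forall i : 'I_133, (i < 7)%N -> c i 0 = 0.
Proof.
move=> h i i7; rewrite -(inord_val i).
exact: (@cartan_inj K^o (fun j => c (inord j) 0)).
Qed.

(** Each root vector is moved by some [e_k] or [f_k], and a combination of the [h_i] killed by all
    [e_k] is zero because the Cartan matrix is invertible. *)
Lemma model_center (c : 'cV[K]_133) :
  (forall k, (k < 7)%N -> Emx k *m c = 0 /\ Fmx k *m c = 0) -> c = 0.
Proof.
move=> h.
pose Z (c : 'cV[K]_133) := forall k, (k < 7)%N -> Emx k *m c = 0 /\ Fmx k *m c = 0.
have [|||Zr Zh] := @wt_split Z c _ _ _ h.
- by move=> k _; rewrite !mulmx0.
- move=> a u w hu hw k k7; have [u1 u2] := hu k k7; have [w1 w2] := hw k k7.
  by rewrite !mulmxDr -!scalemxAr u1 u2 w1 w2 scaler0 addr0.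
- move=> k u k7 hu l l7; suff -> : Hmx k *m u = 0 by rewrite !mulmx0.
  have := EF_comm k7 k7; rewrite /delta eqxx zK1 scale1r => <-.
  by have [u1 u2] := hu k k7; rewrite mulmxBl -!mulmxA u1 u2 !mulmx0 subrr.
apply/colP=> i; rewrite [RHS]mxE; case: (ltnP i 7) => i7; last first.
  have Zi := Zr i i7; have i133 := ltn_ord i.
  have /allP2/(_ i) := root_moves; rewrite i7 i133 => /(_ isT)/hasP [k].
  rewrite mem_iota => k7 hk; have [z1 z2] := Zi k k7.
  have /allP2/(_ k k7)/allP2/(_ i i133)/andP [rE rF] := op_range.
  move: z1 z2; rewrite -!scalemxAr !opmx_dl // /mono !scalerA => /eqP z1 /eqP z2.
  move: z1 z2; rewrite !scaler_eq0 !(negbTE (dl_neq0 _)) // !orbF !mulf_eq0.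
  move=> /orP [/eqP //|/eqP/zK_eq0 z1] /orP [/eqP //|/eqP/zK_eq0 z2].
  by move: hk; rewrite z1 z2.
apply: hsum0 i7 => k k7; have [z1 _] := Zh k k7; move/eqP: z1.
rewrite hsum_E // scaler_eq0 oppr_eq0 (negbTE (dl_neq0 _)) ?orbF; last by lia.
by move/eqP.
Qed.

End AdjointModel.

(** * Identification of the model with the Lie algebra generated by the e_k and f_k *)

Section AdjointBasis.
Variables (K : numClosedFieldType) (n : nat).
Local Notation zK := (zK K).

Lemma chevalley_swap (e f : nat -> 'M[K]_n) : chevalley_rel e f -> chevalley_rel f e.
Proof.
case=> hh he hf ef; split=> i j i7 j7.
- by rewrite br_anti [lie_bracket (f j) _]br_anti [lie_bracket (f i) _]br_anti brN brNl hh // !oppr0.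
- by rewrite [lie_bracket (f i) _]br_anti brNl hf // opprK.
- by rewrite [lie_bracket (f i) _]br_anti brNl he.
- by move=> ij; rewrite br_anti ef ?oppr0 // eq_sym.
Qed.

Definition adX (e f : nat -> 'M[K]_n) i :=
  if (i < 7)%N then lie_bracket (e i) (f i) else
  if (i < 70)%N then xp e (i - 7) else xp f (i - 70).

Definition halfX (e f : nat -> 'M[K]_n) i :=
  if (i < 7)%N then lie_bracket (e i) (f i) else xp e (i - 7).

Lemma adX_half e f p : (p.1 < 70)%N -> mono (halfX e f) p = mono (adX e f) p.
Proof. by move=> p70; rewrite /mono /halfX /adX p70; case: ifP. Qed.

Lemma adX_swap e f p : (p.1 < 70)%N -> mono (halfX f e) p = mono (adX e f) (op_swap p).
Proof.
move=> p70; rewrite /mono /halfX /adX /op_swap; case: ltnP => p7 /=.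
  by rewrite p7 br_anti zKN scalerN scaleNr.
have -> : (p.1 + 63 < 7)%N = false by lia.
have -> : (p.1 + 63 < 70)%N = false by lia.
by congr (_ *: xp _ _); lia.
Qed.

Section Relations.
Variables e f : nat -> 'M[K]_n.
Hypothesis rel : chevalley_rel e f.
Let X := adX e f.

Lemma tEp_range k a : (k < 7)%N -> (a < 63)%N -> ((tEp k a).1 < 70)%N.
Proof.
have h : all (fun k => all (fun a => ((tEp k a).1 < 70)%N) (iota 0 63)) (iota 0 7) by vm_compute.
by move=> k7 a63; have /allP2 h' := h; have /allP2/(_ a a63) := h' k k7.
Qed.

Lemma tFp_range k a : (k < 7)%N -> (a < 63)%N -> ((tFp k a).1 < 70)%N.
Proof.
have h : all (fun k => all (fun a => ((tFp k a).1 < 70)%N) (iota 0 63)) (iota 0 7) by vm_compute.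
by move=> k7 a63; have /allP2 h' := h; have /allP2/(_ a a63) := h' k k7.
Qed.

Lemma adX_E k i : (k < 7)%N -> (i < 133)%N -> lie_bracket (e k) (X i) = mono X (opE k i).
Proof.
move=> k7 i133; case: (ltnP i 7) => i7.
  have := rel_Eh rel k7 i7; rewrite i7 /X {1}/adX i7 => ->.
  by rewrite -(@adX_half e f) // /opE i7 /=; lia.
rewrite {1}/X /adX /opE !(ltnNge i 7) i7 /=; case: (ltnP i 70) => i70.
  have a63 : (i - 7 < 63)%N by lia.
  have [_ hE] := half_rel rel (rt_ht (i - 7)).+1.
  by rewrite (hE _ _ a63 k7 (ltnSn _)) -/(halfX e f) adX_half // tEp_range.
have a63 : (i - 70 < 63)%N by lia.
have [hF _] := half_rel (chevalley_swap rel) (rt_ht (i - 70)).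
by rewrite (hF _ _ a63 k7 (leqnn _)) -/(halfX f e) adX_swap // tFp_range.
Qed.

Lemma adX_F k i : (k < 7)%N -> (i < 133)%N -> lie_bracket (f k) (X i) = mono X (opF k i).
Proof.
move=> k7 i133; case: (ltnP i 7) => i7.
  rewrite /X /adX i7 /mono /opF i7 /= br_anti; case: (rel) => _ _ hf _.
  by rewrite addKn xp_simple // hf // opprK.
rewrite {1}/X /adX /opF !(ltnNge i 7) i7 /=; case: (ltnP i 70) => i70.
  have a63 : (i - 7 < 63)%N by lia.
  have [hF _] := half_rel rel (rt_ht (i - 7)).
  by rewrite (hF _ _ a63 k7 (leqnn _)) -/(halfX e f) adX_half // tFp_range.
have a63 : (i - 70 < 63)%N by lia.
have [_ hE] := half_rel (chevalley_swap rel) (rt_ht (i - 70)).+1.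
by rewrite (hE _ _ a63 k7 (ltnSn _)) -/(halfX f e) adX_swap // tEp_range.
Qed.

Lemma adX_H k i : (k < 7)%N -> (i < 133)%N ->
  lie_bracket (X k) (X i) = zK (opH k i) *: X i.
Proof.
move=> k7 i133; rewrite /X {1}/adX k7 /adX /opH; case: ifP => i7.
  by case: (rel) => hh _ _ _; rewrite hh // scale0r.
case: ifP => i70; first by rewrite (rel_h rel) //; lia.
have a63 : (i - 70 < 63)%N by lia.
have := rel_h (chevalley_swap rel) k7 a63.
by rewrite zKN scaleNr (br_anti (f k)) brNl => <-; rewrite opprK.
Qed.

Lemma adX_e k : (k < 7)%N -> X (7 + k) = e k.
Proof.
move=> k7; rewrite /X /adX ltnNge leq_addr /= addKn xp_simple //.
by have -> : (7 + k < 70)%N by lia.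
Qed.

Lemma adX_f k : (k < 7)%N -> X (70 + k) = f k.
Proof.
by move=> k7; rewrite /X /adX /= addKn xp_simple.
Qed.

Lemma xp_ind (Q : 'M[K]_n -> Prop) (e' : nat -> 'M[K]_n) :
  (forall k, (k < 7)%N -> Q (e' k)) -> (forall a Y, Q Y -> Q (a *: Y)) ->
  (forall Y k, (k < 7)%N -> Q Y -> Q (lie_bracket (e' k) Y)) ->
  forall a, (a < 63)%N -> Q (xp e' a).
Proof.
move=> Qe QZ Qb a; have [N] := ubnP a; elim: N a => // N IH a; rewrite ltnS => aN a63.
case: (ltnP a 7) => a7; first by rewrite xp_simple //; apply: Qe.
have ha : (7 <= a < 63)%N by rewrite a7.
have [h1 h2 _ _] := model_par ha.
by rewrite xpE //; apply: QZ; apply: Qb => //; apply: IH; lia.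
Qed.

Lemma adX_ind (Q : 'M[K]_n -> Prop) :
  (forall k, (k < 7)%N -> Q (e k)) -> (forall k, (k < 7)%N -> Q (f k)) ->
  (forall a Y, Q Y -> Q (a *: Y)) -> (forall Y Z, Q Y -> Q Z -> Q (lie_bracket Y Z)) ->
  forall i, (i < 133)%N -> Q (X i).
Proof.
move=> Qe Qf QZ Qb i i133; rewrite /X /adX.
case: ifP => i7; first by apply: Qb; [apply: Qe | apply: Qf].
by case: ifP => i70; apply: xp_ind; rewrite //; try lia; move=> *; apply: Qb; auto.
Qed.

Definition phi (c : 'cV[K]_133) : 'M[K]_n := \sum_(i < 133) c i 0 *: X i.

Lemma phi_lin a c d : phi (a *: c + d) = a *: phi c + phi d.
Proof.
rewrite /phi scaler_sumr -big_split /=; apply: eq_bigr => i _.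
by rewrite !mxE scalerDl scalerA.
Qed.

Lemma phi0 : phi 0 = 0.
Proof. by rewrite /phi big1 // => i _; rewrite mxE scale0r. Qed.

Lemma phiZ a c : phi (a *: c) = a *: phi c.
Proof. by have := phi_lin a c 0; rewrite !addr0 phi0 addr0. Qed.

Lemma phiD c d : phi (c + d) = phi c + phi d.
Proof. by have := phi_lin 1 c d; rewrite !scale1r. Qed.

Lemma phi_sum I (r : seq I) (P : pred I) (F : I -> 'cV[K]_133) :
  phi (\sum_(i <- r | P i) F i) = \sum_(i <- r | P i) phi (F i).
Proof.
elim: r => [|i r IH]; first by rewrite !big_nil phi0.
by rewrite !big_cons; case: (P i); rewrite ?phiD IH.
Qed.

Lemma phi_dl i : (i < 133)%N -> phi (dl K i) = X i.
Proof.
move=> i133; rewrite /phi (bigD1 (Ordinal i133)) //= big1 => [|j ji].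
  by rewrite mxE eqxx scale1r addr0.
rewrite mxE (_ : (i == j) = false) ?scale0r //; apply/negbTE; move: ji.
by rewrite -(inj_eq val_inj) eq_sym.
Qed.

Lemma phi_mx (op : nat -> nat * Z) (L : 'M[K]_n -> 'M[K]_n) :
  (forall a Y Z, L (a *: Y + Z) = a *: L Y + L Z) ->
  (forall i, (i < 133)%N -> (op i).1 < 133)%N ->
  (forall i, (i < 133)%N -> L (X i) = mono X (op i)) ->
  forall c, phi (opmx K op *m c) = L (phi c).
Proof.
move=> Ll op_lt LX c; have L0 : L 0 = 0.
  by have := Ll 1 0 0; rewrite !scale1r !addr0 => /eqP; rewrite eq_sym -subr_eq0 addrK => /eqP.
have LZ a Y : L (a *: Y) = a *: L Y by have := Ll a Y 0; rewrite !addr0 L0 addr0.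
have LD Y Z : L (Y + Z) = L Y + L Z by have := Ll 1 Y Z; rewrite !scale1r.
have Ls (I : Type) (r : seq I) (F : I -> 'M[K]_n) : L (\sum_(i <- r) F i) = \sum_(i <- r) L (F i).
  by elim: r => [|i r IH]; rewrite ?big_nil ?big_cons ?LD ?IH.
rewrite {1}(colE_dl c) mulmx_sumr phi_sum {2}/phi Ls; apply: eq_bigr => i _.
by rewrite -scalemxAr opmx_dl // phiZ LZ LX // /mono phiZ phi_dl // op_lt.
Qed.

Lemma op_lt k i : (k < 7)%N -> (i < 133)%N -> ((opE k i).1 < 133)%N /\ ((opF k i).1 < 133)%N.
Proof.
by move=> k7 i133; have /allP2/(_ k k7)/allP2/(_ i i133)/andP [] := op_range.
Qed.

Lemma phi_E k c : (k < 7)%N -> phi (Emx K k *m c) = lie_bracket (e k) (phi c).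
Proof.
move=> k7; apply: phi_mx => [a Y Z|i i133|i i133]; first exact: brDr.
  by have [] := op_lt k7 i133.
exact: adX_E.
Qed.

Lemma phi_F k c : (k < 7)%N -> phi (Fmx K k *m c) = lie_bracket (f k) (phi c).
Proof.
move=> k7; apply: phi_mx => [a Y Z|i i133|i i133]; first exact: brDr.
  by have [] := op_lt k7 i133.
exact: adX_F.
Qed.

Lemma phi_H k c : (k < 7)%N -> phi (Hmx K k *m c) = lie_bracket (X k) (phi c).
Proof.
move=> k7; apply: phi_mx => [a Y Z|i i133|i i133] //; first exact: brDr.
exact: adX_H.
Qed.

Hypothesis e_neq0 : forall k, (k < 7)%N -> e k != 0.

Lemma f_neq0 k : (k < 7)%N -> f k != 0.
Proof.
move=> k7; apply/negP=> /eqP f0; case: rel => _ he _ _.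
have := he k k k7 k7; rewrite f0 br0r br0l /cz eqxx => /esym/eqP.
by rewrite scaler_eq0 (negbTE (e_neq0 k7)) orbF => /eqP/zK_eq0.
Qed.

Lemma xp_neq0 (e' f' : nat -> 'M[K]_n) : chevalley_rel e' f' -> (forall k, (k < 7)%N -> e' k != 0) ->
  forall a, (a < 63)%N -> xp e' a != 0.
Proof.
move=> rel' e0 a; have [N] := ubnP a; elim: N a => // N IH a; rewrite ltnS => aN a63.
case: (ltnP a 7) => a7; first by rewrite xp_simple //; apply: e0.
have ha : (7 <= a < 63)%N by rewrite a7.
have [h1 h2 _ _] := model_par ha.
have b63 : ((par a).2 < 63)%N by lia.
apply/negP => /eqP xa0; have [hF _] := half_rel rel' (rt_ht a).
have := hF a (par a).1 a63 h2 (leqnn _); rewrite xa0 br0r.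
have par_dn : all (fun a => ((tFp (par a).1 a).1 == 7 + (par a).2)%N &&
   ~~ Z.eqb (tFp (par a).1 a).2 Z0) (iota 7 56) by vm_compute.
have /allP2/(_ a ha)/andP [/eqP e1 /negbTE/Z.eqb_neq nz] := par_dn.
rewrite /mono e1 ltnNge leq_addr /= addKn => /esym/eqP.
rewrite scaler_eq0 => /orP [/eqP/zK_eq0 //|]; apply/negP; apply: IH => //.
exact: leq_trans h1 aN.
Qed.

Lemma adX_neq0 i : (7 <= i < 133)%N -> X i != 0.
Proof.
case/andP=> i7 i133; rewrite /X /adX ltnNge i7 /=; case: ifP => i70.
  by apply: (xp_neq0 rel) => //; lia.
apply: (xp_neq0 (chevalley_swap rel)); [exact: f_neq0 | lia].
Qed.

(** The kernel is stable under the [h_k], so by [wt_split] it suffices that root vectors are nonzero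
    and that the [e_k] detect the Cartan part. *)
Lemma phi_eq0 c : phi c = 0 -> c = 0.
Proof.
move=> c0; have [|||Zr Zh] := @wt_split K (fun c => phi c = 0) c _ _ _ c0.
- exact: phi0.
- by move=> a u w u0 w0; rewrite phi_lin u0 w0 scaler0 addr0.
- by move=> k u k7 u0; rewrite phi_H // u0 br0r.
apply/colP=> i; rewrite [RHS]mxE; case: (ltnP i 7) => i7; last first.
  have /eqP := Zr i i7; rewrite phiZ phi_dl // scaler_eq0.
  by rewrite (negbTE (adX_neq0 _)) ?i7 ?ltn_ord // orbF => /eqP.
apply: hsum0 i7 => k k7.
have /eqP := congr1 (lie_bracket (e k)) Zh; rewrite br0r -phi_E // hsum_E // phiZ.
rewrite phi_dl; last by lia.
by rewrite adX_e // scaler_eq0 oppr_eq0 (negbTE (e_neq0 k7)) orbF => /eqP.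
Qed.

Lemma phi_inj c d : phi c = phi d -> c = d.
Proof.
move=> cd; apply/eqP; rewrite -subr_eq0; apply/eqP/phi_eq0.
by rewrite -[d in X in phi X]scale1r -scaleNr addrC phi_lin cd scaleN1r addNr.
Qed.

(** The [Y] whose bracket preserves the image of [phi] are closed under brackets, by Jacobi, and
    include the [e_k] and [f_k]. *)
Lemma phi_br c d : exists u, lie_bracket (phi c) (phi d) = phi u.
Proof.
have h i : (i < 133)%N -> forall d, exists u, lie_bracket (X i) (phi d) = phi u.
  apply: (@adX_ind (fun Y => forall d, exists u, lie_bracket Y (phi d) = phi u)) => {d i}.
  - by move=> k k7 d; exists (Emx K k *m d); rewrite phi_E.
  - by move=> k k7 d; exists (Fmx K k *m d); rewrite phi_F.
  - by move=> a Y hY d; have [u hu] := hY d; exists (a *: u); rewrite brZl hu phiZ.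
  move=> Y Z hY hZ d; have [u hu] := hZ d; have [w hw] := hY u.
  have [u' hu'] := hY d; have [w' hw'] := hZ u'.
  exists ((-1) *: w' + w); rewrite phi_lin -hw' -hw -hu -hu' scaleN1r addrC.
  by apply/eqP; rewrite eq_sym subr_eq -jacobi.
have {}h (i : 'I_133) : {u | lie_bracket (X i) (phi d) = phi u} by apply/cid/h.
exists (\sum_(i < 133) c i 0 *: sval (h i)); rewrite phi_sum {1}/phi br_anti br_sum -sumrN.
by apply: eq_bigr => i _; rewrite -br_anti brZl phiZ; case: (h i) => u /= ->.
Qed.

Lemma lie_phi : smallest (@lie_subalgebra K n) (e @` [set k | (k < 7)%N] `|` f @` [set k | (k < 7)%N])
  = range phi.
Proof.
apply/seteqP; split=> [Y|_ [c _ <-] L [[L0 Ll Lb] eL]]; last first.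
  have LX i : (i < 133)%N -> L (X i).
    apply: (@adX_ind L) => //.
    - by move=> k k7; apply: eL; left; exists k.
    - by move=> k k7; apply: eL; right; exists k.
    - by move=> a Y LY; rewrite -[_ *: _]addr0; apply: Ll.
  rewrite /phi; apply: (big_ind L) => //.
    by move=> Y Z LY LZ; rewrite -[Y]scale1r; apply: Ll.
  by move=> i _; rewrite -[_ *: _]addr0; apply: Ll => //; apply: LX.
apply; split.
  split.
  - by exists 0; rewrite ?phi0.
  - by move=> a _ _ [c _ <-] [d _ <-]; exists (a *: c + d); rewrite ?phi_lin.
  - by move=> _ _ [c _ <-] [d _ <-]; have [u ->] := phi_br c d; exists u.
move=> Z [] [k k7 <-].
  by exists (dl K (7 + k)); rewrite // phi_dl ?adX_e //; move: k7 => /=; lia.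
by exists (dl K (70 + k)); rewrite // phi_dl ?adX_f //; move: k7 => /=; lia.
Qed.

End Relations.
End AdjointBasis.

(** * The group of type E_7 and its subgroup H *)

Section ExpDet.
Variable K : numClosedFieldType.

(** The determinants of [exp (s X)] and [exp (- s X)] are polynomials in [s] with product 1, hence
    constant. *)
Lemma det_mx_exp n (X : 'M[K]_n) : nilp X -> \det (mx_exp X) = 1.
Proof.
move=> nX; pose C (F : K -> K) := exists P : {poly K}, forall s, F s = P.[s].
have hC : ring_class C.
  split=> [F1 F2 e [P hP]|c|F1 F2 [P hP] [Q hQ]|F1 F2 [P hP] [Q hQ]].
  - by exists P => s; rewrite -e.
  - by exists c%:P => s; rewrite hornerC.
  - by exists (P + Q) => s; rewrite hornerD hP hQ.
  - by exists (P * Q) => s; rewrite hornerM hP hQ.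
have Cid : C id by exists 'X => s; rewrite hornerX.
have CN : C (fun s => - s) by exists (- 'X) => s; rewrite hornerN hornerX.
have [P hP] := rc_det hC (rcmx_exp hC X Cid).
have [Q hQ] := rc_det hC (rcmx_exp hC X CN).
have PQ : P * Q = 1.
  apply: poly_fun_inj => s _; rewrite hornerM hornerC -hP -hQ -det_mulmx.
  by rewrite scaleNr mx_expNK ?det1 //; apply: nilpZ.
have : P \is a GRing.unit by apply/unitrPr; exists Q.
rewrite poly_unitE => /andP [/eqP/eqP/size_poly1P [c c0 Pc] _].
have := hP 1; rewrite scale1r => ->; have := hP 0; rewrite scale0r mx_exp0 det1.
by rewrite Pc !hornerC.
Qed.

Lemma mx_exp_conj n (A X : 'M[K]_n) : A \in unitmx -> nilp X ->
  nilp (A *m X *m invmx A) /\ A *m mx_exp X *m invmx A = mx_exp (A *m X *m invmx A).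
Proof.
move=> uA nX; have nY : nilp (A *m X *m invmx A).
  case: nX => k Xk; exists k.
  have -> : (A *m X *m invmx A) ^+ k = A *m X ^+ k *m invmx A; last by rewrite Xk mulmx0 mul0mx.
  elim: k {Xk} => [|k IH]; first by rewrite !expr0 mulmx1 mulmxV.
  by rewrite !exprS IH -!mulmxE !mulmxA mulmxKV.
split=> //; rewrite -(mx_exp_intertwine nY nX (B := A)) ?mulmxK //.
by rewrite -mulmxA mulVmx ?mulmx1.
Qed.

Lemma exp1_nilp n (X : 'M[K]_n) : nilp X -> (forall s, mx_exp (s *: X) = 1%:M) -> X = 0.
Proof.
move=> nX h; have h0 : mpder (fun s => mx_exp (s *: X)) (fun _ => 0).
  by apply: mpder_ext (mpderC 1%:M) => // s; rewrite h.
by have := mpder_uniq (mpder_mx_exp nX) h0 0; rewrite scale0r mx_exp0 mul1mx.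
Qed.

End ExpDet.

Section E7Group.
Variables (K : numClosedFieldType) (n : nat).
Local Notation zK := (zK K).
Implicit Types (G T B : set 'M[K]_n) (alpha omega : 'I_7 -> 'M[K]_n -> K).

Definition gens (e f : nat -> 'M[K]_n) (c : nat) := if (c < 7)%N then e c else if (c < 14)%N then f (c - 7)%N else 0.

(** The facts about the root datum that are used from here on. [tau j] is the cocharacter dual to
    [omega j], and its derivative is the coroot [h_j]. Generators and cocharacters are indexed by
    [nat] to match the model. *)
Record e7_data G T B alpha omega (e f : nat -> 'M[K]_n) (tau : nat -> K -> 'M[K]_n) : Prop := E7Data {
  e7_alg : algebraic_group G;
  e7_TG : T `<=` G;
  e7_Tgrp : mx_group T;
  e7_Tab : abelian_mx T;
  e7_rel : chevalley_rel e f;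
  e7_e0 : forall k, (k < 7)%N -> e k != 0;
  e7_B : forall k, lie_algebra B (e k);
  e7_lie : lie_algebra G = range (phi e f);
  e7_nilp : forall c, nilp (gens e f c);
  e7_gen : G = exp_group (gens e f);
  e7_tauT : forall j s, s != 0 -> T (tau j s);
  e7_tauM : forall j s t, s != 0 -> t != 0 -> tau j (s * t) = tau j s *m tau j t;
  e7_tau_lmx : forall j, (j < 7)%N -> lmx (tau j) (lie_bracket (e j) (f j));
  e7_omega : forall i j s, (j < 7)%N -> s != 0 -> omega i (tau j s) = s ^+ (val i == j);
  e7_Tgen : forall t, T t -> exists2 z : nat -> K, (forall j, z j != 0) &
    t = \big[mulmx/1%:M]_(j < 7) tau j (z j);
  e7_Te : forall t k, T t -> (k < 7)%N -> t *m e k *m invmx t = alpha (inord k) t *: e k;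
  e7_Tf : forall t k, T t -> (k < 7)%N -> t *m f k *m invmx t = (alpha (inord k) t)^-1 *: f k;
  e7_alpha0 : forall t k, T t -> alpha k t != 0;
  e7_alpha : forall j k s, (j < 7)%N -> (k < 7)%N -> s != 0 ->
    alpha (inord k) (tau j s) = s ^ int_of_Z (cz j k) }.

Lemma cartan_cz (i j : 'I_7) : E7_cartan i j = int_of_Z (cz i j).
Proof.
rewrite mxE /cz (inj_eq val_inj).
by case: ifP => // _; case: ifP.
Qed.

(** The generated group is closed, connected and nontrivial. Its Lie algebra contains the [x c],
    hence all of Lie(G), and so the logarithms of the conjugates of its generators; this makes it
    normal, and simplicity of [G] concludes. *)
Lemma exp_group_simple G (x : nat -> 'M[K]_n) : simple_algebraic_group G ->
  (forall c, nilp (x c)) -> (forall c, lie_algebra G (x c)) ->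
  (exists c, x c != 0) ->
  (forall L, lie_subalgebra L -> (forall c, L (x c)) -> lie_algebra G `<=` L) ->
  G = exp_group x.
Proof.
move=> [aG cG nabG simpG] nx Lx [c xc0] genL; pose N := exp_group x.
have [gN clN] : algebraic_group N := exp_group_algebraic nx.
have gG : mx_group G by case: aG.
have NG : N `<=` G.
  apply: gen_min => // _ [d _ [s _ <-]]; exact: exp_in_group.
have LN d : lie_algebra N (x d) by apply: lie_exp => // s; apply: exp_group_exp.
have [|||e|//] := simpG N.
- by split.
- exact: exp_group_connected.
- split=> // A X GA; have uA := mxg_unit gG GA.
  apply: (@gen_ind _ _ (exp_curves x) (fun X => N (A *m X *m invmx A))).
  + exact: exp_curves_unit.
  + by rewrite mulmx1 mulmxV //; apply: (mxg1 gN).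
  + move=> Y _ NY [d _ [s _ <-]] NAY.
    have nd : nilp (s *: x d) by apply: nilpZ.
    have [nY eY] := mx_exp_conj uA nd.
    have NE : N (A *m mx_exp (s *: x d) *m invmx A).
      rewrite eY -[mx_exp _]/(mx_exp _) -[_ *m _ *m invmx A]scale1r; apply: exp_in_group => //.
      apply: (genL _ (lie_subalg gN)) => //.
      by apply: lie_Ad => //; apply: lieZ.
    have e1 Z : A *m (Y *m Z) *m invmx A = (A *m Y *m invmx A) *m (A *m Z *m invmx A).
      by rewrite !mulmxA mulmxKV.
    rewrite !e1; split; first exact: (mxgM gN).
    apply: (mxgM gN) => //; have := mxgV gN NE.
    rewrite !invmxM ?unitmx_inv ?mulmx_unit ?mx_exp_unit //.
    by rewrite invmxK mulmxA.
- exfalso; move: xc0; rewrite (@exp1_nilp _ _ (x c)) ?eqxx // => s.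
  have : N (mx_exp (s *: x c)) by apply: exp_group_exp.
  by rewrite e.
Qed.

(* Differentiates c(s) Y c(s)^-1 = s^m Y at s = 1. *)
Lemma lmx_weight (c : K -> 'M[K]_n) X Y (m : int) : lmx c X -> c 1 = 1%:M ->
  (forall s, s != 0 -> c s \in unitmx) ->
  (forall s, s != 0 -> c s *m Y *m invmx (c s) = s ^ m *: Y) -> lie_bracket X Y = m%:~R *: Y.
Proof.
move=> lX c1 uc hY; have l1 := lmxM lX (lmxC Y).
have l2 : lmx (fun s => (s ^ m *: 1%:M) *m Y *m c s) (m%:~R *: Y + Y *m X).
  have lm : lmx (fun s => s ^ m *: (1%:M : 'M[K]_n)) (m%:~R *: 1%:M).
    move=> a b; have := lderZ ((1%:M : 'M[K]_n) a b) (lder_exprz K m).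
    have mE (z : K) : (z *: (1%:M : 'M[K]_n)) a b = (1%:M : 'M[K]_n) a b * z by rewrite mxE mulrC.
    by rewrite mE; apply: lder_ext => s _; rewrite mE.
  have := lmxM (lmxM lm (lmxC Y)) lX.
  rewrite mulmx0 addr0 c1 mulmx1 exp1rz scale1r mul1mx.
  by rewrite -scalemxAl mul1mx.
have : X *m Y + 0 = m%:~R *: Y + Y *m X.
  have := lmx_uniq l1; rewrite c1 mul1mx addr0; apply.
  move=> a b; apply: lder_ext (l2 a b) => s s0.
  by rewrite -scalemxAl mul1mx -hY // mulmxKV // uc.
by rewrite addr0 /lie_bracket => ->; rewrite addrK.
Qed.

Lemma e7_data_exists G T B alpha omega :
  simple_algebraic_group G -> maximal_torus G T ->
  simple_roots E7_cartan G T B alpha -> fundamental_weights E7_cartan T alpha omega ->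
  simply_connected T omega ->
  exists e f tau, e7_data G T B alpha omega e f tau.
Proof.
move=> sG [TG torT _] [chA [e' [f' [re rh rs Lgen]]]] [chO alO] scT.
have aG : algebraic_group G by case: sG.
have gG : mx_group G by case: aG.
have gT : mx_group T by case: torT => [[]].
pose e k := e' (inord k); pose f k := f' (inord k).
have ordE k (k7 : (k < 7)%N) : nat_of_ord (inord k : 'I_7) = k by rewrite inordK.
have cE (i j : nat) : (i < 7)%N -> (j < 7)%N -> (E7_cartan (inord i) (inord j))%:~R = zK (cz i j).
  by move=> i7 j7; rewrite cartan_cz !ordE.
have rel : chevalley_rel e f.
  split=> i j i7 j7.
  - by have [] := rh (inord i) (inord j).
  - by have [_ h _] := rh (inord i) (inord j); rewrite h cE.
  - by have [_ _ h] := rh (inord i) (inord j); rewrite h cE // scaleNr.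
  - move=> ij; have [|h _ _ //] := rs (inord i) (inord j).
    by rewrite -(inj_eq val_inj) /= !ordE.
have e0 k : e k != 0 by have [_ _ h _] := re (inord k).
have Le k : lie_algebra G (e k) by have [[]] := re (inord k).
have Lf k : lie_algebra G (f k) by have [_ _ _ []] := re (inord k).
have ne k : nilp (e k).
  apply: (@lie_nilp _ _ _ (lie_bracket (e k) (f k))).
  have [_ h _] := rh (inord k) (inord k); rewrite h cartan_cz /cz eqxx.
  by [].
have nf k : nilp (f k).
  apply: (@lie_nilp _ _ _ (- lie_bracket (e k) (f k))).
  have [_ _ h] := rh (inord k) (inord k); rewrite brNl h cartan_cz /cz eqxx scaleNr opprK.
  by [].
have Lphi : lie_algebra G = range (phi e f).
  rewrite -lie_phi // Lgen; congr (smallest _ (_ `|` _)); apply/seteqP; split=> Y.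
  - by move=> [k _ <-]; exists k => //=; rewrite /e inord_val.
  - by move=> [k _ <-]; exists (inord k).
  - by move=> [k _ <-]; exists k => //=; rewrite /f inord_val.
  - by move=> [k _ <-]; exists (inord k).
have n0 : nilp (0 : 'M[K]_n) by exists 1%N; rewrite expr1.
have ng c : nilp (gens e f c) by rewrite /gens; case: ifP => // _; case: ifP.
have [tau' [tauT tauX tauM tauO tauG]] := one_param_subgroups torT chO scT.
pose tau j := tau' (inord j).
have tau1 j : tau j 1 = 1%:M.
  have T1 : T (tau j 1) by apply: tauT; apply: oner_neq0.
  have := tauM (inord j) 1 1 (oner_neq0 _) (oner_neq0 _); rewrite mulr1 -/(tau j) => h.
  by rewrite -[LHS](mulKmx (mxg_unit gT T1)) -h mulVmx // (mxg_unit gT T1).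
have alT j k s : (j < 7)%N -> (k < 7)%N -> s != 0 ->
    alpha (inord k) (tau j s) = s ^ int_of_Z (cz j k).
  move=> j7 k7 s0; rewrite alO; last exact: tauT.
  rewrite /char_comb (bigD1 (inord j)) //= big1 => [|i ij].
    by rewrite tauO // eqxx expr1 mulr1 mxE cartan_cz !ordE.
  by rewrite tauO // (negbTE ij) expr0 exp1rz.
have Te t k : T t -> t *m e k *m invmx t = alpha (inord k) t *: e k.
  by move=> Tt; have [[_ h] _ _ _] := re (inord k); apply: h.
have Tf t k : T t -> t *m f k *m invmx t = (alpha (inord k) t)^-1 *: f k.
  by move=> Tt; have [_ _ _ [_ h]] := re (inord k); apply: h.
have tauL j : (j < 7)%N -> lmx (tau j) (lie_bracket (e j) (f j)).
  move=> j7; have [X lX] := tauX (inord j); rewrite -/(tau j) in lX.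
  (* The derivative of [tau j] and the coroot [h_j] have the same brackets with all [e_k] and [f_k].
     Their difference lies in Lie(G), where [model_center] makes it zero. *)
  suff <- : X = lie_bracket (e j) (f j) by [].
  have LX : lie_algebra G X by apply: lie_curve lX _ (tau1 j) => s s0; apply/TG/tauT.
  have : lie_algebra G (- 1 *: lie_bracket (e j) (f j) + X).
    by apply: lie_subspace => //; apply: lie_br.
  rewrite Lphi => -[c _ hc]; suff c0 : c = 0.
    by move: hc; rewrite c0 phi0 scaleN1r => /esym/eqP; rewrite addrC subr_eq0 => /eqP.
  have hj k : (k < 7)%N -> lie_bracket (phi e f c) (e k) = 0 /\ lie_bracket (phi e f c) (f k) = 0.
    move=> k7; case: (rel) => _ he hf _; rewrite hc !brDl scaleN1r !brNl he // hf // opprK.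
    rewrite (@lmx_weight (tau j) X (e k) (int_of_Z (cz j k))) //; first last.
    - by move=> s s0; rewrite Te ?alT //; apply: tauT.
    - by move=> s s0; apply: (mxg_unit gT); apply: tauT.
    rewrite (@lmx_weight (tau j) X (f k) (- int_of_Z (cz j k))) //; first last.
    - by move=> s s0; rewrite Tf ?alT ?invr_expz //; apply: tauT.
    - by move=> s s0; apply: (mxg_unit gT); apply: tauT.
    by rewrite addNr mulrNz scaleNr subrr.
  apply: model_center => k k7; have [h1 h2] := hj k k7.
  by split; apply: (phi_eq0 rel) => //; rewrite ?phi_E ?phi_F // br_anti ?h1 ?h2 oppr0.
exists e, f, tau; split=> //.
- exact: torus_abelian.
- by move=> k; have [_ h _ _] := re (inord k).
- apply: exp_group_simple => //.
  + by move=> c; rewrite /gens; case: ifP => // _; case: ifP => // _; apply: lie0.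
  + by exists 0%N; apply: e0.
  + rewrite Lgen => L sL LX Y; apply; split=> // Z [] [k _ <-].
      by have := LX k; rewrite /gens ltn_ord /e inord_val.
    have := LX (7 + k)%N; rewrite /gens ltnNge leq_addr /= addKn /f inord_val.
    by rewrite -[14%N]/(7 + 7)%N ltn_add2l ltn_ord.
- by move=> j s s0; apply: tauT.
- by move=> j s t s0 t0; apply: tauM.
- by move=> i j s j7 s0; rewrite tauO // -(inj_eq val_inj) /= ordE.
- move=> t Tt; exists (fun j => omega (inord j) t).
    by move=> j; have [_ h _] := chO (inord j); apply: h.
  rewrite [LHS](tauG t Tt); apply: eq_bigr => j _.
  by rewrite /tau inord_val.
- by move=> t k Tt _; apply: Te.
- by move=> t k Tt _; apply: Tf.
- by move=> t k Tt; have [_ h _] := chA k; apply: h.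
Qed.

End E7Group.

(** * The invariant form and the adjoint representation *)

Section ModelForm.
Variable K : numClosedFieldType.
Local Notation zK := (zK K).

Lemma op_cube : all (fun k => all (fun i =>
   let p := opE k i in let q := opE k p.1 in let r := opE k q.1 in
   let p' := opF k i in let q' := opF k p'.1 in let r' := opF k q'.1 in
   Z.eqb (Z.mul p.2 (Z.mul q.2 r.2)) Z0 && Z.eqb (Z.mul p'.2 (Z.mul q'.2 r'.2)) Z0)
  (iota 0 133)) (iota 0 7).
Proof. by vm_compute. Qed.

Lemma opmx_nilp op : (forall i, (i < 133)%N -> ((op i).1 < 133)%N) ->
  (forall i, (i < 133)%N -> Z.mul (op i).2 (Z.mul (op (op i).1).2 (op (op (op i).1).1).2) = Z0) ->
  opmx K op ^+ 3 = 0.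
Proof.
move=> r op0; apply: mx_ext => i i133; rewrite mul0mx 2!exprS expr1 -!mulmxE -!mulmxA.
rewrite (opmx_dl _ op i133) mulmx_mono opmx_dl ?r // -scalemxAr mulmx_mono opmx_dl ?r //.
by rewrite /mono !scalerA -!zKM -Z.mul_assoc op0 // zK0 scale0r.
Qed.

Lemma Emx_nilp k : (k < 7)%N -> nilp (Emx K k).
Proof.
move=> k7; exists 3%N; apply: opmx_nilp => i i133; first by have [] := op_lt k7 i133.
by have /allP2/(_ k k7)/allP2/(_ i i133)/andP [/Z.eqb_eq] := op_cube.
Qed.

Lemma Fmx_nilp k : (k < 7)%N -> nilp (Fmx K k).
Proof.
move=> k7; exists 3%N; apply: opmx_nilp => i i133; first by have [] := op_lt k7 i133.
by have /allP2/(_ k k7)/allP2/(_ i i133)/andP [_ /Z.eqb_eq] := op_cube.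
Qed.

(* The invariant form: the Cartan matrix on the h_i, and +-1 on pairs of
   opposite root vectors. *)
Definition jz (i j : nat) : Z :=
  if (i < 7)%N then if (j < 7)%N then cz i j else Z0 else
  if (j < 7)%N then Z0 else
  if (i + 63 == j)%N then (if odd (rt_ht (i - 7)) then Z.one else Z.opp Z.one) else
  if (j + 63 == i)%N then (if odd (rt_ht (j - 7)) then Z.one else Z.opp Z.one) else Z0.

Lemma jz_inv : all (fun k => all (fun i => let p := opE k i in let p' := opF k i in
  all (fun j => let q := opE k j in let q' := opF k j in
   Z.eqb (Z.add (Z.mul p.2 (jz p.1 j)) (Z.mul q.2 (jz i q.1))) Z0 &&
   Z.eqb (Z.add (Z.mul p'.2 (jz p'.1 j)) (Z.mul q'.2 (jz i q'.1))) Z0)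
  (iota 0 133)) (iota 0 133)) (iota 0 7).
Proof. by vm_compute. Qed.

Definition Jmx : 'M[K]_133 := \matrix_(i, j) zK (jz i j).

Lemma dl_entry (A : 'M[K]_133) (i j : 'I_133) : (dl K i)^T *m A *m dl K j = (A i j)%:M.
Proof.
apply/matrixP=> a b; rewrite !ord1 !mxE eqxx mulr1n (bigD1 j) //= big1 => [|l lj].
  rewrite !mxE eqxx mulr1 addr0 (bigD1 i) //= big1 => [|l li]; rewrite !mxE.
    by rewrite eqxx mul1r addr0.
  by rewrite (_ : (nat_of_ord i == l) = false) ?mul0r //; apply/negbTE; rewrite eq_sym.
by rewrite [dl K j l 0]mxE (_ : (nat_of_ord j == l) = false) ?mulr0 //; apply/negbTE; rewrite eq_sym.
Qed.

Lemma Jmx_inv op : (forall i, (i < 133)%N -> ((op i).1 < 133)%N) ->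
  (forall i j, (i < 133)%N -> (j < 133)%N ->
     Z.add (Z.mul (op i).2 (jz (op i).1 j)) (Z.mul (op j).2 (jz i (op j).1)) = Z0) ->
  (opmx K op)^T *m Jmx = Jmx *m (- opmx K op).
Proof.
move=> r inv; apply/eqP; rewrite mulmxN -addr_eq0; apply/eqP/matrixP=> i j.
rewrite [RHS]mxE; have := dl_entry ((opmx K op)^T *m Jmx + Jmx *m opmx K op) i j.
move=> /matrixP /(_ 0 0); rewrite [(_ %:M) _ _]mxE eqxx mulr1n => <-.
rewrite mulmxDr mulmxDl !mulmxA -trmx_mul -!mulmxA !opmx_dl // /mono.
rewrite linearZ /= -scalemxAl -!scalemxAr mulmxA.
have ri := r i (ltn_ord i); have rj := r j (ltn_ord j).
rewrite -[in (op i).1](@inordK 132 (op i).1) // -[in (op j).1](@inordK 132 (op j).1) //.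
rewrite mulmxA !dl_entry !mxE eqxx !mulr1n !inordK // -!zKM -zKD inv //.
Qed.

Lemma Jmx_E k : (k < 7)%N -> (Emx K k)^T *m Jmx = Jmx *m (- Emx K k).
Proof.
move=> k7; apply: Jmx_inv => [i i133|i j i133 j133]; first by have [] := op_lt k7 i133.
by have /allP2/(_ k k7)/allP2/(_ i i133)/allP2/(_ j j133)/andP [/Z.eqb_eq] := jz_inv.
Qed.

Lemma Jmx_F k : (k < 7)%N -> (Fmx K k)^T *m Jmx = Jmx *m (- Fmx K k).
Proof.
move=> k7; apply: Jmx_inv => [i i133|i j i133 j133]; first by have [] := op_lt k7 i133.
by have /allP2/(_ k k7)/allP2/(_ i i133)/allP2/(_ j j133)/andP [_ /Z.eqb_eq] := jz_inv.
Qed.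

Lemma mx_exp_tr m (X : 'M[K]_m) : (mx_exp X)^T = mx_exp X^T.
Proof.
rewrite /mx_exp linear_sum /=; apply: eq_bigr => k _; rewrite linearZ /=; congr (_ *: _).
elim: (k : nat) => [|j IH]; first by rewrite !expr0 trmx1.
by rewrite exprS exprSr -!mulmxE trmx_mul IH.
Qed.

Lemma nilp_tr m (X : 'M[K]_m) : nilp X -> nilp X^T.
Proof.
case=> k Xk; exists k; rewrite -[RHS]trmx0 -Xk; elim: k {Xk} => [|j IH].
  by rewrite !expr0 trmx1.
by rewrite exprS exprSr -!mulmxE trmx_mul IH.
Qed.

Lemma Jmx_exp m (X J : 'M[K]_m) : nilp X -> X^T *m J = J *m (- X) ->
  (mx_exp X)^T *m J *m mx_exp X = J.
Proof.
move=> nX XJ; rewrite mx_exp_tr (mx_exp_intertwine (nilp_tr nX) (nilpN nX) XJ).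
by rewrite -mulmxA mx_expKN ?mulmx1.
Qed.

End ModelForm.

Section AdjointAction.
Variables (K : numClosedFieldType) (n : nat).
Variables (G T B : set 'M[K]_n) (alpha omega : 'I_7 -> 'M[K]_n -> K).
Variables (e f : nat -> 'M[K]_n) (tau : nat -> K -> 'M[K]_n).
Hypothesis D : e7_data G T B alpha omega e f tau.
Local Notation zK := (zK K).
Local Notation X := (adX e f).
Local Notation phi := (phi e f).
Let rel := e7_rel D.
Let e0 := e7_e0 D.

Lemma e7_grp : mx_group G. Proof. by case: (e7_alg D). Qed.
Let gG := e7_grp.

Lemma e7_det A : G A -> \det A = 1.
Proof.
rewrite (e7_gen D); apply: (@gen_ind _ _ _ (fun A => \det A = 1)).
- apply: exp_curves_unit; exact: e7_nilp D.
- exact: det1.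
- move=> Y _ _ [c _ [s _ <-]] dY; rewrite !det_mulmx det_inv dY.
  by rewrite det_mx_exp ?invr1 ?mulr1 //; apply/nilpZ/(e7_nilp D).
Qed.

Lemma e7_invmx A : G A -> invmx A = \adj A.
Proof. by move=> GA; rewrite /invmx (mxg_unit gG GA) e7_det // invr1 scale1r. Qed.

Lemma e7_irr : irr G.
Proof. by rewrite (e7_gen D); apply: exp_group_irr; apply: e7_nilp D. Qed.

Lemma e7_ind (Q : 'M[K]_n -> Prop) : Q 1%:M ->
  (forall A c s, G A -> (c < 14)%N -> Q A -> Q (A *m mx_exp (s *: gens e f c))) ->
  forall A, G A -> Q A.
Proof.
move=> Q1 QM'; have QM A c s : G A -> Q A -> Q (A *m mx_exp (s *: gens e f c)).
  case: (ltnP c 14) => c14 GA QA; first exact: QM'.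
  have -> : gens e f c = 0 by rewrite /gens; case: ltnP => [|_]; [lia | case: ltnP => [|//]; lia].
  by rewrite scaler0 mx_exp0 mulmx1.
rewrite (e7_gen D); apply: (@gen_ind _ _ _ Q) => //.
  apply: exp_curves_unit; exact: e7_nilp D.
move=> A _ GA [c _ [s _ <-]] QA; have {}GA : G A by rewrite (e7_gen D).
split; first exact: QM.
rewrite mx_exp_inv; last by apply/nilpZ/(e7_nilp D).
by rewrite -scaleNr; apply: QM.
Qed.

Lemma e7_exp c s : G (mx_exp (s *: gens e f c)).
Proof. rewrite (e7_gen D); exact: exp_group_exp. Qed.

Lemma e7_lieX c : lie_algebra G (phi c).
Proof. by rewrite (e7_lie D); exists c. Qed.

Definition Phi : 'M[K]_(133, n * n) := \matrix_i mxvec (X i).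

Lemma mxvec_phi c : mxvec (phi c) = c^T *m Phi.
Proof.
rewrite mulmx_sum_row /Defs.lie_bracket /phi linear_sum /=; apply: eq_bigr => i _.
by rewrite linearZ /= rowK mxE.
Qed.

Lemma Phi_free : row_free Phi.
Proof.
apply: inj_row_free => v v0; have : phi v^T = 0.
  by apply: (can_inj mxvecK); rewrite mxvec_phi trmxK v0 linear0.
by move/(phi_eq0 rel e0)/(congr1 trmx); rewrite trmxK trmx0.
Qed.

(** Coordinates in the basis [X i], extended linearly to all matrices by a pseudo-inverse. *)
Definition coordg (Y : 'M[K]_n) : 'cV[K]_133 := (mxvec Y *m pinvmx Phi)^T.

Lemma coordgK c : coordg (phi c) = c.
Proof. by rewrite /coordg mxvec_phi -mulmxA mulmxVp ?mulmx1 ?trmxK // Phi_free. Qed.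

(** The adjoint representation of [G] in model coordinates. Elements of [G] have determinant 1, so
    the adjugate is the inverse, and every entry is a polynomial function on all matrices. *)
Definition adm (A : 'M[K]_n) : 'M[K]_133 := \matrix_(i, j) coordg (A *m X j *m \adj A) i 0.

Lemma phi_Ad A c : G A -> exists d, A *m phi c *m invmx A = phi d.
Proof.
move=> GA; have : lie_algebra G (A *m phi c *m invmx A) by apply: lie_Ad => //; apply: e7_lieX.
by rewrite (e7_lie D) => -[d _ <-]; exists d.
Qed.

Lemma phi_adm A c : G A -> phi (adm A *m c) = A *m phi c *m invmx A.
Proof.
move=> GA; rewrite {1}(colE_dl c) mulmx_sumr phi_sum.
rewrite {2}/phi mulmx_sumr mulmx_suml; apply: eq_bigr => j _.
rewrite -!scalemxAr -scalemxAl phiZ; congr (_ *: _).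
have [d hd] := phi_Ad (dl K j) GA; rewrite phi_dl // in hd; rewrite hd; congr phi.
apply/colP=> i; rewrite mxE (bigD1 j) //= big1 => [|l lj]; rewrite [dl K j _ 0]mxE.
  by rewrite eqxx mulr1 addr0 [adm A i j]mxE -e7_invmx // hd coordgK.
by rewrite (_ : (nat_of_ord j == l) = false) ?mulr0 //; apply/negbTE; rewrite eq_sym.
Qed.

Lemma phi_mx_inj (M N : 'M[K]_133) : (forall c, phi (M *m c) = phi (N *m c)) -> M = N.
Proof. by move=> h; apply: mx_ext => j _; apply: (phi_inj rel e0). Qed.

Lemma adm_uniq A (M : 'M[K]_133) : G A -> (forall c, phi (M *m c) = A *m phi c *m invmx A) -> adm A = M.
Proof. by move=> GA h; apply: phi_mx_inj => c; rewrite phi_adm. Qed.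

Lemma adm1 : adm 1%:M = 1%:M.
Proof. by apply: adm_uniq => [|c]; [exact: mxg1 | rewrite invmx1 !mul1mx mulmx1]. Qed.

Lemma admM A A' : G A -> G A' -> adm (A *m A') = adm A *m adm A'.
Proof.
move=> GA GA'; apply: adm_uniq => [|c]; first exact: (mxgM gG).
rewrite -mulmxA !phi_adm // invmxM ?(mxg_unit gG) //.
by rewrite !mulmxA.
Qed.

Lemma adm_pmx : pmx adm.
Proof.
move=> i j; have : pmx (fun A : 'M[K]_n => (mxvec (A *m X j *m \adj A) *m pinvmx Phi)^T).
  apply/pmx_tr/pmxM; last exact: pmxC.
  move=> a k; case/mxvec_indexP: k => k l; rewrite ord1.
  have h : pmx (fun A : 'M[K]_n => A *m X j *m \adj A).
    apply: pmxM; first by apply: pmxM; [exact: pmx_id | exact: pmxC].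
    apply: pmx_adj; exact: pmx_id.
  by apply: pfun_ext (h k l) => A; rewrite mxvecE.
by move=> h; apply: pfun_ext (h i 0) => A; rewrite [RHS]mxE.
Qed.

Lemma adm_rep S : S `<=` G -> is_rep S adm.
Proof.
move=> SG; split; [|exact: adm1|by move=> A A' SA SA'; apply: admM; apply: SG].
apply: rmx_pmx; exact: adm_pmx.
Qed.

Lemma mpder_phi (c c' : K -> 'cV[K]_133) : mpder c c' -> mpder (fun s => phi (c s)) (fun s => phi (c' s)).
Proof.
move=> h; have := @mpder_sum K n n 'I_133 (index_enum _) xpredT
  (fun i s => c s i 0 *: X i) (fun i s => c' s i 0 *: X i + c s i 0 *: 0).
case/(_ _)/Wrap => [i|{}h]; first by apply: mpderZ (h i 0) (mpderC _).
apply: mpder_ext h => s //; apply: eq_bigr => i _; by rewrite scaler0 addr0.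
Qed.

(** The curve [exp (- s Y) phi (exp (s M) c) exp (s Y)] has derivative zero. This is
    [Ad (exp Y) = exp (ad Y)]. *)
Lemma exp_ad (Y : 'M[K]_n) (M : 'M[K]_133) c : nilp Y -> nilp M ->
  (forall c, phi (M *m c) = lie_bracket Y (phi c)) ->
  phi (mx_exp M *m c) = mx_exp Y *m phi c *m mx_exp (- Y).
Proof.
move=> nY nM YM; have nY' : nilp (- Y) by apply: nilpN.
have h : mpder (fun s => mx_exp (s *: - Y) *m phi (mx_exp (s *: M) *m c) *m mx_exp (s *: Y)) (fun _ => 0).
  have h1 : mpder (fun s => phi (mx_exp (s *: M) *m c)) (fun s => phi (M *m (mx_exp (s *: M) *m c))).
    apply: mpder_phi; have := mpderM (mpder_mx_exp nM) (mpderC c).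
    apply: mpder_ext => s //=; rewrite mulmx0 addr0 mulmxA; congr (_ *m _).
    apply: mx_exp_intertwine; try exact: nilpZ.
    by rewrite -scalemxAl -scalemxAr.
  apply: mpder_ext (mpderM (mpderM (mpder_mx_exp nY') h1) (mpder_mx_exp nY)) => s //.
  rewrite YM /lie_bracket; set u := phi _.
  have -> : mx_exp (s *: Y) *m Y = Y *m mx_exp (s *: Y).
    apply: mx_exp_intertwine; try exact: nilpZ.
    by rewrite -scalemxAl -scalemxAr.
  rewrite mulmxN mulNmx mulmxBr mulmxDl mulNmx mulmxBl !mulmxA addrA addNr sub0r.
  by rewrite addNr.
have := mpder0_const h 1; rewrite !scale1r !scale0r !mx_exp0 !mul1mx mulmx1 => <-.
rewrite !mulmxA mx_expNK // mul1mx -mulmxA mx_expNK ?mulmx1 //.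
Qed.

Lemma adm_exp (Y : 'M[K]_n) (M : 'M[K]_133) : nilp Y -> nilp M -> G (mx_exp Y) ->
  (forall c, phi (M *m c) = lie_bracket Y (phi c)) -> adm (mx_exp Y) = mx_exp M.
Proof.
move=> nY nM GY YM; apply: adm_uniq => // c.
by rewrite (exp_ad _ nY nM YM) mx_exp_inv.
Qed.

Definition genmx c : 'M[K]_133 := if (c < 7)%N then Emx K c else Fmx K (c - 7).

Lemma gens_ad c d : (c < 14)%N -> phi (genmx c *m d) = lie_bracket (gens e f c) (phi d).
Proof.
move=> c14; rewrite /gens /genmx c14; case: ltnP => c7; first exact: phi_E.
by apply: (phi_F rel); lia.
Qed.

Lemma genmx_nilp c : (c < 14)%N -> nilp (genmx c).
Proof.
move=> c14; rewrite /genmx; case: ltnP => c7; first exact: Emx_nilp.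
by apply: Fmx_nilp; lia.
Qed.

Lemma adm_gens c s : (c < 14)%N -> adm (mx_exp (s *: gens e f c)) = mx_exp (s *: genmx c).
Proof.
move=> c14; apply: adm_exp; [exact/nilpZ/(e7_nilp D)|exact/nilpZ/genmx_nilp|exact: e7_exp|].
by move=> d; rewrite brZl -scalemxAl phiZ gens_ad.
Qed.

Lemma Ad_br (A Y Z : 'M[K]_n) : A \in unitmx ->
  A *m lie_bracket Y Z *m invmx A = lie_bracket (A *m Y *m invmx A) (A *m Z *m invmx A).
Proof.
by move=> uA; rewrite /lie_bracket mulmxBr mulmxBl !mulmxA !mulmxKV.
Qed.

Definition wchar (i : nat) (t : 'M[K]_n) : K :=
  if (i < 7)%N then 1 else
  if (i < 70)%N then \prod_(k < 7) alpha k t ^+ nth 0%N (rt (i - 7)) k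
  else \prod_(k < 7) (alpha k t)^-1 ^+ nth 0%N (rt (i - 70)) k.

Lemma rt_par : all (fun a => rt a == rt_add (par a).1 (rt (par a).2)) (iota 7 56).
Proof. by vm_compute. Qed.

Lemma rt_simpleE : all (fun k => rt k == rt_simple k) (iota 0 7).
Proof. by vm_compute. Qed.

Lemma xp_char (u : 'I_7 -> K) (e' : nat -> 'M[K]_n) A : A \in unitmx ->
  (forall k, (k < 7)%N -> A *m e' k *m invmx A = u (inord k) *: e' k) ->
  forall a, (a < 63)%N -> A *m xp e' a *m invmx A = (\prod_(k < 7) u k ^+ nth 0%N (rt a) k) *: xp e' a.
Proof.
move=> uA ue.
have addE k b : (k < 7)%N ->
    \prod_(l < 7) u l ^+ nth 0%N (rt_add k b) l = u (inord k) * \prod_(l < 7) u l ^+ nth 0%N b l.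
  move=> k7; rewrite (bigD1 (inord k)) //= [in RHS](bigD1 (inord k)) //= mulrA -exprS inordK //.
  rewrite /rt_add nth_set_nth /= eqxx; congr (_ * _); apply: eq_bigr => l lk.
  rewrite nth_set_nth /= (_ : (nat_of_ord l == k) = false) //; apply/negbTE.
  by move: lk; rewrite -(inj_eq val_inj) /= inordK.
move=> a; have [N] := ubnP a; elim: N a => // N IH a; rewrite ltnS => aN a63.
case: (ltnP a 7) => a7.
  have /allP2/(_ a a7)/eqP -> := rt_simpleE.
  rewrite xp_simple // ue // /rt_simple addE //.
  by rewrite big1 ?mulr1 // => l _; rewrite nth_nseq ltn_ord.
have ha : (7 <= a < 63)%N by rewrite a7.
have [h1 h2 _ _] := model_par ha.
rewrite xpE // -scalemxAr -scalemxAl Ad_br // ue // IH; [|lia|lia].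
rewrite brZl brZr !scalerA; have /allP2/(_ a ha)/eqP -> := rt_par.
by rewrite addE // mulrC.
Qed.

Lemma adX_char i t : T t -> (i < 133)%N -> t *m X i *m invmx t = wchar i t *: X i.
Proof.
move=> Tt i133; have ut : t \in unitmx by apply: (mxg_unit gG); apply: (e7_TG D).
rewrite /wchar /adX; case: ifP => i7.
  rewrite Ad_br // (e7_Te D) // (e7_Tf D) // brZl brZr scalerA mulfV ?scale1r //.
  exact: (e7_alpha0 D).
have Te k : (k < 7)%N -> t *m e k *m invmx t = alpha (inord k) t *: e k by move=> k7; apply: (e7_Te D).
have Tf k : (k < 7)%N -> t *m f k *m invmx t = (alpha (inord k) t)^-1 *: f k by move=> k7; apply: (e7_Tf D).
case: ifP => i70; first by apply: (xp_char (u := fun k => alpha k t) ut Te); lia.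
by apply: (xp_char (u := fun k => (alpha k t)^-1) ut Tf); lia.
Qed.

Lemma rt_weight : all (fun j => all (fun a =>
  Z.eqb (tP j a) (foldr (fun k s => Z.add (Z.mul (Z.of_nat (nth 0%N (rt a) k)) (cz j k)) s) Z0 (iota 0 7)))
  (iota 0 63)) (iota 0 7).
Proof. by vm_compute. Qed.

Lemma prod_expz (s : K) (b : seq nat) j : s != 0 ->
  \prod_(k < 7) (s ^ int_of_Z (cz j k)) ^+ nth 0%N b k =
  s ^ int_of_Z (foldr (fun k s => Z.add (Z.mul (Z.of_nat (nth 0%N b k)) (cz j k)) s) Z0 (iota 0 7)).
Proof.
move=> s0; rewrite -(big_mkord xpredT (fun k => (s ^ int_of_Z (cz j k)) ^+ nth 0%N b k)) /index_iota subn0.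
elim: (iota 0 7) => [|k r IH]; first by rewrite big_nil expr0z.
rewrite big_cons IH /= (rmorphD int_of_Z) /= expfzDr //; congr (_ * _).
rewrite (rmorphM int_of_Z) /= mulrC exprnP exprz_exp; congr (_ ^ (_ * _)).
by lia.
Qed.

Lemma wchar_tau i j s : (i < 133)%N -> (j < 7)%N -> s != 0 ->
  wchar i (tau j s) = s ^ int_of_Z (opH j i).
Proof.
move=> i133 j7 s0; rewrite /wchar /opH; case: ifP => i7; first by rewrite expr0z.
have al (k : 'I_7) : alpha k (tau j s) = s ^ int_of_Z (cz j k).
  by rewrite -(e7_alpha D) // inord_val.
have wt a : (a < 63)%N -> \prod_(k < 7) alpha k (tau j s) ^+ nth 0%N (rt a) k = s ^ int_of_Z (tP j a).
  move=> a63; under eq_bigr => k _ do rewrite al.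
  by rewrite prod_expz //; have /allP2/(_ j j7)/allP2/(_ a a63)/Z.eqb_eq <- := rt_weight.
case: ifP => i70; first by apply: wt; lia.
under eq_bigr => k _ do rewrite exprVn.
rewrite prodfV wt ?invr_expz; last by lia.
by rewrite (rmorphN int_of_Z).
Qed.

Lemma adm_T t i : T t -> (i < 133)%N -> adm t *m dl K i = wchar i t *: dl K i.
Proof.
move=> Tt i133; apply: (phi_inj rel e0).
rewrite phi_adm; last exact: (e7_TG D).
by rewrite phi_dl // adX_char // phiZ phi_dl.
Qed.

End AdjointAction.

(** * Root subgroups and generators of H *)

Section RootSubgroups.
Variables (K : numClosedFieldType) (n : nat).
Variables (G T B : set 'M[K]_n) (alpha omega : 'I_7 -> 'M[K]_n -> K).
Variables (e f : nat -> 'M[K]_n) (tau : nat -> K -> 'M[K]_n).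
Hypothesis D : e7_data G T B alpha omega e f tau.
Local Notation zK := (zK K).
Local Notation X := (adX e f).
Local Notation phi := (phi e f).
Local Notation adm := (adm e f).
Let rel := e7_rel D.
Let e0 := e7_e0 D.
Let gG := e7_grp D.

Definition Xmx : nat -> 'M[K]_133 := adX (Emx K) (Fmx K).

Lemma ad_comm (Y Z : 'M[K]_n) (M N : 'M[K]_133) :
  (forall c, phi (M *m c) = lie_bracket Y (phi c)) ->
  (forall c, phi (N *m c) = lie_bracket Z (phi c)) ->
  forall c, phi (lie_bracket M N *m c) = lie_bracket (lie_bracket Y Z) (phi c).
Proof.
move=> hY hZ c; rewrite /(lie_bracket M N) mulmxBl -!mulmxA -scaleN1r addrC phi_lin.
rewrite scaleN1r !(hY, hZ); apply/eqP; rewrite addrC subr_eq; apply/eqP; exact: jacobi.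
Qed.

Lemma ad_scale a (Y : 'M[K]_n) (M : 'M[K]_133) :
  (forall c, phi (M *m c) = lie_bracket Y (phi c)) ->
  forall c, phi (a *: M *m c) = lie_bracket (a *: Y) (phi c).
Proof. by move=> hY c; rewrite -scalemxAl phiZ hY brZl. Qed.

Lemma phi_X i c : (i < 133)%N -> phi (Xmx i *m c) = lie_bracket (X i) (phi c).
Proof.
have h (e' : nat -> 'M[K]_n) (M : nat -> 'M[K]_133) :
    (forall k, (k < 7)%N -> forall c, phi (M k *m c) = lie_bracket (e' k) (phi c)) ->
    forall a, (a < 63)%N -> forall c, phi (xp M a *m c) = lie_bracket (xp e' a) (phi c).
  move=> hM a; have [N] := ubnP a; elim: N a => // N IH a; rewrite ltnS => aN a63.
  case: (ltnP a 7) => a7; first by rewrite !xp_simple //; apply: hM.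
  have ha : (7 <= a < 63)%N by rewrite a7.
  have [h1 h2 _ _] := model_par ha.
  rewrite (xpE M ha) (xpE e' ha).
  apply: (@ad_scale _ (lie_bracket (e' (par a).1) _) (lie_bracket (M (par a).1) _)).
  apply: (@ad_comm (e' (par a).1) _ (M (par a).1)); first exact: hM.
  by apply: IH; lia.
have hE k : (k < 7)%N -> forall c, phi (Emx K k *m c) = lie_bracket (e k) (phi c).
  by move=> k7 d; apply: phi_E.
have hF k : (k < 7)%N -> forall c, phi (Fmx K k *m c) = lie_bracket (f k) (phi c).
  by move=> k7 d; apply: phi_F.
move=> i133; rewrite /Xmx /adX; case: ifP => i7; first by apply: ad_comm => d; [apply: hE | apply: hF].
by case: ifP => i70; apply: h => //; lia.
Qed.

Lemma root_weight : all (fun i => has (fun j => ~~ Z.eqb (opH j i) Z0) (iota 0 7)) (iota 7 126).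
Proof. by vm_compute. Qed.

(** A multiple of some [h_j] acts on [X i] by 2, so [lie_nilp] applies, in the given matrices as
    well as in the model. *)
Lemma root_nilp i : (7 <= i < 133)%N -> nilp (X i) /\ nilp (Xmx i).
Proof.
move=> hi; have /allP2/(_ i hi)/hasP [j] := root_weight.
rewrite mem_iota => j7 /negbTE/Z.eqb_neq nz; case/andP: hi => i7 i133.
have zn : zK (opH j i) != 0 by apply/eqP => /zK_eq0.
split; first apply: (@lie_nilp _ _ _ ((2%:R / zK (opH j i)) *: X j)).
  by rewrite brZl (adX_H rel) // scalerA divfK.
apply: (@lie_nilp _ _ _ ((2%:R / zK (opH j i)) *: Xmx j)).
apply: (phi_mx_inj D) => c; rewrite brZl -!scalemxAl !phiZ phi_X //.
have j133 : (j < 133)%N by move: j7 => /=; lia.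
have hX k : (k < 133)%N -> forall c, phi (Xmx k *m c) = lie_bracket (X k) (phi c).
  by move=> k133 d; apply: phi_X.
rewrite (ad_comm (hX j j133) (hX i i133)) (adX_H rel) // brZl scalerA divfK //.
Qed.

Lemma lie_X i : (i < 133)%N -> lie_algebra G (X i).
Proof. by move=> i133; rewrite -(phi_dl _ _ i133); apply: (e7_lieX D). Qed.

Lemma root_exp i s : (7 <= i < 133)%N -> G (mx_exp (s *: X i)).
Proof.
move=> hi; have [nX _] := root_nilp hi.
by apply: exp_in_group => //; [exact: e7_alg D | apply: lie_X; case/andP: hi].
Qed.

Lemma adm_root i s : (7 <= i < 133)%N -> adm (mx_exp (s *: X i)) = mx_exp (s *: Xmx i).
Proof.
move=> hi; have [nX nM] := root_nilp hi.
apply: (adm_exp D); [exact: nilpZ | exact: nilpZ | exact: root_exp|].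
by apply: ad_scale => c; apply: phi_X; case/andP: hi.
Qed.

Lemma diag_opmx (d : nat -> Z) (c : 'cV[K]_133) i :
  (opmx K (fun j => (j, d j)) *m c) i 0 = zK (d i) * c i 0.
Proof.
rewrite mxE (bigD1 i) //= big1 => [|l li]; rewrite mxE /=; first by rewrite eqxx addr0.
by rewrite (_ : (nat_of_ord l == i) = false) ?mul0r //; apply/negbTE.
Qed.

Lemma e7_tau1 j : tau j 1 = 1%:M.
Proof.
have T1 : T (tau j 1) by apply: (e7_tauT D); apply: oner_neq0.
have := e7_tauM D j (oner_neq0 _) (oner_neq0 _); rewrite mulr1 => h.
have uT := mxg_unit (e7_Tgrp D) T1.
by rewrite -[LHS](mulKmx uT) -h mulVmx.
Qed.

Lemma tau_unit j s : s != 0 -> tau j s \in unitmx.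
Proof. by move=> s0; apply: (mxg_unit (e7_Tgrp D)); apply: (e7_tauT D). Qed.

Definition b2 : nat := Eval vm_compute in index [:: 1; 2; 2; 3; 2; 1; 0]%N pos_roots.

(* The basis vectors of the root spaces for beta_1, ..., beta_7 and their opposites. *)
Definition hidx (c : nat) : nat :=
  (if c < 7 then if c == 1 then 7 + b2 else 7 + c
   else if c == 8 then 70 + b2 else 63 + c)%N.

Lemma hidx_rt : all (fun k => (7 <= hidx k < 70)%N && (hidx (7 + k) == hidx k + 63)%N &&
  all (fun j => (if k.+1 == 2 then nth 0 [:: 1; 2; 2; 3; 2; 1; 0] j else (j == k))%N
     == nth 0%N (rt (hidx k - 7)) j) (iota 0 7)) (iota 0 7).
Proof. by vm_compute. Qed.

Lemma hidx_sep : all (fun c => all (fun i => (i == hidx c) ||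
  has (fun j => ~~ Z.eqb (opH j i) (opH j (hidx c))) (iota 0 7)) (iota 0 133)) (iota 0 14).
Proof. by vm_compute. Qed.

Lemma hidx_range c : (c < 14)%N -> (7 <= hidx c < 133)%N.
Proof.
have h : all (fun c => (7 <= hidx c < 133)%N) (iota 0 14) by vm_compute.
by move=> c14; have /allP2/(_ c c14) := h.
Qed.

Lemma A7_char (k : 'I_7) t : T t ->
  char_comb alpha (A7_base k) t = wchar alpha (hidx k) t /\
  char_comb alpha (- A7_base k) t = wchar alpha (hidx (7 + k)) t.
Proof.
move=> Tt; have /allP2/(_ k (ltn_ord k))/andP [/andP [/andP [h7 h70] /eqP e'] /allP2 h] := hidx_rt.
have E (j : 'I_7) : A7_base k 0 j = nth 0%N (rt (hidx k - 7)) j.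
  rewrite -(eqP (h j (ltn_ord j))) /A7_base; case: ifP => k1.
    by rewrite mxE; case: j {h} => [[|[|[|[|[|[|[|]]]]]]]].
  by rewrite mxE eqxx /= -val_eqE /=; case: (_ == _).
have r1 : (hidx k < 7)%N = false by lia.
have r2 : (hidx k + 63 < 7)%N = false by lia.
have r3 : (hidx k + 63 < 70)%N = false by lia.
rewrite /char_comb /wchar e' r1 r2 r3 h70; split; first by apply: eq_bigr => j _; rewrite E.
have -> : (hidx k + 63 - 70 = hidx k - 7)%N by lia.
by apply: eq_bigr => j _; rewrite mxE E -invr_expz exprVn.
Qed.

(** Differentiating the weight along the [tau j] gives the eigenvalues of the [h_j], and these
    separate [X (hidx c)] from all other basis vectors. *)
Lemma wchar_space c chi : (c < 14)%N -> (forall t, T t -> chi t = wchar alpha (hidx c) t) ->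
  root_space G T chi = [set a *: X (hidx c) | a in setT].
Proof.
move=> c14 hchi; have hc := hidx_range c14; have [h7 h133] := andP hc.
apply/seteqP; split=> [Y [LY hY]|_ [a _ <-]]; last first.
  split; first by apply: lieZ; apply: lie_X.
  move=> t Tt; rewrite -scalemxAr -scalemxAl (adX_char D) // hchi //.
  by rewrite !scalerA mulrC.
move: (LY); rewrite (e7_lie D) => -[d _ hd].
have wt j : (j < 7)%N -> Hmx K j *m d = zK (opH j (hidx c)) *: d.
  move=> j7; apply: (phi_inj rel e0); rewrite phi_H // phiZ hd /adX j7.
  apply: (lmx_weight (e7_tau_lmx D j7) (e7_tau1 j)) => s s0; first exact: tau_unit.
  have Ts := e7_tauT D j s0.
  by rewrite hY // hchi // (wchar_tau D).
exists (d (Ordinal h133) 0) => //; rewrite -hd /phi (bigD1 (Ordinal h133)) //= big1 ?addr0 // => i ih.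
have /allP2/(_ c c14)/allP2/(_ i (ltn_ord i))/orP [/eqP e1|/hasP [j]] := hidx_sep.
  by move: ih; rewrite -(inj_eq val_inj) /= e1 eqxx.
rewrite mem_iota => j7 /negbTE/Z.eqb_neq nz.
have /colP /(_ i) := wt j j7; rewrite /Hmx diag_opmx [RHS]mxE => /eqP.
rewrite -subr_eq0 -mulrBl mulf_eq0 => /orP [|/eqP ->]; last by rewrite scale0r.
by rewrite subr_eq0 => /eqP/zK_inj.
Qed.

Definition hexp : set 'M[K]_n := [set mx_exp (p.2 *: X (hidx p.1)) | p in [set p : nat * K | (p.1 < 14)%N]].

Lemma subsystem_H : subsystem_subgroup G T alpha A7_base = generated (T `|` hexp).
Proof.
congr generated; congr (_ `|` _); apply/seteqP; split=> [A [k _ []]|_ [[c a] /= c14 <-]].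
- rewrite /root_subgroup (@wchar_space k) => [||t Tt]; [|by have := ltn_ord k; lia|].
    by move=> [_ [a _ <-] <-]; exists (nat_of_ord k, a) => //=; have := ltn_ord k; lia.
  by have [] := A7_char k Tt.
- rewrite /root_subgroup (@wchar_space (7 + k)) => [||t Tt]; [|by have := ltn_ord k; lia|].
    by move=> [_ [a _ <-] <-]; exists (7 + k, a)%N => //=; have := ltn_ord k; lia.
  by have [] := A7_char k Tt.
case: (ltnP c 7) => c7.
  exists (Ordinal c7) => //; left; exists (a *: X (hidx c)) => //.
  rewrite (@wchar_space c) => [||t Tt]; [by exists a | by [] |].
  by have [] := A7_char (Ordinal c7) Tt.
have c7' : (c - 7 < 7)%N by lia.
exists (Ordinal c7') => //; right; exists (a *: X (hidx c)) => //.
rewrite (@wchar_space c) => [||t Tt]; [by exists a | by [] |].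
by have [_] := A7_char (Ordinal c7') Tt; rewrite /= subnKC.
Qed.

Let H := generated (T `|` hexp).

Lemma H_sub_units : T `|` hexp `<=` @units K n.
Proof.
move=> A [/(mxg_unit (e7_Tgrp D)) //|[[c a] /= c14 <-]]; apply: mx_exp_unit.
by apply: nilpZ; have [] := root_nilp (hidx_range c14).
Qed.

Lemma H_grp : mx_group H. Proof. exact/gen_group/H_sub_units. Qed.

Lemma H_T : T `<=` H. Proof. by move=> t Tt; apply: gen_sub; left. Qed.

Lemma H_exp c s : (c < 14)%N -> H (mx_exp (s *: X (hidx c))).
Proof. by move=> c14; apply: gen_sub; right; exists (c, s). Qed.

Lemma H_G : H `<=` G.
Proof.
apply: gen_min => // A [/(e7_TG D) //|[[c a] /= c14 <-]].
by apply: root_exp; apply: hidx_range.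
Qed.

Lemma H_ind (Q : 'M[K]_n -> Prop) : Q 1%:M ->
  (forall A t, H A -> Q A -> T t -> Q (A *m t)) ->
  (forall A c s, H A -> Q A -> (c < 14)%N -> Q (A *m mx_exp (s *: X (hidx c)))) ->
  forall A, H A -> Q A.
Proof.
move=> Q1 QT QX; apply: gen_ind => //; first exact: H_sub_units.
move=> A C HA [TC|[[c s] /= c14 <-]] QA.
  by split; apply: QT => //; apply: (mxgV (e7_Tgrp D)).
split; first exact: QX.
have [nX _] := root_nilp (hidx_range c14).
rewrite mx_exp_inv; last exact: nilpZ.
by rewrite -scaleNr; apply: QX.
Qed.

End RootSubgroups.

(** * Highest weight vectors and maximal parabolic subgroups *)

Section TangentVectors.
Variables (K : numClosedFieldType) (n : nat).

(** Differentiates an identity valid on [S] along a tangent vector at 1, although the line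
    [1 + (s - 1) Y] leaves [S]. *)
Lemma lie_lder (S : set 'M[K]_n) (F : 'M[K]_n -> K) Y d : pfun F -> (forall A, S A -> F A = 0) ->
  lie_algebra S Y -> lder (fun s => F (1%:M + (s - 1) *: Y)) d -> d = 0.
Proof.
move=> pF F0 /lieE LY ld; have h : vanish S (polf F) by move=> A SA; rewrite polfE ?F0.
have := lder_mxeval (polf F) (lmx_line 1%:M Y); rewrite subrr scale0r addr0 LY // => l0.
by apply: lder_uniq ld _; apply: lder_ext l0 => s _; rewrite polfE.
Qed.

End TangentVectors.

Section Representation.
Variables (K : numClosedFieldType) (n : nat).
Variables (G T B : set 'M[K]_n) (alpha omega : 'I_7 -> 'M[K]_n -> K).
Variables (e f : nat -> 'M[K]_n) (tau : nat -> K -> 'M[K]_n).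
Hypothesis D : e7_data G T B alpha omega e f tau.
Local Notation zK := (zK K).
Local Notation X := (adX e f).
Local Notation phi := (phi e f).
Local Notation adm := (adm e f).
Let rel := e7_rel D.
Let gG := e7_grp D.
Variables (m : nat) (rho : 'M[K]_n -> 'M[K]_m).
Hypothesis hrho : algebraic_hom G (@units K m) rho.

(** The determinant is 1 on [G], which removes the denominators of regular functions. *)
Lemma rho_poly a b : exists p, forall A, G A -> rho A a b = mxeval A p.
Proof.
case: hrho => _ _ /(_ a b) [p [k h]]; exists p => A GA.
by rewrite h // (e7_det D) // expr1n divr1.
Qed.

Definition rp a b : {mpoly K[n * n]} := sval (cid (rho_poly a b)).

Lemma rpE A a b : G A -> mxeval A (rp a b) = rho A a b.
Proof. by move=> GA; rewrite /rp; case: cid => p /= ->. Qed.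

Lemma rhoM A A' : G A -> G A' -> rho (A *m A') = rho A *m rho A'.
Proof. by case: hrho => _ h _; apply: h. Qed.

Lemma rho_unit A : G A -> rho A \in unitmx.
Proof. by case: hrho => h _ _; apply: h. Qed.

Lemma rho1 : rho 1%:M = 1%:M.
Proof.
have u := rho_unit (mxg1 gG); rewrite -[LHS](mulKmx u) -rhoM ?mulmx1 ?mulVmx //; exact: mxg1.
Qed.

Lemma rhoV A : G A -> rho (invmx A) = invmx (rho A).
Proof.
move=> GA; apply: esym; apply: invmx_unique; rewrite -rhoM ?mulmxV ?rho1 //.
  exact: (mxg_unit gG).
exact: (mxgV gG).
Qed.

(** The differential of [rho] at 1, computed from polynomials that represent its entries on [G]. *)
Definition drho (Y : 'M[K]_n) : 'M[K]_m := \matrix_(a, b) dpf (rp a b) 1%:M Y.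

Lemma drho_lin a Y Z : drho (a *: Y + Z) = a *: drho Y + drho Z.
Proof. by apply/matrixP=> i j; rewrite !mxE dpf_lin. Qed.

Lemma drho0 : drho 0 = 0.
Proof. by apply/matrixP=> i j; rewrite !mxE dpf0. Qed.

Lemma drhoZ a Y : drho (a *: Y) = a *: drho Y.
Proof. by have := drho_lin a Y 0; rewrite !addr0 drho0 addr0. Qed.

Lemma lder_rp (c : K -> 'M[K]_n) Y a b : lmx c Y -> c 1 = 1%:M ->
  lder (fun s => mxeval (c s) (rp a b)) (drho Y a b).
Proof. by move=> lc c1; have := lder_mxeval (rp a b) lc; rewrite c1 mxE. Qed.

Let line (Y : 'M[K]_n) s := 1%:M + (s - 1) *: Y.

Lemma lmx_line1 Y : lmx (line Y) Y. Proof. exact: lmx_line. Qed.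
Lemma line1 Y : line Y 1 = 1%:M. Proof. by rewrite /line subrr scale0r addr0. Qed.

Lemma dR_rho A Y a b : G A -> lie_algebra G Y ->
  mxeval A (dR Y (rp a b)) = (rho A *m drho Y) a b.
Proof.
move=> GA LY; apply/eqP; rewrite -subr_eq0; apply/eqP.
pose F C := mxeval (A *m C) (rp a b) - \sum_c rho A a c * mxeval C (rp c b).
apply: (@lie_lder _ _ G F Y) => //.
- apply: pfunB; first by apply: (pfun_ext _ (pfun_trans A 1%:M (rp a b))) => C; rewrite mulmx1.
  by apply: pfun_sum => c; apply: pfunZ; apply: pfun_mxeval.
- move=> C GC; rewrite /F rpE; last exact: (mxgM gG).
  rewrite rhoM // mxE; apply/eqP; rewrite subr_eq0; apply/eqP.
  by apply: eq_bigr => c _; rewrite rpE.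
apply: lderD; first exact: lder_dR (lmx_line1 Y) (line1 Y).
rewrite mxE; apply: lderN; apply: lder_sum => c; apply: lderZ.
exact: lder_rp (lmx_line1 Y) (line1 Y).
Qed.

Lemma dL_rho A Y a b : G A -> lie_algebra G Y ->
  mxeval A (dL Y (rp a b)) = (drho Y *m rho A) a b.
Proof.
move=> GA LY; apply/eqP; rewrite -subr_eq0; apply/eqP.
pose F C := mxeval (C *m A) (rp a b) - \sum_c mxeval C (rp a c) * rho A c b.
apply: (@lie_lder _ _ G F Y) => //.
- apply: pfunB; first by apply: (pfun_ext _ (pfun_trans 1%:M A (rp a b))) => C; rewrite mul1mx.
  by apply: pfun_sum => c; apply: pfunM; [apply: pfun_mxeval | apply: pfunC].
- move=> C GC; rewrite /F rpE; last exact: (mxgM gG).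
  rewrite rhoM // mxE; apply/eqP; rewrite subr_eq0; apply/eqP.
  by apply: eq_bigr => c _; rewrite rpE.
apply: lderD; first exact: lder_dL (lmx_line1 Y) (line1 Y).
rewrite mxE; apply: lderN; apply: lder_sum => c.
rewrite mulrC; apply: lder_ext (lderZ (rho A c b) (lder_rp a c (lmx_line1 Y) (line1 Y))) => s _.
by rewrite mulrC.
Qed.

Lemma drho_Ad A Y : G A -> lie_algebra G Y ->
  drho (A *m Y *m invmx A) = rho A *m drho Y *m invmx (rho A).
Proof.
move=> GA LY; have uA := mxg_unit gG GA.
have : drho (A *m Y *m invmx A) *m rho A = rho A *m drho Y.
  apply/matrixP=> a b; rewrite -dR_rho // -dL_rho //; last exact: lie_Ad.
  by rewrite dRE dLE mulmxKV.
by move=> <-; rewrite mulmxK // rho_unit.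
Qed.

(** The commutator formula [dRR], evaluated at 1 on the entries of [rho]. *)
Lemma drho_br Y Z : lie_algebra G Y -> lie_algebra G Z ->
  drho (lie_bracket Y Z) = lie_bracket (drho Y) (drho Z).
Proof.
have h Y' Z' a b : lie_algebra G Y' -> lie_algebra G Z' ->
    mxeval 1%:M (dR Z' (dR Y' (rp a b))) = (drho Z' *m drho Y') a b.
  move=> LY LZ; apply/eqP; rewrite -subr_eq0; apply/eqP.
  pose F C := mxeval C (dR Y' (rp a b)) - \sum_c mxeval C (rp a c) * drho Y' c b.
  apply: (@lie_lder _ _ G F Z') => //.
  - apply: pfunB; first exact: pfun_mxeval.
    by apply: pfun_sum => c; apply: pfunM; [apply: pfun_mxeval | apply: pfunC].
  - move=> C GC; rewrite /F dR_rho // mxE; apply/eqP; rewrite subr_eq0; apply/eqP.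
    by apply: eq_bigr => c _; rewrite rpE.
  apply: lderD.
    have := lder_dR (dR Y' (rp a b)) 1%:M (lmx_line1 Z') (line1 Z').
    by apply: lder_ext => s _; rewrite mul1mx.
  rewrite mxE; apply: lderN; apply: lder_sum => c.
  rewrite mulrC; apply: lder_ext (lderZ (drho Y' c b) (lder_rp a c (lmx_line1 Z') (line1 Z'))) => s _.
  by rewrite mulrC.
move=> LY LZ; apply/matrixP=> a b; have := dRR Y Z (rp a b) 1%:M.
rewrite !h // dRE mul1mx => e1; rewrite /(lie_bracket (drho Y) _) !mxE -/(lie_bracket Y Z).
by move: e1; rewrite !mxE => ->.
Qed.

(** Both sides solve the same linear differential equation in [s] with value 1 at [s = 0]. *)
Lemma rho_exp Y s : nilp Y -> lie_algebra G Y -> nilp (drho Y) ->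
  rho (mx_exp (s *: Y)) = mx_exp (s *: drho Y).
Proof.
move=> nY LY nd; have GY t : G (mx_exp (t *: Y)) by apply: exp_in_group => //; apply: (e7_alg D).
have := @ode_exp _ _ _ (fun s => rho (mx_exp (s *: Y))) _ nd.
case/(_ _)/Wrap => [a b|/(_ s) ->]; last by rewrite scale0r mx_exp0 rho1 mul1mx.
apply: pder_ext (pder_expR 1%:M (rp a b) nY) => t; first by rewrite mul1mx rpE.
by rewrite mul1mx dR_rho.
Qed.

Variables (i : 'I_7) (v : 'cV[K]_m) (P : set 'M[K]_n).
Hypothesis BG : B `<=` G.
Hypothesis hv : highest_weight_vector T B rho (omega i) v.
Hypothesis hP : P = [set g | G g /\ exists c, rho g *m v = c *: v].

Lemma v_neq0 : v != 0. Proof. by case: hv. Qed.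

Lemma drho_h j : (j < 7)%N -> drho (lie_bracket (e j) (f j)) *m v = (val i == j)%:R *: v.
Proof.
move=> j7; apply/colP=> a; rewrite mxE [RHS]mxE.
have l1 : lder (fun s => \sum_b rho (tau j s) a b * v b 0)
    (\sum_b drho (lie_bracket (e j) (f j)) a b * v b 0).
  apply: lder_sum => b.
  have := lderZ (v b 0) (lder_rp a b (e7_tau_lmx D j7) (e7_tau1 D j)).
  rewrite mulrC; apply: lder_ext => s s0; rewrite mulrC rpE //.
  by apply: (e7_TG D); apply: (e7_tauT D).
apply: lder_uniq l1 _.
have := lderZ (v a 0) (lder_exprz K (val i == j)); rewrite mulrC; apply: lder_ext => s s0.
have Ts := e7_tauT D j s0; case: hv => _ _ /(_ _ Ts) /colP /(_ a).
by rewrite [LHS]mxE (e7_omega D) // [RHS]mxE => ->; rewrite mulrC.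
Qed.

Lemma line_mem (u : 'cV[K]_m) : (forall a b, v a 0 * u b 0 = v b 0 * u a 0) -> exists c, u = c *: v.
Proof.
move=> h; have [a va] : exists a, v a 0 != 0.
  apply: contrapT => nv; have := v_neq0; case/negP; apply/eqP/colP=> a; rewrite mxE.
  by apply/eqP; apply: contrapT => /negP va; apply: nv; exists a.
exists (u a 0 / v a 0); apply/colP=> b; rewrite mxE mulrAC -[LHS](mulKf va) h.
by rewrite mulrC [u a 0 * _]mulrC.
Qed.

Lemma nilp_eigen (N : 'M[K]_m) c : nilp N -> N *m v = c *: v -> N *m v = 0.
Proof.
case=> k Nk Nv; have h j : N ^+ j *m v = c ^+ j *: v.
  elim: j => [|j IH]; first by rewrite !expr0 mul1mx scale1r.
  by rewrite exprSr -mulmxE -mulmxA Nv -scalemxAr IH scalerA -exprS.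
have := h k; rewrite Nk mul0mx => /esym/eqP; rewrite scaler_eq0 (negbTE v_neq0) orbF.
by rewrite expf_eq0 Nv => /andP [_ /eqP ->]; rewrite scale0r.
Qed.

Lemma drho_gens_nilp c : (c < 14)%N -> nilp (drho (gens e f c)).
Proof.
have Lf k : (k < 7)%N -> lie_algebra G (f k).
  by move=> k7; rewrite -(adX_f e) //; apply: (lie_X D); lia.
have Le k : (k < 7)%N -> lie_algebra G (e k).
  by move=> k7; rewrite -(adX_e _ f) //; apply: (lie_X D); lia.
have Lh k : (k < 7)%N -> lie_algebra G (lie_bracket (e k) (f k)).
  by move=> k7; apply: (lie_br gG); [apply: Le | apply: Lf].
move=> c14; rewrite /gens c14; case: ltnP => c7.
  apply: (@lie_nilp _ _ _ (drho (lie_bracket (e c) (f c)))).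
  rewrite -drho_br; [|exact: Lh|exact: Le]; case: (rel) => _ he _ _; rewrite he // drhoZ.
  by rewrite /cz eqxx.
have c7' : (c - 7 < 7)%N by lia.
apply: (@lie_nilp _ _ _ (drho (- 1 *: lie_bracket (e (c - 7)) (f (c - 7))))).
rewrite -drho_br; [|by apply: lieZ; apply: Lh|exact: Lf].
rewrite brZl; case: (rel) => _ _ hf _; rewrite hf // scaleN1r opprK drhoZ.
by rewrite /cz eqxx.
Qed.

(** [B] preserves the line of [v]; this is expressed by minors vanishing on [B] and then
    differentiated. The resulting eigenvalue of [drho (e k)] is 0 by nilpotency. *)
Lemma drho_e k : (k < 7)%N -> drho (e k) *m v = 0.
Proof.
move=> k7; have [c hc] : exists c, drho (e k) *m v = c *: v.
  apply: line_mem => a b; apply/eqP; rewrite -subr_eq0; apply/eqP.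
  pose F C := v a 0 * (\sum_c v c 0 * mxeval C (rp b c)) - v b 0 * (\sum_c v c 0 * mxeval C (rp a c)).
  apply: (@lie_lder _ _ B F (e k)) => //.
  - by apply: pfunB; apply: pfunZ; apply: pfun_sum => c; apply: pfunZ; apply: pfun_mxeval.
  - move=> A BA; have GA := BG BA; have E l : \sum_c v c 0 * mxeval A (rp l c) = (rho A *m v) l 0.
      by rewrite mxE; apply: eq_bigr => c _; rewrite rpE // mulrC.
    case: hv => _ /(_ _ BA) [c hc] _; rewrite /F !E hc !mxE; ring.
  - exact: e7_B D k.
  have E l : lder (fun s => \sum_c v c 0 * mxeval (line (e k) s) (rp l c)) ((drho (e k) *m v) l 0).
    rewrite mxE; apply: lder_sum => c; rewrite mulrC; apply: lderZ.
    exact: lder_rp (lmx_line1 _) (line1 _).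
  by apply: lderD; [apply: lderZ | apply: lderN; apply: lderZ].
apply: nilp_eigen hc.
by have := @drho_gens_nilp k; rewrite /gens k7; apply; lia.
Qed.

Lemma drho_ef k j : (k < 7)%N -> (j < 7)%N ->
  drho (e k) *m (drho (f j) *m v) = ((k == j) && (val i == k))%:R *: v.
Proof.
move=> k7 j7; have Le : lie_algebra G (e k) by rewrite -(adX_e _ f) //; apply: (lie_X D); lia.
have Lf : lie_algebra G (f j) by rewrite -(adX_f e) //; apply: (lie_X D); lia.
have -> : drho (e k) *m (drho (f j) *m v) = drho (lie_bracket (e k) (f j)) *m v.
  by rewrite drho_br // /lie_bracket mulmxBl -!mulmxA drho_e // mulmx0 subr0.
case: (eqVneq k j) => [<-|kj]; first by rewrite drho_h.
by case: (rel) => _ _ _ ef; rewrite ef // drho0 mul0mx scale0r.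
Qed.

Lemma drho_fi : drho (f i) *m v != 0.
Proof.
apply/negP=> /eqP f0; have := drho_ef (ltn_ord i) (ltn_ord i).
by rewrite f0 mulmx0 !eqxx scale1r => v0; have := v_neq0; rewrite -v0 eqxx.
Qed.

(** [lowest_weight_zero] with [e_k] and [f_k] exchanged: the weight of [v] on [h_k] is 0 for
    [k != i], so [drho (f k) *m v] has weight -2, and it is killed by [e_k]. *)
Lemma drho_f k : (k < 7)%N -> k != i -> drho (f k) *m v = 0.
Proof.
move=> k7 ki; have Le : lie_algebra G (e k) by rewrite -(adX_e _ f) //; apply: (lie_X D); lia.
have Lf : lie_algebra G (f k) by rewrite -(adX_f e) //; apply: (lie_X D); lia.
have Lh : lie_algebra G (lie_bracket (e k) (f k)) by apply: (lie_br gG).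
apply: (@lowest_weight_zero K 'cV[K]_m (mulmx (drho (f k))) (mulmx (drho (e k)))
   (mulmx (drho (- 1 *: lie_bracket (e k) (f k)))) _ 1).
- by move=> a u w; rewrite mulmxDr scalemxAr.
- by move=> a u w; rewrite mulmxDr scalemxAr.
- by move=> a u w; rewrite mulmxDr scalemxAr.
- move=> x; rewrite !mulmxA -mulmxBl scaleN1r -br_anti; congr (_ *m _).
  by rewrite drho_br.
- move=> x; rewrite !mulmxA scalemxAl -mulmxDl; congr (_ *m _).
  apply/eqP; rewrite addrC -subr_eq; apply/eqP.
  have := drho_br (lieZ (-1) Lh) Lf; rewrite /lie_bracket => <-.
  rewrite -/(lie_bracket (-1 *: lie_bracket (e k) (f k)) (f k)) brZl.
  by case: (rel) => _ _ hf _; rewrite hf // scaleN1r opprK drhoZ /cz eqxx.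
- by rewrite drho_ef // eqxx eq_sym (negbTE ki) scale0r.
- rewrite drhoZ -!scalemxAl scaleN1r mulmxA.
  have -> : drho (lie_bracket (e k) (f k)) *m drho (f k) =
      drho (lie_bracket (lie_bracket (e k) (f k)) (f k)) + drho (f k) *m drho (lie_bracket (e k) (f k)).
    by have -> := drho_br Lh Lf; rewrite [in RHS]/lie_bracket subrK.
  case: (rel) => _ _ hf _; rewrite hf // -scaleNr drhoZ mulmxDl -mulmxA drho_h //.
  by rewrite eq_sym (negbTE ki) scale0r mulmx0 addr0 /cz eqxx -scalemxAl -scaleNr opprK.
Qed.

Lemma P_G : P `<=` G. Proof. by rewrite hP => A []. Qed.

Lemma P_grp : mx_group P.
Proof.
rewrite hP; split=> [A [/(mxg_unit gG)] //||A A' [GA [c hc]] [GA' [c' hc']]|A [GA [c hc]]].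
- by split; [exact: mxg1 | exists 1; rewrite rho1 mul1mx scale1r].
- split; first exact: (mxgM gG).
  by exists (c' * c); rewrite rhoM // -mulmxA hc' -scalemxAr hc scalerA.
split; first exact: (mxgV gG).
have c0 : c != 0.
  apply/negP=> /eqP c0; have := v_neq0; rewrite -(mulKmx (rho_unit GA) v) hc c0 scale0r mulmx0.
  by rewrite eqxx.
exists c^-1; rewrite rhoV //; apply: (canRL (scalerK c0)); rewrite scalemxAr -hc.
by rewrite mulKmx ?rho_unit.
Qed.

Lemma P_T : T `<=` P.
Proof.
move=> t Tt; rewrite hP; split; first exact: (e7_TG D).
by exists (omega i t); case: hv => _ _; apply.
Qed.

Lemma P_gens c s : (c < 14)%N -> c != (7 + i)%N -> P (mx_exp (s *: gens e f c)).
Proof.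
move=> c14 ci; rewrite hP; split; first exact: (e7_exp D).
have [j [j133 gE]] : exists j, (j < 133)%N /\ gens e f c = X j.
  rewrite /gens c14; case: ltnP => c7; first by exists (7 + c)%N; rewrite adX_e //; split=> //; lia.
  by exists (70 + (c - 7))%N; rewrite adX_f; [split=> //; lia | lia].
exists 1; rewrite rho_exp ?scale1r; [|exact: e7_nilp D c|by rewrite gE; apply: (lie_X D)|exact: drho_gens_nilp].
have : drho (gens e f c) *m v = 0.
  rewrite /gens c14; case: ltnP => c7; first exact: drho_e.
  by apply: drho_f; [lia | move: ci; apply: contra => /eqP <-; lia].
move=> dv; have := @mx_exp_intertwine _ m 1 (s *: drho (gens e f c)) 0 v.
rewrite mx_exp0 mulmx1 => -> //; first exact/nilpZ/drho_gens_nilp.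
  by exists 1%N; rewrite expr1.
by rewrite -scalemxAl dv scaler0 mulmx0.
Qed.

End Representation.

(** * Grading by the coefficient of one simple root *)

Section Degrees.
Local Open Scope nat_scope.

(* The coefficient of alpha_i in the weight of the j-th basis vector. *)
Definition dz (i j : nat) : Z :=
  if j < 7 then Z0 else
  if j < 70 then Z.of_nat (nth 0 (rt (j - 7)) i) else Z.opp (Z.of_nat (nth 0 (rt (j - 70)) i)).

(** The coefficients of the highest root. *)
Definition topdeg (i : nat) : Z := Z.of_nat (nth 0 [:: 2; 2; 3; 4; 3; 2; 1] i).

Lemma rt_coef_par : all (fun i => all (fun a =>
  nth 0 (rt a) i == ((par a).1 == i) + nth 0 (rt (par a).2) i) (iota 7 56)) (iota 0 7).
Proof. by vm_compute. Qed.

Lemma rt_coef_simple : all (fun i => all (fun k => nth 0 (rt k) i == (k == i)) (iota 0 7)) (iota 0 7).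
Proof. by vm_compute. Qed.

(** From a negative root with nonzero coefficient at [alpha_i], brackets with the [e_k] lead through
    such roots of ever smaller absolute height to [- alpha_i]. *)
Lemma neg_descent : all (fun i => all (fun a => (nth 0 (rt a) i == 0) || (a == i) ||
  has (fun k => let p := opE k (70 + a) in
     [&& 70 <= p.1, p.1 < 133, ~~ Z.eqb p.2 Z0, nth 0 (rt (p.1 - 70)) i != 0 &
         rt_ht (p.1 - 70) < rt_ht a]) (iota 0 7)) (iota 0 63)) (iota 0 7).
Proof. by vm_compute. Qed.

Lemma jz_deg : all (fun i => all (fun j => all (fun l =>
  Z.eqb (jz j l) Z0 || Z.eqb (Z.add (dz i j) (dz i l)) Z0) (iota 0 133)) (iota 0 133)) (iota 0 7).
Proof. by vm_compute. Qed.

Definition partner (j : nat) : nat := if j < 70 then j + 63 else j - 63.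

Lemma jz_partner : all (fun j => [&& partner j < 133, ~~ Z.eqb (jz j (partner j)) Z0 &
  all (fun l => (l == j) || Z.eqb (jz l (partner j)) Z0) (iota 0 133)]) (iota 7 126).
Proof. by vm_compute. Qed.

Lemma jz_h : all (fun j => all (fun l => Z.eqb (jz j l) (if j < 7 then cz j l else Z0))
  (iota 0 7)) (iota 0 133).
Proof. by vm_compute. Qed.

Lemma opE_deg : all (fun i => all (fun k => all (fun j => let p := opE k j in
  Z.eqb p.2 Z0 || Z.eqb (dz i p.1) (Z.add (dz i j) (if k == i then Z.one else Z0)))
  (iota 0 133)) (iota 0 7)) (iota 0 7).
Proof. by vm_compute. Qed.

Definition depth (j : nat) : nat := if j < 70 then 17 - rt_ht (j - 7) else 17 + rt_ht (j - 70).

(** A root vector below top degree is moved by [e_i], or some [e_k] brings it closer to the top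
    while it stays below top degree. The last alternative is the passage from [f_k] over [h_k] to
    [e_k]. *)
Lemma top_ascent : all (fun i => all (fun j => Z.eqb (dz i j) (topdeg i) ||
  has (fun k => let p := opE k j in ~~ Z.eqb p.2 Z0 &&
    [|| k == i, [&& 7 <= p.1, p.1 < 133, ~~ Z.eqb (dz i p.1) (topdeg i) & depth p.1 < depth j] |
        [&& j == 70 + k, p.1 == k, ~~ Z.eqb (opE k k).2 Z0, (opE k k).1 == 7 + k,
            ~~ Z.eqb (dz i (7 + k)) (topdeg i) & depth (7 + k) < depth j]])
   (iota 0 7)) (iota 7 126)) (iota 0 7).
Proof. by vm_compute. Qed.

Lemma dz_le_top : all (fun i => all (fun j => Z.leb (dz i j) (topdeg i)) (iota 0 133) &&
  all (fun k => ~~ Z.eqb (dz i (7 + k)) (topdeg i) || (k == i)) (iota 0 7) &&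
  Z.ltb Z0 (topdeg i)) (iota 0 7).
Proof. by vm_compute. Qed.

Lemma dz_weight : all (fun i => all (fun j => Z.eqb (Z.mul Z.two (dz i j))
  (foldr (fun k s => Z.add (Z.mul (ci i k) (opH k j)) s) Z0 (iota 0 7))) (iota 0 133)) (iota 0 7).
Proof. by vm_compute. Qed.

Definition tops (i : nat) : seq nat := [seq j <- iota 0 133 | Z.eqb (dz i j) (topdeg i)].

End Degrees.

(** * Parabolic subalgebras, their nilradicals and the centres of these *)

Section Parabolic.
Variables (K : numClosedFieldType) (n : nat).
Variables (G T B : set 'M[K]_n) (alpha omega : 'I_7 -> 'M[K]_n -> K).
Variables (e f : nat -> 'M[K]_n) (tau : nat -> K -> 'M[K]_n).
Hypothesis D : e7_data G T B alpha omega e f tau.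
Local Notation zK := (zK K).
Local Notation X := (adX e f).
Local Notation phi := (phi e f).
Local Notation adm := (adm e f).
Local Notation Jmx := (Jmx K).
Let rel := e7_rel D.
Let e0 := e7_e0 D.
Let gG := e7_grp D.

Lemma all7 (Q : nat -> nat -> bool) m N k j : all (fun k => all (Q k) (iota m N)) (iota 0 7) ->
  (k < 7)%N -> (m <= j < m + N)%N -> Q k j.
Proof. by move=> h k7 hj; have /allP2/(_ j hj) := allP2 h (i := k) k7. Qed.

Lemma xp_ind0 (Q : 'M[K]_n -> Prop) (e' : nat -> 'M[K]_n) (i : nat) : (i < 7)%N ->
  (forall k, (k < 7)%N -> k != i -> Q (e' k)) -> (forall a Y, Q Y -> Q (a *: Y)) ->
  (forall Y k, (k < 7)%N -> k != i -> Q Y -> Q (lie_bracket (e' k) Y)) ->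
  forall a, (a < 63)%N -> nth 0%N (rt a) i = 0%N -> Q (xp e' a).
Proof.
move=> i7 Qe QZ Qb a; have [N] := ubnP a; elim: N a => // N IH a; rewrite ltnS => aN a63 ai.
case: (ltnP a 7) => a7.
  rewrite xp_simple //; apply: Qe => //; apply/negP=> ei.
  by have := all7 rt_coef_simple i7 (j := a) a7; rewrite ai ei.
have ha : (7 <= a < 63)%N by rewrite a7.
have [h1 h2 _ _] := model_par ha.
have := all7 rt_coef_par i7 (j := a) ha; rewrite ai eq_sym addn_eq0 => /andP [pi /eqP bi].
rewrite eqb0 in pi.
rewrite xpE //; apply: QZ; apply: Qb => //.
by apply: IH => //; [apply: leq_trans h1 aN | lia].
Qed.

Lemma adm_J A : G A -> (adm A)^T *m Jmx *m adm A = Jmx.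
Proof.
move: A; apply: (e7_ind D (Q := fun A => (adm A)^T *m Jmx *m adm A = Jmx)).
  by rewrite (adm1 D) trmx1 mul1mx mulmx1.
move=> C c s GC c14 IH; rewrite (admM D GC (e7_exp D c s)) trmx_mul -!mulmxA (mulmxA Jmx) (mulmxA (adm C)^T).
rewrite (mulmxA (adm C)^T) IH (adm_gens D) // mulmxA.
have nM := genmx_nilp K c14; apply: Jmx_exp; first exact: nilpZ.
rewrite linearZ /= -scalemxAl -scalerN -scalemxAr; congr (_ *: _).
rewrite /genmx; case: ltnP => c7; first exact: Jmx_E.
by apply: Jmx_F; lia.
Qed.

Lemma adm_JV A : G A -> (adm A)^T *m Jmx = Jmx *m adm (invmx A).
Proof.
move=> GA; have GV := mxgV gG GA; rewrite -[LHS]mulmx1 -(adm1 D).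
by rewrite -(mulmxV (mxg_unit gG GA)) (admM D) // mulmxA adm_J.
Qed.

Definition selmx (r : seq nat) : 'M[K]_(133, size r) := \matrix_(j, t) (nth 0%N r t == j)%:R.

Lemma selmx_mem (r : seq nat) (c : 'cV[K]_133) : uniq r ->
  (forall j : 'I_133, nat_of_ord j \notin r -> c j 0 = 0) -> exists u, c = selmx r *m u.
Proof.
move=> ur hc; exists (\col_t c (inord (nth 0%N r t)) 0); apply/colP=> j; rewrite mxE.
case tj: (nat_of_ord j \in r).
  have ij : (index (nat_of_ord j) r < size r)%N by rewrite index_mem.
  rewrite (bigD1 (Ordinal ij)) //= big1 => [|t tk]; rewrite !mxE.
    by rewrite nth_index // eqxx mul1r addr0 inord_val.
  rewrite (_ : (_ == _) = false) ?mul0r //; apply/negbTE; move: tk; apply: contra => /eqP e1.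
  by rewrite -val_eqE /= -e1 index_uniq.
rewrite hc ?tj // big1 // => t _; rewrite mxE (_ : (_ == _) = false) ?mul0r //; apply/negbTE.
by apply: contraFneq tj => <-; apply: mem_nth.
Qed.

Lemma selmx_out (r : seq nat) u (j : 'I_133) : nat_of_ord j \notin r -> (selmx r *m u : 'cV_133) j 0 = 0.
Proof.
move=> jr; rewrite mxE big1 // => t _; rewrite mxE (_ : (_ == _) = false) ?mul0r //; apply/negbTE.
by apply: contra jr => /eqP <-; apply: mem_nth.
Qed.

Lemma selmx_stable (r : seq nat) (Z : 'cV[K]_133 -> Prop) (M : 'M[K]_133) :
  (forall c, Z c <-> exists u, c = selmx r *m u) -> (forall c, Z c -> Z (M *m c)) ->
  exists S, M *m selmx r = selmx r *m S.
Proof.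
move=> hZ ZM; have h (t : 'I_(size r)) : {u | M *m col t (selmx r) = selmx r *m u}.
  by apply/cid/hZ/ZM/hZ; rewrite colE; exists (delta_mx t 0).
exists (\matrix_(a, t) sval (h t) a 0); apply/matrixP=> a t.
have /colP /(_ a) : col t (M *m selmx r) = selmx r *m sval (h t).
  by rewrite -(svalP (h t)) !colE mulmxA.
rewrite [LHS]mxE => ->; rewrite [LHS]mxE [RHS]mxE.
by apply: eq_bigr => b _; congr (_ * _); rewrite mxE.
Qed.

Section Subspaces.
Variable i : nat.
Hypothesis i7 : (i < 7)%N.

(* Coordinate descriptions of p_i, of its nilradical and of the centre of the latter. *)
Definition inp (c : 'cV[K]_133) := forall j : 'I_133, Z.ltb (dz i j) Z0 -> c j 0 = 0.
Definition inN (c : 'cV[K]_133) := forall j : 'I_133, ~~ Z.ltb Z0 (dz i j) -> c j 0 = 0.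
Definition inW (c : 'cV[K]_133) := forall w, inN w -> lie_bracket (phi c) (phi w) = 0.

Lemma form_sum (c u : 'cV[K]_133) :
  (c^T *m Jmx *m u) 0 0 = \sum_(j < 133) \sum_(l < 133) c l 0 * zK (jz l j) * u j 0.
Proof.
rewrite mxE; apply: eq_bigr => j _; rewrite mxE mulr_suml; apply: eq_bigr => l _.
by rewrite !mxE.
Qed.

Lemma form_dl (c : 'cV[K]_133) (j : 'I_133) : (c^T *m Jmx *m dl K j) 0 0 = \sum_(l < 133) c l 0 * zK (jz l j).
Proof.
rewrite form_sum (bigD1 j) //= [X in _ + X]big1 => [|k kj].
  by rewrite addr0; apply: eq_bigr => l _; rewrite mxE eqxx mulr1.
apply: big1 => l _; rewrite mxE (_ : (nat_of_ord j == k) = false) ?mulr0 //.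
by apply/negbTE; rewrite eq_sym.
Qed.

(** The nilradical is the orthogonal space of p_i for the invariant form. This transfers stability
    under [Ad p] from p_i to the nilradical, and from there to its centre. *)
Lemma inN_perp c : inN c <-> forall u, inp u -> (c^T *m Jmx *m u) 0 0 = 0.
Proof.
split=> [Nc u pu|h j hj].
  rewrite form_sum big1 // => j _; rewrite big1 // => l _.
  have /orP [/Z.eqb_eq ->|/Z.eqb_eq e1] :=
    allP2 (all7 jz_deg i7 (j := l) (ltn_ord l)) (i := j) (ltn_ord j).
    by rewrite zK0 mulr0 mul0r.
  case pos: (Z.ltb Z0 (dz i l)); last by rewrite Nc ?pos // !mul0r.
  by rewrite pu ?mulr0 //; apply/Z.ltb_lt; move/Z.ltb_lt: pos; lia.
case: (ltnP j 7) => j7.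
  apply: hsum0 j7 => k k7.
  have k133 : (k < 133)%N by lia.
  have := h (dl K (Ordinal k133)); rewrite form_dl => h1; rewrite -[RHS]h1.
    rewrite (eq_bigr (fun l : 'I_133 => if (l < 7)%N then zK (cz l k) * c (inord l) 0 else 0)) => [|l _].
      rewrite -big_mkcond /= -(big_mkord (fun l => (l < 7)%N) (fun l => zK (cz l k) * c (inord l) 0)).
      rewrite -(big_mkord xpredT (fun l => zK (cz l k) * c (inord l) 0)).
      by rewrite [LHS](big_nat_widen _ _ 133).
    have /allP2/(_ k k7)/Z.eqb_eq -> := allP2 jz_h (i := l) (ltn_ord l).
    by rewrite inord_val; case: ifP; rewrite ?zK0 ?mulr0 // mulrC.
  by move=> l; rewrite mxE; case: eqP => // <-; rewrite /dz /= k7.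
have hj7 : (7 <= j < 7 + 126)%N by rewrite j7 ltn_ord.
have /and3P [p133 /negbTE/Z.eqb_neq nz /allP2 hl] := allP2 jz_partner (i := j) hj7.
have := h (dl K (Ordinal p133)); rewrite form_dl (bigD1 j) //= big1 => [|l lj].
  rewrite addr0 => h1; suff /h1/eqP : inp (dl K (partner j)).
    by rewrite mulf_eq0 => /orP [/eqP //|/eqP/zK_eq0 //].
  move=> l; rewrite mxE; case: eqP => // <-.
  have /orP [/Z.eqb_eq //|/Z.eqb_eq e1] := allP2 (all7 jz_deg i7 (j := j) (ltn_ord j)) (i := partner j) p133.
  by move=> /Z.ltb_lt e2; case/negP: hj; apply/Z.ltb_lt; lia.
by have /orP [/eqP e1|/Z.eqb_eq ->] := hl l (ltn_ord l); [move: lj; rewrite -val_eqE /= e1 eqxx|rewrite zK0 mulr0].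
Qed.

Lemma inN_lin a c d : inN c -> inN d -> inN (a *: c + d).
Proof. by move=> hc hd j hj; rewrite !mxE hc ?hd // mulr0 addr0. Qed.

Lemma inN_dl j : (j < 133)%N -> Z.ltb Z0 (dz i j) -> inN (dl K j).
Proof. by move=> j133 hj l; rewrite mxE; case: eqP => // <-; rewrite hj. Qed.

Lemma inN_E k c : (k < 7)%N -> inN c -> inN (Emx K k *m c).
Proof.
move=> k7 Nc; rewrite (colE_dl c) mulmx_sumr.
apply: (big_ind inN) => [j _|u w hu hw|j _]; first by rewrite mxE.
  by rewrite -[u]scale1r; apply: inN_lin.
rewrite -scalemxAr opmx_dl // /mono; case pos: (Z.ltb Z0 (dz i j)); last first.
  by rewrite Nc ?pos // scale0r => l _; rewrite mxE.
have /orP [/Z.eqb_eq ->|/Z.eqb_eq e1] :=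
    allP2 (all7 opE_deg i7 (j := k) k7) (i := j) (ltn_ord j).
  by rewrite scale0r scaler0 => l _; rewrite mxE.
rewrite -[_ *: _]addr0 scalerA; apply: inN_lin => [|l _]; last by rewrite mxE.
apply: inN_dl; first by have [] := op_lt k7 (ltn_ord j).
rewrite e1; apply/Z.ltb_lt; move/Z.ltb_lt: pos; case: eqP => _ h; last by rewrite Z.add_0_r.
exact: (Z.lt_trans _ _ _ h (Z.lt_succ_diag_r _)).
Qed.

Lemma inN_H k c : inN c -> inN (Hmx K k *m c).
Proof. by move=> Nc j hj; rewrite /Hmx diag_opmx Nc ?mulr0. Qed.

(** The degree is the eigenvalue of an element of the Cartan algebra, found by inverting the Cartan
    matrix; [ci] is twice the inverse, hence the division by 2. *)
Lemma grading : exists Y, forall j, (j < 133)%N -> lie_bracket Y (X j) = zK (dz i j) *: X j.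
Proof.
exists (\sum_(k < 7) (zK (ci i k) / 2%:R) *: X k) => j j133.
rewrite br_anti br_sum -sumrN.
rewrite (eq_bigr (fun k : 'I_7 => (zK (Z.mul (ci i k) (opH k j)) / 2%:R) *: X j)) => [|k _].
  rewrite -scaler_suml -mulr_suml -(big_mkord xpredT (fun k => zK (Z.mul (ci i k) (opH k j)))).
  have -> : \sum_(0 <= k < 7) zK (Z.mul (ci i k) (opH k j)) = zK (Z.mul Z.two (dz i j)).
    have := all7 dz_weight i7 (j := j) j133 => /Z.eqb_eq ->.
    by rewrite /index_iota /= !big_cons big_nil !zKD zK0.
  rewrite zKM mulrC mulKf //; first by rewrite pnatr_eq0.
rewrite brZr br_anti (adX_H rel) // scalerN opprK zKM scalerA; congr (_ *: _).
by rewrite mulrAC.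
Qed.

Lemma inW_lin a c d : inW c -> inW d -> inW (a *: c + d).
Proof. by move=> hc hd w Nw; rewrite phi_lin brDl brZl hc // hd // scaler0 addr0. Qed.

Lemma inW_op (Y : 'M[K]_n) (M : 'M[K]_133) c : (forall c, phi (M *m c) = lie_bracket Y (phi c)) ->
  (forall c, inN c -> inN (M *m c)) -> inW c -> inW (M *m c).
Proof.
move=> hM NM Wc w Nw; have := jacobi Y (phi c) (phi w).
by rewrite Wc // br0r -!hM Wc ?addr0 //; apply: NM.
Qed.

Lemma inW_E k c : (k < 7)%N -> inW c -> inW (Emx K k *m c).
Proof. by move=> k7; apply: (inW_op (Y := e k)) => d; [apply: phi_E | apply: inN_E]. Qed.

Lemma inW_H k c : (k < 7)%N -> inW c -> inW (Hmx K k *m c).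
Proof. by move=> k7; apply: (inW_op (Y := X k)) => d; [apply: phi_H | apply: inN_H]. Qed.

Lemma inW_Ei c : inW c -> Emx K i *m c = 0.
Proof.
move=> Wc; apply: (phi_eq0 rel e0); rewrite phi_E // br_anti -(adX_e e f) //.
rewrite -(phi_dl e f); last by lia.
rewrite Wc ?oppr0 //; apply: inN_dl; first by lia.
have := all7 rt_coef_simple i7 (j := i) i7; rewrite eqxx => /eqP h.
by rewrite /dz ltnNge leq_addr /= addKn (_ : (7 + i < 70)%N) ?h //; lia.
Qed.

Lemma inW_unscale a c : a != 0 -> inW (a *: c) -> inW c.
Proof.
have W0 : inW 0 by move=> w _; rewrite phi0 br0l.
by move=> a0 Wc; have := inW_lin a^-1 Wc W0; rewrite scalerA mulVf // scale1r addr0.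
Qed.

Lemma inW_root j : (7 <= j < 133)%N -> inW (dl K j) -> Z.eqb (dz i j) (topdeg i).
Proof.
have [N] := ubnP (depth j); elim: N j => // N IH j; rewrite ltnS => jN hj Wj.
have [j7 j133] := andP hj; apply/negPn/negP => ntop.
have := all7 top_ascent i7 (j := j) hj; rewrite (negbTE ntop) => /hasP [k].
rewrite mem_iota => k7 /andP [/negbTE/Z.eqb_neq nz].
have z0 : zK (opE k j).2 != 0 by apply/eqP => /zK_eq0.
have p133 : ((opE k j).1 < 133)%N by have [] := op_lt k7 j133.
case/or3P => [/eqP ki|/and4P [p7 _ nt dp]|/and4P [/eqP jk /eqP pk q0 /and3P [/eqP qk nt dp]]].
- have := inW_Ei Wj; rewrite -ki opmx_dl // /mono => /eqP.
  by rewrite scaler_eq0 (negbTE z0) (negbTE (dl_neq0 _ _)).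
- have := inW_E k7 Wj; rewrite opmx_dl // /mono => /(inW_unscale z0) Wp.
  by move: nt; rewrite IH // ?p7 //; apply: leq_trans dp jN.
have z0' : zK (opE k k).2 != 0 by apply/eqP => /zK_eq0 e1; move: q0; rewrite e1.
have k133 : (k < 133)%N by move: k7 => /=; lia.
have := inW_E k7 Wj; rewrite opmx_dl // /mono pk => /(inW_unscale z0) Wk.
have := inW_E k7 Wk; rewrite opmx_dl // /mono qk => /(inW_unscale z0') Wp.
move: nt; rewrite IH //; first exact: leq_trans dp jN.
by move: k7 => /=; lia.
Qed.

(** A bracket of degree above the top vanishes, which gives one direction. Conversely the centre is
    stable under the [e_k] and [h_k], and a root vector in it below top degree would climb along
    [top_ascent] to one moved by [e_i], which lies in the nilradical. *)
Lemma inW_iff c : inW c <-> forall j : 'I_133, ~~ Z.eqb (dz i j) (topdeg i) -> c j 0 = 0.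
Proof.
have /andP [/andP [/allP2 le_top /allP2 top_e] /Z.ltb_lt top0] := allP2 dz_le_top (i := i) i7.
split=> [Wc|hc w Nw].
  have [|||Zr Zh] := @wt_split K inW c _ _ _ Wc.
  - by move=> w _; rewrite phi0 br0l.
  - by move=> a u w; apply: inW_lin.
  - by move=> k u k7; apply: inW_H.
  move=> j hj; case: (ltnP j 7) => j7; last first.
    apply/eqP/negPn/negP => c0; have := inW_unscale c0 (Zr j j7) => /inW_root.
    by rewrite j7 ltn_ord (negbTE hj) => /(_ isT).
  apply: hsum0 j7 => k k7; apply/eqP; case: (eqVneq k i) => [ki|ki].
    have := inW_Ei Zh; rewrite -ki hsum_E // => /eqP.
    rewrite scaler_eq0 oppr_eq0 (negbTE (dl_neq0 _ _)) ?orbF //; lia.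
  apply/negPn/negP => c0; have := inW_E k7 Zh; rewrite hsum_E // => /inW_unscale.
  rewrite oppr_eq0 => /(_ c0)/inW_root h; have := top_e k k7.
  by rewrite h ?(negbTE ki) //; lia.
rewrite {1}/phi br_anti br_sum -sumrN big1 // => j _; rewrite -br_anti brZl.
case tj: (Z.eqb (dz i j) (topdeg i)); last by rewrite hc ?tj // scale0r.
rewrite /phi br_sum big1 ?scaler0 // => l _; rewrite brZr.
case pl: (Z.ltb Z0 (dz i l)); last by rewrite Nw ?pl // scale0r.
suff -> : lie_bracket (X j) (X l) = 0 by rewrite scaler0.
have [u] := phi_br rel (dl K j) (dl K l); rewrite !phi_dl // => hu.
rewrite hu; have [Y hY] := grading.
suff -> : u = 0 by rewrite phi0.
have : lie_bracket Y (phi u) = zK (Z.add (dz i j) (dz i l)) *: phi u.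
  by rewrite -hu jacobi !hY // brZl brZr -scalerDl zKD.
have -> : lie_bracket Y (phi u) = phi (opmx K (fun j => (j, dz i j)) *m u).
  by apply/esym; apply: phi_mx => // a A A'; apply: brDr.
rewrite -phiZ => /(phi_inj rel e0) eu; apply/colP=> k; rewrite [RHS]mxE.
have /colP /(_ k) := eu; rewrite diag_opmx [RHS]mxE => /eqP.
rewrite -subr_eq0 -mulrBl mulf_eq0 => /orP [|/eqP //].
rewrite subr_eq0 => /eqP/zK_inj e1.
have /Z.leb_le := le_top k (ltn_ord k).
by move/Z.eqb_eq: tj; move/Z.ltb_lt: pl; lia.
Qed.

Lemma tops_mem j : (j \in tops i) = (j < 133)%N && Z.eqb (dz i j) (topdeg i).
Proof. by rewrite mem_filter mem_iota andbC. Qed.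

Lemma inW_sel : forall c, inW c <-> exists u, c = selmx (tops i) *m u.
Proof.
have : uniq (tops i) by exact: filter_uniq (iota_uniq _ _).
have := tops_mem; move: (tops i) => r mr ur c; split.
  move=> /inW_iff hc; apply: selmx_mem => // j; rewrite mr ltn_ord; exact: hc.
move=> [u ->]; apply/inW_iff => j hj; apply: selmx_out.
by rewrite mr (negbTE hj) andbF.
Qed.

Lemma Sel_stable (p : 'M[K]_n) : G p -> (forall c, inp c -> inp (adm (invmx p) *m c)) ->
  (forall c, inp c -> inp (adm p *m c)) -> exists S, adm p *m selmx (tops i) = selmx (tops i) *m S.
Proof.
move=> Gp pV pp; have GV := mxgV gG Gp.
have Np q : G q -> (forall c, inp c -> inp (adm (invmx q) *m c)) ->
    forall c, inN c -> inN (adm q *m c).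
  move=> Gq hq c /inN_perp Nc; apply/inN_perp => u pu.
  by rewrite trmx_mul -(mulmxA c^T) adm_JV // mulmxA -mulmxA Nc //; apply: hq.
have Wp c : inW c -> inW (adm p *m c).
  move=> Wc w Nw; have up := mxg_unit gG Gp.
  have -> : w = adm p *m (adm (invmx p) *m w).
    by rewrite mulmxA -(admM D) // mulmxV // (adm1 D) mul1mx.
  rewrite !(phi_adm D _ Gp) -Ad_br // Wc ?mulmx0 ?mul0mx //.
  by apply: Np => //; rewrite invmxK.
exact: (selmx_stable inW_sel Wp).
Qed.

End Subspaces.
End Parabolic.

(** * The stabilizer of the highest weight line and its action on the centre of the nilradical *)

Section ParabolicStabilizer.
Variables (K : numClosedFieldType) (n : nat).
Variables (G T B : set 'M[K]_n) (alpha omega : 'I_7 -> 'M[K]_n -> K).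
Variables (e f : nat -> 'M[K]_n) (tau : nat -> K -> 'M[K]_n).
Hypothesis D : e7_data G T B alpha omega e f tau.
Local Notation zK := (zK K).
Local Notation X := (adX e f).
Local Notation phi := (phi e f).
Local Notation adm := (adm e f).
Let rel := e7_rel D.
Let e0 := e7_e0 D.
Let gG := e7_grp D.
Variables (m : nat) (rho : 'M[K]_n -> 'M[K]_m).
Hypothesis hrho : algebraic_hom G (@units K m) rho.
Variables (i : 'I_7) (v : 'cV[K]_m) (P : set 'M[K]_n).
Hypothesis BG : B `<=` G.
Hypothesis hv : highest_weight_vector T B rho (omega i) v.
Hypothesis hP : P = [set g | G g /\ exists c, rho g *m v = c *: v].
Local Notation drho := (drho D hrho).

Let pk (Y : 'M[K]_n) := exists a, drho Y *m v = a *: v.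

Let pk_lin a Y Z : pk Y -> pk Z -> pk (a *: Y + Z).
Proof.
move=> [b hb] [c hc]; exists (a * b + c).
by rewrite drho_lin mulmxDl -scalemxAl hb hc scalerA scalerDl.
Qed.

Let pkZ a Y : pk Y -> pk (a *: Y).
Proof. by move=> [b hb]; exists (a * b); rewrite drhoZ -scalemxAl hb scalerA. Qed.

Let pk_br Y Z : lie_algebra G Y -> lie_algebra G Z -> pk Y -> pk Z -> pk (lie_bracket Y Z).
Proof.
move=> LY LZ [a ha] [b hb]; exists 0; rewrite drho_br // /lie_bracket mulmxBl -!mulmxA ha hb.
by rewrite -!scalemxAr ha hb !scalerA mulrC subrr scale0r.
Qed.

Let Lphi c : lie_algebra G (phi c). Proof. exact: (e7_lieX D). Qed.
Let Le k : (k < 7)%N -> lie_algebra G (e k).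
Proof. by move=> k7; rewrite -(adX_e _ f) //; apply: (lie_X D); lia. Qed.
Let Lf k : (k < 7)%N -> lie_algebra G (f k).
Proof. by move=> k7; rewrite -(adX_f e) //; apply: (lie_X D); lia. Qed.

Lemma kills_zero (Y : 'M[K]_n) : drho Y *m v = 0 -> pk Y.
Proof. by move=> h; exists 0; rewrite h scale0r. Qed.

Let pk_e k : (k < 7)%N -> pk (e k).
Proof. by move=> k7; apply/kills_zero; exact: (drho_e D hrho BG hv). Qed.

Let pk_f k : (k < 7)%N -> k != i -> pk (f k).
Proof. by move=> k7 ki; apply/kills_zero; exact: (drho_f D hrho BG hv). Qed.

(** Brackets with the [e_k] stay in the stabilizer algebra of the line, so [neg_descent] leads to
    [f_i]; this is nilpotent under [drho] and does not kill [v]. *)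
Lemma negative_not_pk a : (a < 63)%N -> nth 0%N (rt a) i != 0%N -> ~ pk (X (70 + a)).
Proof.
have [N] := ubnP (rt_ht a); elim: N a => // N IH a; rewrite ltnS => aN a63 ai pa.
have a133 : (70 + a < 133)%N by lia.
have := all7 neg_descent (ltn_ord i) (j := a) a63; rewrite (negbTE ai) orFb.
case/orP => [/eqP ei|/hasP [k]].
  move: pa; rewrite ei adX_f // => -[b hb]; have := drho_fi D hrho BG hv.
  rewrite (nilp_eigen hv (c := b)) ?eqxx //.
  have := @drho_gens_nilp _ _ _ _ _ _ _ _ _ _ D _ _ hrho (7 + i).
  have -> : gens e f (7 + i) = f i.
    rewrite /gens; case: ltnP => [|_]; first by lia.
    by case: ltnP => [_|]; [rewrite addKn | have := ltn_ord i; lia].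
  by apply; have := ltn_ord i; lia.
rewrite mem_iota => k7 /and5P [p70 p133 /negbTE/Z.eqb_neq nz bi ht].
have z0 : zK (opE k (70 + a)).2 != 0 by apply/eqP => /zK_eq0.
have b63 : ((opE k (70 + a)).1 - 70 < 63)%N by lia.
apply: (IH _ (leq_trans ht aN) b63 bi); rewrite subnKC //.
have := pk_br (Le k7) (lie_X D a133) (pk_e k7) pa.
by rewrite (adX_E rel) // /mono => /(pkZ (zK (opE k (70 + a)).2)^-1); rewrite scalerA mulVf // scale1r.
Qed.

(** Stability under the [h_k] reduces the question to single root vectors: those of negative degree
    do not preserve the line, and the others are generated by the [e_k] and the [f_k] with
    [k != i]. *)
Lemma pk_inp c : pk (phi c) <-> inp i c.
Proof.
split=> [pc|ic].
  have [|||Zr _] := @wt_split K (fun c => pk (phi c)) c _ _ _ pc.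
  - by rewrite phi0; apply: kills_zero; rewrite drho0 mul0mx.
  - by move=> a u w pu pw; rewrite phi_lin; apply: pk_lin.
  - move=> k u k7 pu; rewrite phi_H // /adX k7; apply: pk_br => //.
      by apply: (lie_br gG); [apply: Le | apply: Lf].
    by exists (val i == k)%:R; apply: (drho_h D hrho hv).
  move=> j /Z.ltb_lt hj; apply/eqP/negPn/negP => c0.
  have j7 : (7 <= j)%N by rewrite leqNgt; apply/negP => j7; move: hj; rewrite /dz j7; lia.
  have := Zr j j7; rewrite phiZ => /(pkZ (c j 0)^-1); rewrite scalerA mulVf // scale1r.
  rewrite phi_dl // => pj; have j70 : (70 <= j)%N.
    rewrite leqNgt; apply/negP => j70; move: hj; rewrite /dz ltnNge j7 j70 /=; lia.
  apply: (@negative_not_pk (j - 70)); last by rewrite subnKC.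
    by have := ltn_ord j; lia.
  by move: hj; rewrite /dz ltnNge j7 ltnNge j70 /=; lia.
rewrite /phi; apply: (big_ind pk) => [|Y Z pY pZ|j _].
- by apply: kills_zero; rewrite drho0 mul0mx.
- by rewrite -[Y]scale1r; apply: pk_lin.
case neg: (Z.ltb (dz i j) Z0); first by rewrite ic // scale0r; apply: kills_zero; rewrite drho0 mul0mx.
apply: pkZ; rewrite /adX; case: ifP => j7.
  by exists (val i == j)%:R; apply: (drho_h D hrho hv).
have j133 := ltn_ord j; case: ifP => j70.
  have a63 : (j - 7 < 63)%N by lia.
  have [] // := @xp_ind _ _ (fun Y => lie_algebra G Y /\ pk Y) e _ _ _ _ a63.
  - by move=> k k7; split; [apply: Le | apply: pk_e].
  - by move=> a Y [LY pY]; split; [apply: lieZ | apply: pkZ].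
  - by move=> Y k k7 [LY pY]; split; [apply: (lie_br gG) => //; apply: Le | apply: pk_br => //; [apply: Le|apply: pk_e]].
have a63 : (j - 70 < 63)%N by lia.
have ai : nth 0%N (rt (j - 70)) i = 0%N.
  by move: neg; rewrite /dz j7 j70 => /Z.ltb_nlt; lia.
have [] // := @xp_ind0 _ _ (fun Y => lie_algebra G Y /\ pk Y) f i (ltn_ord i) _ _ _ _ a63 ai.
- by move=> k k7 ki; split; [apply: Lf | apply: pk_f].
- by move=> a Y [LY pY]; split; [apply: lieZ | apply: pkZ].
- by move=> Y k k7 ki [LY pY]; split; [apply: (lie_br gG) => //; apply: Lf | apply: pk_br => //; [apply: Lf|apply: pk_f]].
Qed.

Lemma P_inp p c : P p -> inp i c -> inp i (adm p *m c).
Proof.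
move=> Pp /pk_inp [a ha]; apply/pk_inp.
have Gp := P_G hP Pp; have GV := mxgV gG Gp.
have [b hb] : exists b, rho (invmx p) *m v = b *: v.
  by have := mxgV (P_grp D hrho hv hP) Pp; rewrite hP => -[].
have [b' hb'] : exists b, rho p *m v = b *: v by move: Pp; rewrite hP => -[].
exists (b' * (a * b)); rewrite (phi_adm D) // drho_Ad // -(rhoV D hrho Gp) -!mulmxA hb -!scalemxAr ha -scalemxAr hb'.
by rewrite !scalerA; congr (_ *: _); ring.
Qed.

Lemma P_sel p : P p -> exists S, adm p *m selmx K (tops i) = selmx K (tops i) *m S.
Proof.
move=> Pp; apply: (Sel_stable D (ltn_ord i) (P_G hP Pp)) => c; apply: P_inp => //.
exact: (mxgV (P_grp D hrho hv hP)).
Qed.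

End ParabolicStabilizer.

(** * The obstruction for the nodes other than 7 *)

Section CrossForms.
Variable K : numClosedFieldType.

(** Clear when both determinants are nonzero. The general case is a specialisation of polynomial
    matrices: [char_poly_mx (- C)] has a monic determinant and takes the value [C] at 0. *)
Lemma adj_mulmx d (A B : 'M[K]_d) : \adj (A *m B) = \adj B *m \adj A.
Proof.
have idem (C D : 'M[{poly K}]_d) : \det C != 0 -> \det D != 0 -> \adj (C *m D) = \adj D *m \adj C.
  move=> C0 D0; have CD0 : \det (C *m D) != 0 by rewrite det_mulmx mulf_neq0.
  have : (\adj (C *m D) - \adj D *m \adj C) *m (C *m D) = 0.
    rewrite mulmxBl mul_adj_mx mulmxA -(mulmxA (\adj D)) mul_adj_mx.
    by rewrite scalar_mxC -mulmxA mul_adj_mx -scalar_mxM det_mulmx subrr.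
  move=> /(congr1 (mulmx^~ (\adj (C *m D)))); rewrite mul0mx -mulmxA mul_mx_adj mul_mx_scalar.
  move=> h; apply/eqP; rewrite -subr_eq0; apply/eqP/matrixP=> i j; move/matrixP: h => /(_ i j).
  rewrite [LHS]mxE [RHS]mxE => /eqP; rewrite mulf_eq0 (negbTE CD0) => /eqP ->.
  by rewrite mxE.
pose ev : {poly K} -> K := horner_eval 0.
have evP (C : 'M[K]_d) : map_mx ev (char_poly_mx (- C)) = C.
  apply/matrixP=> i j; rewrite !mxE /ev /horner_eval hornerD hornerN hornerMn hornerX mul0rn sub0r.
  by rewrite hornerC opprK.
have nz (C : 'M[K]_d) : \det (char_poly_mx (- C)) != 0 by apply/monic_neq0/char_poly_monic.
by rewrite -{1}(evP A) -{1}(evP B) -map_mxM -map_mx_adj idem // map_mxM !map_mx_adj !evP.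
Qed.

(** With [F2], numerator and denominator of [tr (q^-1 c)^2 / (b q^-1 b^T)], both multiplied by
    [\det q ^+ 2] so that they are polynomial. *)
Definition F1 d (q c : 'M[K]_d) : K := (\tr (\adj q *m c)) ^+ 2.
Definition F2 d (q : 'M[K]_d) (b : 'rV[K]_d) : K := \det q * (b *m \adj q *m b^T) 0 0.

(* F1 and F2 have the same weight under base change and scaling. *)
Lemma F1_scale d (q c S : 'M[K]_d) a :
  F1 (S^T *m q *m S) (a *: (S^T *m c *m S)) = a ^+ 2 * \det S ^+ 4 * F1 q c.
Proof.
rewrite /F1 !adj_mulmx -scalemxAr mxtraceZ.
have -> : \tr (\adj S *m (\adj q *m \adj S^T) *m (S^T *m c *m S)) = \det S ^+ 2 * \tr (\adj q *m c).
  rewrite mxtrace_mulC -!mulmxA (mulmxA S) mul_mx_adj !mulmxA.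
  rewrite mxtrace_mulC -!mulmxA (mulmxA (\adj S^T)) mul_adj_mx det_tr.
  rewrite !mul_scalar_mx -!scalemxAr !mxtraceZ mulrA -expr2.
  by congr (_ * _); rewrite mxtrace_mulC.
by ring.
Qed.

Lemma F2_scale d (q S : 'M[K]_d) (b : 'rV[K]_d) a :
  F2 (S^T *m q *m S) (a *: (b *m S)) = a ^+ 2 * \det S ^+ 4 * F2 q b.
Proof.
rewrite /F2 !adj_mulmx !det_mulmx det_tr linearZ /= -!scalemxAl -!scalemxAr scalerA -expr2 mxE.
have -> : b *m S *m (\adj S *m (\adj q *m \adj S^T)) *m (b *m S)^T =
    \det S ^+ 2 *: (b *m \adj q *m b^T).
  rewrite trmx_mul !mulmxA -(mulmxA b) mul_mx_adj -!mulmxA (mulmxA (\adj S^T)) mul_adj_mx det_tr.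
  by rewrite !mul_scalar_mx -!scalemxAr scalerA expr2.
by rewrite mxE; ring.
Qed.

(** The roots of H are the roots of E_7 with even coefficient at [alpha_2], whose index here is 1.
    Hence [Theta] is 1 on Lie(H) and -1 on q. *)
Definition oddj (j : nat) : bool := Z.odd (dz 1 j).
Definition Pe : 'M[K]_133 := opmx K (fun j => (j, if oddj j then Z0 else Z.one)).
Definition Po : 'M[K]_133 := opmx K (fun j => (j, if oddj j then Z.one else Z0)).
Definition Theta : 'M[K]_133 := Pe - Po.

Lemma PeE : Pe = 2%:R^-1 *: (1%:M + Theta).
Proof.
apply: mx_ext => j j133; rewrite -scalemxAl mulmxDl mulmxBl mul1mx !opmx_dl // /mono /=.
case: ifP => _; rewrite zK0 zK1 !scale0r !scale1r ?sub0r ?subrr ?scaler0 // subr0.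
by rewrite -mulr2n -scaler_nat scalerA mulVf ?scale1r // pnatr_eq0.
Qed.

Lemma PoE : Po = 2%:R^-1 *: (1%:M - Theta).
Proof.
apply: mx_ext => j j133; rewrite -scalemxAl mulmxBl mulmxBl mul1mx !opmx_dl // /mono /=.
case: ifP => _; rewrite zK0 zK1 !scale0r !scale1r ?sub0r ?subr0 ?subrr ?scaler0 // opprK.
by rewrite -mulr2n -scaler_nat scalerA mulVf ?scale1r // pnatr_eq0.
Qed.

Lemma comm_Theta_Pe (A : 'M[K]_133) : A *m Theta = Theta *m A -> A *m Pe = Pe *m A /\ A *m Po = Po *m A.
Proof.
move=> h; rewrite PeE PoE -!scalemxAr -!scalemxAl; split; congr (_ *: _).
  by rewrite mulmxDr mulmxDl mulmx1 mul1mx h.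
by rewrite mulmxBr mulmxBl mulmx1 mul1mx h.
Qed.

Definition thz (j : nat) : Z := if oddj j then Z.opp Z.one else Z.one.

Lemma Theta_dl j : (j < 133)%N -> Theta *m dl K j = zK K (thz j) *: dl K j.
Proof.
move=> j133; rewrite mulmxBl !opmx_dl // /mono /thz /=.
by case: ifP => _; rewrite ?zKN zK0 zK1 scale0r ?sub0r ?subr0 // scaleN1r scale1r.
Qed.

Lemma op_parity : all (fun k => all (fun j =>
  let s := if k == 1%N then Z.opp Z.one else Z.one in let p := opE k j in let p' := opF k j in
  Z.eqb (Z.mul (thz j) p.2) (Z.mul s (Z.mul p.2 (thz p.1))) &&
  Z.eqb (Z.mul (thz j) p'.2) (Z.mul s (Z.mul p'.2 (thz p'.1)))) (iota 0 133)) (iota 0 7).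
Proof. by vm_compute. Qed.

Lemma opmx_Theta op s : (forall i, (i < 133)%N -> ((op i).1 < 133)%N) ->
  (forall j, (j < 133)%N -> Z.mul (thz j) (op j).2 = Z.mul s (Z.mul (op j).2 (thz (op j).1))) ->
  opmx K op *m Theta = zK K s *: (Theta *m opmx K op).
Proof.
move=> r h; apply: mx_ext => j j133; rewrite -scalemxAl -!mulmxA Theta_dl // opmx_dl //.
rewrite -scalemxAr opmx_dl // mulmx_mono Theta_dl ?r // /mono !scalerA -!zKM h //.
by rewrite Z.mul_assoc.
Qed.

Lemma gens_Theta k : (k < 7)%N ->
  let s := zK K (if k == 1%N then Z.opp Z.one else Z.one) in
  Emx K k *m Theta = s *: (Theta *m Emx K k) /\ Fmx K k *m Theta = s *: (Theta *m Fmx K k).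
Proof.
move=> k7 s; split; apply: opmx_Theta => j j133; try by have [] := op_lt k7 j133.
  by have /andP [/Z.eqb_eq] := all7 op_parity k7 (j := j) j133.
by have /andP [_ /Z.eqb_eq] := all7 op_parity k7 (j := j) j133.
Qed.

Lemma xp_Theta (M : nat -> 'M[K]_133) :
  (forall k, (k < 7)%N -> M k *m Theta = (if k == 1%N then -1 else 1) *: (Theta *m M k)) ->
  forall a, (a < 63)%N -> xp M a *m Theta = (-1) ^+ nth 0%N (rt a) 1 *: (Theta *m xp M a).
Proof.
move=> hM a; have [N] := ubnP a; elim: N a => // N IH a; rewrite ltnS => aN a63.
case: (ltnP a 7) => a7.
  rewrite xp_simple // hM //; congr (_ *: _).
  have := all7 rt_coef_simple (isT : 1 < 7)%N (j := a) a7 => /eqP ->.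
  by rewrite eq_sym; case: eqP => _.
have ha : (7 <= a < 63)%N by rewrite a7.
have [h1 h2 _ _] := model_par ha.
have := all7 rt_coef_par (isT : 1 < 7)%N (j := a) ha => /eqP ->.
have IHb := IH _ (leq_trans h1 aN) (ltn_trans h1 a63).
rewrite (xpE M ha); set c := zK K _; set b := xp M (par a).2 in IHb *; set A := M _.
have hA : A *m Theta = (-1) ^+ ((par a).1 == 1%N) *: (Theta *m A).
  by rewrite hM //; congr (_ *: _); case: eqP.
move: IHb hA; rewrite exprD; set t := (-1) ^+ _; set u := (-1) ^+ _ => IHb hA.
rewrite -scalemxAl -scalemxAr scalerA mulrC -scalerA; congr (_ *: _).
clearbody t u; move: (Theta) IHb hA => Th IHb hA; rewrite /lie_bracket mulmxBl mulmxBr scalerBr.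
rewrite -!mulmxA IHb hA -!scalemxAr (mulmxA A) hA (mulmxA b) IHb -!scalemxAl !scalerA.
by rewrite -!mulmxA [u * t]mulrC.
Qed.

Lemma hidx_even : all (fun c => ~~ odd (nth 0%N (rt (if c < 7 then hidx c - 7 else hidx c - 70)%N) 1) &&
   (if (c < 7)%N then (7 <= hidx c < 70)%N else (70 <= hidx c < 133)%N)) (iota 0 14).
Proof. by vm_compute. Qed.

Lemma Xmx_hidx_Theta c : (c < 14)%N -> Xmx K (hidx c) *m Theta = Theta *m Xmx K (hidx c).
Proof.
move=> c14; have /andP [ev hc] := allP2 hidx_even (i := c) c14.
have sgn k : zK K (if k == 1%N then Z.opp Z.one else Z.one) = if k == 1%N then -1 else 1.
  by case: ifP => _; rewrite ?zKN zK1.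
have hE k : (k < 7)%N -> Emx K k *m Theta = (if k == 1%N then -1 else 1) *: (Theta *m Emx K k).
  by move=> k7; have [h _] := gens_Theta k7; rewrite h sgn.
have hF k : (k < 7)%N -> Fmx K k *m Theta = (if k == 1%N then -1 else 1) *: (Theta *m Fmx K k).
  by move=> k7; have [_ h] := gens_Theta k7; rewrite h sgn.
move: ev hc; rewrite /Xmx /adX; case: (ltnP c 7) => c7 ev /andP [h7 h70].
  rewrite ltnNge h7 /= h70 (xp_Theta hE); last by lia.
  by rewrite -signr_odd (negbTE ev) scale1r.
have r1 : (hidx c < 7)%N = false by lia.
have r2 : (hidx c < 70)%N = false by lia.
rewrite r1 r2 (xp_Theta hF); last by lia.
by rewrite -signr_odd (negbTE ev) scale1r.
Qed.

End CrossForms.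

(** * Semi-invariance of the two functions and the cross identity *)

Section CrossIdentity.
Variables (K : numClosedFieldType) (n : nat).
Variables (G T B : set 'M[K]_n) (alpha omega : 'I_7 -> 'M[K]_n -> K).
Variables (e f : nat -> 'M[K]_n) (tau : nat -> K -> 'M[K]_n).
Hypothesis D : e7_data G T B alpha omega e f tau.
Local Notation zK := (zK K).
Local Notation X := (adX e f).
Local Notation phi := (phi e f).
Local Notation adm := (adm e f).
Local Notation Jmx := (Jmx K).
Local Notation Pe := (Pe K).
Local Notation Po := (Po K).
Local Notation Theta := (Theta K).
Let rel := e7_rel D.
Let e0 := e7_e0 D.
Let gG := e7_grp D.

Definition ady (y : 'cV[K]_133) : 'M[K]_133 := \sum_(i < 133) y i 0 *: Xmx K i.

Lemma phi_ady y c : phi (ady y *m c) = lie_bracket (phi y) (phi c).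
Proof.
rewrite /ady mulmx_suml phi_sum {2}/phi br_anti br_sum -sumrN; apply: eq_bigr => i _.
rewrite -scalemxAl phiZ (phi_X D) // -br_anti brZl //.
Qed.

Lemma ady_dl k : (k < 7)%N -> ady (dl K (7 + k)) = Emx K k.
Proof.
move=> k7; have k133 : (7 + k < 133)%N by lia.
rewrite /ady (bigD1 (Ordinal k133)) //= big1 => [|j jk].
  by rewrite mxE eqxx scale1r addr0 /Xmx adX_e.
rewrite mxE (_ : (_ == nat_of_ord j) = false) ?scale0r //; apply/negbTE.
by move: jk; rewrite -val_eqE /= eq_sym.
Qed.

Lemma adyZ a y : ady (a *: y) = a *: ady y.
Proof.
by rewrite /ady scaler_sumr; apply: eq_bigr => i _; rewrite mxE scalerA.
Qed.

Lemma adm_ady g y : G g -> adm g *m ady y = ady (adm g *m y) *m adm g.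
Proof.
move=> Gg; apply: (phi_mx_inj D) => c; rewrite -!mulmxA phi_ady !(phi_adm D _ Gg) phi_ady.
by rewrite Ad_br // (mxg_unit gG).
Qed.

Section Forms.
Variable d : nat.
Implicit Types (y : 'cV[K]_133) (M : 'M[K]_(133, d)).

Definition qf M := M^T *m (Pe^T *m Jmx *m Pe) *m M.
Definition cf y M := M^T *m (Po^T *m Jmx *m ady y *m Pe) *m M.
Definition bf y M := y^T *m Jmx *m M.
Definition f1 y M := F1 (qf M) (cf y M).
Definition f2 y M := F2 (qf M) (bf y M).

Lemma f_equiv (A : 'M[K]_133) y M : A^T *m Jmx *m A = Jmx -> A *m Theta = Theta *m A ->
  A *m ady y = ady (A *m y) *m A ->
  f1 (A *m y) (A *m M) = f1 y M /\ f2 (A *m y) (A *m M) = f2 y M.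
Proof.
move=> AJ ATh Aad; have [AP AQ] := comm_Theta_Pe ATh.
have AP' : A^T *m Pe^T = Pe^T *m A^T by rewrite -!trmx_mul AP.
have AQ' : A^T *m Po^T = Po^T *m A^T by rewrite -!trmx_mul AQ.
have q1 : qf (A *m M) = qf M.
  rewrite /qf trmx_mul !mulmxA -[M^T *m A^T *m _]mulmxA AP' -!mulmxA (mulmxA Pe) -AP.
  by rewrite -!mulmxA (mulmxA Jmx) (mulmxA A^T) (mulmxA A^T) AJ.
have c1 : cf (A *m y) (A *m M) = cf y M.
  rewrite /cf trmx_mul !mulmxA -[M^T *m A^T *m _]mulmxA AQ' -!mulmxA (mulmxA Pe) -AP.
  rewrite -!mulmxA (mulmxA (ady (A *m y))) -Aad -!mulmxA (mulmxA Jmx) (mulmxA A^T) (mulmxA A^T) AJ.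
  by [].
have b1 : bf (A *m y) (A *m M) = bf y M.
  by rewrite /bf trmx_mul -!mulmxA (mulmxA Jmx) (mulmxA A^T) (mulmxA A^T) AJ mulmxA.
by rewrite /f1 /f2 q1 c1 b1.
Qed.

Lemma f_right y M S : f1 y (M *m S) = \det S ^+ 4 * f1 y M /\ f2 y (M *m S) = \det S ^+ 4 * f2 y M.
Proof.
have q1 : qf (M *m S) = S^T *m qf M *m S by rewrite /qf trmx_mul !mulmxA.
have c1 : cf y (M *m S) = 1 *: (S^T *m cf y M *m S) by rewrite scale1r /cf trmx_mul !mulmxA.
have b1 : bf y (M *m S) = 1 *: (bf y M *m S) by rewrite scale1r /bf mulmxA.
by rewrite /f1 /f2 q1 c1 b1 F1_scale F2_scale expr1n mul1r.
Qed.

Lemma f_scale a y M : f1 (a *: y) M = a ^+ 2 * f1 y M /\ f2 (a *: y) M = a ^+ 2 * f2 y M.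
Proof.
have q1 : qf M = (1%:M)^T *m qf M *m 1%:M by rewrite trmx1 mul1mx mulmx1.
have c1 : cf (a *: y) M = a *: ((1%:M)^T *m cf y M *m 1%:M).
  by rewrite trmx1 mul1mx mulmx1 /cf adyZ -!scalemxAr -!scalemxAl -!scalemxAr -scalemxAl.
have b1 : bf (a *: y) M = a *: (bf y M *m 1%:M).
  by rewrite mulmx1 /bf linearZ /= -!scalemxAl.
by rewrite /f1 /f2 {1 3}q1 c1 b1 F1_scale F2_scale det1 expr1n mulr1.
Qed.

End Forms.

Variable r : seq nat.
Let MM g := adm g *m selmx K r.

(** Proportionality of the two functions on [G], written without division; it covers the case where
    one of them vanishes identically. *)
Definition cross y := forall g1 g2, G g1 -> G g2 ->
  f1 y (MM g1) * f2 y (MM g2) = f1 y (MM g2) * f2 y (MM g1).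

Lemma f_pfun y : pfun (fun g => f1 y (MM g)) /\ pfun (fun g => f2 y (MM g)).
Proof.
have pM : pmx MM by apply: pmxM; [exact: adm_pmx | exact: pmxC].
have pq : pmx (fun g => qf (MM g)) by apply: pmxM => //; apply: pmxM; [exact: pmx_tr | exact: pmxC].
have pc : pmx (fun g => cf y (MM g)) by apply: pmxM => //; apply: pmxM; [exact: pmx_tr | exact: pmxC].
have pb : pmx (fun g => bf y (MM g)) by apply: pmxM => //; exact: pmxC.
split; first by apply/pfunX/pfun_tr/pmxM => //; apply: pmx_adj.
apply: pfunM; first exact: pfun_det.
by apply: (pmxM (pmxM pb (pmx_adj pq)) (pmx_tr pb)).
Qed.

Lemma open_vanish (O : set 'M[K]_n) (F : 'M[K]_n -> K) : open_in G O -> O !=set0 -> pfun F ->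
  (forall g, O g -> F g = 0) -> forall g, G g -> F g = 0.
Proof.
move=> [Z [I ZI] OZ] [g0 Og0] pF FO; move: (Og0); rewrite OZ => -[Gg0 Zg0].
have [p Ip p0] : exists2 p, I p & mxeval g0 p != 0.
  apply: contrapT => np; apply: Zg0; rewrite ZI; split; first exact: (mxg_unit gG).
  by move=> p Ip; apply/eqP/negPn/negP => p0; apply: np; exists p.
have [||h g Gg] := e7_irr D (p := p) (q := polf F); last 1 first.
- by rewrite -(polfE _ pF) h.
- move=> g Gg; rewrite polfE //; case: (eqVneq (mxeval g p) 0) => [->|pg]; first by rewrite mul0r.
  rewrite FO ?mulr0 // OZ; split=> //; rewrite ZI => -[_ /(_ p Ip)] /eqP.
  by rewrite (negbTE pg).
- by move=> /(_ g0 Gg0) h; rewrite h eqxx in p0.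
Qed.

Variables (P BH : set 'M[K]_n).
Hypothesis hP : forall p, P p -> G p /\ exists S, adm p *m selmx K r = selmx K r *m S.
Hypothesis BG : BH `<=` G.
Hypothesis BTh : forall b, BH b -> adm b *m Theta = Theta *m adm b.

Lemma orbit_weight y b g p : y != 0 -> BH b -> (exists a, adm b *m y = a *: y) -> G g -> P p ->
  exists a, f1 y (MM (b *m g *m p)) = a * f1 y (MM g) /\ f2 y (MM (b *m g *m p)) = a * f2 y (MM g).
Proof.
move=> y0 Bb [x hx] Gg Pp; have [Gp [S hS]] := hP Pp; have Gb := BG Bb.
have x0 : x != 0.
  apply/negP=> /eqP x0; case/negP: y0; apply/eqP.
  have ub : adm (invmx b) *m adm b = 1%:M.
    by rewrite -(admM D) ?mulVmx ?(adm1 D) ?(mxg_unit gG) //; apply: (mxgV gG).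
  by rewrite -[y]mul1mx -ub -mulmxA hx x0 scale0r mulmx0.
have -> : MM (b *m g *m p) = (adm b *m MM g) *m S.
  by rewrite /MM !(admM D) //; [rewrite -!mulmxA hS | apply: (mxgM gG)].
have [h1 h2] := f_right y (adm b *m MM g) S; rewrite h1 h2.
have [h3 h4] := f_equiv (MM g) (adm_J D Gb) (BTh Bb) (adm_ady y Gb).
move: h3 h4; rewrite hx; have [-> ->] := f_scale x y (adm b *m MM g) => <- <-.
(* Both functions agree at [(y, M)] and [(Ad b y, Ad b M)], and [Ad b y = x y]; returning from [x y]
   to [y] costs the factor [x^-2]. *)
exists (\det S ^+ 4 * x ^- 2); by split; rewrite -[RHS]mulrA mulKf // expf_neq0.
Qed.

Lemma orbit_cross y g0 : y != 0 -> (forall b, BH b -> exists a, adm b *m y = a *: y) -> G g0 ->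
  forall g1 g2, (exists b p, [/\ BH b, P p & g1 = b *m g0 *m p]) ->
    (exists b p, [/\ BH b, P p & g2 = b *m g0 *m p]) ->
  f1 y (MM g1) * f2 y (MM g2) = f1 y (MM g2) * f2 y (MM g1).
Proof.
move=> y0 hy Gg0 _ _ [b1 [p1 [Bb1 Pp1 ->]]] [b2 [p2 [Bb2 Pp2 ->]]].
have [a1 [-> ->]] := orbit_weight y0 Bb1 (hy _ Bb1) Gg0 Pp1.
have [a2 [-> ->]] := orbit_weight y0 Bb2 (hy _ Bb2) Gg0 Pp2.
ring.
Qed.

(** The identity holds for two points of the open orbit, and [open_vanish] extends it to all of [G]
    one variable at a time. *)
Lemma open_orbit_cross y g0 O : y != 0 -> (forall b, BH b -> exists a, adm b *m y = a *: y) ->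
  G g0 -> open_in G O -> O !=set0 ->
  (forall g, O g -> exists b p, [/\ BH b, P p & g = b *m g0 *m p]) -> cross y.
Proof.
move=> y0 hy Gg0 oO O0 hO; have [p1 p2] := f_pfun y.
have pF a b (u w : 'M[K]_n -> K) : pfun u -> pfun w -> pfun (fun g => u g * a - b * w g).
  by move=> pu pw; apply: pfunB; [apply: pfunM => //; apply: pfunC | apply: pfunZ].
have pF' a b (u w : 'M[K]_n -> K) : pfun u -> pfun w -> pfun (fun g => a * u g - w g * b).
  by move=> pu pw; apply: pfunB; [apply: pfunZ | apply: pfunM => //; apply: pfunC].
have h g1 g2 : O g2 -> G g1 ->
    f1 y (MM g1) * f2 y (MM g2) = f1 y (MM g2) * f2 y (MM g1).
  move=> Og2; move: g1; pose F g1 := f1 y (MM g1) * f2 y (MM g2) - f1 y (MM g2) * f2 y (MM g1).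
  suff h g1 : G g1 -> F g1 = 0 by move=> g1 /h /eqP; rewrite subr_eq0 => /eqP.
  apply: open_vanish oO O0 _ _ g1.
    exact: (pF _ _ _ _ p1 p2).
  move=> g1 Og1; apply/eqP; rewrite subr_eq0; apply/eqP.
  by apply: (orbit_cross y0 hy Gg0); apply: hO.
move=> g1 g2 Gg1 Gg2; apply/eqP; rewrite -subr_eq0; apply/eqP.
pose F g2 := f1 y (MM g1) * f2 y (MM g2) - f1 y (MM g2) * f2 y (MM g1).
apply: (@open_vanish O F) => //; last first.
  by move=> g Og; apply/eqP; rewrite subr_eq0; apply/eqP/h.
exact: (pF' _ _ _ _ p2 p1).
Qed.

End CrossIdentity.

(** * Moving y: invariance under H and a limit along the torus *)

Section CrossLimit.
Variables (K : numClosedFieldType) (n : nat).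
Variables (G T B : set 'M[K]_n) (alpha omega : 'I_7 -> 'M[K]_n -> K).
Variables (e f : nat -> 'M[K]_n) (tau : nat -> K -> 'M[K]_n).
Hypothesis D : e7_data G T B alpha omega e f tau.
Local Notation zK := (zK K).
Local Notation X := (adX e f).
Local Notation phi := (phi e f).
Local Notation adm := (adm e f).
Local Notation Pe := (Pe K).
Local Notation Po := (Po K).
Local Notation Theta := (Theta K).
Let rel := e7_rel D.
Let e0 := e7_e0 D.
Let gG := e7_grp D.
Let H := generated (T `|` hexp e f).

Lemma adm_tau j s : (j < 7)%N -> s != 0 -> forall i, (i < 133)%N ->
  adm (tau j s) *m dl K i = s ^ int_of_Z (opH j i) *: dl K i.
Proof.
by move=> j7 s0 i i133; rewrite (adm_T D (e7_tauT D j s0)) // (wchar_tau D).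
Qed.

Lemma adm_H_Theta h : H h -> adm h *m Theta = Theta *m adm h.
Proof.
apply: (H_ind D (Q := fun h => adm h *m Theta = Theta *m adm h)).
- by rewrite (adm1 D) mul1mx mulmx1.
- move=> A t HA IH Tt; rewrite (admM D (H_G D HA) (e7_TG D Tt)).
  rewrite -mulmxA (_ : adm t *m Theta = Theta *m adm t) ?mulmxA ?IH //.
  apply: mx_ext => j j133; rewrite -!mulmxA (adm_T D Tt) // Theta_dl // -!scalemxAr.
  by rewrite (adm_T D Tt) // Theta_dl // !scalerA mulrC.
move=> A c s HA IH c14; have hc := hidx_range c14.
rewrite (admM D (H_G D HA) (root_exp D s hc)) (adm_root D s hc).
rewrite -mulmxA (_ : mx_exp _ *m Theta = Theta *m mx_exp (s *: Xmx K (hidx c))) ?mulmxA ?IH //.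
have [_ nM] := root_nilp D hc; apply: mx_exp_intertwine; try exact: nilpZ.
by rewrite -scalemxAl -scalemxAr (Xmx_hidx_Theta K c14).
Qed.

Variable r : seq nat.
Local Notation cross := (cross G e f r).
Let MM g := adm g *m selmx K r.

Lemma cross_H h y : H h -> cross y -> cross (adm h *m y).
Proof.
move=> Hh cy; have Gh := H_G D Hh; have GV := mxgV gG Gh.
have E g : G g -> f1 (adm h *m y) (MM g) = f1 y (MM (invmx h *m g)) /\
    f2 (adm h *m y) (MM g) = f2 y (MM (invmx h *m g)).
  move=> Gg; have -> : MM g = adm h *m MM (invmx h *m g).
    have GVg := mxgM gG GV Gg.
    by rewrite /MM mulmxA -(admM D) // mulKVmx // (mxg_unit gG).
  exact: (f_equiv _ (adm_J D Gh) (adm_H_Theta Hh) (adm_ady D y Gh)).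
move=> g1 g2 Gg1 Gg2; have [e1 e2] := E g1 Gg1; have [e3 e4] := E g2 Gg2.
rewrite /MM in e1 e2 e3 e4; rewrite e1 e2 e3 e4; apply: cy; exact: (mxgM gG).
Qed.

Lemma cross_unscale a y : a != 0 -> cross (a *: y) -> cross y.
Proof.
move=> a0 cy g1 g2 Gg1 Gg2; have := cy g1 g2 Gg1 Gg2.
have E M : f1 (a *: y) M = a ^+ 2 * f1 y M /\ f2 (a *: y) M = a ^+ 2 * f2 y M.
  exact: f_scale.
have [-> _] := E _ (adm g1 *m selmx K r); have [_ ->] := E _ (adm g2 *m selmx K r).
have [-> _] := E _ (adm g2 *m selmx K r); have [_ ->] := E _ (adm g1 *m selmx K r).
move: (f1 y _) (f2 y _) (f1 y _) (f2 y _) => p1 p2 p3 p4 h.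
have a4 : a ^+ 4 != 0 by rewrite expf_neq0.
apply: (mulfI a4); have -> : a ^+ 4 * (p3 * p4) = a ^+ 2 * p3 * (a ^+ 2 * p4) by ring.
by rewrite h; ring.
Qed.

(** Among the weights of q only [alpha_2], of index 8, has value 2 on the coroot of [alpha_2]; all
    others have smaller values. *)
Lemma odd_range : all (fun j => (j < 7)%N ==> ~~ oddj j) (iota 0 133) &&
  all (fun j => oddj j ==> (Z.leb Z0 (Z.sub Z.two (opH 1 j)) && ((Z.eqb (opH 1 j) Z.two) == (j == 8))%N))
    (iota 0 133).
Proof. by vm_compute. Qed.

Lemma Pe0_coord (y : 'cV[K]_133) (j : 'I_133) : Pe *m y = 0 -> ~~ oddj j -> y j 0 = 0.
Proof.
move=> /colP /(_ j) h nj; move: h; rewrite /Pe diag_opmx (negbTE nj) zK1 mul1r.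
by rewrite [RHS]mxE.
Qed.

Let C (F : K -> K) := exists p : {poly K}, forall u, F u = p.[u].

Lemma poly_class : ring_class C.
Proof.
split=> [F1 F2 e1 [p hp]|c|F1 F2 [p hp] [q hq]|F1 F2 [p hp] [q hq]].
- by exists p => s; rewrite -e1.
- by exists c%:P => s; rewrite hornerC.
- by exists (p + q) => s; rewrite hornerD hp hq.
- by exists (p * q) => s; rewrite hornerM hp hq.
Qed.

Let rcC := rcC poly_class.

Lemma f_poly (y : K -> 'cV[K]_133) (M : 'M[K]_(133, size r)) : rcmx C y ->
  C (fun u => f1 (y u) M) /\ C (fun u => f2 (y u) M).
Proof.
move=> py; have pc : rcmx C (fun u => cf (y u) M).
  apply: (rcmxM poly_class); last exact: (rcmxC poly_class).
  apply: (rcmxM poly_class); first exact: (rcmxC poly_class).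
  apply: (rcmxM poly_class); last exact: (rcmxC poly_class).
  apply: (rcmxM poly_class); first exact: (rcmxC poly_class).
  apply: (rcmx_sum poly_class) => i; apply: (rcmxZ poly_class); first exact: py.
  exact: (rcmxC poly_class).
have pb : rcmx C (fun u => bf (y u) M).
  apply: (rcmxM poly_class); last exact: (rcmxC poly_class).
  apply: (rcmxM poly_class); last exact: (rcmxC poly_class).
  by move=> i j; apply: (rc_ext poly_class) (py j i) => u; rewrite mxE.
split.
  apply: (rcX poly_class); apply: (rc_sum poly_class) => i.
  by apply: (rcmxM poly_class) => //; apply: (rcmxC poly_class).
apply: (rcM poly_class); first exact: rcC.
apply: (rcmxM poly_class); first by apply: (rcmxM poly_class) => //; apply: (rcmxC poly_class).
by move=> i j; apply: (rc_ext poly_class) (pb j i) => u; rewrite [RHS]mxE.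
Qed.

(* The limit of u^2 Ad(tau_2(1/u)) y as u tends to 0. *)
Lemma cross_limit y : Pe *m y = 0 -> y (inord 8) 0 != 0 -> cross y -> cross (dl K 8).
Proof.
move=> y0 y8 cy; have /andP [/allP2 lt7 /allP2 hodd] := odd_range.
(* On the weights of q these exponents are nonnegative and vanish only for [j = 8], so [yu] is
   polynomial in [u] and [yu 0] is a multiple of the root vector of [alpha_2]. *)
pose nn (j : nat) : nat := Z.to_nat (Z.sub Z.two (opH 1 j)).
pose yu (u : K) : 'cV[K]_133 := \col_j (u ^+ nn j * y j 0).
have yuE u : u != 0 -> yu u = u ^+ 2 *: (adm (tau 1 u^-1) *m y).
  move=> u0; rewrite [y in RHS]colE_dl mulmx_sumr scaler_sumr [LHS]colE_dl.
  apply: eq_bigr => j _; rewrite -scalemxAr adm_tau ?invr_neq0 // [yu u j 0]mxE.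
  case oj: (oddj j); last by rewrite Pe0_coord ?oj // mulr0 !scale0r scaler0.
  rewrite !scalerA; congr (_ *: _).
  have := hodd j (ltn_ord j); rewrite oj => /andP [/Z.leb_le le _].
  rewrite exprz_inv mulrAC; congr (_ * _).
  have -> : u ^+ 2 = u ^ 2 by [].
  rewrite -expfzDr //; have -> : u ^+ nn j = u ^ (nn j)%:Z by [].
  by congr (_ ^ _); rewrite /nn; move: le; case: (opH 1 j) => [|p|p]; rewrite /Z.two; lia.
have cyu u : u != 0 -> cross (yu u).
  move=> u0; have u2 : u ^- 2 != 0 by rewrite invr_neq0 // expf_neq0.
  have cH : cross (adm (tau 1 u^-1) *m y).
    have V0 : u^-1 != 0 by rewrite invr_neq0.
    have Hh : H (tau 1 u^-1) by apply: H_T; apply: (e7_tauT D).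
    exact: (cross_H Hh cy).
  apply: (cross_unscale u2); rewrite (yuE u u0) scalerA mulVf; last by rewrite expf_neq0.
  by rewrite scale1r; exact: cH.
have c0 : cross (yu 0).
  move=> g1 g2 Gg1 Gg2.
  have py : rcmx C yu.
    move=> i j; apply: (rc_ext poly_class) (_ : C (fun u => u ^+ nn i * y i 0)) => [u|].
      by rewrite mxE.
    apply: (rcM poly_class); last exact: rcC.
    by apply: (rcX poly_class); exists 'X => u; rewrite hornerX.
  have [p1 q2] := f_poly (MM g1) py; have [p2 q1] := f_poly (MM g2) py.
  have [p hp] := rcM poly_class p1 q1; have [q hq] := rcM poly_class p2 q2.
  have pq : p = q by apply: poly_fun_inj => u u0; rewrite -hp -hq; apply: cyu.
  by have := hp 0; rewrite pq -hq.
apply: (cross_unscale y8); rewrite (_ : _ *: _ = yu 0) //.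
apply/colP=> j; rewrite !mxE; case oj: (oddj j); last first.
  rewrite [y j 0]Pe0_coord ?oj // mulr0; case: eqP => [e8|]; last by rewrite mulr0.
  by move: oj; rewrite -e8.
have := hodd j (ltn_ord j); rewrite oj => /andP [/Z.leb_le le /eqP e8].
rewrite expr0n eq_sym; case: (eqVneq (nat_of_ord j) 8%N) e8 => [j8|j8] /= e8.
  have -> : nn j = 0%N by move/Z.eqb_eq: e8; rewrite /nn => ->.
  rewrite mul1r mulr1; congr (y _ 0); apply: val_inj; by rewrite /= inordK // j8.
rewrite mulr0; have -> : (nn j == 0%N) = false; last by rewrite mul0r.
move/Z.eqb_neq: e8; rewrite /nn; move: le; move: (opH 1 j) (Z.two) => a b; lia.
Qed.

End CrossLimit.

(** * Irreducibility of q under H, and the cross identity from an open orbit *)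

Section CrossSpherical.
Variables (K : numClosedFieldType) (n : nat).
Variables (G T B : set 'M[K]_n) (alpha omega : 'I_7 -> 'M[K]_n -> K).
Variables (e f : nat -> 'M[K]_n) (tau : nat -> K -> 'M[K]_n).
Hypothesis D : e7_data G T B alpha omega e f tau.
Local Notation zK := (zK K).
Local Notation X := (adX e f).
Local Notation phi := (phi e f).
Local Notation adm := (adm e f).
Local Notation Pe := (Pe K).
Local Notation Theta := (Theta K).
Let rel := e7_rel D.
Let e0 := e7_e0 D.
Let gG := e7_grp D.
Let H := generated (T `|` hexp e f).

(** With the next two checks, a path inside q from any root to [alpha_2] by root vectors of H:
    positive roots descend by the [f_k], negative ones ascend by the [e_k] to [- alpha_2], and the
    root vector of [beta_2] leads from there to a positive root. *)
Lemma odd_descent : all (fun j => oddj j ==> (j == 8)%N ||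
  has (fun k => (k != 1)%N && let p := opF k j in
    [&& ~~ Z.eqb p.2 Z0, 7 <= p.1, p.1 < 70, oddj p.1 & rt_ht (p.1 - 7) < rt_ht (j - 7)]%N) (iota 0 7))
  (iota 7 63).
Proof. by vm_compute. Qed.

Lemma odd_ascent : all (fun a => oddj (70 + a) ==> (a == 1)%N ||
  has (fun k => (k != 1)%N && let p := opE k (70 + a) in
    [&& ~~ Z.eqb p.2 Z0, 70 <= p.1, p.1 < 133, oddj p.1 & rt_ht (p.1 - 70) < rt_ht a]%N) (iota 0 7))
  (iota 0 63).
Proof. by vm_compute. Qed.

Lemma odd_jump : let p := opF 1 (7 + b2) in
  [&& ~~ Z.eqb p.2 Z0, 7 <= p.1, p.1 < 70 & oddj p.1]%N.
Proof. by vm_compute. Qed.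

Lemma mx_dl (M : 'M[K]_133) a (i : 'I_133) : (M *m dl K i) a 0 = M a i.
Proof.
rewrite mxE (bigD1 i) //= big1 => [|l li]; rewrite mxE ?eqxx ?mulr1 ?addr0 //.
by rewrite (_ : (nat_of_ord i == l) = false) ?mulr0 //; apply/negbTE; rewrite eq_sym.
Qed.

(** The vectors of q whose whole H-orbit has coordinate 0 at [alpha_2]: an H-stable subspace, shown
    below to contain no root vector. *)
Let Z (u : 'cV[K]_133) := Pe *m u = 0 /\ forall h, H h -> (adm h *m u) (inord 8) 0 = 0.

Let Z_lin a u w : Z u -> Z w -> Z (a *: u + w).
Proof.
move=> [u0 hu] [w0 hw]; split; first by rewrite mulmxDr -scalemxAr u0 w0 scaler0 addr0.
by move=> h Hh; rewrite mulmxDr -scalemxAr [LHS]mxE [X in X + _]mxE hu // hw // mulr0 addr0.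
Qed.

Let Z00 : Z 0.
Proof. by split=> [|h _]; rewrite mulmx0 // mxE. Qed.

Let Z_unscale a u : a != 0 -> Z (a *: u) -> Z u.
Proof. by move=> a0 /(Z_lin a^-1) /(_ Z00); rewrite scalerA mulVf // scale1r addr0. Qed.

Let Z_X c u : (c < 14)%N -> Z u -> Z (Xmx K (hidx c) *m u).
Proof.
move=> c14 [u0 hu]; have hc := hidx_range c14; have [_ nM] := root_nilp D hc.
set M := Xmx K _ in nM *; have [cP _] := comm_Theta_Pe (Xmx_hidx_Theta K c14).
split; first by rewrite mulmxA -cP -mulmxA u0 mulmx0.
move=> h Hh; have h1 := mpderM (mpderC (adm h)) (mpderM (mpder_mx_exp nM) (mpderC u)).
have h2 : pder (fun s => (adm h *m (mx_exp (s *: M) *m u)) (inord 8) 0) (fun _ => 0).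
  apply: pder_ext (pderC 0) => // s; rewrite -(adm_root D s hc) mulmxA.
  have Hs : H (mx_exp (s *: X (hidx c))) by apply: H_exp.
  have Gs := H_G D Hs; have Gh := H_G D Hh.
  by rewrite -(admM D Gh Gs) hu //; apply: (mxgM (H_grp D)).
have := pder_uniq (h1 (inord 8) 0) h2 0; rewrite scale0r mx_exp0 mul1mx mul0mx add0r.
by rewrite mulmx0 addr0.
Qed.

Let Z_H j u : (j < 7)%N -> Z u -> Z (Hmx K j *m u).
Proof.
move=> j7 [u0 hu]; split.
  apply/colP=> i; rewrite /Pe /Hmx !diag_opmx [RHS]mxE.
  have /colP /(_ i) := u0; rewrite /Pe diag_opmx [RHS]mxE => h.
  by rewrite mulrCA h mulr0.
move=> h Hh; apply: (@lder_uniq _ (fun s => (adm h *m (adm (tau j s) *m u)) (inord 8) 0)); last first.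
  apply: lder_ext (lderC 0) => s s0; have Hs : H (tau j s) by apply: H_T; apply: (e7_tauT D).
  by rewrite mulmxA -(admM D (H_G D Hh) (H_G D Hs)) hu //; apply: (mxgM (H_grp D)).
have E (F : nat -> K) (A : 'M[K]_133) : (forall i, (i < 133)%N -> A *m dl K i = F i *: dl K i) ->
    (adm h *m (A *m u)) (inord 8) 0 = \sum_(i < 133) (adm h (inord 8) i * u i 0) * F i.
  move=> hA; rewrite {1}(colE_dl u) !mulmx_sumr summxE; apply: eq_bigr => i _.
  by rewrite -!scalemxAr hA // -scalemxAr scalerA [LHS]mxE mx_dl; ring.
rewrite (E (fun i => zK (opH j i))); last by move=> i i133; apply: Hmx_dl.
have l1 : lder (fun s => \sum_(i < 133) (adm h (inord 8) i * u i 0) * s ^ int_of_Z (opH j i))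
   (\sum_(i < 133) (adm h (inord 8) i * u i 0) * zK (opH j i)).
  by apply: lder_sum => i; apply: lderZ; apply: lder_exprz.
apply: lder_ext l1 => s s0; rewrite (E (fun i => s ^ int_of_Z (opH j i))) // => i i133.
exact: (adm_tau D).
Qed.

Let Z_root i : (7 <= i < 133)%N -> oddj i -> ~ Z (dl K i).
Proof.
have Epos : forall i, (7 <= i < 70)%N -> oddj i -> ~ Z (dl K i).
  move=> {}i; have [N] := ubnP (rt_ht (i - 7)); elim: N i => // N IH i; rewrite ltnS => iN hi oi Zi.
  have := allP2 odd_descent (i := i) hi; rewrite oi => /orP [/eqP i8|/hasP [k]].
    move: Zi; rewrite i8 => -[_ /(_ _ (mxg1 (H_grp D)))].
    rewrite (adm1 D) mul1mx mxE inordK // eqxx => /eqP; by rewrite oner_eq0.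
  rewrite mem_iota => k7 /andP [k1 /and5P [/negbTE/Z.eqb_neq nz p7 p70 op ht]].
  have c14 : (7 + k < 14)%N by move: k7 => /=; lia.
  have := Z_X c14 Zi; have -> : hidx (7 + k) = (70 + k)%N.
    rewrite /hidx; have -> : (7 + k < 7)%N = false by lia.
    by have -> : (7 + k == 8)%N = false by move: k1; lia.
  rewrite /Xmx adX_f // opmx_dl; last by move: hi; lia.
  rewrite /mono => /Z_unscale h; apply: (IH _ (leq_trans ht iN) _ op); first by rewrite p7.
  by apply: h; apply/eqP => /zK_eq0.
have [N] := ubnP (rt_ht (i - 70)); elim: N i => // N IH i; rewrite ltnS => iN /andP [i7 i133] oi Zi.
case: (ltnP i 70) => i70; first by apply: (Epos i) => //; rewrite i7.
have a63 : (i - 70 < 63)%N by lia.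
have := allP2 odd_ascent (i := i - 70) a63; rewrite subnKC // oi => /orP [/eqP i71|/hasP [k]].
  have {i71} i71 : i = 71%N by lia.
  have /and4P [/negbTE/Z.eqb_neq nz p7 p70 op] := odd_jump.
  have := Z_X (isT : 1 < 14)%N Zi; have -> : hidx 1 = (7 + b2)%N by [].
  have b133 : (7 + b2 < 133)%N by [].
  have -> : Xmx K (7 + b2) *m dl K i = - mono (dl K) (opF 1 (7 + b2)).
    apply: (phi_inj rel e0); rewrite (phi_X D) // phi_dl // -scaleN1r phiZ /mono phiZ phi_dl; last by lia.
    have X71 : X 71 = f 1%N by exact: (@adX_f _ _ e f 1).
    rewrite i71 X71.
    by rewrite br_anti (adX_F rel) // scaleN1r.
  rewrite -scaleN1r /mono scalerA => /Z_unscale h.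
  apply: (Epos _ _ op); first by rewrite p7.
  by apply: h; rewrite mulN1r oppr_eq0; apply/eqP => /zK_eq0.
rewrite mem_iota => k7 /andP [k1 /and5P [/negbTE/Z.eqb_neq nz p7 p70 op ht]].
have c14 : (k < 14)%N by move: k7 => /=; lia.
have := Z_X c14 Zi; have -> : hidx k = (7 + k)%N.
  rewrite /hidx; have -> : (k < 7)%N by [].
  by rewrite (negbTE k1).
rewrite /Xmx adX_e // opmx_dl // /mono => /Z_unscale h.
apply: (IH _ (leq_trans ht iN) _ op); first by lia.
by apply: h; apply/eqP => /zK_eq0.
Qed.

Lemma odd_move (y : 'cV[K]_133) : y != 0 -> Pe *m y = 0 -> exists2 h, H h & (adm h *m y) (inord 8) 0 != 0.
Proof.
move=> y0 Py; apply: contrapT => nh.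
have Zy : Z y.
  by split=> // h Hh; apply/eqP/negPn/negP => h0; apply: nh; exists h.
have [|||Zr _] := @wt_split K Z y _ _ _ Zy; [exact: Z00|exact: Z_lin|by move=> k u; apply: Z_H|].
case/negP: y0; apply/eqP/colP=> i; rewrite [RHS]mxE; apply/eqP/negPn/negP => yi.
have oi : oddj i by apply: contraNT yi => noi; apply/eqP; apply: Pe0_coord Py noi.
case: (ltnP i 7) => i7.
  by have /andP [/allP2 lt7 _] := odd_range; have := lt7 i (ltn_ord i); rewrite i7 oi.
apply: (@Z_root i) => //; first by rewrite i7 ltn_ord.
exact: Z_unscale yi (Zr i i7).
Qed.

Variables (r : seq nat) (P : set 'M[K]_n).
Hypothesis hP : forall p, P p -> G p /\ exists S, adm p *m selmx K r = selmx K r *m S.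
Hypothesis P1 : P 1%:M.

(** For the given Borel subgroup [BH], Lie-Kolchin on q yields an eigenvector [y]; [odd_move] and
    [cross_limit] replace it by the root vector of [alpha_2]. *)
Lemma spherical_cross : spherical H G P -> cross G e f r (dl K 8).
Proof.
move=> [BH [BHH [aB cB sB] _] [x [g0 Gg0 <-] [_ oO]]].
have gB : mx_group BH by case: aB.
have BG : BH `<=` G by move=> b /BHH /(H_G D).
have BTh b : BH b -> adm b *m Theta = Theta *m adm b by move=> /BHH; apply: (adm_H_Theta D).
have [U hU] := @pred_vspace K 'cV[K]_133 (fun u => Pe *m u = 0) (mulmx0 _ _)
  (fun a u w hu hw => etrans (mulmxDr _ _ _) (etrans (congr2 +%R (etrans (esym (scalemxAr _ _ _))
     (etrans (congr1 _ hu) (scaler0 _ _))) hw) (addr0 _))).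
have U8 : dl K 8 \in U by apply/hU; rewrite /Pe opmx_dl // /mono /= scale0r.
have U0 : U != 0%VS.
  apply/negP=> /eqP U0; move: U8; rewrite U0 memv0 => /eqP e1.
  by have := @dl_neq0 K 8 isT; rewrite e1 eqxx.
have [y [yU y0 hy]] : exists y, [/\ y \in U, y != 0 & forall b, BH b -> exists a, adm b *m y = a *: y].
  apply: (@lie_kolchin K n 133 BH adm U gB) => //.
  - by apply: connected_fc => // b /(mxg_unit gB).
  - exact: (adm_rep D BG).
  - move=> b u Bb /hU Pu; apply/hU; have [cP _] := comm_Theta_Pe (BTh b Bb).
    by rewrite mulmxA -cP -mulmxA Pu mulmx0.
have Py : Pe *m y = 0 by apply/hU.
have hO g : G g /\ orbit_of BH (left_translate g0 P) (left_translate g P) ->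
    exists b p, [/\ BH b, P p & g = b *m g0 *m p].
  move=> [Gg [b Bb e1]]; have : left_translate g P g by exists 1%:M => //; rewrite mulmx1.
  by rewrite -e1 => -[_ [p Pp <-] <-]; exists b, p; split=> //; rewrite mulmxA.
have cy : cross G e f r y.
  apply: (open_orbit_cross D hP BG BTh y0 hy Gg0 oO _ hO).
  exists g0; split=> //; exists 1%:M; first exact: mxg1.
  by apply/seteqP; split=> [A [C hC <-]|A hA]; [rewrite mul1mx | exists A => //; rewrite mul1mx].
have [h Hh h8] := odd_move y0 Py.
apply: (cross_limit D _ h8); last exact: (cross_H D Hh cy).
have [cP _] := comm_Theta_Pe (adm_H_Theta D Hh).
by rewrite mulmxA -cP -mulmxA Py mulmx0.
Qed.

End CrossSpherical.

(* Integer vectors as lists of length 133, and the action on them of products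
   of elements exp(e_k), exp(f_k). *)
Section IntegerVectors.

Definition vinc (j : nat) (z : Z) (v : seq Z) : seq Z := set_nth Z0 v j (Z.add (nth Z0 v j) z).

Definition vacc (L : seq (nat * nat * Z)) (v acc : seq Z) : seq Z :=
  foldr (fun t acc => vinc t.1.2 (Z.mul t.2 (nth Z0 v t.1.1)) acc) acc L.
Definition vact L v := vacc L v v.
Definition v0 : seq Z := nseq 133 Z0.

Definition genop (c : nat) : nat -> nat * Z := if (c < 7)%N then opE c else opF (c - 7).

(* exp(x) - 1 = x + x^2/2 for the c-th generator, as a list of entries (column, row, value). *)
Definition tabexp : seq (seq (nat * nat * Z)) := Eval vm_compute in
  [seq [seq (j, (genop c j).1, (genop c j).2) | j <- iota 0 133 & ~~ Z.eqb (genop c j).2 Z0] ++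
       [:: if (c < 7)%N then (70 + c, 7 + c, Z.opp Z.one)%N else (c, 63 + c, Z.opp Z.one)%N]
  | c <- iota 0 14].

Definition Lexp c := nth [::] tabexp c.

Definition vword (w : seq nat) (v : seq Z) : seq Z := foldr (fun c v => vact (Lexp c) v) v w.

Definition vdl (t : nat) : seq Z := vinc t Z.one v0.

Definition vJ (v : seq Z) : seq Z :=
  [seq if (i < 7)%N then zsum (iota 0 7) (fun l => Z.mul (cz i l) (nth Z0 v l))
       else Z.mul (jz i (partner i)) (nth Z0 v (partner i)) | i <- iota 0 133].

Definition vP (b : bool) (v : seq Z) : seq Z :=
  [seq if oddj p.1 == b then p.2 else Z0 | p <- zip (iota 0 133) v].

Definition vdot (u v : seq Z) : Z := foldr (fun p s => Z.add (Z.mul p.1 p.2) s) Z0 (zip u v).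

(** Compares [2 x + x^2] with twice the list, column by column, to stay within the integers. The
    square contributes a single entry, from a root vector to the opposite one. *)
Lemma Lexp_check : all (fun c =>
  all (fun t => (t.1.1 < 133) && (t.1.2 < 133))%N (Lexp c) &&
  all (fun j => let p := genop c j in let q := genop c p.1 in
    lc_null ((p.1, Z.mul Z.two p.2) :: (q.1, Z.mul p.2 q.2) ::
      [seq (t.1.2, Z.opp (Z.mul Z.two t.2)) | t <- Lexp c & t.1.1 == j])) (iota 0 133)) (iota 0 14).
Proof. by vm_compute. Qed.

Lemma vJ_check : all (fun i => all (fun j => Z.eqb (jz i j) (if (i < 7)%N then if (j < 7)%N then cz i j else Z0
  else if j == partner i then jz i (partner i) else Z0)) (iota 0 133)) (iota 0 133).
Proof. by vm_compute. Qed.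

Variable K : numClosedFieldType.
Local Notation zK := (zK K).

Definition vcol (v : seq Z) : 'cV[K]_133 := \col_i zK (nth Z0 v i).

Lemma vcol_inc j z v : vcol (vinc j z v) = vcol v + zK z *: dl K j.
Proof.
apply/colP=> i; rewrite !mxE nth_set_nth /=; rewrite eq_sym; case: eqP => [->|_].
  by rewrite mulr1 zKD.
by rewrite mulr0 addr0.
Qed.

Lemma vcol0 : vcol v0 = 0.
Proof. by apply/colP=> i; rewrite !mxE nth_nseq ltn_ord. Qed.

Lemma vcol_dl t : vcol (vdl t) = dl K t.
Proof.
by rewrite vcol_inc zK1 scale1r vcol0 add0r.
Qed.

Definition spmx (L : seq (nat * nat * Z)) : 'M[K]_133 :=
  \sum_(t <- L) zK t.2 *: (dl K t.1.2 *m (dl K t.1.1)^T).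

Lemma dl_tr j (c : 'cV[K]_133) : (j < 133)%N -> (dl K j)^T *m c = (c (inord j) 0)%:M.
Proof.
move=> j133; apply/matrixP=> a b; rewrite !ord1 mxE (bigD1 (inord j)) //= big1 => [|l lj].
  by rewrite !mxE inordK // eqxx mul1r addr0.
rewrite !mxE (_ : (j == l) = false) ?mul0r //; apply/negbTE; apply: contra lj => /eqP ->.
by rewrite inord_val.
Qed.

Lemma vcol_acc L v acc : all (fun t => (t.1.1 < 133) && (t.1.2 < 133))%N L ->
  vcol (vacc L v acc) = vcol acc + spmx L *m vcol v.
Proof.
rewrite /spmx mulmx_suml; elim: L => [|t L IH] /=; first by rewrite big_nil addr0.
move=> /andP [/andP [t1 t2] /IH {}IH]; rewrite vcol_inc IH big_cons -addrA; congr (_ + _).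
rewrite addrC; congr (_ + _); rewrite -scalemxAl -mulmxA dl_tr // mul_mx_scalar scalerA zKM.
by rewrite mxE inordK.
Qed.

Lemma mx_exp3 m (Y : 'M[K]_m.+3) : Y ^+ 3 = 0 -> mx_exp Y = 1%:M + Y + 2%:R^-1 *: (Y *m Y).
Proof.
move=> Y3; rewrite /mx_exp -(big_mkord xpredT (fun k => (k`!%:R)^-1 *: Y ^+ k)).
rewrite 3?big_ltn // big_nat big1 => [|k /andP [k3 _]].
  by rewrite addr0 addrA expr0 expr1 expr2 !invr1 !scale1r.
by rewrite -(subnK k3) exprD Y3 mulr0 scaler0.
Qed.

Lemma genmx_op c : (c < 14)%N -> genmx K c = opmx K (genop c).
Proof. by rewrite /genmx /genop; case: ifP. Qed.

Lemma genop_lt c i : (c < 14)%N -> (i < 133)%N -> ((genop c i).1 < 133)%N.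
Proof.
rewrite /genop => c14 i133; case: (ltnP c 7) => c7; first by have [] := op_lt c7 i133.
have c7' : (c - 7 < 7)%N by lia.
by have [] := op_lt c7' i133.
Qed.

Lemma exp_spmx c : (c < 14)%N -> mx_exp (genmx K c) = 1%:M + spmx (Lexp c).
Proof.
move=> c14; rewrite mx_exp3; last first.
  rewrite genmx_op //; apply: opmx_nilp => i i133; first exact: genop_lt.
  rewrite /genop; case: (ltnP c 7) => c7.
    by have := all7 op_cube c7 (j := i) i133 => /andP [/Z.eqb_eq].
  have c7' : (c - 7 < 7)%N by lia.
  by have := all7 op_cube c7' (j := i) i133 => /andP [_ /Z.eqb_eq].
rewrite -addrA; congr (_ + _); apply: mx_ext => j j133.
have r := genop_lt c14 j133; have /andP [rL /allP2 hL] := allP2 Lexp_check (i := c) c14.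
have := lin_null (dl K) (hL j j133); rewrite /lin !big_cons big_map big_filter /mono /=.
have e1 : genmx K c *m dl K j = zK (genop c j).2 *: dl K (genop c j).1 by rewrite genmx_op // opmx_dl.
have e2 : genmx K c *m genmx K c *m dl K j =
    zK (Z.mul (genop c j).2 (genop c (genop c j).1).2) *: dl K (genop c (genop c j).1).1.
  by rewrite -mulmxA e1 -scalemxAr genmx_op // opmx_dl // /mono scalerA zKM.
rewrite mulmxDl -scalemxAl e1 e2.
rewrite (_ : \sum_(_ <- _ | _) _ = - (2%:R *: (spmx (Lexp c) *m dl K j))).
  move=> /eqP; rewrite addrA subr_eq0 => /eqP h; have n2 : (2%:R : K) != 0 by rewrite pnatr_eq0.
  by rewrite -[RHS](scalerK n2) -h scalerDr [zK (Z.mul Z.two _)]zKM -scalerA [in RHS]scalerK.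
rewrite /spmx mulmx_suml scaler_sumr -sumrN big_mkcond /= big_seq [RHS]big_seq; apply: eq_bigr => t tL.
have /andP [t1 t2] := allP rL t tL; rewrite -scalemxAl -mulmxA dl_tr // mul_mx_scalar mxE inordK //.
rewrite eq_sym; case: eqP => _; last by rewrite scale0r !scaler0 oppr0.
by rewrite scale1r scalerA zKN zKM scaleNr.
Qed.

Lemma vcol_exp c v : (c < 14)%N -> vcol (vact (Lexp c) v) = mx_exp (genmx K c) *m vcol v.
Proof.
move=> c14; rewrite exp_spmx // mulmxDl mul1mx /vact vcol_acc //.
by have /andP [] := allP2 Lexp_check (i := c) c14.
Qed.

Lemma vcol_J v : vcol (vJ v) = Jmx K *m vcol v.
Proof.
apply/colP=> i; rewrite !mxE (nth_map 0%N) ?size_iota // nth_iota // add0n.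
have hJ (j : 'I_133) := allP2 (allP2 vJ_check (i := i) (ltn_ord i)) (i := j) (ltn_ord j).
case: ifP => i7.
  rewrite zK_sum (eq_bigr (fun j : 'I_133 => if (j < 7)%N then zK (Z.mul (cz i j) (nth Z0 v j)) else 0)).
    rewrite -big_mkcond /= -(big_mkord (fun j => (j < 7)%N) (fun j => zK (Z.mul (cz i j) (nth Z0 v j)))).
    rewrite -(big_mkord xpredT (fun j => zK (Z.mul (cz i j) (nth Z0 v j)))).
    by rewrite [LHS](big_nat_widen _ _ 133).
  move=> j _; rewrite [Jmx K i j]mxE [vcol v j 0]mxE.
  have /Z.eqb_eq -> := hJ j; rewrite i7; by case: ifP => _; rewrite ?zKM // zK0 mul0r.
have hi : (7 <= i < 7 + 126)%N by rewrite ltn_ord andbT leqNgt i7.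
have /andP [p133 _] := allP2 jz_partner (i := i) hi.
rewrite (bigD1 (Ordinal p133)) //= big1 => [|j jp]; first by rewrite !mxE addr0 zKM.
rewrite mxE; have /Z.eqb_eq -> := hJ j; rewrite i7 (_ : (nat_of_ord j == _) = false) ?zK0 ?mul0r //.
by apply/negbTE; apply: contra jp => /eqP e; rewrite -val_eqE /= e.
Qed.

Lemma vcol_P b v : size v = 133 -> vcol (vP b v) = (if b then Po K else Pe K) *m vcol v.
Proof.
move=> sv; apply/colP=> i; rewrite mxE (nth_map (0%N, Z0)) ?size_zip ?size_iota ?sv //.
rewrite nth_zip ?size_iota ?sv // nth_iota // add0n /=.
by case: b; rewrite /Po /Pe diag_opmx mxE; case: oddj; rewrite ?zK0 ?zK1 ?mul0r ?mul1r.
Qed.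

Lemma vdot_sum u v : size u = size v ->
  \sum_(i < size u) zK (Z.mul (nth Z0 u i) (nth Z0 v i)) = zK (vdot u v).
Proof.
elim: u v => [|x u IH] [|y v] //=; first by rewrite big_ord0.
by case=> e; rewrite big_ord_recl /= /vdot /= zKD -IH.
Qed.

Lemma vdotE u v : size u = 133 -> size v = 133 -> (vcol u)^T *m vcol v = (zK (vdot u v))%:M.
Proof.
move=> su sv; apply/matrixP=> a b; rewrite !ord1 mxE [RHS]mxE eqxx mulr1n.
rewrite (eq_bigr (fun j : 'I_133 => zK (Z.mul (nth Z0 u j) (nth Z0 v j)))) => [|j _].
  have := vdot_sum (etrans su (esym sv)).
  rewrite -(big_mkord xpredT (fun i => zK (Z.mul (nth Z0 u i) (nth Z0 v i)))) su.
  by rewrite big_mkord => ->.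
by rewrite !mxE zKM.
Qed.

Lemma size_vacc L v acc : all (fun t => (t.1.1 < 133) && (t.1.2 < 133))%N L -> size acc = 133 ->
  size (vacc L v acc) = 133.
Proof.
move=> hL sv; elim: L hL => //= t L IH /andP [/andP [_ t2] /IH {}IH].
by rewrite size_set_nth IH; apply/maxn_idPr.
Qed.

Lemma size_vword w v : all (fun c => c < 14)%N w -> size v = 133 -> size (vword w v) = 133.
Proof.
move=> hw sv; elim: w hw => //= c w IH /andP [c14 /IH {}IH]; apply: size_vacc => //.
by have /andP [] := allP2 Lexp_check (i := c) c14.
Qed.

Lemma size_vdl t : (t < 133)%N -> size (vdl t) = 133.
Proof. by move=> t133; rewrite size_set_nth size_nseq; apply/maxn_idPr. Qed.

Fixpoint mword (w : seq nat) : 'M[K]_133 := if w is c :: w' then mx_exp (genmx K c) *m mword w' else 1%:M.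

Lemma vcol_word w v : all (fun c => c < 14)%N w -> vcol (vword w v) = mword w *m vcol v.
Proof.
elim: w => [|c w IH] /=; first by rewrite mul1mx.
by move=> /andP [c14 /IH {}IH]; rewrite vcol_exp // IH mulmxA.
Qed.

End IntegerVectors.

(* For each of the nodes i <> 7, two words g in the generators, with the
   certificate q(g) N = d 1 of the invertibility of the form q(g). *)
Local Open Scope Z_scope.
Definition neg_tab : seq ((seq nat * seq (seq Z) * Z) * (seq nat * seq (seq Z) * Z)) :=
  [:: (([:: 8; 10; 11; 12; 9; 10; 13; 7; 11; 9; 10; 8; 12; 11; 10; 9; 7]%N,
    [:: [:: 1]],
    2),
   ([:: 8; 10; 9; 11; 12; 10; 7; 11; 9; 8; 10; 11; 8; 9; 12; 7; 10; 13; 9; 11; 12; 10; 8; 11; 10; 9; 7]%N,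
    [:: [:: 1]],
    7680));
  (([:: 8; 10; 11; 9; 12; 13; 7; 10; 9; 8; 11; 13; 12; 10; 11; 12; 8; 13; 9; 10; 9; 8; 11; 10; 13; 12; 11; 7; 9; 10; 8]%N,
    [:: [:: 0; 0; 0; 2; -22; 72; -132];
     [:: 0; 0; 0; -5; 65; -225; 445];
     [:: 0; 0; 0; 10; -140; 505; -1155];
     [:: 2; -5; 10; -22; 166; -603; 1563];
     [:: -22; 65; -140; 166; -150; 317; -817];
     [:: 72; -225; 505; -603; 317; -244; 444];
     [:: -132; 445; -1155; 1563; -817; 444; -444]],
    1600),
   ([:: 8; 10; 9; 11; 10; 8; 12; 7; 9; 11; 13; 12; 10; 11; 8; 10; 9; 12; 7; 13; 10; 8; 11; 10; 12; 11; 9; 10; 8]%N,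
    [:: [:: 0; 0; 0; 1; -8; 26; -67];
     [:: 0; 0; 0; -6; 61; -215; 600];
     [:: 0; 0; 0; 11; -120; 438; -1353];
     [:: 1; -6; 11; -20; 119; -439; 1550];
     [:: -8; 61; -120; 119; -96; 214; -761];
     [:: 26; -215; 438; -439; 214; -204; 501];
     [:: -67; 600; -1353; 1550; -761; 501; -528]],
    352));
  (([:: 8; 10; 9; 11; 10; 8; 7; 10; 11; 9; 8; 12; 7; 13; 9; 10; 7; 13; 11; 13; 7; 10; 8; 13; 9; 7; 10; 12; 13; 12; 11; 7; 10; 8; 8; 9; 10; 13; 12; 8; 11; 7; 10; 9]%N,
    [:: [:: 3; -784];
     [:: -784; 205397]],
    2984040),
   ([:: 8; 10; 10; 9; 8; 7; 11; 11; 7; 10; 8; 12; 11; 7; 10; 9; 9; 13; 12; 7; 7; 12; 10; 10; 11; 12; 9; 9; 8; 7; 13; 10; 11; 8; 9; 11; 12; 10; 8; 7; 11; 10; 10; 9]%N,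
    [:: [:: 1; -374];
     [:: -374; 140587]],
    13105152));
  (([:: 8; 10; 9; 10; 8; 11; 7; 12; 13; 10; 11; 7; 11; 12; 9; 8; 7; 13; 10; 11; 9; 10; 8; 7; 12; 8; 10; 12; 9; 11; 10; 12; 13; 12; 8; 7; 11; 9; 10]%N,
    [:: [:: 0; 2; -85];
     [:: 2; -52; 1212];
     [:: -85; 1212; -9020]],
    9600),
   ([:: 8; 10; 11; 9; 10; 12; 7; 9; 13; 8; 10; 11; 12; 10; 8; 13; 9; 10; 7; 9; 11; 10; 12; 9; 8; 7; 10; 11; 9; 10]%N,
    [:: [:: 0; 1; -7];
     [:: 1; -52; 255];
     [:: -7; 255; -1014]],
    16));
  (([:: 8; 10; 9; 11; 10; 8; 12; 11; 7; 13; 9; 10; 9; 12; 8; 11; 10; 9; 7; 8; 12; 13; 9; 11; 10; 8; 11; 9; 12; 10; 11]%N,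
    [:: [:: 0; 0; 10; -68; 318];
     [:: 0; 0; -59; 450; -2657];
     [:: 10; -59; 328; -1594; 9782];
     [:: -68; 450; -1594; 3896; -17898];
     [:: 318; -2657; 9782; -17898; 52812]],
    1952),
   ([:: 8; 10; 11; 9; 12; 7; 10; 8; 11; 13; 9; 10; 8; 12; 9; 11; 11; 10; 7; 8; 9; 12; 7; 11; 10; 9; 8; 11; 10; 13; 12; 11]%N,
    [:: [:: 0; 0; 7; -45; 138];
     [:: 0; 0; -59; 427; -1688];
     [:: 7; -59; 354; -1605; 6220];
     [:: -45; 427; -1605; 3784; -10288];
     [:: 138; -1688; 6220; -10288; 14756]],
    5344));
  (([:: 8; 10; 11; 9; 9; 10; 12; 7; 8; 11; 12; 9; 10; 8; 8; 9; 7; 13; 12; 7; 11; 10; 7; 8; 12; 7; 12; 8; 9; 11; 10; 13; 11; 12]%N,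
    [:: [:: 0; 0; 0; 0; 0; 0; 0; 0; 0; 2];
     [:: 0; 1; 29; -54; 74; 52; -288; 419; -447; 104];
     [:: 0; 29; 841; -1566; 2146; 1508; -8448; 12341; -13289; 3096];
     [:: 0; -54; -1566; 2916; -3996; -2808; 15742; -23002; 24782; -5776];
     [:: 0; 74; 2146; -3996; 5476; 3846; -21608; 31598; -34114; 7992];
     [:: 0; 52; 1508; -2808; 3846; 2704; -15164; 22164; -23892; 5572];
     [:: 0; -288; -8448; 15742; -21608; -15164; 85264; -124684; 134612; -31536];
     [:: 0; 419; 12341; -23002; 31598; 22164; -124684; 182329; -196847; 46116];
     [:: 0; -447; -13289; 24782; -34114; -23892; 134612; -196847; 212521; -49788];
     [:: 2; 104; 3096; -5776; 7992; 5572; -31536; 46116; -49788; 11664]],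
    128),
   ([:: 8; 8; 10; 11; 9; 12; 10; 8; 11; 8; 10; 13; 12; 9; 7; 11; 9; 10; 8; 11; 12; 8; 10; 11; 9; 10; 11; 7; 8; 12; 9; 10; 11; 13; 12]%N,
    [:: [:: 4; 28; 130; -238; 390; 414; -1578; 1954; -1632; 1445];
     [:: 28; 196; 910; -1666; 2730; 2942; -11526; 14626; -12091; 8244];
     [:: 130; 910; 4225; -7735; 12675; 13793; -55245; 71832; -61986; 41622];
     [:: -238; -1666; -7735; 14161; -23205; -25311; 102332; -134323; 117804; -80062];
     [:: 390; 2730; 12675; -23205; 38025; 41146; -167895; 222495; -198900; 139230];
     [:: 414; 2942; 13793; -25311; 41146; 45329; -183093; 242129; -214722; 147794];
     [:: -1578; -11526; -55245; 102332; -167895; -183093; 741321; -982401; 878220; -614754];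
     [:: 1954; 14626; 71832; -134323; 222495; 242129; -982401; 1301881; -1163820; 814674];
     [:: -1632; -12091; -61986; 117804; -198900; -214722; 878220; -1163820; 1040400; -728280];
     [:: 1445; 8244; 41622; -80062; 139230; 147794; -614754; 814674; -728280; 509796]],
    1198088))].
Local Close Scope Z_scope.

(** * Verification of the certificates *)

Section NegativeCertificates.

Definition LE1 : seq (nat * nat * Z) := Eval vm_compute in
  [seq (j, (opE 1 j).1, (opE 1 j).2) | j <- iota 0 133 & ~~ Z.eqb (opE 1 j).2 Z0].

Lemma LE1_check : all (fun t => (t.1.1 < 133) && (t.1.2 < 133))%N LE1 &&
  all (fun j => lc_null (opE 1 j :: [seq (t.1.2, Z.opp t.2) | t <- LE1 & t.1.1 == j])) (iota 0 133).
Proof. by vm_compute. Qed.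

Definition vcols (r w : seq nat) : seq (seq Z) := [seq vword w (vdl t) | t <- r].

Definition qlist (U : seq (seq Z)) :=
  let PU := map (vP false) U in let JP := map vJ PU in [seq [seq vdot a b | b <- JP] | a <- PU].
Definition clist (U : seq (seq Z)) :=
  let EJ := [seq vJ (vacc LE1 (vP false u) v0) | u <- U] in
  [seq [seq vdot a b | b <- EJ] | a <- map (vP true) U].
Definition blist (U : seq (seq Z)) := [seq nth Z0 (vJ u) 8 | u <- U].

Definition ent (L : seq (seq Z)) s t : Z := nth Z0 (nth [::] L s) t.

Definition cert_mul d (q N : seq (seq Z)) del : bool := ~~ Z.eqb del Z0 &&
  all (fun s => all (fun t => Z.eqb (zsum (iota 0 d) (fun u => Z.mul (ent q s u) (ent N u t)))
    (if s == t then del else Z0)) (iota 0 d)) (iota 0 d).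
Definition cert_tr d (N c : seq (seq Z)) : Z :=
  zsum (iota 0 d) (fun s => zsum (iota 0 d) (fun t => Z.mul (ent N s t) (ent c t s))).
Definition cert_form d (b : seq Z) (N : seq (seq Z)) : Z :=
  zsum (iota 0 d) (fun t => Z.mul (zsum (iota 0 d) (fun s => Z.mul (nth Z0 b s) (ent N s t))) (nth Z0 b t)).

(** Beside the validity of the certificates, the failure of the cross identity at the two words:
    [adj q] is replaced by [(det q / d) N], and the common factor, which contains the squares of the
    determinants, is cancelled. *)
Definition neg_check (r : seq nat) (x y : seq nat * seq (seq Z) * Z) : bool :=
  let d := size r in
  let: (w1, N1, d1) := x in let: (w2, N2, d2) := y in
  let U1 := vcols r w1 in let U2 := vcols r w2 in
  let t1 := cert_tr d N1 (clist U1) in let t2 := cert_tr d N2 (clist U2) in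
  [&& all (fun c => c < 14)%N w1, all (fun c => c < 14)%N w2,
      cert_mul d (qlist U1) N1 d1, cert_mul d (qlist U2) N2 d2 &
      ~~ Z.eqb (Z.mul (Z.mul t1 t1) (Z.mul d2 (cert_form d (blist U2) N2)))
               (Z.mul (Z.mul t2 t2) (Z.mul d1 (cert_form d (blist U1) N1)))].

Lemma neg_checks : all (fun i => let p := nth (([::], [::], Z0), ([::], [::], Z0)) neg_tab i in
  neg_check (tops i) p.1 p.2) (iota 0 6).
Proof. by vm_compute. Qed.

Variable K : numClosedFieldType.
Local Notation zK := (zK K).

(** [q N = del 1] with [del != 0] makes [q] invertible and [adj q] proportional to [N], so no
    determinant has to be evaluated. *)
Lemma F_cert d (q c N : 'M[K]_d) (b : 'rV[K]_d) del : del != 0 -> q *m N = del%:M ->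
  [/\ \det q != 0, F1 q c = (\det q / del) ^+ 2 * \tr (N *m c) ^+ 2 &
      F2 q b = \det q ^+ 2 / del * (b *m N *m b^T) 0 0].
Proof.
move=> d0 qN; have q0 : \det q != 0.
  apply/negP=> /eqP q0; have := congr1 (fun A : 'M_d => \det A) qN; rewrite det_mulmx q0 mul0r det_scalar.
  by move=> /esym/eqP; rewrite expf_eq0 (negbTE d0) andbF.
have adjE : \adj q = (\det q / del) *: N.
  have := congr1 (mulmx (\adj q)) qN; rewrite mulmxA mul_adj_mx mul_scalar_mx mul_mx_scalar => h.
  by rewrite mulrC -scalerA h scalerA mulVf // scale1r.
rewrite /F1 /F2 adjE -scalemxAl mxtraceZ -scalemxAr -scalemxAl; split=> //; first by rewrite exprMn.
by rewrite [X in _ * X = _]mxE mulrA expr2 !mulrA.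
Qed.

Definition mxL d (L : seq (seq Z)) : 'M[K]_d := \matrix_(s, t) zK (ent L s t).
Definition rvL d (b : seq Z) : 'rV[K]_d := \row_t zK (nth Z0 b t).

Lemma zsumK d (F : nat -> Z) : zK (zsum (iota 0 d) F) = \sum_(k < d) zK (F k).
Proof. exact: zK_sum. Qed.

Lemma cert_mulP d q N del : cert_mul d q N del -> zK del != 0 /\ mxL d q *m mxL d N = (zK del)%:M.
Proof.
case/andP=> /negbTE/Z.eqb_neq d0 /allP2 h; split; first by apply/eqP=> /zK_eq0.
apply/matrixP=> s t; rewrite !mxE -val_eqE /=.
have /allP2/(_ t (ltn_ord t))/Z.eqb_eq := h s (ltn_ord s).
move=> /(congr1 zK); rewrite zsumK => e; rewrite (eq_bigr (fun u : 'I_d => zK (Z.mul (ent q s u) (ent N u t)))).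
  by rewrite e; case: eqP => _; rewrite ?mulr1n ?mulr0n // zK0.
by move=> u _; rewrite !mxE zKM.
Qed.

Lemma cert_trP d N c : \tr (mxL d N *m mxL d c) = zK (cert_tr d N c).
Proof.
rewrite zsumK; apply: eq_bigr => s _; rewrite zsumK mxE; apply: eq_bigr => t _.
by rewrite !mxE zKM.
Qed.

Lemma cert_formP d b N : (rvL d b *m mxL d N *m (rvL d b)^T) 0 0 = zK (cert_form d b N).
Proof.
rewrite mxE zsumK; apply: eq_bigr => t _; rewrite !mxE zKM zsumK; congr (_ * _).
by apply: eq_bigr => s _; rewrite !mxE zKM.
Qed.

Lemma spmx_LE1 : spmx K LE1 = Emx K 1.
Proof.
have /andP [rL /allP2 hL] := LE1_check; apply: mx_ext => j j133.
have := lin_null (dl K) (hL j j133); rewrite /lin big_cons big_map big_filter opmx_dl // => h.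
apply/eqP; rewrite -subr_eq0 -oppr_eq0 opprB -[X in _ == X]h; apply/eqP; congr (_ + _).
rewrite /spmx mulmx_suml -sumrN [RHS]big_mkcond /= big_seq [RHS]big_seq; apply: eq_bigr => t tL.
have /andP [t1 t2] := allP rL t tL; rewrite -scalemxAl -mulmxA dl_tr // mul_mx_scalar mxE inordK //.
rewrite eq_sym; case: eqP => _; last by rewrite scale0r !scaler0 oppr0.
by rewrite scale1r /mono /= zKN scaleNr.
Qed.

Lemma size_vP b v : size v = 133 -> size (vP b v) = 133.
Proof. by move=> sv; rewrite size_map size_zip size_iota sv. Qed.

Lemma size_vJ v : size (vJ v) = 133.
Proof. by rewrite size_map size_iota. Qed.

Lemma mx_entry a b (A : 'M[K]_(133, a)) (C : 'M[K]_(133, b)) (Y : 'M[K]_133) s t :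
  (A^T *m Y *m C) s t = ((col s A)^T *m Y *m col t C) 0 0.
Proof.
rewrite !mxE; apply: eq_bigr => j _; rewrite !mxE; congr (_ * _).
by apply: eq_bigr => l _; rewrite !mxE.
Qed.

Section Word.
Variables r w : seq nat.
Hypothesis rP : all (fun t => t < 133)%N r.
Hypothesis wP : all (fun c => c < 14)%N w.
Let U := vcols r w.
Let M := mword K w *m selmx K r.

Lemma size_col (t : 'I_(size r)) : size (nth [::] U t) = 133.
Proof.
rewrite (nth_map 0%N) // size_vword // size_vdl //.
by apply: (allP rP); apply: mem_nth.
Qed.

Lemma col_word (t : 'I_(size r)) : col t M = vcol K (nth [::] U t).
Proof.
rewrite (nth_map 0%N) // vcol_word // vcol_dl colE -mulmxA -colE; congr (_ *m _).
by apply/colP=> j; rewrite !mxE.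
Qed.

Lemma qlistP : qf M = mxL (size r) (qlist U).
Proof.
apply/matrixP=> s t; rewrite mx_entry !col_word [RHS]mxE /ent /qlist.
have sU : size U = size r by rewrite size_map.
rewrite !mulmxA -trmx_mul -!mulmxA.
rewrite -(vcol_P K false (size_col s)) -(vcol_P K false (size_col t)) -vcol_J.
rewrite vdotE ?size_vP ?size_vJ ?size_col // mxE eqxx mulr1n; congr zK.
by rewrite (nth_map [::]) ?(nth_map [::]) ?size_map // !(nth_map [::]) ?size_map ?sU.
Qed.

Lemma clistP : cf (dl K 8) M = mxL (size r) (clist U).
Proof.
apply/matrixP=> s t; rewrite mx_entry !col_word [RHS]mxE /ent /clist.
have sU : size U = size r by rewrite size_map.
rewrite (ady_dl K (isT : 1 < 7)%N) !mulmxA -trmx_mul -!mulmxA.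
rewrite -(vcol_P K true (size_col s)) -(vcol_P K false (size_col t)) -spmx_LE1.
have /andP [rL _] := LE1_check.
rewrite -[spmx K LE1 *m _]add0r -(vcol0 K) -vcol_acc // -vcol_J.
rewrite vdotE ?size_vP ?size_vJ ?size_col // mxE eqxx mulr1n; congr zK.
by rewrite (nth_map [::]) ?(nth_map [::]) ?size_map // !(nth_map [::]) ?size_map ?sU.
Qed.

Lemma blistP : bf (dl K 8) M = rvL (size r) (blist U).
Proof.
apply/matrixP=> s t; rewrite ord1 [RHS]mxE.
have sU : size U = size r by rewrite size_map.
rewrite /bf mx_entry col_word -mulmxA -vcol_J col_id dl_tr // mxE eqxx mulr1n mxE inordK //.
by rewrite (nth_map [::]) ?sU.
Qed.

End Word.
End NegativeCertificates.

(** * The cross identity fails at the certified elements *)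

Section NotSpherical.
Variables (K : numClosedFieldType) (n : nat).
Variables (G T B : set 'M[K]_n) (alpha omega : 'I_7 -> 'M[K]_n -> K).
Variables (e f : nat -> 'M[K]_n) (tau : nat -> K -> 'M[K]_n).
Hypothesis D : e7_data G T B alpha omega e f tau.
Local Notation zK := (zK K).
Let gG := e7_grp D.

Fixpoint gword (w : seq nat) : 'M[K]_n :=
  if w is c :: w' then mx_exp (1 *: gens e f c) *m gword w' else 1%:M.

Lemma gword_mem w : G (gword w).
Proof.
by elim: w => [|c w IH] /=; [exact: mxg1 | apply: (mxgM gG) => //; apply: (e7_exp D)].
Qed.

Lemma adm_gword w : all (fun c => c < 14)%N w -> adm e f (gword w) = mword K w.
Proof.
elim: w => [|c w IH] /=; first by rewrite (adm1 D).
move=> /andP [c14 /IH {}IH]; rewrite (admM D (e7_exp D c 1) (gword_mem w)) IH (adm_gens D) //.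
by rewrite scale1r.
Qed.

Lemma neg_check_cross r x y : all (fun t => t < 133)%N r -> neg_check r x y ->
  ~ cross G e f r (dl K 8).
Proof.
case: x => [[w1 N1] d1]; case: y => [[w2 N2] d2] rP; rewrite /neg_check.
set d := size r; set U1 := vcols r w1; set U2 := vcols r w2.
set t1 := cert_tr d N1 (clist U1); set t2 := cert_tr d N2 (clist U2).
case/and5P => h1 h2 /(cert_mulP K) [z1 e1] /(cert_mulP K) [z2 e2] ne cr.
have := cr _ _ (gword_mem w1) (gword_mem w2); rewrite !adm_gword //.
have C1 := F_cert (mxL K d (clist U1)) (rvL K d (blist U1)) z1 e1.
have C2 := F_cert (mxL K d (clist U2)) (rvL K d (blist U2)) z2 e2.
rewrite /f1 /f2 (qlistP K rP h1) (qlistP K rP h2) (clistP K rP h1) (clistP K rP h2).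
rewrite (blistP K r h1) (blistP K r h2) -/d -/U1 -/U2.
have [q1 -> ->] := C1; have [q2 -> ->] := C2.
rewrite !cert_trP !cert_formP -/t1 -/t2.
move: (\det _) q1 (\det _) q2 => a a0 b b0 E; case/negP: ne; apply/Z.eqb_eq/(zK_inj (K := K)).
rewrite !zKM; set x1 := zK t1 in E *; set x2 := zK t2 in E *.
set y1 := zK (cert_form d _ N1) in E *; set y2 := zK (cert_form d _ N2) in E *.
have ab : a ^+ 2 * b ^+ 2 / (zK d1 ^+ 2 * zK d2 ^+ 2) != 0.
  by rewrite mulf_neq0 // ?invr_neq0 // mulf_neq0 // expf_neq0.
apply: (mulfI ab).
have -> : a ^+ 2 * b ^+ 2 / (zK d1 ^+ 2 * zK d2 ^+ 2) * (x1 * x1 * (zK d2 * y2)) =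
  (a / zK d1) ^+ 2 * x1 ^+ 2 * (b ^+ 2 / zK d2 * y2) by field; rewrite z1 z2.
by rewrite E; field; rewrite z1 z2.
Qed.

Variables (m : nat) (rho : 'M[K]_n -> 'M[K]_m).
Hypothesis hrho : algebraic_hom G (@units K m) rho.
Variables (i : 'I_7) (v : 'cV[K]_m) (P : set 'M[K]_n).
Hypothesis BG : B `<=` G.
Hypothesis hv : highest_weight_vector T B rho (omega i) v.
Hypothesis hP : P = [set g | G g /\ exists c, rho g *m v = c *: v].

Lemma not_spherical : i != ord_max -> ~ spherical (generated (T `|` hexp e f)) G P.
Proof.
move=> im sph; have i6 : (i < 6)%N.
  by have := ltn_ord i; rewrite ltnS leq_eqVlt => /orP [/eqP e1|//]; case/eqP: im; apply: val_inj.
have rP : all (fun t => t < 133)%N (tops i) by apply/allP => j; rewrite tops_mem => /andP [].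
apply: (neg_check_cross rP (allP2 neg_checks (i := i) i6)).
apply: (spherical_cross D _ _ sph).
- by move=> p Pp; split; [exact: (P_G hP Pp) | apply: (P_sel D hrho BG hv hP)].
- exact: mxg1 (P_grp D hrho hv hP).
Qed.

End NotSpherical.

(** * The open orbit for the node 7 *)

Section ParametrizedSets.
Variable K : numClosedFieldType.
Let TF := term_fun_class K.

(** Images of polynomial maps on a closed set of parameters. The shift by [N] is there because the
    parameters stand behind the [n * n] entries of [A] in the environment; only the first [k] of
    them matter. *)
Lemma definable_param n k (M : (nat -> K) -> 'M[K]_n) (I : finType) (c : I -> (nat -> K) -> K) :
  (forall N, rcmx (@term_fun K) (fun e => M (fun i => e`_(N + i)))) ->
  (forall i N, term_fun (fun e : seq K => c i (fun j => e`_(N + j)))) ->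
  (forall s t, (forall i, (i < k)%N -> s i = t i) -> M s = M t /\ forall i, c i s = c i t) ->
  definable [set A | exists s, A = M s /\ forall i, c i s = 0].
Proof.
move=> tM tc ext.
exists k, ('I_n * 'I_n + I)%type, (fun x e => match x with
  | inl ij => (M (fun i => e`_(n * n + i)) - env_mx n e) ij.1 ij.2
  | inr i => c i (fun j => e`_(n * n + j)) end); split.
  by move=> [[i j]|i]; [apply: (rcmxB TF); [apply: tM | apply: env_mx_term_fun] | apply: tc].
move=> A; have e1 (y : seq K) i : (env A ++ y)`_(n * n + i) = y`_i.
  by rewrite nth_cat size_env ltnNge leq_addr /= addKn.
split=> [[s [-> cs]]|[y sy h]].
  exists (mkseq s k); rewrite ?size_mkseq //.
  have [|eM ec] := ext (fun i => (env (M s) ++ mkseq s k)`_(n * n + i)) s.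
    by move=> i ik; rewrite nth_cat size_env ltnNge leq_addr /= addKn nth_mkseq.
  by move=> [[i j]|i] /=; rewrite ?env_mxK ?eM ?subrr ?mxE // ec cs.
exists (fun i => y`_i); have [eM ec] := ext (fun i => (env A ++ y)`_(n * n + i)) (fun i => y`_i) (fun i _ => e1 y i).
split; last by move=> i; have := h (inr i); rewrite /= ec.
apply/matrixP=> i j; have := h (inl (i, j)); rewrite /= env_mxK eM !mxE => /eqP.
by rewrite subr_eq0 => /eqP.
Qed.

Lemma horner_term_fun (P : {poly K}) F : term_fun F -> term_fun (fun e => P.[F e]).
Proof.
move=> tF; apply: (rc_ext TF) (_ : term_fun (fun e => \sum_(i < size P) P`_i * F e ^+ i)) => [e|].
  by rewrite horner_coef.
by apply: (rc_sum TF) => i; apply: (rcM TF); [apply: (rcC TF) | apply: (rcX TF)].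
Qed.

(** Terms are polynomial, so negative powers of [s] are expressed in a second variable that stands
    for [s^-1]. *)
Lemma laurent_matrix n (c : K -> 'M[K]_n) X : lmx c X -> exists c' : K -> K -> 'M[K]_n,
  (forall s, s != 0 -> c s = c' s s^-1) /\
  forall F F', term_fun F -> term_fun F' -> rcmx (@term_fun K) (fun e => c' (F e) (F' e)).
Proof.
move=> lc; have h (i j : 'I_n) : {p : {poly K} * nat | forall s, s != 0 -> c s i j = p.1.[s] / s ^+ p.2}.
  by apply: cid; have [P [k [hP _]]] := lc i j; exists (P, k).
exists (fun s t => \matrix_(i, j) ((sval (h i j)).1.[s] * t ^+ (sval (h i j)).2)); split=> [s s0|F F' tF tF'].
  by apply/matrixP=> i j; rewrite mxE (svalP (h i j)) // exprVn.
move=> i j; apply: (rc_ext TF) (_ : term_fun (fun e => (sval (h i j)).1.[F e] * F' e ^+ (sval (h i j)).2)) => [e|].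
  by rewrite mxE.
by apply: (rcM TF); [apply: horner_term_fun | apply: (rcX TF)].
Qed.

End ParametrizedSets.

(** * Products of the torus with groups generated by exponentials *)

Section TorusExtension.
Variables (K : numClosedFieldType) (n : nat).
Variables (G T B : set 'M[K]_n) (alpha omega : 'I_7 -> 'M[K]_n -> K).
Variables (e f : nat -> 'M[K]_n) (tau : nat -> K -> 'M[K]_n).
Hypothesis D : e7_data G T B alpha omega e f tau.
Let TF := term_fun_class K.
Let gT := e7_Tgrp D.

Definition tprod (r : seq nat) (z : nat -> K) := \big[mulmx/1%:M]_(j <- r) tau j (z j).

Lemma tprod_mem r z : (forall j, z j != 0) -> T (tprod r z).
Proof.
move=> z0; rewrite /tprod; elim: r => [|j r IH]; first by rewrite big_nil; apply: (mxg1 gT).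
by rewrite big_cons; apply: (mxgM gT) => //; apply: (e7_tauT D).
Qed.

Lemma T_tprod t : T t -> exists2 z : nat -> K, (forall j, z j != 0) & t = tprod (iota 0 7) z.
Proof.
move=> Tt; have [z z0 ->] := e7_Tgen D Tt; exists z => //.
by rewrite -(big_mkord xpredT (fun j => tau j (z j))).
Qed.

Lemma tprod_irr r : uniq r -> (forall j, j \in r -> (j < 7)%N) ->
  irr [set A | exists2 z : nat -> K, (forall j, z j != 0) & A = tprod r z].
Proof.
elim: r => [_ _|j r IH /= /andP [jr ur] hr].
  move=> p q h; have := h 1%:M; rewrite /tprod.
  have h1 : exists2 z : nat -> K, (forall j, z j != 0) & 1%:M = \big[mulmx/1%:M]_(j <- [::]) tau j (z j).
    by exists (fun _ => 1) => [_|]; rewrite ?oner_neq0 // big_nil.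
  move=> /(_ h1)/eqP; rewrite mulf_eq0 => /orP [] /eqP h0; [left|right] => A [z _ ->];
  by rewrite /tprod big_nil.
have hr' i : i \in r -> (i < 7)%N by move=> ir; apply: hr; rewrite inE ir orbT.
have {}IH := IH ur hr'; have j7 : (j < 7)%N by apply: hr; rewrite inE eqxx.
have := irr_mul (irr_laurent (e7_tau_lmx D j7)) IH.
congr irr; apply/seteqP; split=> A /=.
  move=> [_ [_ [[s s0 <-] [z z0 ->] ->]]]; exists (fun i => if i == j then s else z i).
    by move=> i; case: ifP.
  rewrite /tprod big_cons eqxx; congr (_ *m _); apply: eq_big_seq => i ir.
  by case: eqP => // ij; rewrite -ij ir in jr.
move=> [z z0 ->]; exists (tau j (z j)), (tprod r z); split; last by rewrite /tprod big_cons.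
  by exists (z j).
by exists z.
Qed.

Lemma T_irr : irr T.
Proof.
have := @tprod_irr (iota 0 7) (iota_uniq _ _) (fun j => _); rewrite (_ : [set A | _] = T).
  by apply=> j; rewrite mem_iota.
by apply/seteqP; split=> [A [z z0 ->]|A /T_tprod //]; apply: tprod_mem.
Qed.

Lemma tau_poly : exists c : nat -> K -> K -> 'M[K]_n, forall j, (j < 7)%N ->
  (forall s, s != 0 -> tau j s = c j s s^-1) /\
  forall F F', term_fun F -> term_fun F' -> rcmx (@term_fun K) (fun e => c j (F e) (F' e)).
Proof.
have h j : {c : K -> K -> 'M[K]_n | (j < 7)%N -> (forall s, s != 0 -> tau j s = c s s^-1) /\
    forall F F', term_fun F -> term_fun F' -> rcmx (@term_fun K) (fun e => c (F e) (F' e))}.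
  apply: cid; case: (ltnP j 7) => j7; last by exists (fun _ _ => 0).
  by have [c hc] := laurent_matrix (e7_tau_lmx D j7); exists c.
by exists (fun j => sval (h j)) => j; apply: (svalP (h j)).
Qed.

Definition tau' := sval (cid tau_poly).

Lemma tau'E j s : (j < 7)%N -> s != 0 -> tau j s = tau' j s s^-1.
Proof. by rewrite /tau'; case: cid => c /= hc j7; have [h _] := hc j j7; apply: h. Qed.

Lemma tau'_term j F F' : (j < 7)%N -> term_fun F -> term_fun F' ->
  rcmx (@term_fun K) (fun e => tau' j (F e) (F' e)).
Proof. by rewrite /tau'; case: cid => c /= hc j7; have [_ h] := hc j j7; apply: h. Qed.

(* The element of T with parameters s_0, ..., s_6 and inverse parameters s_7, ..., s_13. *)
Definition tword (s : nat -> K) := \big[mulmx/1%:M]_(j <- iota 0 7) tau' j (s j) (s (7 + j)).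

Lemma tword_term N : rcmx (@term_fun K) (fun e => tword (fun i => e`_(N + i))).
Proof.
rewrite /tword; have : all (fun j => j < 7)%N (iota 0 7) by [].
elim: (iota 0 7) => [_|j r IH /= /andP [j7 /IH {}IH]] a b.
  by apply: (rc_ext TF) (rcmxC TF 1%:M a b) => v; rewrite big_nil.
have h := rcmxM TF (tau'_term j7 (term_fun_var K (N + j)) (term_fun_var K (N + (7 + j)))) IH.
by apply: (rc_ext TF) (h a b) => v; rewrite big_cons.
Qed.

Lemma tword_ext s t : (forall i, (i < 14)%N -> s i = t i) -> tword s = tword t.
Proof.
move=> h; apply: eq_big_seq => j; rewrite mem_iota => j7.
by rewrite !h //; move: j7 => /=; lia.
Qed.

Lemma tword_T (s : nat -> K) : (forall j : 'I_7, s j * s (7 + j)%N - 1 = 0) -> T (tword s).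
Proof.
move=> h; have -> : tword s = tprod (iota 0 7) (fun j => if (j < 7)%N then s j else 1).
  apply: eq_big_seq => j; rewrite mem_iota => /= j7; rewrite j7.
  have /eqP := h (Ordinal j7); rewrite subr_eq0 => /eqP /= e1.
  have s0 : s j != 0 by apply: contra_eq_neq e1 => ->; rewrite mul0r eq_sym oner_neq0.
  by rewrite tau'E //; congr tau'; rewrite -[RHS]mulr1 -e1 mulKf.
apply: tprod_mem => j; case: ifP => j7; last exact: oner_neq0.
have /eqP := h (Ordinal j7); rewrite subr_eq0 => /eqP /= e1.
by apply: contra_eq_neq e1 => ->; rewrite mul0r eq_sym oner_neq0.
Qed.

(** [u] prescribes the parameters from 14 on, so that the torus can be combined with word maps. *)
Lemma T_tword t (u : nat -> K) : T t -> exists s, [/\ t = tword s,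
  forall j : 'I_7, s j * s (7 + j)%N - 1 = 0 & forall i, s (14 + i)%N = u i].
Proof.
move=> /T_tprod [z z0 ->].
exists (fun i => if (i < 7)%N then z i else if (i < 14)%N then (z (i - 7)%N)^-1 else u (i - 14)%N); split.
- apply: eq_big_seq => j; rewrite mem_iota => /andP [_ j7]; rewrite j7.
  have -> : (7 + j < 7)%N = false by lia.
  have -> : (7 + j < 14)%N by lia.
  by rewrite addKn tau'E.
- move=> j; rewrite ltn_ord ltnNge leq_addr /= addKn.
  have -> : (7 + j < 14)%N by have := ltn_ord j; lia.
  by rewrite mulfV // subrr.
- move=> i; have -> : (14 + i < 7)%N = false by lia.
  have -> : (14 + i < 14)%N = false by lia.
  by rewrite addKn.
Qed.

Section Extension.
Variable x : nat -> 'M[K]_n.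
Hypothesis nx : forall c, nilp (x c).
Hypothesis ex : forall c t, T t -> exists a, t *m x c *m invmx t = a *: x c.
Let E := exp_group x.
Let gE : mx_group E := exp_groupP nx.

Definition text : set 'M[K]_n := [set A | exists t g, [/\ T t, E g & A = t *m g]].

Lemma T_norm t g : T t -> E g -> E (t *m g *m invmx t).
Proof.
move=> Tt; have ut := mxg_unit gT Tt.
apply: (@gen_ind _ _ (exp_curves x) (fun g => E (t *m g *m invmx t))).
- exact: exp_curves_unit.
- by rewrite mulmx1 mulmxV //; apply: (mxg1 gE).
move=> A _ _ [c _ [s _ <-]] EA; have nc : nilp (s *: x c) by apply: nilpZ.
have [_ eY] := mx_exp_conj ut nc.
have EX : E (t *m mx_exp (s *: x c) *m invmx t).
  have [a ha] := ex c Tt; rewrite eY -scalemxAr -scalemxAl ha scalerA.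
  exact: exp_group_exp.
have e1 Z : t *m (A *m Z) *m invmx t = (t *m A *m invmx t) *m (t *m Z *m invmx t).
  by rewrite !mulmxA mulmxKV.
rewrite !e1; split; first exact: (mxgM gE).
apply: (mxgM gE) => //; have := mxgV gE EX.
rewrite !invmxM ?unitmx_inv ?mulmx_unit ?mx_exp_unit //.
by rewrite invmxK mulmxA.
Qed.

Lemma text_T : T `<=` text.
Proof. by move=> t Tt; exists t, 1%:M; rewrite mulmx1; split=> //; apply: (mxg1 gE). Qed.

Lemma text_E : E `<=` text.
Proof. by move=> g Eg; exists 1%:M, g; rewrite mul1mx; split=> //; apply: (mxg1 gT). Qed.

Lemma text_group : mx_group text.
Proof.
split=> [_ [t [g [Tt Eg ->]]]||_ _ [t [g [Tt Eg ->]]] [t' [g' [Tt' Eg' ->]]]|_ [t [g [Tt Eg ->]]]].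
- by apply: mulmx_unit; [apply: (mxg_unit gT) | apply: (mxg_unit gE)].
- by apply: text_T; apply: (mxg1 gT).
- have ut := mxg_unit gT Tt'; exists (t *m t'), ((invmx t' *m g *m t') *m g'); split.
  + exact: (mxgM gT).
  + apply: (mxgM gE) => //; rewrite -{2}[t'](invmxK t'); apply: T_norm => //; exact: (mxgV gT).
  + by rewrite !mulmxA mulmxK.
have ut := mxg_unit gT Tt; have ug := mxg_unit gE Eg.
exists (invmx t), (t *m invmx g *m invmx t); split.
- exact: (mxgV gT).
- by apply: T_norm => //; apply: (mxgV gE).
- by rewrite invmxM // !mulmxA mulVmx // mul1mx.
Qed.

Lemma text_irr : irr text.
Proof. exact: irr_mul T_irr (exp_group_irr nx). Qed.

(** Fourteen parameters describe the torus, subject to [s_j s_(7+j) = 1], and the rest feed a word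
    map onto [E]; irreducible definable groups are closed. *)
Lemma text_closed : zariski_closed text.
Proof.
have [w hw] := exp_group_image nx.
apply: (definable_group_closed text_group text_irr).
pose M (s : nat -> K) := tword s *m wmap x w (fun i => s (14 + i)%N).
pose c (j : 'I_7) (s : nat -> K) := s j * s (7 + j)%N - 1.
have [N|j N|s t st|] := @definable_param K n (14 + size w) M 'I_7 c.
- apply: (rcmxM TF); first exact: tword_term.
  move=> a b; apply: (rc_ext TF) (wmap_term_fun x w (N + 14) a b) => v.
  by congr ((wmap x w _) a b); apply/funext => i; rewrite addnA.
- have h i : term_fun (fun v : seq K => v`_(N + i)) by apply: term_fun_var.
  apply: (rcD TF); last exact: (rcC TF).
  by apply: (rcM TF).
- split; first congr (_ *m _).
  + by apply: tword_ext => i i14; apply: st; rewrite ltn_addr.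
  + by apply: wmap_ext => i iw; apply: st; rewrite ltn_add2l.
  + by move=> j; rewrite /c !st //; have := ltn_ord j; lia.
move=> k [I [F [tF hF]]]; exists k, I, F; split=> // A; rewrite -hF.
split=> [[t [g [Tt /hw [s ->] ->]]]|[s [-> hs]]].
  have [s' [-> h1 h2]] := T_tword s Tt; exists s'; split=> //.
  by congr (_ *m wmap x w _); apply/funext => i; rewrite h2.
exists (tword s), (wmap x w (fun i => s (14 + i)%N)); split=> //; first exact: tword_T.
by apply/hw; exists (fun i => s (14 + i)%N).
Qed.

Lemma text_algebraic : algebraic_group text.
Proof. by split; [exact: text_group | exact: text_closed]. Qed.

Lemma text_connected : zariski_connected text.
Proof. by apply: irr_connected text_irr => A /(mxg_unit text_group). Qed.

End Extension.
End TorusExtension.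

(** * Filtration of the matrix algebra by eigenvalues of ad h *)

Section AdFiltration.
Variables (K : numClosedFieldType) (n : nat) (h : 'M[K]_n).
Implicit Types (A F : 'M[K]_n) (i j l : nat).

(** Sums of eigenvectors of [ad h] with integral eigenvalues at least [i]. As [ad h] is a derivation
    of the associative product, this filtration is multiplicative, as [filtered_solvable]
    requires. *)
Inductive ad_filt i : 'M[K]_n -> Prop :=
| ad_filt0 : ad_filt i 0
| ad_filtS l F A : (i <= l)%N -> lie_bracket h F = l%:R *: F -> ad_filt i A -> ad_filt i (F + A).

Lemma ad_filt1 i l F : (i <= l)%N -> lie_bracket h F = l%:R *: F -> ad_filt i F.
Proof. by move=> il hF; rewrite -[F]addr0; apply: ad_filtS il hF (ad_filt0 i). Qed.

Lemma ad_filtD i A B : ad_filt i A -> ad_filt i B -> ad_filt i (A + B).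
Proof.
move=> hA hB; elim: hA => [|l F A' il hF _ IH]; first by rewrite add0r.
by rewrite -addrA; apply: ad_filtS il hF IH.
Qed.

Lemma ad_filtZ i a A : ad_filt i A -> ad_filt i (a *: A).
Proof.
elim=> [|l F A' il hF _ IH]; first by rewrite scaler0; apply: ad_filt0.
rewrite scalerDr; apply: ad_filtS il _ IH.
by rewrite brZr hF !scalerA mulrC.
Qed.

Lemma ad_filtN i A : ad_filt i A -> ad_filt i (- A).
Proof. by rewrite -scaleN1r; apply: ad_filtZ. Qed.

Lemma ad_filtW i j A : (i <= j)%N -> ad_filt j A -> ad_filt i A.
Proof.
move=> ij; elim=> [|l F A' jl hF _ IH]; first exact: ad_filt0.
by apply: ad_filtS (leq_trans ij jl) hF IH.
Qed.

Lemma lie_bracket_mul A B : lie_bracket h (A *m B) = lie_bracket h A *m B + A *m lie_bracket h B.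
Proof. by rewrite /lie_bracket mulmxBl mulmxBr !mulmxA addrA subrK. Qed.

Lemma ad_filtM i j A B : ad_filt i A -> ad_filt j B -> ad_filt (i + j) (A *m B).
Proof.
move=> hA hB; elim: hA => [|l F A' il hF _ IH]; first by rewrite mul0mx; apply: ad_filt0.
rewrite mulmxDl; apply: ad_filtD => //.
elim: hB => [|l' F' B' jl hF' _ IH']; first by rewrite mulmx0; apply: ad_filt0.
rewrite mulmxDr; apply: ad_filtD => //; apply: (@ad_filt1 _ (l + l')); first exact: leq_add.
by rewrite lie_bracket_mul hF hF' -scalemxAl -scalemxAr -scalerDl natrD.
Qed.

Lemma ad_filt_one : ad_filt 0 1%:M.
Proof. by apply: (@ad_filt1 0 0) => //; rewrite /lie_bracket mulmx1 mul1mx subrr scale0r. Qed.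

Lemma ad_filtX i A k : ad_filt i A -> ad_filt (i * k) (A ^+ k).
Proof.
move=> hA; elim: k => [|k IH]; first by rewrite expr0 muln0; apply: ad_filt_one.
by rewrite exprS mulnS; apply: ad_filtM.
Qed.

Lemma ad_filt_exp A : ad_filt 1 A -> ad_filt 1 (mx_exp A - 1%:M).
Proof.
move=> hA; rewrite /mx_exp big_ord_recl /= expr0 fact0 invr1 scale1r addrC addKr.
elim: (index_enum _) => [|k r IH]; first by rewrite big_nil; apply: ad_filt0.
rewrite big_cons; apply: ad_filtD IH; apply: ad_filtZ.
by apply: (@ad_filtW _ (1 * bump 0 k)) (ad_filtX _ hA); rewrite mul1n.
Qed.

(** [ad h] has finitely many eigenvalues, so from some [N] on no integer is among them. *)
Lemma ad_filt_eq0 : exists N, forall A, ad_filt N A -> A = 0.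
Proof.
have [l hl] := eigenvalues_finite (lin_mulmx h - lin_mulmxr h)^T.
have [N hN] : exists N, forall k, (N <= k)%N -> k%:R \notin l.
  elim: l {hl} => [|a l [N hN]]; first by exists 0%N.
  case: (pselect (exists k, k%:R = a)) => [[k <-]|no].
    exists (maxn N k.+1) => j; rewrite geq_max => /andP [/hN jl kj].
    by rewrite inE negb_or jl eqr_nat gtn_eqF.
  exists N => j /hN jl; rewrite inE negb_or jl andbT; apply/eqP => e; apply: no.
  by exists j.
have F0 k F : (N <= k)%N -> lie_bracket h F = k%:R *: F -> F = 0.
  move=> /hN kl hF; apply: contrapT => /eqP F0; have := hl k%:R (mxvec F)^T.
  rewrite trmx_eq0 mxvec_eq0 F0 -trmx_mul mulmxBr !mul_vec_lin /= -linearB /=.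
  have -> : h *m F - F *m h = k%:R *: F by [].
  by rewrite linearZ /= linearZ /= (negbTE kl) => /(_ erefl erefl).
exists N => A; elim=> // l' F A' Nl hF _ ->.
by rewrite (F0 _ _ Nl hF) add0r.
Qed.

End AdFiltration.

(** * A connected solvable subgroup of H *)

Section BorelOfH.
Variables (K : numClosedFieldType) (n : nat).
Variables (G T B : set 'M[K]_n) (alpha omega : 'I_7 -> 'M[K]_n -> K).
Variables (e f : nat -> 'M[K]_n) (tau : nat -> K -> 'M[K]_n).
Hypothesis D : e7_data G T B alpha omega e f tau.
Local Notation X := (adX e f).
Let rel := e7_rel D.
Let gT := e7_Tgrp D.

(** [m = 7] gives the positive simple root vectors of H, [m = 14] their opposites as well. *)
Definition hroots m c : 'M[K]_n := if (c < m)%N then X (hidx c) else 0.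

Lemma hroots_nilp m c : (m <= 14)%N -> nilp (hroots m c).
Proof.
move=> m14; rewrite /hroots; case: ifP => cm; last by exists 1%N; rewrite expr1.
by have [] := root_nilp D (hidx_range (leq_trans cm m14)).
Qed.

Lemma hroots_eigen m c t : (m <= 14)%N -> T t -> exists a, t *m hroots m c *m invmx t = a *: hroots m c.
Proof.
move=> m14 Tt; rewrite /hroots; case: ifP => cm; last by exists 0; rewrite mulmx0 mul0mx scaler0.
have /andP [_ c133] := hidx_range (leq_trans cm m14).
by exists (wchar alpha (hidx c) t); apply: (adX_char D).
Qed.

Lemma text_gen m : (m <= 14)%N -> text T (hroots m) =
  generated (T `|` [set mx_exp (p.2 *: X (hidx p.1)) | p in [set p : nat * K | (p.1 < m)%N]]).
Proof.
move=> m14; have nx c := hroots_nilp c m14; have ex c t := @hroots_eigen m c t m14.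
have gx := text_group D nx ex.
have u : T `|` [set mx_exp (p.2 *: X (hidx p.1)) | p in [set p : nat * K | (p.1 < m)%N]] `<=` @units K n.
  move=> A [/(mxg_unit gT) //|[[c a] /= cm <-]]; apply: mx_exp_unit; apply: nilpZ.
  by have := nx c; rewrite /hroots cm.
apply/seteqP; split=> [A [t [g [Tt Eg ->]]]|]; last first.
  apply: gen_min => // A [|[[c a] /= cm <-]]; first exact: (text_T nx).
  apply: (text_E D); have -> : X (hidx c) = hroots m c by rewrite /hroots cm.
  exact: exp_group_exp.
have gg := gen_group u; apply: (mxgM gg); first by apply: gen_sub; left.
move: Eg; apply: gen_min => // _ [c _ [s _ <-]]; rewrite /hroots; case: ifP => cm.
  by apply: gen_sub; right; exists (c, s).
by rewrite scaler0 mx_exp0; apply: (mxg1 gg).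
Qed.

(** The sum of the positive coroots of E_7 in terms of the simple ones. So [hrho] acts on a root
    vector by twice the height, an integer that is positive on the simple roots of H. *)
Definition rho_coef := [:: 34; 49; 66; 96; 75; 52; 27]%N.
Definition hrho : 'M[K]_n := \sum_(j <- iota 0 7) (nth 0%N rho_coef j)%:R *: X j.

Definition hrho_val i : Z :=
  foldr (fun j s => Z.add (Z.mul (Z.of_nat (nth 0%N rho_coef j)) (opH j i)) s) Z0 (iota 0 7).

Lemma hrho_pos : all (fun c => Z.ltb Z0 (hrho_val (hidx c))) (iota 0 7).
Proof. by vm_compute. Qed.

Lemma hrhoE i : (i < 133)%N -> lie_bracket hrho (X i) = zK K (hrho_val i) *: X i.
Proof.
move=> i133; rewrite /hrho /hrho_val; have : all (fun j => j < 7)%N (iota 0 7) by [].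
elim: (iota 0 7) => [_|j r IH /= /andP [j7 /IH {}IH]]; first by rewrite big_nil br0l zK0 scale0r.
rewrite big_cons brDl IH brZl (adX_H rel) // scalerA -scalerDl zKD zKM.
by congr ((_ * _ + _) *: _); rewrite /zK pmulrn; congr (_%:~R); lia.
Qed.

Lemma T_hrho t : T t -> lie_bracket hrho t = 0%:R *: t.
Proof.
move=> Tt; have ut := mxg_unit gT Tt; rewrite scale0r /hrho /lie_bracket.
have : all (fun j => j < 7)%N (iota 0 7) by [].
elim: (iota 0 7) => [_|j r IH /= /andP [j7 /IH {}IH]]; first by rewrite big_nil mul0mx mulmx0 subrr.
have j133 : (j < 133)%N by lia.
have := adX_char D Tt j133; rewrite /wchar j7 scale1r => /(congr1 (mulmx^~ t)).
rewrite mulmxKV // => c; rewrite big_cons mulmxDl mulmxDr opprD addrACA IH addr0.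
by rewrite -scalemxAl -scalemxAr c subrr.
Qed.

(** H is the group [text] for [m = 14], hence closed. For [m = 7] an element differs from its torus
    part by terms of positive degree for [ad hrho], and the torus is commutative of degree 0, so
    [filtered_solvable] applies. *)
Lemma borel_H_exists : exists2 BH, borel_subgroup (generated (T `|` hexp e f)) BH &
  text T (hroots 7) `<=` BH.
Proof.
have nx c := hroots_nilp c (isT : 7 <= 14)%N; have ex c t := @hroots_eigen 7 c t isT.
apply: borel_exists.
- rewrite /hexp -text_gen //; apply: (text_algebraic D) => c; first exact: hroots_nilp.
  by move=> t; apply: hroots_eigen.
- exact: (text_group D).
- rewrite text_gen //; apply: gen_min; first exact: (H_grp D).
  move=> A [|[[c a] /= c7 <-]]; first exact: H_T.
  by apply: H_exp; apply: leq_trans c7 _.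
- exact: (text_connected D).
have [N hN] := ad_filt_eq0 hrho.
have tr A : text T (hroots 7) A -> exists2 t, T t & ad_filt hrho 1 (A - t).
  move=> [t [g [Tt Eg ->]]]; exists t => //.
  have -> : t *m g - t = t *m (g - 1%:M) by rewrite mulmxBr mulmx1.
  rewrite -[1%N]add0n; apply: ad_filtM.
    by apply: (@ad_filt1 _ _ _ 0 0) => //; apply: T_hrho.
  move: g Eg; apply: (@gen_ind _ _ (exp_curves (hroots 7)) (fun g => ad_filt hrho 1 (g - 1%:M))).
  - exact: exp_curves_unit.
  - by rewrite subrr; apply: ad_filt0.
  move=> g _ _ [c _ [s _ <-]] hg.
  have hx r : ad_filt hrho 1 (mx_exp (r *: hroots 7 c) - 1%:M).
    apply: ad_filt_exp; apply: ad_filtZ; rewrite /hroots; case: ifP => c7; last exact: ad_filt0.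
    have /allP2/(_ c c7)/Z.ltb_lt pos := hrho_pos.
    have /andP [_ c133] := hidx_range (leq_trans c7 (isT : 7 <= 14)%N).
    apply: (@ad_filt1 _ _ _ 1 (Z.to_nat (hrho_val (hidx c)))); first by lia.
    by rewrite hrhoE // /zK pmulrn; congr (_%:~R *: _); lia.
  have h0 r : ad_filt hrho 1 (g *m mx_exp (r *: hroots 7 c) - 1%:M).
    have -> : g *m mx_exp (r *: hroots 7 c) - 1%:M =
        (g - 1%:M) *m (mx_exp (r *: hroots 7 c) - 1%:M) + (mx_exp (r *: hroots 7 c) - 1%:M) + (g - 1%:M).
      by rewrite mulmxBl mul1mx subrK mulmxBr mulmx1 addrA subrK.
    apply: ad_filtD => //; apply: ad_filtD => //.
    by apply: (@ad_filtW _ _ _ 1 (1 + 1)) => //; apply: ad_filtM.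
  split=> //; rewrite mx_exp_inv; last by apply: nilpZ; apply: nx.
  by rewrite -scaleNr.
exists N.+1; apply: (@filtered_solvable _ _ _ (ad_filt hrho)) => //.
- exact: (text_group D).
- by move=> i j A A'; apply: ad_filtM.
- by move=> i A A'; apply: ad_filtD.
- by move=> i A; apply: ad_filtN.
- by move=> i A; apply: ad_filtW.
- move=> A /tr [t Tt hA]; rewrite -[A](subrK t); apply: ad_filtD; first exact: ad_filtW hA.
  by apply: (@ad_filt1 _ _ _ 0 0) => //; apply: T_hrho.
move=> A A' /tr [t Tt hA] /tr [t' Tt' hA'].
have h0 s : T s -> ad_filt hrho 0 s.
  by move=> Ts; apply: (@ad_filt1 _ _ _ 0 0) => //; apply: T_hrho.
have w C : ad_filt hrho 1 C -> ad_filt hrho 0 C by apply: ad_filtW.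
have -> : A *m A' - A' *m A = (A - t) *m A' + t *m (A' - t') - ((A' - t') *m A + t' *m (A - t)).
  rewrite !mulmxBl !mulmxBr (e7_Tab D Tt Tt').
  by move: (A *m A') (A' *m A) (t *m A') (t' *m A) (t' *m t) => a b c d u; apply/matrixP=> x y; rewrite !mxE; ring.
have hA0 : ad_filt hrho 0 A by rewrite -[A](subrK t); apply: ad_filtD; [apply: w | apply: h0].
have hA0' : ad_filt hrho 0 A' by rewrite -[A'](subrK t'); apply: ad_filtD; [apply: w | apply: h0].
apply: ad_filtD; [|apply: ad_filtN]; apply: ad_filtD.
- by rewrite -[1%N]addn0; apply: ad_filtM.
- by rewrite -[1%N]add0n; apply: ad_filtM => //; apply: h0.
- by rewrite -[1%N]addn0; apply: ad_filtM.
- by rewrite -[1%N]add0n; apply: ad_filtM => //; apply: h0.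
Qed.

End BorelOfH.

(** * Density of a double coset from transversality of Lie algebras *)

Section Transversality.
Variables (K : numClosedFieldType) (n : nat).
Implicit Types (p q r : {mpoly K[n * n]}) (A X Y Z : 'M[K]_n) (w u : seq 'M[K]_n).

Definition dRw w p := foldr (@dR K n) p w.

Lemma dpf_add r p q : (forall A, mxeval A r = mxeval A p + mxeval A q) ->
  forall A X, dpf r A X = dpf p A X + dpf q A X.
Proof.
move=> h A X; have l := @lder_mxeval K n _ _ _ (lmx_line A X).
have := l r; have := lderD (l p) (l q); rewrite subrr scale0r addr0 => h1 h2.
by apply: lder_uniq h2 _; apply: lder_ext h1 => s _; rewrite h.
Qed.

Lemma dRw_add w r p q : (forall A, mxeval A r = mxeval A p + mxeval A q) ->
  forall A, mxeval A (dRw w r) = mxeval A (dRw w p) + mxeval A (dRw w q).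
Proof.
move=> h; elim: w => [|X w IH] A //=; rewrite !dRE; exact: dpf_add.
Qed.

Lemma dRL_eq X Y p : dR X (dL Y p) = dL Y (dR X p).
Proof. by congr polf; apply/funext => A; rewrite -dRE -dLE dRL. Qed.

Lemma dRw_dL w Y p : dRw w (dL Y p) = dL Y (dRw w p).
Proof. by elim: w => //= X w ->; rewrite dRL_eq. Qed.

Section Orbit.
Variables (S P : set 'M[K]_n) (g0 : 'M[K]_n) (L : set 'M[K]_n).
Hypotheses (gS : mx_group S) (gP : mx_group P) (u0 : g0 \in unitmx).
Definition dcoset : set 'M[K]_n := [set A | exists s b, [/\ S s, P b & A = s *m g0 *m b]].
Local Notation E := dcoset.

(** With [inR], the infinitesimal stabilizers, from the left and from the right, of the vanishing
    ideal of the double coset. *)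
Definition inL X := forall p, vanish E p -> vanish E (dL X p).
Definition inR X := forall p, vanish E p -> vanish E (dR X p).

Lemma inL_lin a X Y : inL X -> inL Y -> inL (a *: X + Y).
Proof.
move=> hX hY p Ep A EA; rewrite dLE mulmxDl -scalemxAl dpf_lin -!dLE.
by rewrite hX // hY // mulr0 addr0.
Qed.

Lemma inR_lin a X Y : inR X -> inR Y -> inR (a *: X + Y).
Proof.
move=> hX hY p Ep A EA; rewrite dRE mulmxDr -scalemxAr dpf_lin -!dRE.
by rewrite hX // hY // mulr0 addr0.
Qed.

Lemma inL0 : inL 0.
Proof. by move=> p Ep A EA; rewrite dLE mul0mx dpf0. Qed.

Lemma inR0 : inR 0.
Proof. by move=> p Ep A EA; rewrite dRE mulmx0 dpf0. Qed.

Lemma inL_br X Y : inL X -> inL Y -> inL (lie_bracket X Y).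
Proof.
move=> hX hY p Ep A EA; rewrite -dLL (hX _ (hY _ Ep)) // (hY _ (hX _ Ep)) //.
by rewrite subrr.
Qed.

Lemma inR_br X Y : inR X -> inR Y -> inR (lie_bracket X Y).
Proof.
move=> hX hY p Ep A EA; rewrite -dRR (hX _ (hY _ Ep)) // (hY _ (hX _ Ep)) //.
by rewrite subrr.
Qed.

Lemma inL_curve (c : K -> 'M[K]_n) X : lmx c X -> c 1 = 1%:M -> (forall s, s != 0 -> S (c s)) -> inL X.
Proof.
move=> lc c1 Sc p Ep A [s [q [Ss Pq eA]]].
apply: lder_uniq (lder_dL p A lc c1) (lder_ext _ (lderC 0)) => t t0.
rewrite Ep //; exists (c t *m s), q; split=> //; last by rewrite eA !mulmxA.
by apply: (mxgM gS) => //; apply: Sc.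
Qed.

Lemma inR_curve (c : K -> 'M[K]_n) X : lmx c X -> c 1 = 1%:M -> (forall s, s != 0 -> P (c s)) -> inR X.
Proof.
move=> lc c1 Pc p Ep A [s [q [Ss Pq eA]]].
apply: lder_uniq (lder_dR p A lc c1) (lder_ext _ (lderC 0)) => t t0.
rewrite Ep //; exists s, (q *m c t); split=> //; last by rewrite eA !mulmxA.
by apply: (mxgM gP) => //; apply: Pc.
Qed.

Lemma inL_exp X : nilp X -> (forall s, S (mx_exp (s *: X))) -> inL X.
Proof.
move=> nX SX; apply: (inL_curve (lmx_exp nX)) => [|s _]; last exact: SX.
by rewrite subrr scale0r mx_exp0.
Qed.

Lemma inR_exp X : nilp X -> (forall s, P (mx_exp (s *: X))) -> inR X.
Proof.
move=> nX SX; apply: (inR_curve (lmx_exp nX)) => [|s _]; last exact: SX.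
by rewrite subrr scale0r mx_exp0.
Qed.

Hypothesis Lbr : forall X Y, L X -> L Y -> L (lie_bracket X Y).
Hypothesis trans : forall Y, L Y -> exists X Z, [/\ inL X, inR Z, L Z &
  Y = invmx g0 *m X *m g0 + Z].

(* An operator dR Z with Z in the right stabilizer is moved to the inside of the
   word, and dR Y with Y conjugate to X in the left one acts at g0 as dL X. *)
Lemma dRw_orbit w p : (forall Y, Y \in w -> L Y) -> vanish E p -> mxeval g0 (dRw w p) = 0.
Proof.
have Eg0 : E g0.
  by exists 1%:M, 1%:M; rewrite mul1mx mulmx1; split=> //; apply: mxg1.
have [k] := ubnP (size w); elim: k w p => // k IH [|Y w] p /= wk Lw Ep; first exact: Ep.
have {}IH u q : (size u <= size w)%N -> (forall Y, Y \in u -> L Y) -> vanish E q -> mxeval g0 (dRw u q) = 0.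
  by move=> uw Lu Eq; apply: IH => //; apply: leq_ltn_trans uw _.
have [X [Z [LX RZ LZ eY]]] := trans (Lw Y (mem_head _ _)).
have {}Lw V : V \in w -> L V by move=> Vw; apply: Lw; rewrite inE Vw orbT.
rewrite dRE eY mulmxDr dpfD !mulmxA mulmxV // mul1mx -dLE -dRE -dRw_dL (IH _ _ (leqnn _) Lw (LX _ Ep)) add0r.
(* [dR Z] is moved inwards past [dR V]. The commutator [dR [Z, V]] leaves a word no longer than [w],
   covered by the induction; once innermost, [dR Z] preserves the ideal. *)
have key u w' : (size (u ++ w') <= size w)%N -> (forall V, V \in u -> L V) -> (forall V, V \in w' -> L V) ->
    mxeval g0 (dRw (u ++ Z :: w') p) = 0.
  elim: w' u => [|V w' IHw] u su Lu Lw'.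
    by rewrite /dRw foldr_cat /=; apply: IH; [move: su; rewrite cats0 | | apply: RZ].
  have LV := Lw' V (mem_head _ _).
  have {}Lw' C : C \in w' -> L C by move=> Cw; apply: Lw'; rewrite inE Cw orbT.
  rewrite /dRw foldr_cat -/(dRw u _) /=.
  rewrite (@dRw_add u _ (dR V (dR Z (dRw w' p))) (dR (lie_bracket Z V) (dRw w' p))); last first.
    move=> A; have h1 := dRR Z V (dRw w' p) A; apply/eqP; rewrite addrC -subr_eq; apply/eqP; exact: h1.
  have := IHw (rcons u V); rewrite cat_rcons /dRw foldr_cat /= foldr_rcons -/(dRw u _) => -> //.
  - rewrite add0r; have := IH (u ++ lie_bracket Z V :: w') p; rewrite /dRw foldr_cat /=; apply=> //.
      by move: su; rewrite !size_cat /= addnS.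
    move=> C; rewrite mem_cat inE => /or3P [/Lu|/eqP ->|/Lw'] //; exact: Lbr.
  - by move=> C; rewrite mem_rcons inE => /orP [/eqP ->|/Lu].
exact: (key [::] w).
Qed.

(** The iterated derivatives of [p] along [L] form a family stable under each [dR Y] with [Y] in [L]
    and vanishing at [g0]; Taylor expansion carries the vanishing along every exponential factor. *)
Lemma orbit_dense (x : nat -> 'M[K]_n) : (forall c, nilp (x c)) -> (forall c, L (x c)) ->
  exp_group x g0 -> forall p, vanish E p -> vanish (exp_group x) p.
Proof.
move=> nx Lx Gg0 p Ep.
pose F : set {mpoly K[n * n]} := [set q | exists2 w, (forall Y, Y \in w -> L Y) & q = dRw w p].
suff h A : exp_group x A -> forall q, F q -> mxeval (g0 *m A) q = 0.
  move=> A GA; have gG := exp_groupP nx.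
  have := h (invmx g0 *m A) (mxgM gG (mxgV gG Gg0) GA) p; rewrite mulKVmx //; apply.
  by exists [::].
have FR Y q : L Y -> F q -> F (dR Y q).
  by move=> LY [w Lw ->]; exists (Y :: w) => // V; rewrite inE => /orP [/eqP ->|/Lw].
move: A; apply: (gen_ind (Q := fun A => forall q, F q -> mxeval (g0 *m A) q = 0)).
- exact: exp_curves_unit.
- by move=> q [w Lw ->]; rewrite mulmx1; apply: dRw_orbit.
move=> A _ GA [c _ [s _ <-]] hA; have nc : nilp (x c) := nx c.
have h (t : K) q : F q -> mxeval (g0 *m (A *m mx_exp (t *: x c))) q = 0.
  move=> Fq; rewrite mulmxA; apply: (taylorR nc (F := F)) => // q' Fq'; by apply: FR.
split=> q Fq; first exact: h.
rewrite mx_exp_inv; last exact: nilpZ.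
by rewrite -scaleNr; apply: h.
Qed.

End Orbit.
End Transversality.

(** * The certificate of transversality *)

Section PositiveCertificate.

(* An element g0^-1, as a word in the exp(f_k), for which the projection of
   Ad(g0^-1) Lie(S) to the degree -1 part with respect to alpha_7 is onto; the
   j-th entry of pos_tab is mapped to pos_den times the j-th basis vector. *)
Definition pos_word : seq nat := [:: 13; 12; 11; 10; 8; 9; 10; 7; 11; 9; 10; 12; 8; 13; 11; 10; 12; 9; 11; 10; 7; 8; 9; 10; 11; 12; 13]%N.
Local Open Scope Z_scope.
Definition pos_den : Z := 2.
Definition pos_tab : seq (seq (nat * Z)) :=
  [:: [:: (69%N, 2)];
  [:: (68%N, (-2)); (69%N, 12)];
  [:: (67%N, 2); (68%N, (-12)); (69%N, 36)];
  [:: (66%N, (-2)); (67%N, 12); (68%N, (-36)); (69%N, 72)];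
  [:: (1%N, (-1)); (4%N, 1); (5%N, 2); (6%N, 1); (12%N, 2); (18%N, (-10)); (24%N, (-34)); (25%N, 12); (30%N, (-48)); (31%N, 36); (34%N, (-56)); (37%N, 50); (41%N, 58); (59%N, (-24)); (66%N, 132); (67%N, (-396)); (68%N, 528); (69%N, (-594))];
  [:: (64%N, 2); (66%N, (-12)); (67%N, 36); (68%N, (-72)); (69%N, 114)];
  [:: (59%N, (-2)); (64%N, 10); (66%N, (-34)); (67%N, 70); (68%N, (-112)); (69%N, 154)];
  [:: (1%N, (-2)); (4%N, 2); (5%N, 4); (6%N, 2); (12%N, 4); (18%N, (-20)); (24%N, (-66)); (25%N, 24); (30%N, (-92)); (31%N, 70); (34%N, (-106)); (37%N, 96); (41%N, 110); (59%N, (-48)); (64%N, 12); (66%N, 216); (67%N, (-696)); (68%N, 936); (69%N, (-1056))];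
  [:: (1%N, (-3)); (4%N, 3); (5%N, 6); (6%N, 3); (12%N, 6); (17%N, (-2)); (18%N, (-30)); (23%N, (-4)); (24%N, (-90)); (25%N, 36); (27%N, (-6)); (30%N, (-120)); (31%N, 98); (34%N, (-132)); (37%N, 130); (41%N, 144); (59%N, (-84)); (64%N, 60); (66%N, 228); (67%N, (-924)); (68%N, 1284); (69%N, (-1470))];
  [:: (1%N, 2); (4%N, (-2)); (5%N, (-4)); (6%N, (-2)); (12%N, (-4)); (18%N, 18); (24%N, 56); (25%N, (-22)); (30%N, 76); (31%N, (-60)); (34%N, 86); (37%N, (-80)); (41%N, (-90)); (59%N, 48); (64%N, (-36)); (66%N, (-120)); (67%N, 504); (68%N, (-696)); (69%N, 792)];
  [:: (1%N, 5); (4%N, (-5)); (5%N, (-10)); (6%N, (-5)); (11%N, 2); (12%N, (-10)); (17%N, 12); (18%N, 38); (23%N, 20); (24%N, 98); (25%N, (-50)); (27%N, 26); (30%N, 120); (31%N, (-120)); (34%N, 124); (37%N, (-150)); (41%N, (-160)); (59%N, 156); (64%N, (-180)); (66%N, (-156)); (67%N, 1188); (68%N, (-1740)); (69%N, 2034)];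
  [:: (1%N, (-2)); (4%N, 2); (5%N, 4); (6%N, 2); (12%N, 4); (18%N, (-12)); (24%N, (-36)); (25%N, 16); (30%N, (-48)); (31%N, 40); (34%N, (-54)); (37%N, 52); (41%N, 58); (59%N, (-48)); (64%N, 72); (66%N, (-24)); (67%N, (-216)); (68%N, 336); (69%N, (-396))];
  [:: (1%N, 5); (4%N, (-3)); (5%N, (-10)); (6%N, (-5)); (11%N, 20); (12%N, (-12)); (16%N, 4); (17%N, 36); (18%N, 6); (20%N, 10); (23%N, 36); (24%N, 60); (25%N, (-34)); (27%N, 22); (30%N, 104); (31%N, (-106)); (34%N, 156); (37%N, (-154)); (41%N, (-198)); (59%N, 192); (64%N, (-192)); (66%N, (-324)); (67%N, 1776); (68%N, (-2592)); (69%N, 3054)];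
  [:: (1%N, (-7)); (4%N, 7); (5%N, 14); (6%N, 7); (11%N, (-8)); (12%N, 14); (17%N, (-32)); (18%N, (-22)); (23%N, (-48)); (24%N, (-46)); (25%N, 44); (27%N, (-58)); (30%N, (-48)); (31%N, 92); (34%N, (-44)); (37%N, 110); (41%N, 116); (59%N, (-240)); (64%N, 360); (66%N, (-84)); (67%N, (-1188)); (68%N, 1896); (69%N, (-2286))];
  [:: (1%N, 2); (4%N, (-2)); (5%N, (-4)); (6%N, (-2)); (12%N, (-4)); (18%N, 2); (24%N, 10); (25%N, (-6)); (30%N, 14); (31%N, (-14)); (34%N, 16); (37%N, (-18)); (41%N, (-20)); (59%N, 48); (64%N, (-114)); (66%N, 192); (67%N, (-120)); (68%N, 84); (69%N, (-66))];
  [:: (1%N, (-12)); (4%N, 4); (5%N, 24); (6%N, 12); (11%N, (-80)); (12%N, 32); (16%N, (-16)); (17%N, (-124)); (18%N, 56); (20%N, (-38)); (23%N, (-104)); (24%N, (-66)); (25%N, 40); (27%N, (-40)); (30%N, (-228)); (31%N, 214); (34%N, (-434)); (37%N, 372); (41%N, 536); (59%N, (-504)); (64%N, 468); (66%N, 1008); (67%N, (-5016)); (68%N, 7296); (69%N, (-8604))];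
  [:: (1%N, 9); (4%N, (-9)); (5%N, (-18)); (6%N, (-9)); (11%N, 18); (12%N, (-18)); (17%N, 58); (18%N, (-18)); (23%N, 82); (24%N, (-42)); (25%N, (-18)); (27%N, 96); (30%N, (-60)); (31%N, (-34)); (34%N, (-72)); (37%N, (-40)); (41%N, (-42)); (59%N, 330); (64%N, (-570)); (66%N, 408); (67%N, 1056); (68%N, (-1902)); (69%N, 2382)];
  [:: (1%N, 12); (4%N, 4); (5%N, (-24)); (6%N, (-12)); (11%N, 140); (12%N, (-40)); (14%N, 2); (16%N, 32); (17%N, 168); (18%N, (-134)); (20%N, 68); (23%N, 88); (24%N, 116); (25%N, (-14)); (27%N, (-48)); (30%N, 468); (31%N, (-308)); (34%N, 882); (37%N, (-612)); (41%N, (-928)); (59%N, 552); (64%N, (-252)); (66%N, (-2136)); (67%N, 7632); (68%N, (-10752)); (69%N, 12564)];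
  [:: (1%N, 21); (4%N, (-3)); (5%N, (-42)); (6%N, (-21)); (11%N, 180); (12%N, (-60)); (16%N, 34); (17%N, 256); (18%N, (-186)); (20%N, 78); (23%N, 200); (24%N, 54); (25%N, (-18)); (27%N, 66); (30%N, 408); (31%N, (-352)); (34%N, 834); (37%N, (-684)); (41%N, (-1020)); (59%N, 924); (64%N, (-786)); (66%N, (-2148)); (67%N, 9822); (68%N, (-14196)); (69%N, 16710)];
  [:: (1%N, (-24)); (5%N, 48); (6%N, 24); (11%N, (-192)); (12%N, 72); (14%N, (-12)); (16%N, (-48)); (17%N, (-192)); (18%N, 72); (20%N, (-84)); (23%N, (-48)); (24%N, (-624)); (25%N, 144); (27%N, 144); (30%N, (-1344)); (31%N, 864); (34%N, (-2046)); (37%N, 1488); (41%N, 2044); (59%N, (-864)); (66%N, 4896); (67%N, (-15120)); (68%N, 21024); (69%N, (-24552))];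
  [:: (0%N, (-1)); (1%N, (-33)); (4%N, (-17)); (5%N, 66); (6%N, 33); (11%N, (-432)); (12%N, 116); (14%N, (-15)); (16%N, (-90)); (17%N, (-492)); (18%N, 440); (20%N, (-173)); (23%N, (-254)); (24%N, (-352)); (25%N, 8); (27%N, 111); (30%N, (-1414)); (31%N, 910); (34%N, (-2597)); (37%N, 1825); (41%N, 2739); (59%N, (-1548)); (64%N, 534); (66%N, 6666); (67%N, (-22764)); (68%N, 31896); (69%N, (-37155))];
  [:: (0%N, 6); (1%N, 90); (5%N, (-180)); (6%N, (-90)); (11%N, 720); (12%N, (-270)); (14%N, 90); (16%N, 156); (17%N, 720); (18%N, (-270)); (20%N, 204); (23%N, 240); (24%N, 2340); (25%N, (-540)); (27%N, (-336)); (30%N, 4938); (31%N, (-3240)); (34%N, 7362); (37%N, (-5518)); (41%N, (-7482)); (59%N, 3240); (66%N, (-18360)); (67%N, 56700); (68%N, (-78912)); (69%N, 91908)];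
  [:: (0%N, 4); (1%N, 31); (4%N, 23); (5%N, (-66)); (6%N, (-33)); (11%N, 468); (12%N, (-122)); (14%N, 42); (16%N, 84); (17%N, 516); (18%N, (-464)); (20%N, 116); (23%N, 272); (24%N, 430); (25%N, (-14)); (27%N, (-42)); (30%N, 1582); (31%N, (-1010)); (34%N, 2786); (37%N, (-2006)); (41%N, (-2962)); (59%N, 1548); (64%N, (-270)); (66%N, (-7680)); (67%N, 24780); (68%N, (-34488)); (69%N, 39954)];
  [:: (0%N, (-24)); (1%N, (-144)); (4%N, 12); (5%N, 312); (6%N, 156); (11%N, (-1152)); (12%N, 456); (14%N, (-252)); (16%N, (-192)); (17%N, (-1272)); (18%N, 312); (20%N, (-54)); (23%N, (-696)); (24%N, (-3762)); (25%N, 1008); (27%N, (-180)); (30%N, (-7644)); (31%N, 5332); (34%N, (-10914)); (37%N, 8844); (41%N, 11640); (59%N, (-5472)); (66%N, 31104); (67%N, (-95688)); (68%N, 133200); (69%N, (-154368))];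
  [:: (0%N, 36); (1%N, 120); (4%N, (-36)); (5%N, (-312)); (6%N, (-156)); (11%N, 984); (12%N, (-432)); (14%N, 330); (16%N, 96); (17%N, 1392); (18%N, (-90)); (20%N, (-264)); (23%N, 1248); (24%N, 2904); (25%N, (-1084)); (27%N, 1392); (30%N, 5532); (31%N, (-4560)); (34%N, 7242); (37%N, (-7152)); (41%N, (-8868)); (59%N, 5184); (66%N, (-29664)); (67%N, 90504); (68%N, (-125856)); (69%N, 144900)];
  [:: (0%N, (-36)); (1%N, (-84)); (4%N, 48); (5%N, 312); (6%N, 156); (11%N, (-912)); (12%N, 418); (14%N, (-312)); (16%N, (-24)); (17%N, (-1680)); (18%N, 4); (20%N, 396); (23%N, (-1968)); (24%N, (-1792)); (25%N, 1100); (27%N, (-2568)); (30%N, (-3152)); (31%N, 3676); (34%N, (-3556)); (37%N, 5348); (41%N, 6130); (59%N, (-4752)); (64%N, (-816)); (66%N, 30768); (67%N, (-89688)); (68%N, 123648); (69%N, (-141456))];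
  [:: (0%N, 30); (1%N, 54); (4%N, (-48)); (5%N, (-310)); (6%N, (-156)); (11%N, 916); (12%N, (-406)); (14%N, 252); (16%N, (-12)); (17%N, 1940); (18%N, (-4)); (20%N, (-390)); (23%N, 2500); (24%N, 998); (25%N, (-1080)); (27%N, 3284); (30%N, 1566); (31%N, (-3076)); (34%N, 1288); (37%N, (-4180)); (41%N, (-4458)); (59%N, 4368); (64%N, 1836); (66%N, (-32904)); (67%N, 91476); (68%N, (-124896)); (69%N, 142332)]].
Local Close Scope Z_scope.

Definition vsparse (l : seq (nat * Z)) : seq Z := foldr (fun p v => vinc p.1 p.2 v) v0 l.

(* The basis vectors of the Lie algebra of the positive Borel subgroup of H, and
   of the parabolic subalgebra of alpha_7. *)
Definition leftok (i : nat) : bool := (i < 7)%N || (i < 70)%N && ~~ odd (nth 0%N (rt (i - 7)) 1).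
Definition rightok (i : nat) : bool := (i < 70)%N || (nth 0%N (rt (i - 70)) 6 == 0)%N.

Definition neg_idx : seq nat := Eval vm_compute in [seq i <- iota 70 63 | ~~ rightok i].

Lemma neg_idx_mem : all (fun i => rightok i || (i \in neg_idx)) (iota 0 133) && all (fun i => i < 133)%N neg_idx
  && (size neg_idx == size pos_tab).
Proof. by vm_compute. Qed.

Lemma pos_check : all (fun t => let v := vsparse (nth [::] pos_tab t) in
  all (fun i => leftok i || Z.eqb (nth Z0 v i) Z0) (iota 0 133) &&
  let u := vword pos_word v in
  all (fun s => Z.eqb (nth Z0 u (nth 0%N neg_idx s)) (if s == t then pos_den else Z0)) (iota 0 27)) (iota 0 27).
Proof. by vm_compute. Qed.

(** In the order of the list, a positive root of H that is no [beta_k] arises from an earlier one by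
    adding a simple root other than [alpha_2]. Hence the [X (hidx c)] with [c < 7] generate all
    positive root vectors of H. *)
Lemma left_descent : all (fun i => leftok i ==>
  (has (fun c => i == hidx c) (iota 0 7) || has (fun k => (k != 1) &&
    has (fun j => [&& (j < i)%N, leftok j, (opE k j).1 == i & ~~ Z.eqb (opE k j).2 Z0]) (iota 7 63)) (iota 0 7)))
  (iota 7 63).
Proof. by vm_compute. Qed.

End PositiveCertificate.

Section OpenOrbit.
Variables (K : numClosedFieldType) (n : nat).

Lemma left_translateM (A C : 'M[K]_n) (Q : set 'M[K]_n) :
  left_translate A (left_translate C Q) = left_translate (A *m C) Q.
Proof.
apply/seteqP; split=> [_ [_ [x Qx <-] <-]|_ [x Qx <-]]; first by exists x; rewrite ?mulmxA.
by exists (C *m x); [exists x | rewrite mulmxA].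
Qed.

Lemma left_translate_stab (C : 'M[K]_n) (Q : set 'M[K]_n) : mx_group Q -> Q C -> left_translate C Q = Q.
Proof.
move=> gQ QC; apply/seteqP; split=> [_ [x Qx <-]|x Qx]; first exact: (mxgM gQ).
exists (invmx C *m x); last by rewrite mulKVmx // (mxg_unit gQ).
by apply: (mxgM gQ) => //; apply: (mxgV gQ).
Qed.

(* An orbit of double cosets which contains a nonempty open set is open, as the
   union of its translates. *)
Lemma orbit_open (G S P : set 'M[K]_n) g0 p : mx_group G -> mx_group S -> mx_group P ->
  S `<=` G -> P `<=` G -> G g0 -> ~ vanish G p ->
  (forall A, G A -> mxeval A p != 0 -> dcoset S P g0 A) ->
  open_in_coset_space G P (orbit_of S (left_translate g0 P)).
Proof.
move=> gG gS gP SG PG Gg0 np hp; split.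
  move=> _ [s Ss <-]; exists (s *m g0); last by rewrite left_translateM.
  by apply: (mxgM gG) => //; apply: SG.
have [A0 GA0 pA0] := notvanish np; have [s0 [c0 [Ss0 Pc0 eA0]]] := hp A0 GA0 pA0.
pose F s c : 'M[K]_n -> K := fun A => mxeval (s *m A *m c) p.
exists [set A | A \in unitmx /\ forall q, [set q | exists s c, [/\ S s, P c & q = polf (F s c)]] q -> mxeval A q = 0].
  by exists [set q | exists s c, [/\ S s, P c & q = polf (F s c)]].
have FE s c A : mxeval A (polf (F s c)) = mxeval (s *m A *m c) p by rewrite polfE //; apply: pfun_trans.
apply/seteqP; split=> A.
  move=> [GA [s Ss eA]]; split=> // -[_ hA].
  have : left_translate A P A by exists 1%:M; [exact: mxg1 | rewrite mulmx1].
  rewrite -eA left_translateM => -[c Pc e].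
  have us := mxg_unit gS Ss; have uc := mxg_unit gP Pc.
  have := hA (polf (F (s0 *m invmx s) (invmx c *m c0))); rewrite FE -e.
  have -> : s0 *m invmx s *m (s *m g0 *m c) *m (invmx c *m c0) = A0.
    by rewrite eA0 !mulmxA mulmxKV // mulmxK.
  move=> h; move: pA0; rewrite h ?eqxx //; exists (s0 *m invmx s), (invmx c *m c0); split=> //.
    by apply: (mxgM gS) => //; apply: (mxgV gS).
  by apply: (mxgM gP) => //; apply: (mxgV gP).
move=> [GA hA]; split=> //.
have [s [c [Ss Pc hsc]]] : exists s c, [/\ S s, P c & mxeval (s *m A *m c) p != 0].
  apply: contrapT => no; apply: hA; split; first exact: (mxg_unit gG GA).
  move=> _ [s [c [Ss Pc ->]]]; rewrite FE; apply/eqP/negPn/negP => h; apply: no.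
  by exists s, c.
have GsAc : G (s *m A *m c) by apply: (mxgM gG); [apply: (mxgM gG) => //; apply: SG | apply: PG].
have [s' [c' [Ss' Pc' e]]] := hp _ GsAc hsc.
have us := mxg_unit gS Ss; have uc := mxg_unit gP Pc.
have eA : A = invmx s *m s' *m g0 *m (c' *m invmx c).
  by rewrite -[LHS](mulmxK uc) -[A *m c](mulKmx us) (mulmxA s A c) e !mulmxA.
exists (invmx s *m s'); first by apply: (mxgM gS) => //; apply: (mxgV gS).
have Pc1 : P (c' *m invmx c) by apply: (mxgM gP) => //; apply: (mxgV gP).
by rewrite left_translateM eA -(left_translateM (invmx s *m s' *m g0)) (left_translate_stab gP Pc1).
Qed.

End OpenOrbit.

(** * The open orbit in G/P_7 *)

Section Spherical.
Variables (K : numClosedFieldType) (n : nat).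
Variables (G T B : set 'M[K]_n) (alpha omega : 'I_7 -> 'M[K]_n -> K).
Variables (e f : nat -> 'M[K]_n) (tau : nat -> K -> 'M[K]_n).
Hypothesis D : e7_data G T B alpha omega e f tau.
Local Notation zK := (zK K).
Local Notation X := (adX e f).
Local Notation phi := (phi e f).
Local Notation adm := (adm e f).
Let rel := e7_rel D.
Let gG := e7_grp D.
Let TF := term_fun_class K.
Variables (m : nat) (rho : 'M[K]_n -> 'M[K]_m).
Hypothesis hrho : algebraic_hom G (@units K m) rho.
Variables (v : 'cV[K]_m) (P : set 'M[K]_n).
Hypothesis BG : B `<=` G.
Hypothesis hv : highest_weight_vector T B rho (omega ord_max) v.
Hypothesis hP : P = [set g | G g /\ exists c, rho g *m v = c *: v].
Let S := text T (hroots e f 7).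
Let nx c : nilp (hroots e f 7 c) := hroots_nilp D c (isT : 7 <= 14)%N.
Let ex c t := @hroots_eigen _ _ _ _ _ _ _ _ _ _ D 7 c t isT.
Let gS : mx_group S := text_group D nx ex.
Let gP : mx_group P := P_grp D hrho hv hP.
(** The inverse of the word, so that the adjoint action of [g0^-1] is the integral matrix
    [mword K pos_word]. *)
Definition gpos : 'M[K]_n := invmx (gword e f pos_word).
Local Notation g0 := gpos.
Let Gw : G (gword e f pos_word) := gword_mem D pos_word.
Let Gg0 : G g0 := mxgV gG Gw.
Let LL := inL S P g0.
Let RR := inR S P g0.

Lemma phi_supp (Q : 'M[K]_n -> Prop) (d : 'cV[K]_133) : Q 0 -> (forall a Y Z, Q Y -> Q Z -> Q (a *: Y + Z)) ->
  (forall i : 'I_133, d i 0 != 0 -> Q (X i)) -> Q (phi d).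
Proof.
move=> Q0 Qlin hd; rewrite /phi; elim/big_rec: _ => // i Y _ QY.
case: (eqVneq (d i 0) 0) => [->|nz]; first by rewrite scale0r add0r.
by apply: Qlin => //; apply: hd.
Qed.

Lemma inL_leftok i : (i < 133)%N -> leftok i -> LL (X i).
Proof.
have LX c : (c < 7)%N -> LL (X (hidx c)).
  move=> c7; have hc : hroots e f 7 c = X (hidx c) by rewrite /hroots c7.
  apply: (inL_exp gS); first by rewrite -hc; apply: nx.
  by move=> s; apply: (text_E D); rewrite -hc; apply: exp_group_exp.
have Le k : (k < 7)%N -> k != 1 -> LL (e k).
  move=> k7 k1; rewrite -(adX_e e f k7); have := LX k k7.
  by rewrite /hidx k7 (negbTE k1).
have [N] := ubnP i; elim: N i => // N IH i; rewrite ltnS => iN i133 ok.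
case: (ltnP i 7) => i7.
  rewrite /adX i7; apply: (inL_curve gS (e7_tau_lmx D i7)); first exact: (e7_tau1 D).
  by move=> s s0; apply: (text_T nx); apply: (e7_tauT D).
case/orP: (ok) => [|/andP [i70 _]]; first by rewrite ltnNge i7.
have hi : (7 <= i < 7 + 63)%N by rewrite i7.
have := allP2 left_descent hi; rewrite ok implyTb => /orP [/hasP [c]|/hasP [k]].
  by rewrite mem_iota => /andP [_ c7] /eqP ->; apply: LX.
rewrite mem_iota => /andP [_ k7] /andP [k1 /hasP [j]]; rewrite mem_iota => hj.
case/and4P => ji okj /eqP e1 /negbTE/Z.eqb_neq nz.
have j133 : (j < 133)%N by lia.
have z0 : zK (opE k j).2 != 0 by apply/eqP => /zK_eq0.
have Lb : LL (lie_bracket (e k) (X j)).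
  by apply: inL_br; [exact: Le | apply: IH => //; apply: leq_trans ji iN].
rewrite (adX_E rel k7 j133) /mono e1 in Lb.
have := inL_lin (zK (opE k j).2)^-1 Lb (@inL0 K n S P g0).
by rewrite scalerA mulVf // scale1r addr0.
Qed.

Lemma inR_rightok i : (i < 133)%N -> rightok i -> RR (X i).
Proof.
have RZ a Y : RR Y -> RR (a *: Y).
  by move=> RY; have := inR_lin a RY (@inR0 K n S P g0); rewrite addr0.
have Re k : (k < 7)%N -> RR (e k).
  move=> k7; have hk : gens e f k = e k by rewrite /gens k7.
  apply: (inR_exp gP); first by rewrite -hk; apply: (e7_nilp D).
  move=> s; rewrite -hk; apply: (P_gens D hrho BG hv hP); first by lia.
  by apply/eqP => /=; lia.
have Rf k : (k < 7)%N -> k != 6 -> RR (f k).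
  move=> k7 k6; have hk : gens e f (7 + k) = f k.
    by rewrite /gens ltnNge leq_addr /= addKn; have -> : (7 + k < 14)%N by lia.
  apply: (inR_exp gP); first by rewrite -hk; apply: (e7_nilp D).
  move=> s; rewrite -hk; apply: (P_gens D hrho BG hv hP); first by lia.
  by apply: contra k6 => /eqP /= h; apply/eqP; lia.
move=> i133 ok; rewrite /adX; case: ifP => i7.
  apply: (inR_curve gP (e7_tau_lmx D i7)); first exact: (e7_tau1 D).
  by move=> s s0; apply: (P_T D hv hP); apply: (e7_tauT D).
case: ifP => i70.
  apply: xp_ind => //; last by lia.
  by move=> Y k k7 RY; apply: inR_br => //; apply: Re.
apply: (@xp_ind0 _ _ RR f 6) => //; [|by lia|].
  by move=> Y k k7 k6 RY; apply: inR_br => //; apply: Rf.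
by move: ok; rewrite /rightok i70 => /eqP.
Qed.

Lemma pos_vector (t : nat) : (t < 27)%N -> exists d : 'cV[K]_133,
  LL (phi d) /\ forall s, (s < 27)%N -> (mword K pos_word *m d) (inord (nth 0%N neg_idx s)) 0 =
     zK (if s == t then pos_den else Z0).
Proof.
move=> t27; have := allP2 pos_check t27; set l := nth [::] pos_tab t => /andP [h1 h2].
exists (vcol K (vsparse l)); split.
  apply: phi_supp => [||i]; [exact: inL0 | exact: inL_lin | rewrite mxE => nz].
  apply: inL_leftok => //; have := allP2 h1 (ltn_ord i); case/orP => // /Z.eqb_eq z0.
  by rewrite z0 zK0 eqxx in nz.
move=> s s27; rewrite -vcol_word //; have /Z.eqb_eq <- := allP2 h2 s27.
rewrite mxE inordK //; case/andP: neg_idx_mem => /andP [_ /allP hn] _.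
by apply: hn; apply: mem_nth.
Qed.

Lemma g0_trans Y : range phi Y -> exists X Z, [/\ LL X, RR Z, range phi Z & Y = invmx g0 *m X *m g0 + Z].
Proof.
move=> [c _ <-].
have hd (t : nat) : {d : 'cV[K]_133 | (t < 27)%N -> LL (phi d) /\ forall s, (s < 27)%N ->
    (mword K pos_word *m d) (inord (nth 0%N neg_idx s)) 0 = zK (if s == t then pos_den else Z0)}.
  apply: cid; case: (ltnP t 27) => t27; last by exists 0.
  by have [d h] := pos_vector t27; exists d.
have dz : zK pos_den != 0 by apply/eqP => /zK_eq0.
(* The vectors of [pos_vector] are mapped to [pos_den] times the basis vectors of degree -1, modulo
   Lie(P_7). These coefficients cancel the degree -1 part of [c], so the remainder lies in
   Lie(P_7). *)
pose a t := c (inord (nth 0%N neg_idx t)) 0 / zK pos_den.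
pose x : 'cV[K]_133 := \sum_(t < 27) a t *: sval (hd t).
pose M := mword K pos_word.
have hM d : invmx g0 *m phi d *m g0 = phi (M *m d).
  by rewrite /M -(adm_gword D) // (phi_adm D) // /gpos invmxK.
exists (phi x), (phi (c - M *m x)); split.
- rewrite /x phi_sum; elim/big_rec: _ => [|t Z _ LZ]; first exact: inL0.
  rewrite phiZ; apply: inL_lin => //.
  by have [] := svalP (hd t) (ltn_ord t).
- apply: phi_supp => [||i]; [exact: inR0 | exact: inR_lin | move=> nz].
  apply: inR_rightok => //; case/andP: neg_idx_mem => /andP [/allP hn _] _.
  have hi : nat_of_ord i \in iota 0 133 by rewrite mem_iota ltn_ord.
  have /orP [//|ineg] := hn _ hi.
  have si : (index (nat_of_ord i) neg_idx < 27)%N by rewrite -index_mem in ineg.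
  have ei : i = inord (nth 0%N neg_idx (index (nat_of_ord i) neg_idx)) by rewrite nth_index // inord_val.
  have e0 : (c - M *m x) i 0 = c i 0 - (M *m x) i 0 by rewrite [LHS]mxE; congr (_ + _); rewrite [LHS]mxE.
  case/negP: nz; rewrite e0 subr_eq0 ei; move: (index _ _) si => s s27; apply/eqP.
  rewrite /x mulmx_sumr summxE (bigD1 (Ordinal s27)) //= big1 => [|t ts].
    rewrite addr0 -scalemxAr mxE; have [_ /(_ s s27) ->] := svalP (hd s) s27.
    by rewrite eqxx /a divfK.
  rewrite -scalemxAr mxE; have [_ /(_ s s27) ->] := svalP (hd t) (ltn_ord t).
  rewrite (_ : (s == t) = false) ?zK0 ?mulr0 //; apply/negbTE; apply: contra ts => /eqP e1.
  by rewrite -val_eqE /= e1.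
- by exists (c - M *m x).
- by rewrite hM -phiD addrC subrK.
Qed.

Lemma pos_dense p : vanish (dcoset S P g0) p -> vanish G p.
Proof.
rewrite (e7_gen D); apply: (@orbit_dense _ _ S P g0 (range phi)) => //.
- exact: (mxg_unit gG Gg0).
- by move=> Y Z [c _ <-] [d _ <-]; have [u ->] := phi_br rel c d; exists u.
- exact: g0_trans.
- exact: (e7_nilp D).
- move=> c; rewrite /gens; case: ifP => c7.
    by exists (dl K (7 + c)) => //; rewrite phi_dl ?adX_e //; lia.
  case: ifP => c14; last by exists 0; rewrite ?phi0.
  by exists (dl K (70 + (c - 7))) => //; rewrite phi_dl ?adX_f //; lia.
- by rewrite -(e7_gen D).
Qed.

(** The two-by-two minors of the pair [v], [rho A *m v]: polynomial equations of [P] inside [G]. *)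
Definition line_eq (a b : 'I_m) (A : 'M[K]_n) : K :=
  v a 0 * (\sum_c v c 0 * mxeval A (rp D hrho b c)) - v b 0 * (\sum_c v c 0 * mxeval A (rp D hrho a c)).

Lemma line_eqP A : G A -> (forall a b, line_eq a b A = 0) <-> exists c, rho A *m v = c *: v.
Proof.
move=> GA; have E l : \sum_c v c 0 * mxeval A (rp D hrho l c) = (rho A *m v) l 0.
  by rewrite mxE; apply: eq_bigr => c _; rewrite (rpE D) // mulrC.
rewrite /line_eq; split=> [h|[c hc] a b]; last by rewrite !E hc !mxE; ring.
apply: (line_mem hv) => a b; have := h a b; rewrite !E => /eqP.
by rewrite subr_eq0 => /eqP.
Qed.

(** Fourteen parameters serve the torus, [size w] the unipotent part of S, and [size w'] an element
    of [G] that the equations [line_eq] force into [P]. *)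
Lemma dcoset_definable : definable (dcoset S P g0).
Proof.
have [w hw] := exp_group_image nx; have [w' hw'] := exp_group_image (e7_nilp D).
pose Mg (s : nat -> K) := wmap (gens e f) w' (fun i => s (14 + size w + i)%N).
pose M (s : nat -> K) := tword D s *m wmap (hroots e f 7) w (fun i => s (14 + i)%N) *m g0 *m Mg s.
pose c (j : 'I_7 + 'I_m * 'I_m) (s : nat -> K) := match j with
  | inl j => s j * s (7 + j)%N - 1 | inr ab => line_eq ab.1 ab.2 (Mg s) end.
have Gg s : G (Mg s) by rewrite (e7_gen D); apply/hw'; exists (fun i => s (14 + size w + i)%N).
have tM' N : rcmx (@term_fun K) (fun v => Mg (fun i => v`_(N + i))).
  move=> a b; apply: (rc_ext TF) (wmap_term_fun (gens e f) w' (N + (14 + size w)) a b) => u.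
  by congr ((wmap _ _ _) a b); apply/funext => i; rewrite !addnA.
have [N|j N|s t st|] := @definable_param K n (14 + size w + size w') M _ c.
- apply: (rcmxM TF) (tM' N); apply: (rcmxM TF); last exact: (rcmxC TF).
  apply: (rcmxM TF); first exact: tword_term.
  move=> a b; apply: (rc_ext TF) (wmap_term_fun (hroots e f 7) w (N + 14) a b) => u.
  by congr ((wmap _ w _) a b); apply/funext => i; rewrite addnA.
- have tB (x y : seq K -> K) : term_fun x -> term_fun y -> term_fun (fun u => x u - y u).
    move=> tx ty; apply: (rc_ext TF) (_ : term_fun (fun u => x u + (-1) * y u)) => [u|]; first by rewrite mulN1r.
    by apply: (rcD TF) => //; apply: (rcM TF) => //; apply: (rcC TF).
  case: j => [j|[a b]] /=; apply: tB.
  + by apply: (rcM TF); apply: term_fun_var.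
  + exact: (rcC TF).
  + apply: (rcM TF); first exact: (rcC TF).
    by apply: (rc_sum TF) => l; apply: (rcM TF); [apply: (rcC TF) | apply: (rc_mxeval TF)].
  + apply: (rcM TF); first exact: (rcC TF).
    by apply: (rc_sum TF) => l; apply: (rcM TF); [apply: (rcC TF) | apply: (rc_mxeval TF)].
- have eg : Mg s = Mg t by apply: wmap_ext => i iw; apply: st; rewrite ltn_add2l.
  split; first congr (_ *m _ *m _ *m _) => //.
  + by apply: tword_ext => i i14; apply: st; lia.
  + by apply: wmap_ext => i iw; apply: st; lia.
  + move=> [j|ab]; rewrite /c ?eg // !st //; have := ltn_ord j; lia.
move=> k [I [F [tF hF]]]; exists k, I, F; split=> // A; rewrite -hF.
split=> [[_ [b [[t [g [Tt /hw [s ->] ->]]] Pb ->]]]|[s [-> hs]]].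
  have Gb := P_G hP Pb; have := Gb; rewrite {1}(e7_gen D) => /hw' [s' eb].
  pose u i := if (i < size w)%N then s i else s' (i - size w)%N.
  have [z [-> h1 h2]] := T_tword D u Tt; exists z.
  have ez : Mg z = b.
    rewrite eb /Mg; congr wmap; apply/funext => i; rewrite -addnA h2 /u ltnNge leq_addr /=.
    by rewrite addKn.
  split.
    rewrite /M ez; congr (_ *m _ *m _ *m _); apply: wmap_ext => i iw.
    by rewrite h2 /u iw.
  move=> [j|[a a']]; first exact: h1.
  rewrite /c ez; apply: (proj2 (line_eqP Gb)) a a'.
  by move: Pb; rewrite hP => -[].
exists (tword D s *m wmap (hroots e f 7) w (fun i => s (14 + i)%N)), (Mg s); split=> //.
  exists (tword D s), (wmap (hroots e f 7) w (fun i => s (14 + i)%N)); split=> //.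
    by apply: tword_T => j; apply: (hs (inl j)).
  by apply/hw; exists (fun i => s (14 + i)%N).
rewrite hP; split=> //; apply/(line_eqP (Gg s)) => a b.
exact: (hs (inr (a, b))).
Qed.

Lemma spherical_max : spherical (generated (T `|` hexp e f)) G P.
Proof.
have [BH bBH SB] := borel_H_exists D; exists BH => //.
have BHG : BH `<=` G by case: bBH => h _ _; apply: subset_trans h (H_G D).
have gBH : mx_group BH by case: bBH => _ [[]].
have PG := P_G hP.
exists (left_translate g0 P); first by exists g0.
have EG : dcoset S P g0 `<=` G.
  move=> _ [s [c [Ss Pc ->]]]; apply: (mxgM gG); last exact: PG.
  by apply: (mxgM gG) => //; apply: BHG; apply: SB.
have [||p np hp] := chevalley (e7_irr D) dcoset_definable.
- move=> p hp; apply: pos_dense => A EA; apply: hp; split=> //; exact: EG.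
- by exists g0.
(* The open set found in [S g0 P] also lies in the possibly larger double coset of [BH]. *)
apply: (orbit_open gG gBH gP BHG PG Gg0 np) => A GA pA.
have [s [c [Ss Pc eA]]] := hp A GA pA; exists s, c; split=> //; exact: SB.
Qed.

End Spherical.

Theorem theorem23 (R : realType) (n : nat) (G T B H : set 'M[R[i]]_n)
    (alpha omega : 'I_7 -> 'M[R[i]]_n -> R[i])
    (P : 'I_7 -> set 'M[R[i]]_n) :
  simple_algebraic_group G ->
  maximal_torus G T ->
  borel_subgroup G B ->
  T `<=` B ->
  simple_roots E7_cartan G T B alpha ->
  fundamental_weights E7_cartan T alpha omega ->
  simply_connected T omega ->
  H = subsystem_subgroup G T alpha A7_base ->
  (forall i, highest_weight_parabolic G T B (omega i) (P i)) ->
  spherical H G (P ord_max) /\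
  (forall i, i != ord_max -> ~ spherical H G (P i)).

Proof.
move=> sG mT bB TB sr fw sc -> hP.
have [e [f [tau D]]] := e7_data_exists sG mT sr fw sc.
have BG : B `<=` G by case: bB.
rewrite (subsystem_H D); split=> [|i im].
  have [m [rho [v [[_ hrho _] hv eP]]]] := hP ord_max.
  exact: (spherical_max D hrho BG hv eP).
have [m [rho [v [[_ hrho _] hv eP]]]] := hP i.
exact: (not_spherical D hrho BG hv eP im).
Qed.
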